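(* Let $C$ be any hyperelliptic curve of genus $g\ge 2$ with Weierstrass points $P_0,P_1,\ldots,P_{2g+1}$, and fix $\nu\in\{0,1,\ldots,2g+1\}$. For every $A\in K\otimes H$ we have $$I_{P_\nu}(A)\equiv \kappa_\nu(A)\ \mathrm{mod}\ \mathbb{Z},$$ where $I_{P_\nu}$ is the pointed harmonic volume of $(C,P_\nu)$ and $\kappa_\nu\colon K\otimes H\to \frac12\mathbb{Z}/\mathbb{Z}$ is the counting function defined in the context.
   Context: **Pointed harmonic volume.** Let $X$ be a compact Riemann surface of genus $g\ge 2$ and $p\in X$. Let $H=H_1(X;\mathbb{Z})$, identified with $H^1(X;\mathbb{Z})$ by Poincaré duality and, by the Hodge theorem, with the group of real harmonic $1$-forms on $X$ with integral periods; the harmonic form of $h\in H$ has period $\int_\gamma h=(h,[\gamma])$ along a loop $\gamma$, where $(\ ,\ )$ is the intersection pairing. Let $K$ be the kernel of $(\ ,\ )\colon H\otimes H\to\mathbb{Z}$. For $\sum_{i=1}^m a_i\otimes b_i\in K$ (with $a_i,b_i$ viewed as harmonic forms) there is a unique $1$-form $\eta$ on $X$ with $d\eta=\sum_i a_i\wedge b_i$ and $\int_X\eta\wedge *\alpha=0$ for every closed $1$-form $\alpha$ ($*$ is the Hodge star). For $c\in H$ choose a loop $\gamma\colon[0,1]\to X$ based at $p$ with homology class $c$. The pointed harmonic volume is the homomorphism $I_p\colon K\otimes H\to\mathbb{R}/\mathbb{Z}$ given by $$I_p\Big(\big(\sum_i a_i\otimes b_i\big)\otimes c\Big)=\sum_i\int_\gamma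 a_ib_i-\int_\gamma\eta\ \ \mathrm{mod}\ \mathbb{Z},$$ where $\int_\gamma a_ib_i=\int_{0\le t_1\le t_2\le 1}f_i(t_1)g_i(t_2)\,dt_1dt_2$ is Chen's iterated integral, with $\gamma^*a_i=f_i(t)dt$ and $\gamma^*b_i=g_i(t)dt$. **Hyperelliptic curve.** $C$ is the smooth compactification of the plane curve $w^2=\prod_{i=0}^{2g+1}(z-p_i)$ with $p_0,\ldots,p_{2g+1}\in\mathbb{C}$ distinct; $\pi\colon C\to\mathbb{C}P^1$, $(z,w)\mapsto z$, is the double covering with branch locus $B=\{p_0,\ldots,p_{2g+1}\}$, and $P_i\in C$ is the point with $\pi(P_i)=p_i$. The $P_i$ are exactly the Weierstrass points of $C$. **The classes $f_i$.** Let $\mathbb{Z}_2=\mathbb{Z}/2\mathbb{Z}$ and $H_{\mathbb{Z}_2}=H_1(C;\mathbb{Z}_2)$. For each $i$ let $\epsilon_i\in H_1(\mathbb{C}P^1\setminus B;\mathbb{Z}_2)$ be the class of a loop going once around $p_i$ and around no other $p_k$; then $\epsilon_0,\ldots,\epsilon_{2g}$ is a basis and $\epsilon_0+\cdots+\epsilon_{2g+1}=0$. Representing a class in $H_{\mathbb{Z}_2}$ by a cycle in $C\setminus\pi^{-1}(B)$ and pushing it forward by $\pi$ gives a well-defined injective linear map $v\colon H_{\mathbb{Z}_2}\to H_1(\mathbb{C}P^1\setminus B;\mathbb{Z}_2)$, whose image is the kernel of the map to $\mathbb{Z}_2$ sending every $\epsilon_i$ to $1$. For fixed $\nu$, let $f_i\in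 H_{\mathbb{Z}_2}$ be the element with $v(f_i)=\epsilon_\nu+\epsilon_i$, $i=0,\ldots,2g+1$. Thus $f_\nu=0$, the $f_i$ generate $H_{\mathbb{Z}_2}$, and $f_0+\cdots+f_{2g+1}=0$. **The counting function.** For $A\in K\otimes H$ ($H=H_1(C;\mathbb{Z})$), write its reduction mod $2$ in $H_{\mathbb{Z}_2}^{\otimes 3}$ as $\sum_{p,q,r\ne\nu}A_{p,q,r}\,f_p\otimes f_q\otimes f_r$ with $A_{p,q,r}\in\mathbb{Z}_2=\{0,1\}$, and set $$\kappa_\nu(A)=\tfrac12\,\sharp\{(p,q,r):\ A_{p,q,r}=1,\ \sharp\{p,q,r\}=2\}\ \ \mathrm{mod}\ \mathbb{Z}.$$ Here $\sharp\{p,q,r\}=2$ means that exactly two of $p,q,r$ coincide. The value does not depend on the chosen expression of $A$ mod $2$. *)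

(* Defs.v *)
From HB Require Import structures.
From mathcomp Require Import all_boot all_order all_algebra.
From mathcomp Require Import all_classical all_reals all_analysis.
From mathcomp Require Import complex generic_quotient ring_quotient.
From mathcomp Require Import freeg.

Set Implicit Arguments.
Unset Strict Implicit.
Unset Printing Implicit Defensive.

Import Order.TTheory GRing.Theory Num.Theory.
Import numFieldNormedType.Exports.

Local Open Scope classical_set_scope.
Local Open Scope ring_scope.
Local Open Scope complex_scope.
Local Open Scope quotient_scope.

Definition generated_subgroup (G : zmodType) (S : set G) : {pred G} :=
  fun x => `[< forall P : {pred G}, zmod_closed P ->
                 (forall y, S y -> y \in P) -> x \in P >].

Lemma generated_subgroup_zmod (G : zmodType) (S : set G) :
  zmod_closed (generated_subgroup S).
Proof.
split=> [|x y /asboolP xS /asboolP yS]; apply/asboolP => P PZ SP.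
  by case: PZ.
by case: (PZ) => _; apply; [exact: xS|exact: yS].
Qed.

HB.instance Definition _ (G : zmodType) (S : set G) :=
  GRing.isZmodClosed.Build G (generated_subgroup S)
    (generated_subgroup_zmod S).

Definition tensor_relation (U V : zmodType) : set {freeg (U * V) / int} :=
  [set x | (exists u u' v, x = << (u + u', v) >> - << (u, v) >> - << (u', v) >>)
        \/ (exists u v v',
              x = << (u, v + v') >> - << (u, v) >> - << (u, v') >>)].

Local Notation tensor_subgroup U V := (generated_subgroup (@tensor_relation U V)).

Definition tensor (U V : zmodType) : Type :=
  Quotient.quot (tensor_subgroup U V).
HB.instance Definition _ (U V : zmodType) := GRing.Zmodule.on (tensor U V).

Definition tens (U V : zmodType) (u : U) (v : V) : tensor U V :=
  \pi_(Quotient.quot (tensor_subgroup U V)) << (u, v) >>.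

Lemma tensDl (U V : zmodType) (u u' : U) (v : V) :
  tens (u + u') v = tens u v + tens u' v.
Proof.
rewrite /tens; apply/eqP.
have -> : \pi_(Quotient.quot (tensor_subgroup U V)) << (u, v) >>
          + \pi_(Quotient.quot (tensor_subgroup U V)) << (u', v) >>
        = \pi_(Quotient.quot (tensor_subgroup U V))
            (<< (u, v) >> + << (u', v) >>) by rewrite !piE.
rewrite -Quotient.idealrBE opprD addrA; apply/asboolP => P _; apply; left.
by exists u, u', v.
Qed.

Lemma tensNl (U V : zmodType) (u : U) (v : V) : tens (- u) v = - tens u v.
Proof.
have t0 : tens (0 : U) v = 0.
  by apply: (addrI (tens (0 : U) v)); rewrite -tensDl !addr0.
by apply/eqP; rewrite -addr_eq0 -tensDl addNr t0.
Qed.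

(** The map induced by [f] on the tensor product.  It is evaluated on a chosen
    representative, hence meaningful only for biadditive [f]. *)
Definition tensor_lift (U V W : zmodType) (f : U -> V -> W)
    (x : tensor U V) : W :=
  let c := repr (x : Quotient.quot (tensor_subgroup U V)) in
  \sum_(k <- dom c) f k.1 k.2 *~ coeff k c.

Definition integers (R : realType) : {pred R} := fun x => x \is a Num.int.

Lemma integers_zmod (R : realType) : zmod_closed (@integers R).
Proof. by split=> [|x y xZ yZ]; [exact: rpred0|exact: rpredB]. Qed.

HB.instance Definition _ (R : realType) :=
  GRing.isZmodClosed.Build R (@integers R) (@integers_zmod R).

Definition RmodZ (R : realType) : Type := Quotient.quot (@integers R).
HB.instance Definition _ (R : realType) := GRing.Zmodule.on (RmodZ R).

Definition modZ (R : realType) (x : R) : RmodZ R :=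
  \pi_(Quotient.quot (@integers R)) x.

Section Homology.
Context (R : realType) (T : topologicalType) (G : nzRingType) (S : set T).

Definition std_simplex2 : set (R * R) :=
  [set x | 0 <= x.1 /\ 0 <= x.2 /\ x.1 + x.2 <= 1].

(** Simplices are total functions; their values outside the standard simplex
    are irrelevant, since two functions that agree on it are homologous. *)
Definition singular1 (s : R -> T) : Prop :=
  {within `[0, 1], continuous s} /\ (forall x, 0 <= x <= 1 -> S (s x)).

Definition singular2 (s : R * R -> T) : Prop :=
  {within std_simplex2, continuous s} /\ (forall x, std_simplex2 x -> S (s x)).

Definition bd1 (c : {freeg (R -> T) / G}) : {freeg T / G} :=
  fglift (fun s : R -> T => << s 1 >> - << s 0 >> : {freeg T / G}) c.

Definition bd2 (s : R * R -> T) : {freeg (R -> T) / G} :=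
  << (fun x => s (1 - x, x)) >> - << (fun x => s (0, x)) >>
  + << (fun x => s (x, 0)) >>.

Definition cycle1 : {pred {freeg (R -> T) / G}} :=
  fun c => `[< (forall s, coeff s c != 0 -> singular1 s) /\ bd1 c = 0 >].

Lemma bd1B (c d : {freeg (R -> T) / G}) : bd1 (c - d) = bd1 c - bd1 d.
Proof. exact: lift_is_additive. Qed.

Lemma cycle1_zmod : zmod_closed cycle1.
Proof.
split=> [|x y /asboolP[xs x0] /asboolP[ys y0]]; apply/asboolP.
  split=> [s|]; first by rewrite coeff0 eqxx.
  by rewrite -(subrr 0) bd1B subrr.
split=> [s|]; last by rewrite bd1B x0 y0 subrr.
have [x_0|/xs//] := eqVneq (coeff s x) 0.
have [y_0|/ys//] := eqVneq (coeff s y) 0.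
by rewrite coeffB x_0 y_0 subrr eqxx.
Qed.

HB.instance Definition _ :=
  GRing.isZmodClosed.Build {freeg (R -> T) / G} cycle1 cycle1_zmod.

Definition Z1 : Type := {c : {freeg (R -> T) / G} | c \in cycle1}.
HB.instance Definition _ := SubType.on Z1.
HB.instance Definition _ := Choice.on Z1.
HB.instance Definition _ := [SubChoice_isSubZmodule of Z1 by <:].

Definition boundary1 : {pred Z1} :=
  fun z => `[< exists l : seq (G * (R * R -> T)),
     (forall k, k \in l -> singular2 k.2) /\
     val z = \sum_(k <- l) k.1 *: bd2 k.2 >].

Lemma boundary1_zmod : zmod_closed boundary1.
Proof.
split=> [|x y /asboolP[l [ls xE]] /asboolP[m [ms yE]]]; apply/asboolP.
  by exists [::]; rewrite big_nil raddf0; split.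
exists (l ++ [seq (- k.1, k.2) | k <- m]); split=> [k|].
  by rewrite mem_cat => /orP[/ls//|/mapP[k' /ms ? ->]].
rewrite raddfB /= xE yE big_cat big_map /= -sumrN.
by congr (_ + _); apply: eq_bigr => k _; rewrite scaleNr.
Qed.

HB.instance Definition _ := GRing.isZmodClosed.Build Z1 boundary1 boundary1_zmod.

Definition H1 : Type := Quotient.quot boundary1.
HB.instance Definition _ := GRing.Zmodule.on H1.

(** The homology class of a chain; 0 if the chain is not a cycle in [S]. *)
Definition hclass (c : {freeg (R -> T) / G}) : H1 :=
  \pi_(Quotient.quot boundary1) (insubd 0 c).

Definition hrepr (x : H1) : {freeg (R -> T) / G} :=
  val (repr (x : Quotient.quot boundary1)).

End Homology.

Arguments H1 : clear implicits.
Arguments hclass {R T G} S c.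

Definition push (R : realType) (T T' : topologicalType) (G : nzRingType)
    (h : T -> T') (c : {freeg (R -> T) / G}) : {freeg (R -> T') / G} :=
  fglift (fun s : R -> T => << (h \o s) >> : {freeg (R -> T') / G}) c.

Definition red2 (R : realType) (T : topologicalType) (S : set T)
    (x : H1 R T int S) : H1 R T 'F_2 S :=
  hclass S (\sum_(s <- dom (hrepr x))
    << (coeff s (hrepr x))%:~R *g s >> : {freeg (R -> T) / 'F_2}).

(** A chart is given by the inverse map, a parametrization of an open subset of
    the surface by the open set [chart_dom] of the complex plane. *)
Record chart (R : realType) (T : Type) := Chart {
  chart_dom : set R[i]^o;
  chart_map :> R[i]^o -> T }.

Section Smooth.
Context (R : realType).
Local Notation C := (R[i]^o).
Implicit Types (F : C -> R) (V : set C) (c : R -> C) (t : C).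

Definition line_x F t : R -> R := fun s => F (t + s%:C).
Definition line_y F t : R -> R := fun s => F (t + s *i).

Definition partial_x F : C -> R := fun t => derive1 (line_x F t) 0.
Definition partial_y F : C -> R := fun t => derive1 (line_y F t) 0.

Fixpoint Ck (k : nat) V F : Prop :=
  if k is k'.+1 then
    [/\ forall t, V t -> derivable (line_x F t) 0 1 /\ derivable (line_y F t) 0 1,
        Ck k' V (partial_x F) & Ck k' V (partial_y F)]
  else forall t, V t -> {for t, continuous F}.

Definition smooth_on V F : Prop := forall k, Ck k V F.

Definition velocity c (s : R) : C :=
  derive1 (@complex.Re R \o c) s +i* derive1 (@complex.Im R \o c) s.

Definition C1_near c (s : R) : Prop :=
  \forall r \near s,
    [/\ derivable (@complex.Re R \o c) r 1, derivable (@complex.Im R \o c) r 1,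
        {for r, continuous (derive1 (@complex.Re R \o c))} &
        {for r, continuous (derive1 (@complex.Im R \o c))}].

End Smooth.

Section Forms.
Context (R : realType) (T : topologicalType) (atlas : set (chart R T)).
Local Notation C := (R[i]^o).

(** For a real 1-form [w], the number [w psi t l] is the value of [w] on the
    image of the tangent vector [l] at [t] under the differential of [psi];
    thus [w = w psi t 1 dx + w psi t 'i dy] in the coordinate [x + iy]. *)
Definition form1 : Type := chart R T -> C -> C -> R.

(** [W psi t] is the coefficient of [dx /\ dy] in the chart [psi]. *)
Definition form2 : Type := chart R T -> C -> R.

Definition is_form1 (w : form1) : Prop :=
  [/\ forall psi t (r : R) (l m : C), atlas psi -> chart_dom psi t ->
        w psi t (r%:C * l + m) = r * w psi t l + w psi t m,
      (* invariance under the holomorphic change of charts [tau], with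
         derivative [d] *)
      forall (psi phi : chart R T) (t : C) (tau : C -> C) (d : C),
        atlas psi -> atlas phi -> chart_dom psi t -> chart_dom phi (tau t) ->
        (\forall s \near t, phi (tau s) = psi s) ->
        is_derive t (1 : C) tau d ->
        forall l, w psi t l = w phi (tau t) (d * l)
    & forall psi, atlas psi ->
        smooth_on (chart_dom psi) (fun t => w psi t 1) /\
        smooth_on (chart_dom psi) (fun t => w psi t 'i)].

Definition wedge (a b : form1) : form2 :=
  fun psi t => a psi t 1 * b psi t 'i - a psi t 'i * b psi t 1.

Definition ext_d (w : form1) : form2 :=
  fun psi t => partial_x (fun s => w psi s 'i) t - partial_y (fun s => w psi s 1) t.

(** [*dx = dy] and [*dy = -dx]. *)
Definition hodge (w : form1) : form1 := fun psi t l => - w psi t ('i * l).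

Definition eq_form2 (a b : form2) : Prop :=
  forall psi t, atlas psi -> chart_dom psi t -> a psi t = b psi t.

Definition closed_form1 (w : form1) : Prop :=
  is_form1 w /\ eq_form2 (ext_d w) (fun _ _ => 0).

Definition harmonic (w : form1) : Prop :=
  closed_form1 w /\ eq_form2 (ext_d (hodge w)) (fun _ _ => 0).

(** Piecewise continuously differentiable paths: around each parameter, [gamma]
    coincides in a chart with a [C^1] curve on each side. *)
Definition piecewise_C1 (gamma : R -> T) : Prop :=
  forall t, 0 <= t <= 1 -> exists psi (c d : R -> C),
    [/\ atlas psi, C1_near c t /\ C1_near d t,
        chart_dom psi (c t), chart_dom psi (d t) &
        \forall s \near t,
          (0 <= s <= t -> gamma s = psi (c s)) /\
          (t <= s <= 1 -> gamma s = psi (d s))].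

Definition is_loop (gamma : R -> T) : Prop :=
  piecewise_C1 gamma /\ gamma 0 = gamma 1.

(** [f] such that [f(t) dt] is the pullback of [w] by [gamma]; the value is
    arbitrary at the parameters where [gamma] is not [C^1]. *)
Definition pullback (gamma : R -> T) (w : form1) : R -> R := fun t =>
  xget 0 [set y | exists psi (c : R -> C),
    [/\ atlas psi, C1_near c t, chart_dom psi (c t),
        \forall s \near t, gamma s = psi (c s) &
        y = w psi (c t) (velocity c t)]].

Definition path_integral (gamma : R -> T) (w : form1) : R :=
  \int[lebesgue_measure]_(t in `[0, 1]) pullback gamma w t.

Definition chen_integral (gamma : R -> T) (a b : form1) : R :=
  \int[(lebesgue_measure \x lebesgue_measure)%E]_(t in
      [set t : R * R | 0 <= t.1 /\ t.1 <= t.2 /\ t.2 <= 1])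
    (pullback gamma a t.1 * pullback gamma b t.2).

Local Notation H := (H1 R T int [set: T]).

Definition loop_class (G : nzRingType) (gamma : R -> T) : H1 R T G [set: T] :=
  hclass [set: T] << gamma >>.

Definition closed_C1_curve (gamma : R -> T) : Prop :=
  (forall t, gamma (t + 1) = gamma t) /\
  (forall t, exists psi (c : R -> C),
    [/\ atlas psi, C1_near c t, chart_dom psi (c t) &
        \forall s \near t, gamma s = psi (c s)]).

(** The curves [gamma] and [delta] cross transversally at [gamma s = delta t]
    with sign [e], relative to the complex orientation. *)
Definition crosses_with_sign (gamma delta : R -> T) (s t : R) (e : int) : Prop :=
  exists psi (c d : R -> C),
    [/\ [/\ atlas psi, C1_near c s, C1_near d t & c s = d t],
        chart_dom psi (c s),
        \forall r \near s, gamma r = psi (c r),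
        \forall r \near t, delta r = psi (d r) &
        let D := complex.Im ((velocity c s)^* * velocity d t) in
        D != 0 /\ e = sgz D].

(** Every two classes contain transversal closed curves, so that the crossings
    condition determines the pairing. *)
Record intersection_pairing := IntersectionPairing {
  pairing :> H -> H -> int;
  pairingDl : forall a b c, pairing (a + b) c = pairing a c + pairing b c;
  pairingDr : forall a b c, pairing a (b + c) = pairing a b + pairing a c;
  pairing_crossings : forall (gamma delta : R -> T) (l : seq (R * R))
      (e : R * R -> int),
    closed_C1_curve gamma -> closed_C1_curve delta -> uniq l ->
    (forall s t, 0 <= s < 1 -> 0 <= t < 1 ->
       (gamma s = delta t <-> (s, t) \in l)) ->
    (forall x, x \in l -> [/\ 0 <= x.1 < 1, 0 <= x.2 < 1 &
       crosses_with_sign gamma delta x.1 x.2 (e x)]) ->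
    pairing (loop_class int gamma) (loop_class int delta) = \sum_(x <- l) e x }.

Section Volume.
Context (B : intersection_pairing).

(** The kernel of the map induced by [B] on [tensor H H]: by biadditivity the
    sum does not depend on the expression of [x]. *)
Definition pairing_kernel : {pred tensor H H} :=
  fun x => `[< exists k : seq (H * H),
    x = \sum_(ab <- k) tens ab.1 ab.2 /\ \sum_(ab <- k) B ab.1 ab.2 = 0 >].

Lemma pairing_kernel_zmod : zmod_closed pairing_kernel.
Proof.
have BN a b : B (- a) b = - B a b.
  have B0 : B 0 b = 0 by apply: (addrI (B 0 b)); rewrite -pairingDl !addr0.
  by apply/eqP; rewrite -addr_eq0 -pairingDl addNr B0.
split=> [|_ _ /asboolP[k [-> k0]] /asboolP[m [-> m0]]]; apply/asboolP.
  by exists [::]; rewrite !big_nil.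
exists (k ++ [seq (- ab.1, ab.2) | ab <- m]).
rewrite !big_cat !big_map /= k0 add0r -sumrN; split.
  by congr (_ + _); apply: eq_bigr => ab _; rewrite tensNl.
by under eq_bigr do rewrite BN; rewrite sumrN m0 oppr0.
Qed.

HB.instance Definition _ :=
  GRing.isZmodClosed.Build (tensor H H) pairing_kernel pairing_kernel_zmod.

Definition K : Type := {x : tensor H H | x \in pairing_kernel}.
HB.instance Definition _ := SubType.on K.
HB.instance Definition _ := Choice.on K.
HB.instance Definition _ := [SubChoice_isSubZmodule of K by <:].

Definition harmonic_forms (hf : H -> form1) : Prop :=
  forall h, harmonic (hf h) /\
    forall gamma, is_loop gamma ->
      path_integral gamma (hf h) = (B h (loop_class int gamma))%:~R.

(** [surf_int] is the integration of 2-forms over the surface.  The conditions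
    determine [eta] uniquely, and loops at [P] represent all classes, so that
    they determine [I]. *)
Definition is_pointed_harmonic_volume (surf_int : form2 -> R)
    (hf : H -> form1) (P : T) (I : {additive tensor K H -> RmodZ R}) : Prop :=
  forall (x : K) (ab : seq (H * H)),
    val x = \sum_(k <- ab) tens k.1 k.2 ->
    exists2 eta : form1,
      [/\ is_form1 eta,
          eq_form2 (ext_d eta)
            (fun psi t => \sum_(k <- ab) wedge (hf k.1) (hf k.2) psi t) &
          forall alpha, closed_form1 alpha ->
            surf_int (wedge eta (hodge alpha)) = 0] &
      forall gamma, is_loop gamma -> gamma 0 = P ->
        I (tens x (loop_class int gamma)) =
        modZ (\sum_(k <- ab) chen_integral gamma (hf k.1) (hf k.2)
              - path_integral gamma eta).

Definition red2_KH (A : tensor K H) :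
    tensor (tensor (H1 R T 'F_2 [set: T]) (H1 R T 'F_2 [set: T]))
           (H1 R T 'F_2 [set: T]) :=
  tensor_lift (fun x c =>
    tens (tensor_lift (fun a b => tens (red2 a) (red2 b)) (val x)) (red2 c)) A.

End Volume.
End Forms.

Section Hyperelliptic.
Context (R : realType) (g : nat) (p : 'I_(2 * g + 2) -> R[i]^o).
Local Notation C := (R[i]^o).

Definition branch_poly (z : C) : C := \prod_i (z - p i).

(** The points [(z, w)] of the affine curve, together with the two points at
    infinity, at which [u = 1 / z] vanishes and [v = w / z ^+ g.+1] is 1 or -1
    in the equation [v ^+ 2 = \prod_i (1 - p i * u)]. *)
Definition curve : Type :=
  ({x : C * C | x.2 ^+ 2 == branch_poly x.1} + {v : C | v ^+ 2 == 1})%type.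
HB.instance Definition _ := Choice.on curve.

(** The affine pieces [w ^+ 2 = \prod_i (z - p i)] (for [false]) and
    [v ^+ 2 = \prod_i (1 - p i * u)] (for [true]) and their coordinates
    [(z, w)] and [(u, v)]. *)
Definition piece (b : bool) : set curve :=
  [set P | match P with
           | inl x => b -> (val x).1 != 0
           | inr _ => b
           end].

Definition coord (b : bool) (P : curve) : C * C :=
  match P with
  | inl x => if b then ((val x).1^-1, (val x).2 / (val x).1 ^+ g.+1) else val x
  | inr v => (0, val v)
  end.

Definition curve_open (U : set curve) : Prop :=
  forall b, exists2 W : set (C * C), open W &
    forall P, piece b P -> (U P <-> W (coord b P)).

Lemma curve_openT : curve_open setT.
Proof. by move=> b; exists setT; first exact: openT. Qed.

Lemma curve_openI : setI_closed curve_open.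
Proof.
move=> U V oU oV b; have [W oW UW] := oU b; have [W' oW' VW'] := oV b.
exists (W `&` W'); first exact: openI.
by move=> P bP; rewrite /setI /= (UW P bP) (VW' P bP).
Qed.

Lemma curve_open_bigU (I : Type) (f : I -> set curve) :
  (forall i, curve_open (f i)) -> curve_open (\bigcup_i f i).
Proof.
move=> of_ b; have {of_}/boolp.choice[W WP] i : exists W : set (C * C),
    open W /\ forall P, piece b P -> (f i P <-> W (coord b P)).
  by have [W oW fW] := of_ i b; exists W.
exists (\bigcup_i W i); first by apply: bigcup_open => i _; case: (WP i).
move=> P bP; split=> -[i _ iP]; exists i => //; case: (WP i) => _ /(_ P bP);
  by case; auto.
Qed.

HB.instance Definition _ := isOpenTopological.Build curve
  curve_openT curve_openI curve_open_bigU.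

(** The charts are the injective holomorphic immersions of open sets into one
    of the two affine pieces. *)
Definition curve_atlas : set (chart R curve) :=
  [set psi | [/\ open (chart_dom psi), set_inj (chart_dom psi) psi &
    exists b, forall t, chart_dom psi t ->
      let x := fun s : C => (coord b (psi s)).1 in
      let y := fun s : C => (coord b (psi s)).2 in
      [/\ piece b (psi t), derivable x t 1, derivable y t 1 &
          'D_1 x t != 0 \/ 'D_1 y t != 0]]].

Definition sphere : Type := one_point_compactification C.
HB.instance Definition _ := Topological.on sphere.

Definition cover (P : curve) : sphere :=
  match P with inl x => Some (val x).1 | inr _ => None end.

Definition affine_point (x : C * C) (xP : x.2 ^+ 2 == branch_poly x.1) : curve :=
  inl (exist (fun x : C * C => x.2 ^+ 2 == branch_poly x.1) x xP).

Lemma branch_point_subproof i : (p i, 0 : C).2 ^+ 2 == branch_poly (p i, 0 : C).1.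
Proof. by rewrite /branch_poly (bigD1 i) //= subrr mul0r expr0n. Qed.

Definition weierstrass_point (i : 'I_(2 * g + 2)) : curve :=
  affine_point (branch_point_subproof i).

Definition branch_locus : set sphere := [set x | exists i, x = Some (p i)].

(** Integration of 2-forms, through the coordinate [z] on both sheets; this
    leaves out the points over [p i] and infinity only. *)
Definition density_z (W : form2 R curve) (P : curve) : R :=
  xget 0 [set y | exists psi t,
    [/\ curve_atlas psi,
        forall s, chart_dom psi s -> piece false (psi s) /\ (coord false (psi s)).1 = s,
        chart_dom psi t, psi t = P & y = W psi t]].

Lemma sheet_subproof (b : bool) (z : C) :
  (z, (-1) ^+ b * sqrtC (branch_poly z)).2 ^+ 2 ==
  branch_poly (z, (-1) ^+ b * sqrtC (branch_poly z)).1.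
Proof. by rewrite /= exprMn sqrr_sign mul1r sqrtCK. Qed.

Definition sheet (b : bool) (z : C) : curve := affine_point (sheet_subproof b z).

Definition curve_integral (W : form2 R curve) : R :=
  \int[(lebesgue_measure \x lebesgue_measure)%E]_(q in [set: R * R])
    (density_z W (sheet false (q.1 +i* q.2)) + density_z W (sheet true (q.1 +i* q.2))).

Local Notation H2 := (H1 R curve 'F_2 [set: curve]).
Local Notation H2_sphere := (H1 R sphere 'F_2 (~` branch_locus)).

Definition branch_radius (i : 'I_(2 * g + 2)) : R :=
  \big[Num.min/1]_(k | k != i) (complex.Re `|p k - p i| / 2).

Definition branch_circle (i : 'I_(2 * g + 2)) (t : R) : sphere :=
  Some (p i + (branch_radius i)%:C * (cos (2 * trigo.pi * t) +i* sin (2 * trigo.pi * t))).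

Definition epsilon (i : 'I_(2 * g + 2)) : H2_sphere :=
  hclass (~` branch_locus) << branch_circle i >>.

(** Every class contains a cycle avoiding the ramification points, so that this
    determines [v]. *)
Definition is_pushforward_off_branch (v : {additive H2 -> H2_sphere}) : Prop :=
  forall c : {freeg (R -> curve) / 'F_2},
    c \in cycle1 (cover @^-1` (~` branch_locus)) ->
    v (hclass [set: curve] c) = hclass (~` branch_locus) (push cover c).

Definition f_expansion (nu : 'I_(2 * g + 2)) (f : 'I_(2 * g + 2) -> H2)
    (a : 'I_(2 * g + 2) -> 'I_(2 * g + 2) -> 'I_(2 * g + 2) -> bool) :
    tensor (tensor H2 H2) H2 :=
  \sum_(i | i != nu) \sum_(j | j != nu) \sum_(k | k != nu)
    tens (tens (f i) (f j)) (f k) *+ a i j k.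

Definition kappa (nu : 'I_(2 * g + 2))
    (a : 'I_(2 * g + 2) -> 'I_(2 * g + 2) -> 'I_(2 * g + 2) -> bool) : RmodZ R :=
  modZ (2^-1 * #|[pred x : 'I_(2 * g + 2) * 'I_(2 * g + 2) * 'I_(2 * g + 2) |
    let: (i, j, k) := x in
    [&& i != nu, j != nu, k != nu, a i j k & #|pred3 i j k| == 2]]|%:R).

End Hyperelliptic.

(* Main.v *)
(* Let [iota (z, w) = (z, - w)].  Harmonic forms are anti-invariant under [iota]: the invariant
   part of a harmonic form descends to the [z]-line, where its coefficients are harmonic, bounded
   near the branch points and small at infinity, hence zero.  Then [d eta] is invariant, so
   [beta := eta - iota^* eta] is closed; it is orthogonal to [eta], and the integral that expresses
   this is that of [|beta|^2] over the plane.  So [eta] is invariant.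

   Number the branch points [q_0, q_1, ..] by increasing real part (after a rotation).  The loops
   [L_k] over the segments [[q_k, q_(k+1)]] generate [H], and only consecutive ones meet, once and
   transversally.  Let [M_r] be a path over these segments from [P_nu] to [P_r] followed by its
   image under [iota] run backwards; the classes of the [M_r] generate [H] too.  As
   [M_r (1 - t) = iota (M_r t)], an anti-invariant form pulls back to a function that is symmetric
   in [t], so the iterated integral of [a b] along [M_r] is half the product of the integrals of [a]
   and [b], and the integral of [eta] vanishes.  Hence [I] is half of [sum_i (a_i, M_r) (b_i, M_r)]
   on [(sum_i a_i (x) b_i) (x) M_r].

   Let [chi_r] be the sign change of the square root of [(z - p_r) / (z - p_nu)] along a cycle.
   Checked on the [L_k], one has mod 2 [(a, M_r) = chi_r a], [(a, b) = sum_r chi_r a * chi_r b] and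
   [sum_r chi_r = 0]; so [I] is half of the cubic form [sum_r chi_r (x) chi_r (x) chi_r], which is
   evaluated on the products of the [f_i] through [chi_r (f_i) = [r <> nu] * [r <> i]]. *)

Require Import Defs.
From HB Require Import structures.
From mathcomp Require Import all_boot all_order all_algebra.
From mathcomp Require Import all_classical all_reals all_analysis.
From mathcomp Require Import complex generic_quotient ring_quotient freeg.
From mathcomp Require Import measurable_realfun ring lra zify.

Set Implicit Arguments.
Unset Strict Implicit.
Unset Printing Implicit Defensive.

Import Order.TTheory GRing.Theory Num.Theory.
Import numFieldNormedType.Exports.

Local Open Scope classical_set_scope.
Local Open Scope ring_scope.
Local Open Scope complex_scope.
Local Open Scope quotient_scope.

(** The formula for the pairing is what ties the cubic form to [K]. Write theta_r for chi_r (x)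
    chi_r. The loops M_r give I on x (x) L_k as half of theta_k x + theta_(k+1) x; the cubic form
    has there the further term sum_r theta_r x whenever L_k is incident to P_nu. This sum is the
    pairing of x mod 2, hence 0 on [K]. Three obstacles shape the rest. Homology is that of singular
    chains, so generation is proved by a potential: a function on points whose differences are the
    classes of paths modulo the L_k, glued from cones in star-shaped charts. An integral over the
    plane reads an infinite value as 0, so the vanishing of the integral of |beta|^2 says nothing
    until the integrand is bounded by an integrable function; it grows at most like |z - q|^-1 at
    the branch points and decays like |z|^-4 at infinity. Finally the pairing is described on curves
    with finitely many crossings and the pushforward on cycles off the branch points, so each L_k is
    also moved to a loop over an ellipse with foci q_k and q_(k+1). *)

Local Notation crd := Defs.coord.
Local Notation nrm := ComplexField.Normc.normc.

(** * Continuity and differentiability of complex functions *)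

Section ComplexTopology.
Context (R : realType).
Local Notation C := (R[i]^o).
Implicit Types (z w : C).

Lemma normcE_real z : `|z| = (nrm z)%:C. Proof. by []. Qed.

Lemma nrm_ge0 z : 0 <= nrm z.
Proof. by case: z => a b; exact: sqrtr_ge0. Qed.

Lemma nrm_eq0 z : (nrm z == 0) = (z == 0).
Proof.
apply/eqP/eqP => [/ComplexField.Normc.eq0_normc//|->].
exact: ComplexField.Normc.normc0.
Qed.

Lemma nrm_gt0 z : (0 < nrm z) = (z != 0).
Proof. by rewrite lt_neqAle eq_sym nrm_eq0 nrm_ge0 andbT. Qed.

Lemma nrmM z w : nrm (z * w) = nrm z * nrm w.
Proof. exact: ComplexField.Normc.normcM. Qed.

Lemma nrmV z : nrm z^-1 = (nrm z)^-1.
Proof. exact: ComplexField.Normc.normcV. Qed.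

Lemma nrmD z w : nrm (z + w) <= nrm z + nrm w.
Proof. exact: le_normcD. Qed.

Lemma nrmN z : nrm (- z) = nrm z.
Proof. exact: normcN. Qed.

Lemma nrmBC z w : nrm (z - w) = nrm (w - z).
Proof. by rewrite -nrmN opprB. Qed.

Lemma nrmX z n : nrm (z ^+ n) = nrm z ^+ n.
Proof.
elim: n => [|n IH]; first exact: ComplexField.Normc.normc1.
by rewrite !exprS nrmM IH.
Qed.

Lemma nrm_sqr z : nrm z ^+ 2 = complex.Re z ^+ 2 + complex.Im z ^+ 2.
Proof. by case: z => a b /=; rewrite sqr_sqrtr // addr_ge0 ?sqr_ge0. Qed.

Lemma nrm_real (x : R) : nrm (x%:C) = `|x|.
Proof. by rewrite /= expr0n addr0 sqrtr_sqr. Qed.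

Lemma nrmB_le z w : nrm z - nrm w <= nrm (z - w).
Proof. by rewrite lerBlDr; have := nrmD (z - w) w; rewrite subrK. Qed.

Lemma Re_le_nrm z : `|complex.Re z| <= nrm z.
Proof.
by rewrite -[leLHS]sqrtr_sqr; case: z => a b /=; rewrite ler_wsqrtr // lerDl sqr_ge0.
Qed.

Lemma Im_le_nrm z : `|complex.Im z| <= nrm z.
Proof.
by rewrite -[leLHS]sqrtr_sqr; case: z => a b /=; rewrite ler_wsqrtr // lerDr sqr_ge0.
Qed.

Lemma nrm_le_ReIm z : nrm z <= `|complex.Re z| + `|complex.Im z|.
Proof.
rewrite -(@ler_pXn2r _ 2) ?nnegrE ?nrm_ge0 ?addr_ge0 // nrm_sqr.
rewrite sqrrD !real_normK ?num_real //.
have : 0 <= `|complex.Re z| * `|complex.Im z| by rewrite mulr_ge0.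
by rewrite mulr2n; lra.
Qed.

(** The balls of [R[i]^o] have radii in [R[i]]. A positive radius there is a positive real number,
    so real radii suffice. *)
Lemma nbhsC_nrm z (A : set C) :
  nbhs z A <-> exists2 e : R, 0 < e & forall y, nrm (y - z) < e -> A y.
Proof.
split=> [/nbhs_ballP[[e e'] /= e0 H]|[e e0 H]].
  have /andP[/eqP ie re] : (e' == 0) && (0 < e).
    by move: e0; rewrite ltcE /=.
  exists e => // y Hy; apply: H.
  by rewrite /ball /= -normrN opprB normcE_real ltcE /= ie eqxx.
apply/nbhs_ballP; exists (e%:C) => /=; first by rewrite ltcR.
by move=> y; rewrite /ball /= -normrN opprB normcE_real ltcR; exact: H.
Qed.

Lemma continuousCP (T : topologicalType) (f : T -> C) (x : T) :
  {for x, continuous f} <->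
  forall e : R, 0 < e -> \forall y \near x, nrm (f y - f x) < e.
Proof.
split=> [fc e e0|H A /nbhsC_nrm[e e0 He]].
  by apply: (fc [set y | nrm (y - f x) < e]); apply/nbhsC_nrm; exists e.
by apply: filterS (H e e0) => y; exact: He.
Qed.

Lemma continuousRP (T : topologicalType) (f : T -> R) (x : T) :
  {for x, continuous f} <->
  forall e : R, 0 < e -> \forall y \near x, `|f y - f x| < e.
Proof.
split=> [fc e e0|H A /nbhs_ballP[e /= e0 He]].
  by apply: (fc [set y | `|y - f x| < e]); apply/nbhs_ballP; exists e => // y /=;
     rewrite /ball /= distrC.
by apply: filterS (H e e0) => y fy; apply: He; rewrite /ball /= distrC.
Qed.

Lemma continuous_Re (T : topologicalType) (f : T -> C) x :
  {for x, continuous f} -> {for x, continuous (fun y => complex.Re (f y))}.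
Proof.
move=> /continuousCP fc; apply/continuousRP => e /fc; apply: filterS => y.
by apply: le_lt_trans; rewrite -raddfB; exact: Re_le_nrm.
Qed.

Lemma continuous_Im (T : topologicalType) (f : T -> C) x :
  {for x, continuous f} -> {for x, continuous (fun y => complex.Im (f y))}.
Proof.
move=> /continuousCP fc; apply/continuousRP => e /fc; apply: filterS => y.
by apply: le_lt_trans; rewrite -raddfB; exact: Im_le_nrm.
Qed.

Lemma continuous_nrm (T : topologicalType) (f : T -> C) x :
  {for x, continuous f} -> {for x, continuous (fun y => nrm (f y))}.
Proof.
move=> /continuousCP fc; apply/continuousRP => e /fc; apply: filterS => y.
apply: le_lt_trans; rewrite ler_norml nrmB_le andbT lerNl opprB.
by rewrite (nrmBC (f y)); exact: nrmB_le.
Qed.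

Lemma continuous_Complex (T : topologicalType) (f g : T -> R) x :
  {for x, continuous f} -> {for x, continuous g} ->
  {for x, continuous (fun y => (f y +i* g y : C))}.
Proof.
move=> /continuousRP fc /continuousRP gc; apply/continuousCP => e e0.
have e2 : 0 < e / 2 by rewrite divr_gt0.
near=> y; apply: le_lt_trans (nrm_le_ReIm _) _ => /=.
rewrite [ltRHS](splitr e); apply: ltrD; near: y; [exact: fc|exact: gc].
Unshelve. all: by end_near. Qed.

Lemma continuous_toC (T : topologicalType) (f : T -> R) x :
  {for x, continuous f} -> {for x, continuous (fun y => ((f y)%:C : C))}.
Proof. by move=> fc; apply: continuous_Complex => //; exact: cst_continuous. Qed.

End ComplexTopology.

(* Sealing continuity keeps unification from unfolding complex arithmetic. *)
HB.lock Definition cts (R : realType) (T : topologicalType) (f : T -> R[i]^o) (x : T) : Prop :=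
  {for x, continuous f}.

Section ComplexContinuity.
Context (R : realType) (T : topologicalType).
Local Notation C := (R[i]^o).
Implicit Types (f g : T -> C) (x : T).

Lemma ctsP f x : cts f x <-> {for x, continuous f}. Proof. by rewrite cts.unlock. Qed.

Lemma ctsE f x : cts f x <->
  forall e : R, 0 < e -> \forall y \near x, nrm (f y - f x) < e.
Proof. by rewrite cts.unlock; exact: continuousCP. Qed.

Lemma cts_cst (c : C) x : cts (fun=> c) x.
Proof. by rewrite cts.unlock; exact: cst_continuous. Qed.

Lemma ctsD f g x : cts f x -> cts g x -> cts (fun y => f y + g y) x.
Proof. rewrite cts.unlock => fc gc; exact: (@cvgD _ _ _ _ _ _ _ _ _ fc gc). Qed.

Lemma ctsN f x : cts f x -> cts (fun y => - f y) x.
Proof. rewrite cts.unlock => fc; exact: (@cvgN _ _ _ _ _ _ _ fc). Qed.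

Lemma ctsB f g x : cts f x -> cts g x -> cts (fun y => f y - g y) x.
Proof. by move=> fc /ctsN; exact: ctsD. Qed.

Lemma ctsM f g x : cts f x -> cts g x -> cts (fun y => f y * g y) x.
Proof. rewrite cts.unlock => fc gc; exact: (@cvgM _ _ _ _ _ _ _ _ fc gc). Qed.

Lemma ctsV f x : f x != 0 -> cts f x -> cts (fun y => (f y)^-1) x.
Proof. rewrite cts.unlock => f0 fc; exact: (@cvgV _ _ _ _ _ _ f0 fc). Qed.

Lemma cts_eq f g x : (\forall y \near x, f y = g y) -> cts f x -> cts g x.
Proof.
move=> E /ctsE fc; apply/ctsE => e /fc; apply: filterS2 (E) => y <-.
by rewrite (nbhs_singleton E).
Qed.

Lemma ctsX f n x : cts f x -> cts (fun y => f y ^+ n) x.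
Proof.
move=> fc; elim: n => [|n IH].
  rewrite (_ : (fun y => _) = (fun=> 1)); first exact: cts_cst.
  by apply/funext => y; rewrite expr0.
rewrite (_ : (fun y => _) = fun y => f y * f y ^+ n).
  by apply: ctsM; [exact: fc|exact: IH].
by apply/funext => y; rewrite exprS.
Qed.

Lemma cts_comp (U : topologicalType) (h : U -> T) f (u : U) :
  {for u, continuous h} -> cts f (h u) -> cts (fun y => f (h y)) u.
Proof. by rewrite cts.unlock; exact: continuous_comp. Qed.

Lemma cts_compC (g : C -> C) f x : cts f x -> cts g (f x) -> cts (fun y => g (f y)) x.
Proof. by rewrite cts.unlock; exact: continuous_comp. Qed.

Lemma cts_Complex (f g : T -> R) x :
  {for x, continuous f} -> {for x, continuous g} -> cts (fun y => f y +i* g y) x.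
Proof. by rewrite cts.unlock; exact: continuous_Complex. Qed.

Lemma cts_toC (f : T -> R) x : {for x, continuous f} -> cts (fun y => (f y)%:C) x.
Proof. by rewrite cts.unlock; exact: continuous_toC. Qed.

Lemma cts_Re f x : cts f x -> {for x, continuous (fun y => complex.Re (f y))}.
Proof. by rewrite cts.unlock; exact: continuous_Re. Qed.

Lemma cts_Im f x : cts f x -> {for x, continuous (fun y => complex.Im (f y))}.
Proof. by rewrite cts.unlock; exact: continuous_Im. Qed.

Lemma cts_nrm f x : cts f x -> {for x, continuous (fun y => nrm (f y))}.
Proof. by rewrite cts.unlock; exact: continuous_nrm. Qed.

Lemma cts_near_neq0 f x : cts f x -> f x != 0 -> \forall y \near x, f y != 0.
Proof.
move=> /ctsE fc fx0; have := fc _ (_ : 0 < nrm (f x)).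
rewrite nrm_gt0 => /(_ fx0); apply: filterS => y; apply: contraTN => /eqP->.
by rewrite sub0r nrmN ltxx.
Qed.

Lemma near_gt (f : T -> R) x (a : R) : {for x, continuous f} -> a < f x ->
  \forall y \near x, a < f y.
Proof.
move=> fc fx; apply: (fc [set y | a < y]); apply/nbhs_ballP; exists (f x - a) => /=.
  by rewrite subr_gt0.
by move=> y; rewrite /ball /= => /ltr_distlBl; rewrite opprB addrC subrK.
Qed.

Lemma near_lt (f : T -> R) x (a : R) : {for x, continuous f} -> f x < a ->
  \forall y \near x, f y < a.
Proof.
move=> fc fx; apply: (fc [set y | y < a]); apply/nbhs_ballP; exists (a - f x) => /=.
  by rewrite subr_gt0.
by move=> y; rewrite /ball /= distrC => /ltr_distlDr; rewrite addrC subrK.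
Qed.

Lemma Re_gt0_neq0 (z : C) : 0 < complex.Re z -> z != 0.
Proof. by apply: contraTneq => ->; rewrite ltxx. Qed.

End ComplexContinuity.

(** Carathéodory's derivative: the difference quotient is a factor [phi] continuous at [x], and no
    limit is taken. The map [j] is [toC] for real parameters and [id] for complex ones, so one
    calculus serves paths and holomorphic maps. *)
HB.lock Definition has_d (R : realType) (V : topologicalType) (j f : V -> R[i]^o) (x : V)
    (d : R[i]^o) : Prop :=
  exists phi : V -> R[i]^o, [/\ cts phi x, phi x = d &
    forall y, f y - f x = (j y - j x) * phi y].

HB.lock Definition C1at (R : realType) (V : topologicalType) (j f : V -> R[i]^o) (x : V) :
    Prop :=
  exists v : V -> R[i]^o,
    \forall y \near x, has_d j f y (v y) /\ cts v y.

Lemma has_dP (R : realType) (V : topologicalType) (j f : V -> R[i]^o) (x : V)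
    (d : R[i]^o) :
  has_d j f x d <-> exists phi : V -> R[i]^o, [/\ cts phi x, phi x = d &
    forall y, f y - f x = (j y - j x) * phi y].
Proof. by rewrite has_d.unlock. Qed.

Lemma C1P (R : realType) (V : topologicalType) (j f : V -> R[i]^o) (x : V) :
  C1at j f x <-> exists v : V -> R[i]^o,
    \forall y \near x, has_d j f y (v y) /\ cts v y.
Proof. by rewrite C1at.unlock. Qed.

(** * Rules for derivatives given by Carathéodory factors *)

Section Derivation.
Context (R : realType) (V : topologicalType).
Local Notation C := (R[i]^o).
Context (j : V -> C).
Hypothesis jc : forall x, cts j x.
Implicit Types (f g : V -> C) (x : V).

Lemma has_d_cont f x d : has_d j f x d -> cts f x.
Proof.
move=> /has_dP[phi [pc _ E]].
have -> : f = (fun y => f x + (j y - j x) * phi y).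
  by apply/funext => y; rewrite -E addrC subrK.
apply: ctsD; first exact: cts_cst.
by apply: ctsM => //; apply: ctsB; [exact: jc|exact: cts_cst].
Qed.

Lemma has_d_cst (c : C) x : has_d j (fun=> c) x 0.
Proof.
by apply/has_dP; exists (fun=> 0); split=> // [|y]; [exact: cts_cst|rewrite subrr mulr0].
Qed.

Lemma has_d_j x : has_d j j x 1.
Proof. by apply/has_dP; exists (fun=> 1); split=> // [|y]; [exact: cts_cst|rewrite mulr1]. Qed.

Lemma has_dD f g x d e :
  has_d j f x d -> has_d j g x e -> has_d j (fun y => f y + g y) x (d + e).
Proof.
move=> /has_dP[p [pc <- pE]] /has_dP[q [qc <- qE]]; apply/has_dP; exists (fun y => p y + q y); split=> //.
  exact: ctsD.
by move=> y; rewrite mulrDr -pE -qE opprD addrACA.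
Qed.

Lemma has_dN f x d : has_d j f x d -> has_d j (fun y => - f y) x (- d).
Proof.
move=> /has_dP[p [pc <- pE]]; apply/has_dP; exists (fun y => - p y); split=> //; first exact: ctsN.
by move=> y; rewrite mulrN -pE opprB opprK addrC.
Qed.

Lemma has_dM f g x d e :
  has_d j f x d -> has_d j g x e ->
  has_d j (fun y => f y * g y) x (d * g x + f x * e).
Proof.
move=> fd gd; have gc := has_d_cont gd; move: fd gd => /has_dP[p [pc <- pE]] /has_dP[q [qc <- qE]].
apply/has_dP; exists (fun y => p y * g y + f x * q y); split=> //.
  apply: ctsD; apply: ctsM => //; exact: cts_cst.
by move=> y; rewrite mulrDr mulrA -pE mulrCA -qE; ring.
Qed.

Lemma has_d_comp (g : C -> C) f x d e :
  has_d j f x d -> has_d id g (f x) e -> has_d j (fun y => g (f y)) x (e * d).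
Proof.
move=> fd; have fc := has_d_cont fd; move: fd => /has_dP[p [pc <- pE]] /has_dP[q [qc <- qE]].
apply/has_dP; exists (fun y => q (f y) * p y); split=> // [|y].
  by apply: ctsM => //; apply: (cts_compC fc).
by rewrite qE pE mulrAC mulrA.
Qed.

Lemma has_d_C1 (f v : V -> C) x : (\forall y \near x, has_d j f y (v y)) ->
  (\forall y \near x, cts v y) -> C1at j f x.
Proof. by move=> fd vc; apply/C1P; exists v; apply: filterS2 fd vc => y; split. Qed.

Lemma C1_cont f x : C1at j f x -> cts f x.
Proof. by move=> /C1P[v] /nbhs_singleton[/has_d_cont]. Qed.

Lemma C1_has_d f x : C1at j f x -> exists d, has_d j f x d.
Proof. by move=> /C1P[v] /nbhs_singleton[]; exists (v x). Qed.

Lemma C1_cst (c : C) x : C1at j (fun=> c) x.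
Proof.
apply/C1P; exists (fun=> 0); near=> y; split; [exact: has_d_cst|exact: cts_cst].
Unshelve. all: by end_near. Qed.

Lemma C1_j x : C1at j j x.
Proof.
apply/C1P; exists (fun=> 1); near=> y; split; [exact: has_d_j|exact: cts_cst].
Unshelve. all: by end_near. Qed.

Lemma C1D f g x : C1at j f x -> C1at j g x -> C1at j (fun y => f y + g y) x.
Proof.
move=> /C1P[v Hv] /C1P[w Hw]; apply/C1P; exists (fun y => v y + w y); apply: filterS2 Hv Hw.
by move=> y [fd vc] [gd wc]; split; [exact: has_dD|exact: ctsD].
Qed.

Lemma C1N f x : C1at j f x -> C1at j (fun y => - f y) x.
Proof.
move=> /C1P[v Hv]; apply/C1P; exists (fun y => - v y); apply: filterS Hv.
by move=> y [fd vc]; split; [exact: has_dN|exact: ctsN].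
Qed.

Lemma C1B f g x : C1at j f x -> C1at j g x -> C1at j (fun y => f y - g y) x.
Proof. by move=> fd /C1N; exact: C1D. Qed.

Lemma C1M f g x : C1at j f x -> C1at j g x -> C1at j (fun y => f y * g y) x.
Proof.
move=> /C1P[v Hv] /C1P[w Hw]; apply/C1P; exists (fun y => v y * g y + f y * w y).
apply: filterS2 Hv Hw => y [fd vc] [gd wc]; split; first exact: has_dM.
by apply: ctsD; apply: ctsM => //; apply: has_d_cont; eassumption.
Qed.

Lemma C1_prod (I : Type) (r : seq I) (P : pred I) (f : I -> V -> C) x :
  (forall i, P i -> C1at j (f i) x) -> C1at j (fun y => \prod_(i <- r | P i) f i y) x.
Proof.
move=> fc; elim: r => [|i r IH].
  rewrite (_ : (fun y => _) = (fun=> 1)); first exact: C1_cst.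
  by apply/funext => y; rewrite big_nil.
have [Pi|/negPf Pi] := boolP (P i); last first.
  rewrite (_ : (fun y => _) = fun y => \prod_(i <- r | P i) f i y); first exact: IH.
  by apply/funext => y; rewrite big_cons Pi.
rewrite (_ : (fun y => _) = fun y => f i y * \prod_(i <- r | P i) f i y).
  by apply: C1M; [exact: fc|exact: IH].
by apply/funext => y; rewrite big_cons Pi.
Qed.

Lemma C1X f n x : C1at j f x -> C1at j (fun y => f y ^+ n) x.
Proof.
move=> fc; elim: n => [|n IH]; first exact: C1_cst.
rewrite (_ : (fun y => _) = fun y => f y * f y ^+ n); first exact: C1M.
by apply/funext => y; rewrite exprS.
Qed.

Lemma C1_comp (g : C -> C) f x :
  C1at j f x -> C1at id g (f x) -> C1at j (fun y => g (f y)) x.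
Proof.
move=> fC; have /ctsP fc := C1_cont fC; move: fC => /C1P[v Hv] /C1P[w Hw].
apply/C1P; exists (fun y => w (f y) * v y); have {}Hw := fc _ Hw.
apply: filterS2 Hv Hw => y [fd vc] /= [gd wc]; split; first exact: has_d_comp.
by apply: ctsM => //; apply: (cts_compC (has_d_cont fd)).
Qed.

(** The factorization in [has_d] is required at every point, so the factor for [g] is the old one
    where [f] and [g] agree and a difference quotient elsewhere. Injectivity of [j] keeps the
    denominator nonzero there. *)
Lemma has_d_near f g x d : injective j -> (\forall y \near x, f y = g y) ->
  has_d j f x d -> has_d j g x d.
Proof.
move=> ji E; have fgx := nbhs_singleton E; move=> /has_dP[p [pc <- pE]].
apply/has_dP; exists (fun y => if f y == g y then p y else (g y - g x) / (j y - j x)); split=> //.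
- have Ep : \forall y \near x, p y = if f y == g y then p y else (g y - g x) / (j y - j x).
    by apply: filterS E => y ->; rewrite eqxx.
  exact: cts_eq Ep pc.
- by rewrite fgx eqxx.
- move=> y; case: eqP => [<-|fgy]; first by rewrite -fgx pE.
  rewrite mulrC divfK // subr_eq0; apply: contra_not_neq fgy => /ji->.
  exact: fgx.
Qed.

Lemma C1_eq f g x : injective j -> (\forall y \near x, f y = g y) ->
  C1at j f x -> C1at j g x.
Proof.
move=> ji E /C1P[v Hv]; apply/C1P; exists v; apply: filterS2 (near_join E) Hv => y Ey [fd vc].
by split=> //; exact: has_d_near Ey fd.
Qed.

(** The two factors agree wherever [j y != j x], and such points come arbitrarily close to [x];
    continuity does the rest. *)
Lemma has_d_uniq f x d e :
  (forall A, nbhs x A -> exists2 y, A y & j y != j x) ->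
  has_d j f x d -> has_d j f x e -> d = e.
Proof.
move=> iso /has_dP[p [pc <- pE]] /has_dP[q [qc <- qE]]; apply/eqP; rewrite -subr_eq0.
apply/negP => /negP pq; have pqc : cts (fun y => p y - q y) x.
  exact: ctsB.
have [y /eqP ny jy] := iso _ (cts_near_neq0 pqc pq).
apply: ny; apply/eqP; rewrite subr_eq0; apply/eqP.
by apply: (mulfI (_ : j y - j x != 0)); rewrite ?subr_eq0 // -pE -qE.
Qed.

End Derivation.

(** * Agreement with the usual derivatives *)

Section Caratheodory.
Context (K : numFieldType).
Implicit Types (f : K^o -> K^o) (a d : K^o).

Lemma is_derive_caratheodory f a d : is_derive a 1 f d <->
  exists phi : K^o -> K^o, [/\ {for a, continuous phi}, phi a = d &
    forall y, f y - f a = (y - a) * phi y].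
Proof.
split=> [[fd <-]|[phi [pc <- pE]]].
  pose phi y : K^o := if y == a then 'D_1 f a else (y - a)^-1 * (f y - f a).
  exists phi; split; last 2 first.
  - by rewrite /phi eqxx.
  - move=> y; rewrite /phi; case: eqP => [->|/eqP ya]; first by rewrite !subrr mul0r.
    by rewrite mulrA divff ?mul1r // subr_eq0.
  have /cvgrPdist_lt H : (fun h : K^o => h^-1 *: (f (h *: (1 : K^o) + a) - f a))
     @ 0^' --> 'D_1 f a by exact: fd.
  move=> A /nbhs_ballP[e /= e0 He]; have := H _ e0.
  rewrite near_withinE => /nbhs_ballP[r /= r0 Hr].
  apply/nbhs_ballP; exists r => //= y; rewrite /ball /= distrC => ya.
  apply: He; rewrite /ball /= /phi eqxx.
  case: eqP => [_|/eqP nya]; first by rewrite subrr normr0.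
  have := Hr (y - a); rewrite /ball /= sub0r normrN subr_eq0 => /(_ ya nya).
  by rewrite /GRing.scale /= mulr1 subrK.
have H : (fun h : K^o => h^-1 *: (f (h *: (1 : K^o) + a) - f a)) @ 0^' --> phi a.
  have pc' : (fun h : K^o => phi (h + a)) @ 0^' --> phi a.
    move=> A /pc /nbhs_ballP[r /= r0 Hr].
    change (\forall h \near (0 : K^o)^', A (phi (h + a))); rewrite near_withinE.
    apply/nbhs_ballP; exists r => //= h; rewrite /ball /= sub0r normrN => hr _.
    by apply: Hr; rewrite /ball /= opprD addrCA subrr addr0 normrN.
  apply: cvg_trans pc'; apply: near_eq_cvg; rewrite near_withinE.
  near=> h => h0; rewrite /GRing.scale /= mulr1 pE addrK mulrA mulVf ?mul1r //.
split; first by apply/cvg_ex; exists (phi a).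
exact: cvg_lim H.
Unshelve. all: by end_near. Qed.

End Caratheodory.

Section Bridges.
Context (R : realType).
Local Notation C := (R[i]^o).

Lemma cReB (z w : C) : complex.Re (z - w) = complex.Re z - complex.Re w.
Proof. exact: raddfB. Qed.

Lemma cImB (z w : C) : complex.Im (z - w) = complex.Im z - complex.Im w.
Proof. exact: raddfB. Qed.

Lemma cReD (z w : C) : complex.Re (z + w) = complex.Re z + complex.Re w.
Proof. exact: raddfD. Qed.

Lemma cImD (z w : C) : complex.Im (z + w) = complex.Im z + complex.Im w.
Proof. exact: raddfD. Qed.

Lemma cReM (z w : C) :
  complex.Re (z * w) = complex.Re z * complex.Re w - complex.Im z * complex.Im w.
Proof. by case: z w => [a b] [c d]. Qed.

Lemma cImM (z w : C) :
  complex.Im (z * w) = complex.Re z * complex.Im w + complex.Im z * complex.Re w.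
Proof. by case: z w => [a b] [c d]. Qed.

Definition toC : R -> C := fun x => x%:C.

Lemma Re_toCM (a : R) (z : C) : complex.Re (toC a * z) = a * complex.Re z.
Proof. by rewrite cReM /= mul0r subr0. Qed.

Lemma Im_toCM (a : R) (z : C) : complex.Im (toC a * z) = a * complex.Im z.
Proof. by rewrite cImM /= mul0r addr0. Qed.

Lemma toCc x : cts toC x. Proof. by apply: cts_toC; exact: cvg_id. Qed.

Lemma idCc (x : C) : cts id x. Proof. by apply/ctsP; exact: cvg_id. Qed.

Lemma toC_inj : injective toC. Proof. exact: complexI. Qed.

Lemma toC_nonisolated x (A : set R) : nbhs x A -> exists2 y, A y & toC y != toC x.
Proof.
move=> /nbhs_ballP[e /= e0 H]; have e2 : 0 < e / 2 by rewrite divr_gt0.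
exists (x + e / 2).
  by apply: H; rewrite /ball /= opprD addNKr normrN gtr0_norm // ltr_pdivrMr // mulr_natr mulr2n ltrDl.
by apply/eqP => /toC_inj; move: e2; lra.
Qed.

Lemma idC_nonisolated (x : C) (A : set C) : nbhs x A -> exists2 y, A y & id y != id x.
Proof.
move=> /nbhsC_nrm[e e0 H]; have e2 : 0 < e / 2 by rewrite divr_gt0.
exists (x + (e / 2)%:C).
  by apply: H; rewrite addrAC subrr add0r nrm_real gtr0_norm // ltr_pdivrMr // mulr_natr mulr2n ltrDl.
by rewrite -subr_eq0 addrAC subrr add0r gt_eqF // ltcR.
Qed.

Lemma has_d_uniqR (f : R -> C) x d e : has_d toC f x d -> has_d toC f x e -> d = e.
Proof. by apply: has_d_uniq; exact: toC_nonisolated. Qed.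

Lemma has_d_uniqC (f : C -> C) x d e : has_d id f x d -> has_d id f x e -> d = e.
Proof. by apply: has_d_uniq; exact: idC_nonisolated. Qed.

Lemma has_d_is_derive (f : C -> C) t d : has_d id f t d <-> is_derive t (1 : C) f d.
Proof.
split=> [/has_dP[p [/ctsP pc <- pE]]|/is_derive_caratheodory[p [pc <- pE]]].
  by apply/is_derive_caratheodory; exists p.
by apply/has_dP; exists p; split=> //; apply/ctsP.
Qed.

Lemma derivable_has_d (f : C -> C) t : derivable f t (1 : C) -> has_d id f t ('D_1 f t).
Proof. by move=> fd; apply/has_d_is_derive; exact: derivableP. Qed.

Lemma has_d_derivable (f : C -> C) t d : has_d id f t d -> derivable f t (1 : C).
Proof. by move/has_d_is_derive => -[]. Qed.

Lemma has_d_toC (f : R -> R) (x d : R) : is_derive x (1 : R) f d ->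
  has_d toC (fun y => toC (f y)) x (toC d).
Proof.
move=> /is_derive_caratheodory[p [pc <- pE]]; apply/has_dP; exists (fun y => toC (p y)).
split=> //; first exact: cts_toC.
by move=> y; rewrite /toC -!rmorphB /= pE rmorphM.
Qed.

Lemma has_d_ReIm (c : R -> C) s d : has_d toC c s d <->
  is_derive s (1 : R) (@complex.Re R \o c) (complex.Re d) /\
  is_derive s (1 : R) (@complex.Im R \o c) (complex.Im d).
Proof.
have toCB (x y : R) : toC x - toC y = toC (x - y) by rewrite /toC rmorphB.
split=> [/has_dP[p [pc <- pE]]|].
  split; apply/is_derive_caratheodory.
    exists (fun y => complex.Re (p y)); split=> //; first exact: cts_Re.
    by move=> y /=; rewrite -cReB pE toCB Re_toCM.
  exists (fun y => complex.Im (p y)); split=> //; first exact: cts_Im.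
  by move=> y /=; rewrite -cImB pE toCB Im_toCM.
move=> [/is_derive_caratheodory[p [pc pd pE]] /is_derive_caratheodory[q [qc qd qE]]].
apply/has_dP; exists (fun y => p y +i* q y); split.
- exact: cts_Complex.
- by rewrite pd qd; case: (d).
- move=> y; apply/eqP; rewrite eq_complex toCB; apply/andP; split; apply/eqP.
    by rewrite Re_toCM cReB; exact: pE.
  by rewrite Im_toCM cImB; exact: qE.
Qed.

Lemma has_d_velocity (c : R -> C) s d : has_d toC c s d -> velocity c s = d.
Proof.
move=> /has_d_ReIm[[_ dr] [_ di]]; rewrite /velocity !derive1E dr di.
by case: (d).
Qed.

Lemma C1_C1_near (c : R -> C) s : C1at toC c s -> C1_near c s.
Proof.
move=> /C1P[v /near_join Hv]; apply: filterS Hv => r Hr.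
have [cd vc] := nbhs_singleton Hr.
have E : \forall y \near r, v y = velocity c y.
  by apply: filterS Hr => y [/has_d_velocity-> _].
have /has_d_ReIm[[? _] [? _]] := cd.
have vvc : cts (velocity c) r by exact: cts_eq E vc.
by split; [assumption|assumption|exact: (cts_Re vvc)|exact: (cts_Im vvc)].
Qed.

Lemma C1_near_has_d (c : R -> C) s : C1_near c s -> has_d toC c s (velocity c s).
Proof.
move=> /nbhs_singleton[rd idv _ _]; apply/has_d_ReIm => /=.
by rewrite !derive1E; split; exact: derivableP.
Qed.

Lemma C1_near_C1at (c : R -> C) s : C1_near c s <-> C1at toC c s.
Proof.
split=> [cC|/C1_C1_near//]; apply/C1P; exists (velocity c).
have := near_join cC; apply: filterS => r Hr; split; first exact: C1_near_has_d.
have [_ _ rc ic] := nbhs_singleton Hr; exact: cts_Complex.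
Qed.

Lemma C1_toC (f f' : R -> R) x : (forall y, is_derive y (1 : R) f (f' y)) ->
  continuous f' -> C1at toC (fun y => toC (f y)) x.
Proof.
move=> fd fc; apply/C1P; exists (fun y => toC (f' y)); near=> y; split.
  exact: has_d_toC.
by apply: cts_toC; exact: fc.
Unshelve. all: by end_near. Qed.

End Bridges.

(** * The principal square root on the right half plane *)

Section SquareRoot.
Context (R : realType).
Local Notation C := (R[i]^o).
Implicit Types z w : C.

Lemma Re_sqrtc_ge0 z : 0 <= complex.Re (sqrtc z).
Proof. by case: z => a b; rewrite /= sqrtr_ge0. Qed.

Lemma Re_sqrtc_gt0 z : 0 < complex.Re z -> 0 < complex.Re (sqrtc z).
Proof.
case: z => a b /= a0; rewrite sqrtr_gt0 divr_gt0 // ltr_wpDl ?sqrtr_ge0 //.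
Qed.

Lemma sqr_eq_sign z w : z ^+ 2 = w ^+ 2 -> exists b : bool, z = (-1) ^+ b * w.
Proof.
move=> /eqP; rewrite eqf_sqr => /orP[/eqP->|/eqP->].
  by exists false; rewrite mul1r.
by exists true; rewrite mulN1r.
Qed.

Lemma sqrtc_add_neq0 z w : 0 < complex.Re z -> sqrtc w + sqrtc z != 0.
Proof.
move=> z0; apply: Re_gt0_neq0; rewrite raddfD /= ltr_wpDl ?Re_sqrtc_ge0 //.
exact: Re_sqrtc_gt0.
Qed.

(** Both roots have nonnegative real part, and that of [sqrtc z] is positive, so their sum is
    invertible. The right-hand side already has the shape of [has_d]: continuity and derivative are
    read off. *)
Lemma sqrtcB z w : 0 < complex.Re z ->
  sqrtc w - sqrtc z = (w - z) * (sqrtc w + sqrtc z)^-1.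
Proof.
move=> z0; have n0 := sqrtc_add_neq0 w z0.
by rewrite -{2}[w]sqr_sqrtc -{2}[z]sqr_sqrtc subr_sqr mulfK.
Qed.

Lemma cts_sqrtc z : 0 < complex.Re z -> cts (@sqrtc R : C -> C) z.
Proof.
move=> z0; apply/ctsE => e e0; have r0 := Re_sqrtc_gt0 z0.
apply/nbhsC_nrm; exists (e * complex.Re (sqrtc z)); first by rewrite mulr_gt0.
move=> y yz; rewrite sqrtcB // nrmM nrmV ltr_pdivrMr; last first.
  by rewrite nrm_gt0 sqrtc_add_neq0.
apply: lt_le_trans yz _; rewrite ler_pM2l //.
apply: le_trans (Re_le_nrm _); apply: le_trans (ler_norm _).
by rewrite raddfD /= lerDr Re_sqrtc_ge0.
Qed.

Lemma has_d_sqrtc z : 0 < complex.Re z ->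
  has_d id (@sqrtc R : C -> C) z ((sqrtc z + sqrtc z)^-1).
Proof.
move=> z0; apply/has_dP; exists (fun y : C => (sqrtc y + sqrtc z)^-1); split.
- apply: ctsV; first exact: sqrtc_add_neq0.
  by apply: ctsD; [exact: cts_sqrtc|exact: cts_cst].
- by [].
- by move=> y; exact: sqrtcB.
Qed.

Lemma C1_sqrtc z : 0 < complex.Re z -> C1at id (@sqrtc R : C -> C) z.
Proof.
move=> z0; apply: (@has_d_C1 _ _ _ _ (fun y : C => (sqrtc y + sqrtc y)^-1)).
  have := near_gt (cts_Re (idCc z)) z0; apply: filterS => y; exact: has_d_sqrtc.
have := near_gt (cts_Re (idCc z)) z0; apply: filterS => y y0.
apply: ctsV; first exact: sqrtc_add_neq0.
by apply: ctsD; exact: cts_sqrtc.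
Qed.

Lemma cts_has_dV (V : topologicalType) (j f : V -> C) x d : (forall y, cts j y) ->
  f x != 0 -> has_d j f x d -> has_d j (fun y => (f y)^-1) x (- (f x ^- 2) * d).
Proof.
move=> jc f0 fd; have fc := has_d_cont jc fd.
have inv_d : has_d id (@GRing.inv C) (f x) (- (f x ^- 2)).
  apply/has_dP; exists (fun y : C => if y == 0 then (f x) ^- 2 else - (y * f x)^-1).
  split.
  - apply: (@cts_eq _ _ (fun y : C => - (y * f x)^-1)).
      have := cts_near_neq0 (idCc (f x)) f0; apply: filterS => y /= /negPf->.
      by [].
    apply: ctsN; apply: ctsV; first by rewrite mulf_neq0.
    by apply: ctsM; [exact: idCc|exact: cts_cst].
  - by rewrite (negPf f0) expr2.
  - move=> y; case: eqP => [->|/eqP y0].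
      by rewrite invr0 !sub0r; field.
    by field; rewrite y0 f0.
exact: has_d_comp.
Qed.

Lemma C1V (V : topologicalType) (j f : V -> C) x : (forall y, cts j y) ->
  f x != 0 -> C1at j f x -> C1at j (fun y => (f y)^-1) x.
Proof.
move=> jc f0 fC; have fc := C1_cont jc fC; have := cts_near_neq0 fc f0.
move: fC => /C1P[v Hv] N0; apply/C1P; exists (fun y => - (f y ^- 2) * v y).
apply: filterS2 Hv N0 => y [fd vc] fy0; split; first exact: cts_has_dV.
apply: ctsM => //; apply: ctsN; apply: ctsV; first by rewrite expf_neq0.
by apply: ctsX; exact: has_d_cont fd.
Qed.

End SquareRoot.

(** Charts of the atlas are only known to be differentiable, whereas the explicit charts and loops
    are [C1at]. The flag [c] lets the same closure lemmas serve both. *)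
Definition smo (R : realType) (c : bool) (V : topologicalType) (j f : V -> R[i]^o)
    (x : V) : Prop :=
  if c then C1at j f x else exists d, has_d j f x d.

Section Smoothness.
Context (R : realType) (c : bool) (V : topologicalType).
Local Notation C := (R[i]^o).
Context (j : V -> C).
Hypothesis jc : forall x, cts j x.
Implicit Types (f : V -> C) (x : V).

Lemma smo_cts f x : smo c j f x -> cts f x.
Proof. by case: c => [/C1_cont|[d /has_d_cont]]; apply. Qed.

Lemma smo_C1 f x : C1at j f x -> smo c j f x.
Proof. by rewrite /smo; case: c => // /C1_has_d. Qed.

Lemma smo_cst (a : C) x : smo c j (fun=> a) x.
Proof. by apply: smo_C1; exact: C1_cst. Qed.

Lemma smoN f x : smo c j f x -> smo c j (fun y => - f y) x.
Proof.
rewrite /smo; case: c => [|[d fd]]; first exact: C1N.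
by exists (- d); exact: has_dN.
Qed.

Lemma smoM f h x : smo c j f x -> smo c j h x -> smo c j (fun y => f y * h y) x.
Proof.
rewrite /smo; case: c => [|[d fd] [e he]]; first exact: C1M.
by exists (d * h x + f x * e); exact: has_dM.
Qed.

Lemma smoV f x : f x != 0 -> smo c j f x -> smo c j (fun y => (f y)^-1) x.
Proof.
move=> f0; rewrite /smo; case: c => [|[d fd]]; first exact: C1V.
by exists (- (f x ^- 2) * d); exact: cts_has_dV.
Qed.

Lemma smoX f n x : smo c j f x -> smo c j (fun y => f y ^+ n) x.
Proof.
move=> fs; elim: n => [|n IH]; first exact: smo_cst.
rewrite (_ : (fun y => _) = fun y => f y * f y ^+ n); first exact: smoM.
by apply/funext => y; rewrite exprS.
Qed.

Lemma smo_comp (h : C -> C) f x :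
  smo c j f x -> C1at id h (f x) -> smo c j (fun y => h (f y)) x.
Proof.
rewrite /smo; case: c => [|[d fd] hC]; first exact: C1_comp.
by have [e he] := C1_has_d hC; exists (e * d); exact: has_d_comp.
Qed.

Lemma smo_eq f h x : injective j -> (\forall y \near x, f y = h y) ->
  smo c j f x -> smo c j h x.
Proof.
move=> ji E; rewrite /smo; case: c => [|[d fd]]; first exact: C1_eq.
by exists d; exact: has_d_near E fd.
Qed.

End Smoothness.

(** * Charts of the curve *)

Section CurveTopology.
Context (R : realType) (g : nat) (p : 'I_(2 * g + 2) -> R[i]^o).
Local Notation C := (R[i]^o).
Local Notation T := (curve p).
Implicit Types (P Q : T) (b : bool).

Definition swap (x : C * C) : C * C := (x.1^-1, x.2 / x.1 ^+ g.+1).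

Lemma swapK (x : C * C) : x.1 != 0 -> swap (swap x) = x.
Proof.
case: x => u v /= u0; rewrite /swap /= invrK exprVn invrK divfK //.
by rewrite expf_neq0.
Qed.

Lemma piece_neq b P : piece b P -> (piece (~~ b) P <-> (crd b P).1 != 0).
Proof.
case: b P => -[[x xP]|v] //= x0; split=> //; rewrite ?eqxx //.
- by move=> _; rewrite invr_eq0; exact: x0.
- by move=> /(_ isT).
Qed.

Lemma coord_swap b P : piece b P -> piece (~~ b) P -> crd (~~ b) P = swap (crd b P).
Proof.
case: b P => -[[x xP]|v] //= x0 _; exact/esym/swapK/x0.
Qed.

Lemma piece_or P : piece false P \/ piece true P.
Proof. by case: P => [x|v]; [left|right]. Qed.

Lemma coord_inj b P Q : piece b P -> piece b Q -> crd b P = crd b Q -> P = Q.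
Proof.
have inj0 (x y : {x : C * C | x.2 ^+ 2 == branch_poly p x.1}) :
  val x = val y -> inl x = inl y :> T by move/val_inj->.
case: b P Q => -[x|v] [y|w] //=.
- move=> x0 y0 E; apply: inj0.
  rewrite -[LHS](swapK (x0 isT)) -[RHS](swapK (y0 isT)); congr swap; exact: E.
- by move=> x0 _ [/eqP]; rewrite invr_eq0 (negPf (x0 isT)).
- by move=> _ y0 [/esym/eqP]; rewrite invr_eq0 (negPf (y0 isT)).
- by move=> _ _ E; congr inr; apply: val_inj; case: E.
- by move=> _ _; exact: inj0.
Qed.

Definition recip_poly (u : C) : C := \prod_i (1 - p i * u).

Lemma card_branch : #|{: 'I_(2 * g + 2)}| = (g.+1 * 2)%N.
Proof. by rewrite card_ord; lia. Qed.

Lemma recip_polyE u : u != 0 -> recip_poly u = u ^+ (g.+1 * 2) * branch_poly p u^-1.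
Proof.
move=> u0; rewrite /recip_poly /branch_poly -card_branch -prodr_const -big_split /=.
by apply: eq_bigr => i _; rewrite mulrBr divff // [u * _]mulrC.
Qed.

Definition curve_eq b : C -> C := if b then recip_poly else branch_poly p.

Lemma coord_eq b P : piece b P -> (crd b P).2 ^+ 2 = curve_eq b (crd b P).1.
Proof.
case: b P => -[[[z w] /= /eqP E]|v] //=.
- move=> /(_ isT) z0; rewrite recip_polyE ?invr_eq0 // invrK -E expr_div_n -exprM.
  by rewrite exprVn mulrC.
- by move=> _; rewrite (eqP (valP v)) /recip_poly big1 // => i _; rewrite mulr0 subr0.
Qed.

Definition aff0 : {x : C * C | x.2 ^+ 2 == branch_poly p x.1} :=
  exist (fun x : C * C => x.2 ^+ 2 == branch_poly p x.1) _ (sheet_subproof p false 0).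

Definition inf0 : {v : C | v ^+ 2 == 1} :=
  exist (fun v : C => v ^+ 2 == 1) 1 (introT eqP (expr1n C 2)).

Definition mkaff (x : C * C) : T := inl (insubd aff0 x).

Lemma piece_mkaff x : piece false (mkaff x). Proof. by []. Qed.

Lemma coord_mkaff (x : C * C) : x.2 ^+ 2 = branch_poly p x.1 -> crd false (mkaff x) = x.
Proof. move=> /eqP E; exact: (insubdK aff0 E). Qed.

Definition mkinf (x : C * C) : T :=
  if x.1 == 0 then inr (insubd inf0 x.2)
  else mkaff (swap x).

Lemma mkinf_spec (x : C * C) : x.2 ^+ 2 = recip_poly x.1 ->
  piece true (mkinf x) /\ crd true (mkinf x) = x.
Proof.
case: x => u v /= E; rewrite /mkinf /=; case: eqP => [u0|/eqP u0].
  split=> //; have v1 : v ^+ 2 == 1.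
    by rewrite E u0 /recip_poly big1 // => i _; rewrite mulr0 subr0.
  by rewrite /crd (insubdK inf0 v1) u0.
have sE : (swap (u, v)).2 ^+ 2 = branch_poly p (swap (u, v)).1.
  rewrite /= expr_div_n E recip_polyE // -exprM mulrAC divff ?mul1r //.
  by rewrite expf_neq0.
have cE := coord_mkaff sE; have z0 : (crd false (mkaff (swap (u, v)))).1 != 0.
  by rewrite cE /= invr_eq0.
have tp := (piece_neq (piece_mkaff (swap (u, v)))).2 z0.
split; first exact: tp.
by rewrite (coord_swap (piece_mkaff _) tp) cE swapK.
Qed.

Definition mkpt b : C * C -> T := if b then mkinf else mkaff.

Lemma mkpt_spec b (x : C * C) : x.2 ^+ 2 = curve_eq b x.1 ->
  piece b (mkpt b x) /\ crd b (mkpt b x) = x.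
Proof.
by case: b => [/mkinf_spec//|E]; split; [exact: piece_mkaff|exact: coord_mkaff].
Qed.

Lemma cts_fst (x : C * C) : cts (fun y : C * C => y.1) x.
Proof. by apply/ctsP; exact: cvg_fst. Qed.

Lemma cts_snd (x : C * C) : cts (fun y : C * C => y.2) x.
Proof. by apply/ctsP; exact: cvg_snd. Qed.

Lemma cts_swap (x : C * C) : x.1 != 0 ->
  cts (fun y => (swap y).1) x /\ cts (fun y => (swap y).2) x.
Proof.
move=> x0; have fc := cts_fst x; split; first exact: ctsV.
apply: ctsM; first exact: cts_snd.
by apply: ctsV; [rewrite expf_neq0|exact: ctsX].
Qed.

Definition box b (x : C * C) (e : R) : set T :=
  [set Q | [/\ piece b Q, nrm ((crd b Q).1 - x.1) < e & nrm ((crd b Q).2 - x.2) < e]].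

Lemma open_box b x e : open (box b x e).
Proof.
have near_box (V : topologicalType) (h1 h2 : V -> C) (y : V) : cts h1 y -> cts h2 y ->
    nrm (h1 y - x.1) < e -> nrm (h2 y - x.2) < e ->
    \forall z \near y, nrm (h1 z - x.1) < e /\ nrm (h2 z - x.2) < e.
  move=> c1 c2 l1 l2.
  have := near_lt (cts_nrm (ctsB c1 (cts_cst x.1 y))) l1.
  have := near_lt (cts_nrm (ctsB c2 (cts_cst x.2 y))) l2.
  by apply: filterS2 => z; split.
move=> b'; have [->|nb] := eqVneq b' b.
  exists [set y | nrm (y.1 - x.1) < e /\ nrm (y.2 - x.2) < e]; last first.
    by move=> Q bQ; split=> [[]|[]].
  by rewrite openE => y [l1 l2]; exact: (near_box _ fst snd y (cts_fst y) (cts_snd y)).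
have b'E : b = ~~ b' by case: b b' nb => -[].
exists [set y : C * C | y.1 != 0 /\
    (nrm ((swap y).1 - x.1) < e /\ nrm ((swap y).2 - x.2) < e)].
  rewrite openE => y [y0 [l1 l2]]; have [c1 c2] := cts_swap y0.
  apply: filterS2 (cts_near_neq0 (cts_fst y) y0) (near_box _ _ _ _ c1 c2 l1 l2) => z.
  by move=> ? ?; split.
move=> Q b'Q; split=> [[bQ]|[]].
  rewrite {1 2}b'E coord_swap -?b'E // => l1 l2; split=> //.
  by apply/(piece_neq b'Q); rewrite -b'E.
move=> /(piece_neq b'Q); rewrite -b'E => bQ; rewrite /box /= {2 3}b'E coord_swap -?b'E //.
by case.
Qed.

(** Openness is tested in both affine pieces. A box of one piece passes both tests, as [swap] is
    continuous where the pieces overlap; hence the coordinates of any one piece at [P] describe its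
    neighbourhoods. *)
Lemma nbhs_curve b P (A : set T) : piece b P ->
  (nbhs P A <-> exists2 e : R, 0 < e & box b (crd b P) e `<=` A).
Proof.
move=> bP; split=> [|[e e0 eA]]; last first.
  apply: filterS eA _; apply: open_nbhs_nbhs; split; first exact: open_box.
  by split=> //; rewrite subrr ComplexField.Normc.normc0.
rewrite nbhsE => -[U [oU UP] UA]; have [W oW WU] := oU b.
have : nbhs (crd b P) W by apply: open_nbhs_nbhs; split=> //; exact/WU.
move=> [[A1 A2] /= [/nbhsC_nrm[e1 e10 He1] /nbhsC_nrm[e2 e20 He2]] AW].
exists (Num.min e1 e2); first by rewrite lt_min e10.
move=> Q [bQ]; rewrite !lt_min => /andP[l1 _] /andP[_ l2].
by apply/UA/WU => //; apply: AW; split=> /=; [exact: He1|exact: He2].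
Qed.

Lemma near_piece b P : piece b P -> \forall Q \near P, piece b Q.
Proof. by move=> bP; apply/(nbhs_curve _ bP); exists 1 => // Q []. Qed.

Lemma cts_coord b P : piece b P ->
  cts (fun Q => (crd b Q).1) P /\ cts (fun Q => (crd b Q).2) P.
Proof.
by move=> bP; split; apply/ctsE => e e0; apply/(nbhs_curve _ bP); exists e => // Q [].
Qed.

Lemma continuous_curve b (V : topologicalType) (h : V -> T) (x : V) :
  (\forall y \near x, piece b (h y)) ->
  cts (fun y => (crd b (h y)).1) x -> cts (fun y => (crd b (h y)).2) x ->
  {for x, continuous h}.
Proof.
move=> bh /ctsE c1 /ctsE c2 A /(nbhs_curve _ (nbhs_singleton bh))[e e0 eA].
by apply: filterS3 bh (c1 _ e0) (c2 _ e0) => y ? ? ?; exact: eA.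
Qed.

Lemma cts_coord_comp b (V : topologicalType) (h : V -> T) (x : V) :
  piece b (h x) -> {for x, continuous h} ->
  [/\ \forall y \near x, piece b (h y), cts (fun y => (crd b (h y)).1) x &
      cts (fun y => (crd b (h y)).2) x].
Proof.
move=> bx hc; have [c1 c2] := cts_coord bx; split.
- exact: hc (near_piece bx).
- exact: cts_comp hc c1.
- exact: cts_comp hc c2.
Qed.

Definition smooth_curve c (V : topologicalType) (j : V -> C) b (h : V -> T) (x : V) :=
  [/\ \forall y \near x, piece b (h y), smo c j (fun y => (crd b (h y)).1) x &
      smo c j (fun y => (crd b (h y)).2) x].

Lemma smooth_curve_continuous c V j b h x : (forall y, cts j y) ->
  @smooth_curve c V j b h x -> {for x, continuous h}.
Proof.
by move=> jc [bh s1 s2]; apply: (continuous_curve bh); apply: (smo_cts jc); eassumption.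
Qed.

Lemma smooth_curve_piece c V j b b' h x : (forall y, cts j y) -> injective j ->
  piece b' (h x) -> @smooth_curve c V j b h x -> @smooth_curve c V j b' h x.
Proof.
move=> jc ji b'x hs; have hc := smooth_curve_continuous jc hs; case: hs => bh s1 s2.
have [->|nb] := eqVneq b' b; first by split.
have b'E : b' = ~~ b by case: b b' nb {bh s1 s2 b'x} => -[].
have b'h := hc _ (near_piece b'x).
have x0 : (crd b (h x)).1 != 0.
  by apply/(piece_neq (nbhs_singleton bh)); rewrite -b'E.
have E : \forall y \near x, swap (crd b (h y)) = crd b' (h y).
  by apply: filterS2 bh b'h => y; rewrite b'E => ? ?; rewrite coord_swap.
split=> //.
  apply: (smo_eq (f := fun y => (crd b (h y)).1^-1)) => //; last exact: smoV.
  by apply: filterS E => y <-.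
apply: (smo_eq (f := fun y => (crd b (h y)).2 / (crd b (h y)).1 ^+ g.+1)) => //.
  by apply: filterS E => y <-.
apply: smoM => //; apply: smoV => //; first by rewrite expf_neq0.
exact: smoX.
Qed.

Lemma invol_aff_subproof (x : {x : C * C | x.2 ^+ 2 == branch_poly p x.1}) :
  ((val x).1, - (val x).2).2 ^+ 2 == branch_poly p ((val x).1, - (val x).2).1.
Proof. by rewrite /= sqrrN; exact: (valP x). Qed.

Lemma invol_inf_subproof (v : {v : C | v ^+ 2 == 1}) : (- val v) ^+ 2 == 1.
Proof. by rewrite sqrrN; exact: (valP v). Qed.

Definition invol P : T :=
  match P with
  | inl x => inl (exist (fun x : C * C => x.2 ^+ 2 == branch_poly p x.1) _ (invol_aff_subproof x))
  | inr v => inr (exist (fun v : C => v ^+ 2 == 1) _ (invol_inf_subproof v))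
  end.

Lemma piece_invol b P : piece b (invol P) = piece b P.
Proof. by case: P. Qed.

Lemma coord_invol b P : crd b (invol P) = ((crd b P).1, - (crd b P).2).
Proof. by case: b P => -[x|v] //=; rewrite mulNr. Qed.

Lemma involK : involutive invol.
Proof.
move=> P; have [bP|bP] := piece_or P; apply: (coord_inj _ bP); rewrite ?piece_invol //;
  by rewrite !coord_invol /= opprK; case: (crd _ _).
Qed.

Lemma invol_continuous : continuous invol.
Proof.
move=> P; have [b bP] : exists b, piece b P.
  by have [|] := piece_or P; [exists false|exists true].
have [c1 c2] := cts_coord bP.
apply: (@continuous_curve b).
- by apply: filterS (near_piece bP) => Q; rewrite piece_invol.
- by rewrite (_ : (fun _ => _) = (fun Q => (crd b Q).1)) //; apply/funext => Q; rewrite coord_invol.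
- rewrite (_ : (fun _ => _) = (fun Q => - (crd b Q).2)); first exact: ctsN.
  by apply/funext => Q; rewrite coord_invol.
Qed.

Lemma smooth_curve_invol c V j b h x :
  @smooth_curve c V j b h x -> @smooth_curve c V j b (invol \o h) x.
Proof.
case=> bh s1 s2; split.
- by apply: filterS bh => y; rewrite /= piece_invol.
- by rewrite (_ : (fun _ => _) = (fun y => (crd b (h y)).1)) //; apply/funext => y; rewrite /= coord_invol.
- rewrite (_ : (fun _ => _) = (fun y => - (crd b (h y)).2)); first exact: smoN.
  by apply/funext => y; rewrite /= coord_invol.
Qed.

End CurveTopology.

(** * Charts with explicit inverses *)

Section GoodCharts.
Context (R : realType) (g : nat) (p : 'I_(2 * g + 2) -> R[i]^o).
Local Notation C := (R[i]^o).
Local Notation T := (curve p).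
Implicit Types (P Q : T) (b : bool).

(** The other possibility [x = - y] would put [x] at distance [2 * nrm y] from [y]. *)
Lemma sqr_near_eq (x y : C) : x ^+ 2 = y ^+ 2 -> nrm (x - y) < nrm y -> x = y.
Proof.
move=> /sqr_eq_sign[[]]; rewrite ?expr0 ?mul1r // expr1 mulN1r => ->.
rewrite -opprD nrmN => lt; have : nrm (y + y) = nrm y *+ 2.
  by rewrite -mulr2n normcMn.
by move=> E; exfalso; have := nrm_ge0 y; move: lt; rewrite E mulr2n; lra.
Qed.

Lemma atlas_smooth (phi : chart R T) s : curve_atlas phi -> chart_dom phi s ->
  exists b, smooth_curve false (id : C -> C) b phi s.
Proof.
move=> [oD _ [b Hb]] Ds; exists b; have [_ dx dy _] := Hb s Ds; split.
- have : nbhs s (chart_dom phi) by apply: open_nbhs_nbhs; split.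
  by apply: filterS => y /Hb[].
- exists ('D_1 (fun s : C => (crd b (phi s)).1) s); exact: derivable_has_d dx.
- exists ('D_1 (fun s : C => (crd b (phi s)).2) s); exact: derivable_has_d dy.
Qed.

Lemma atlas_continuous (phi : chart R T) s : curve_atlas phi -> chart_dom phi s ->
  {for s, continuous (phi : C -> T)}.
Proof.
move=> aphi Ds; have [b] := atlas_smooth aphi Ds.
by apply: smooth_curve_continuous; exact: idCc.
Qed.

Lemma atlas_near (phi : chart R T) s : curve_atlas phi -> chart_dom phi s ->
  \forall y \near s, chart_dom phi y.
Proof. by move=> [oD _ _] Ds; apply: open_nbhs_nbhs; split. Qed.

(** The value of a form in this chart is the value in [phi] of its pullback under [invol]. *)
Definition invol_chart (phi : chart R T) : chart R T :=
  @Chart R T (chart_dom phi) (fun t => invol (phi t)).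

Lemma invol_chart_atlas (phi : chart R T) : curve_atlas phi ->
  curve_atlas (invol_chart phi).
Proof.
move=> [oD inj [b Hb]]; split=> //.
  by move=> x y Dx Dy /(can_inj (@involK R g p)); exact: inj.
exists b => t Dt; have [bt dx dy nz] := Hb t Dt.
have E1 : (fun s : C => (crd b (invol_chart phi s)).1) = (fun s : C => (crd b (phi s)).1).
  by apply/funext => s; rewrite /= coord_invol.
have E2 : (fun s : C => (crd b (invol_chart phi s)).2) =
    - (fun s : C => (crd b (phi s)).2 : C).
  by apply/funext => s; rewrite /= coord_invol.
split.
- by rewrite /= piece_invol.
- by rewrite E1.
- by rewrite E2; exact: derivableN.
- rewrite E1 E2; case: nz => nz; [by left|right].
  by rewrite deriveN // oppr_eq0.
Qed.

(** A chart with an explicit local inverse [inv] that turns smooth curves into smooth functions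
    ([gc_smooth]). Changes of charts into a good chart are then differentiable by composition, which
    takes the place of an inverse function theorem. *)
Record good_chart (psi : chart R T) (inv : T -> C) : Prop := GoodChart {
  gc_atlas : curve_atlas psi;
  gc_C1 : forall t, chart_dom psi t ->
    exists b, smooth_curve true (id : C -> C) b psi t;
  gc_inv : forall t, chart_dom psi t -> inv (psi t) = t;
  gc_near : forall t, chart_dom psi t ->
    \forall Q \near psi t, chart_dom psi (inv Q) /\ psi (inv Q) = Q;
  gc_cts : forall t, chart_dom psi t -> cts inv (psi t);
  gc_smooth : forall t c (V : topologicalType) (j : V -> C) b (h : V -> T) x,
    chart_dom psi t -> (forall y, cts j y) -> injective j -> h x = psi t ->
    smooth_curve c j b h x -> smo c j (fun y => inv (h y)) x }.

Lemma mk_good_chart (psi : chart R T) (inv : T -> C) b :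
  open (chart_dom psi) ->
  (forall t, chart_dom psi t -> smooth_curve true (id : C -> C) b psi t /\
    exists d1 d2, [/\ has_d id (fun s => (crd b (psi s)).1) t d1,
      has_d id (fun s => (crd b (psi s)).2) t d2 & d1 != 0 \/ d2 != 0]) ->
  (forall t, chart_dom psi t -> inv (psi t) = t) ->
  (forall t, chart_dom psi t ->
    \forall Q \near psi t, chart_dom psi (inv Q) /\ psi (inv Q) = Q) ->
  (forall t, chart_dom psi t -> cts inv (psi t)) ->
  (forall t c (V : topologicalType) (j : V -> C) (h : V -> T) x,
    chart_dom psi t -> (forall y, cts j y) -> injective j -> h x = psi t ->
    smooth_curve c j b h x -> smo c j (fun y => inv (h y)) x) ->
  good_chart psi inv.
Proof.
move=> oD Hb invK near_inv cts_inv smooth_inv; split=> //.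
- split=> //.
    by move=> x y /set_mem Dx /set_mem Dy E; rewrite -(invK _ Dx) -(invK _ Dy) E.
  exists b => t Dt; have [[bt _ _] [d1 [d2 [h1 h2 nz]]]] := Hb t Dt.
  split.
  + exact: nbhs_singleton bt.
  + exact: has_d_derivable h1.
  + exact: has_d_derivable h2.
  + move: h1 h2 => /has_d_is_derive[_ e1] /has_d_is_derive[_ e2].
    by case: nz => nz; [left; rewrite e1|right; rewrite e2].
- by move=> t Dt; have [? _] := Hb t Dt; exists b.
- move=> t c V j b' h x Dt jc ji hx hs; apply: smooth_inv (hx) _ => //.
  apply: smooth_curve_piece hs => //; rewrite hx.
  by have [[/nbhs_singleton]] := Hb t Dt.
Qed.

Definition graph_chart b (D : set C) (Y : C -> C) : chart R T :=
  @Chart R T D (fun t => mkpt p b (t, Y t)).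

Section GraphChart.
Context (b : bool) (D : set C) (Y : C -> C).
Hypothesis oD : open D.
Hypothesis Y2 : forall t, Y t ^+ 2 = curve_eq p b t.
Hypothesis YC : forall t, D t -> C1at id Y t.
Hypothesis Y0 : forall t, D t -> Y t != 0.

Lemma crd_graph_chart t : piece b (graph_chart b D Y t) /\
  crd b (graph_chart b D Y t) = (t, Y t).
Proof. by apply: mkpt_spec; rewrite /= Y2. Qed.

Lemma graph_chart_good : good_chart (graph_chart b D Y) (fun Q => (crd b Q).1).
Proof.
have E1 : (fun s => (crd b (graph_chart b D Y s)).1) = id.
  by apply/funext => s; rewrite (crd_graph_chart s).2.
have E2 : (fun s => (crd b (graph_chart b D Y s)).2) = Y.
  by apply/funext => s; rewrite (crd_graph_chart s).2.
apply: (@mk_good_chart _ _ b) => //.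
- move=> t Dt; split.
    split; first by near=> s; exact: (crd_graph_chart s).1.
    + by rewrite E1; exact: C1_j.
    + by rewrite E2; exact: YC.
  have [d2 h2] := C1_has_d (YC Dt); exists 1, d2; rewrite E1 E2; split=> //.
  + exact: has_d_j.
  + by left; rewrite oner_eq0.
- by move=> t Dt; rewrite (crd_graph_chart t).2.
- move=> t Dt; have [bt tE] := crd_graph_chart t.
  set P := graph_chart b D Y t in bt tE *.
  have [c1 c2] := cts_coord bt; have nP := near_piece bt.
  have DP : nbhs ((crd b P).1) D by rewrite tE; apply: open_nbhs_nbhs; split.
  have nD : \forall Q \near P, D (crd b Q).1 by have /ctsP := c1; apply.
  have YcP : cts (fun Q => Y (crd b Q).1) P.
    by apply: cts_compC => //; rewrite tE; apply: (C1_cont (@idCc R)); exact: YC.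
  (* The second coordinate of a nearby point is a root of the same number as [Y]; being closer to
     [Y] than [Y] is to 0, it equals [Y], so that the point lies on the graph. *)
  have lt0 : nrm ((crd b P).2 - Y (crd b P).1) < nrm (Y (crd b P).1).
    by rewrite tE /= subrr ComplexField.Normc.normc0 nrm_gt0 Y0.
  have nlt : \forall Q \near P, 0 < nrm (Y (crd b Q).1) - nrm ((crd b Q).2 - Y (crd b Q).1).
    apply: near_gt; last by rewrite subr_gt0.
    by apply: continuousB; apply: cts_nrm => //; exact: ctsB.
  have nall : \forall Q \near P, [/\ piece b Q, D (crd b Q).1 &
     0 < nrm (Y (crd b Q).1) - nrm ((crd b Q).2 - Y (crd b Q).1)].
    by apply: filterS3 nP nD nlt => Q; split.
  apply: filterS nall => Q [bQ DQ ltQ]; split=> //.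
  have [bt' tE'] := crd_graph_chart (crd b Q).1.
  apply: (coord_inj bt' bQ); rewrite tE'.
  have -> : Y (crd b Q).1 = (crd b Q).2.
    apply/esym/sqr_near_eq; last by rewrite -subr_gt0.
    by rewrite coord_eq // Y2.
  by case: (crd b Q).
- by move=> t Dt; have [bt _] := crd_graph_chart t; have [] := cts_coord bt.
- by move=> t c V j h x Dt jc ji hx [_ s1 _].
Unshelve. all: by end_near. Qed.

End GraphChart.

Lemma branch_poly_C1 (z : C) : C1at id (branch_poly p) z.
Proof.
apply: (C1_prod (@idCc R)) => i _.
apply: (C1B (f := id) (g := fun=> p i)); last exact: C1_cst.
exact: C1_j.
Qed.

Definition z_dom (w0 : C) : set C := [set z | 0 < complex.Re (branch_poly p z / w0 ^+ 2)].

(** Division by [w0 ^+ 2] brings the radicand to 1 at the point with second coordinate [w0], away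
    from the cut of [sqrtc]; the factor [w0] then selects the sheet of that point. *)
Definition z_branch (w0 z : C) : C := w0 * sqrtc (branch_poly p z / w0 ^+ 2).

Definition z_chart (w0 : C) : chart R T := graph_chart false (z_dom w0) (z_branch w0).

Lemma z_chart_good (w0 : C) : w0 != 0 -> good_chart (z_chart w0) (fun Q => (crd false Q).1).
Proof.
move=> w00; have w20 : w0 ^+ 2 != 0 by rewrite expf_neq0.
have HC z : C1at id (fun z => branch_poly p z / w0 ^+ 2) z.
  apply: (C1M (@idCc R)); first exact: branch_poly_C1.
  exact: C1_cst.
apply: graph_chart_good.
- rewrite openE => z z0.
  have c : {for z, continuous (fun z => complex.Re (branch_poly p z / w0 ^+ 2))}.
    by apply: cts_Re; apply: (C1_cont (@idCc R)).
  exact: near_gt c z0.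
- by move=> z; rewrite /z_branch exprMn sqr_sqrtc mulrC divfK.
- move=> z z0; apply: (C1M (@idCc R)); first exact: C1_cst.
  by apply: (C1_comp (@idCc R)) => //; exact: C1_sqrtc.
- move=> z z0; rewrite mulf_neq0 // sqrtc_eq0; exact: Re_gt0_neq0.
Qed.

Definition inf_dom : set C := [set u | forall i, 0 < complex.Re (1 - p i * u)].

(** The factors [1 - p i * u] are 1 at [u = 0], so the product of their principal roots is
    holomorphic around it; the sign selects one of the two points at infinity. *)
Definition inf_branch (s : bool) (u : C) : C := (-1) ^+ s * \prod_i sqrtc (1 - p i * u).

Definition inf_chart (s : bool) : chart R T := graph_chart true inf_dom (inf_branch s).

Lemma open_inf_dom : open inf_dom.
Proof.
rewrite openE => u u0; apply: (@filter_forall _ _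
  (fun i v => 0 < complex.Re (1 - p i * v)) (nbhs u)) => i.
have c : {for u, continuous (fun v => complex.Re (1 - p i * v))}.
  apply: cts_Re; apply: ctsB; first exact: cts_cst.
  by apply: ctsM; [exact: cts_cst|exact: idCc].
exact: near_gt c (u0 i).
Qed.

Lemma inf_branch_sqr s u : inf_branch s u ^+ 2 = recip_poly p u.
Proof.
rewrite /inf_branch exprMn sqrr_sign mul1r -prodrXl.
by apply: eq_bigr => i _; rewrite sqr_sqrtc.
Qed.

Lemma inf_chart_good (s : bool) : good_chart (inf_chart s) (fun Q => (crd true Q).1).
Proof.
apply: graph_chart_good.
- exact: open_inf_dom.
- by move=> u; rewrite inf_branch_sqr.
- move=> u u0; apply: (C1M (@idCc R)); first exact: C1_cst.
  apply: (C1_prod (@idCc R)) => i _; apply: (C1_comp (@idCc R)); last exact: C1_sqrtc.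
  apply: C1B; first exact: C1_cst.
  apply: (C1M (@idCc R)); [exact: C1_cst|exact: C1_j].
- move=> u u0; rewrite mulf_neq0 ?signr_eq0 //; apply/prodf_neq0 => i _.
  by rewrite sqrtc_eq0; exact: Re_gt0_neq0.
Qed.

End GoodCharts.

(** * Charts at the branch points *)

Section SortedCharts.
Context (R : realType) (g : nat) (p : 'I_(2 * g + 2) -> R[i]^o).
Local Notation C := (R[i]^o).
Local Notation T := (curve p).
Local Notation n := (2 * g + 2)%N.
Context (q : nat -> C) (rot : C).
Hypothesis rot0 : rot != 0.
(* [rot] is chosen so that the branch points have distinct real parts after rotation. *)
Definition ell (z : C) : R := complex.Re (rot * z).
Hypothesis q_sorted : forall i j, (i < j)%N -> (j < n)%N -> ell (q i) < ell (q j).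
Hypothesis branch_polyE : forall z, branch_poly p z = \prod_(k <- iota 0 n) (z - q k).

Implicit Types z w : C.

Lemma ellB z w : ell (z - w) = ell z - ell w.
Proof. by rewrite /ell mulrBr cReB. Qed.

Lemma ellD z w : ell (z + w) = ell z + ell w.
Proof. by rewrite /ell mulrDr cReD. Qed.

Lemma ellZ (a : R) z : ell (toC a * z) = a * ell z.
Proof.
rewrite /ell (_ : rot * (toC a * z) = toC a * (rot * z)); first exact: Re_toCM.
exact: mulrCA.
Qed.

Lemma ell_continuous (V : topologicalType) (f : V -> C) x : cts f x ->
  {for x, continuous (fun y => ell (f y))}.
Proof. by move=> fc; apply: cts_Re; apply: ctsM => //; exact: cts_cst. Qed.

Definition side_rot (up : bool) : C := if up then rot else - rot.

Lemma side_rot_neq0 up : side_rot up != 0.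
Proof. by case: up => //=; rewrite oppr_eq0. Qed.

Definition side (up : bool) (k : nat) (z : C) : Prop :=
  if up then ell (q k) < ell z else ell z < ell (q k).

(** A root of [z - q k] on the half plane [side up k]: the factor [side_rot up] turns this half
    plane into the right half plane, where [sqrtc] is holomorphic, and the constant in front undoes
    it. *)
Definition sr (up : bool) (k : nat) (z : C) : C :=
  sqrtc (side_rot up)^-1 * sqrtc (side_rot up * (z - q k)).

Lemma side_Re up k z : side up k z <-> 0 < complex.Re (side_rot up * (z - q k)).
Proof.
case: up; rewrite /side /side_rot.
  by rewrite -/(ell (z - q k)) ellB subr_gt0.
by rewrite mulNr -mulrN opprB -/(ell (q k - z)) ellB subr_gt0.
Qed.

Lemma sr_sqr up k z : sr up k z ^+ 2 = z - q k.
Proof. by rewrite /sr exprMn !sqr_sqrtc mulrA mulVf ?mul1r // side_rot_neq0. Qed.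

Lemma sr_C1 up k z : side up k z -> C1at id (sr up k) z.
Proof.
move=> /side_Re z0; have ic := @idCc R.
apply: (C1M ic); first exact: C1_cst.
apply: (C1_comp ic (g := @sqrtc R)); last exact: C1_sqrtc.
apply: (C1M ic); first exact: C1_cst.
by apply: C1B; [exact: C1_j|exact: C1_cst].
Qed.

Lemma sr_neq0 up k z : side up k z -> sr up k z != 0.
Proof.
move=> /side_Re z0; rewrite mulf_neq0 // sqrtc_eq0 ?invr_eq0 ?side_rot_neq0 //.
exact: Re_gt0_neq0.
Qed.

Lemma side_near (V : topologicalType) (f : V -> C) x up k :
  cts f x -> side up k (f x) -> \forall y \near x, side up k (f y).
Proof. by move=> /ell_continuous fc; case: up => /= ?; [exact: near_gt|exact: near_lt]. Qed.

Lemma side_convex up k z w (s : R) : 0 <= s <= 1 -> side up k z -> side up k w ->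
  side up k (z + toC s * (w - z)).
Proof.
move=> /andP[s0 s1]; rewrite /side ellD ellZ ellB.
by case: (lerP (ell z) (ell w)) => zw; case: up => /= *; nra.
Qed.

(* [strip d i]: the points that lie beyond all branch points but [q i .. q (i + d)]. *)
Definition outer (d i k : nat) : bool := (k < i)%N || (i + d < k)%N.

Definition strip (d i : nat) : set C :=
  [set z | forall k, (k < n)%N -> outer d i k -> side (k < i)%N k z].

Lemma strip_near (V : topologicalType) (f : V -> C) x d i :
  cts f x -> strip d i (f x) -> \forall y \near x, strip d i (f y).
Proof.
move=> fc fx.
have : \forall y \near x, forall k : 'I_n, outer d i k -> side (k < i)%N k (f y).
  apply: (@filter_forall _ _ (fun (k : 'I_n) y => outer d i k -> side (k < i)%N k (f y))
    (nbhs x)) => k; case: (boolP (outer d i k)) => [ok|_]; last exact: nearW.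
  by apply: filterS (side_near fc (fx k (ltn_ord k) ok)) => y.
by apply: filterS => y H k kn; exact: (H (Ordinal kn)).
Qed.

Lemma strip_convex d i z w (s : R) : 0 <= s <= 1 -> strip d i z -> strip d i w ->
  strip d i (z + toC s * (w - z)).
Proof. by move=> s01 sz sw k kn ok; apply: side_convex => //; [exact: sz|exact: sw]. Qed.

Definition outer_root (d i : nat) (z : C) : C :=
  \prod_(k <- iota 0 n | outer d i k) sr (k < i)%N k z.

Lemma outer_root_C1 d i z : strip d i z -> C1at id (outer_root d i) z.
Proof.
move=> sz; rewrite /outer_root.
have -> : (fun z => \prod_(k <- iota 0 n | outer d i k) sr (k < i)%N k z) =
  (fun z => \prod_(k <- iota 0 n | (k \in iota 0 n) && outer d i k) sr (k < i)%N k z).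
  by apply/funext => y; rewrite big_seq_cond.
apply: (C1_prod (@idCc R)) => k /andP[]; rewrite mem_iota => /andP[_ kn] ok.
by apply: sr_C1; exact: sz.
Qed.

Lemma outer_root_neq0 d i z : strip d i z -> outer_root d i z != 0.
Proof.
move=> sz; rewrite prodf_seq_neq0; apply/allP => k; rewrite mem_iota => /andP[_ kn].
by apply/implyP => ok; apply: sr_neq0; apply: sz.
Qed.

Lemma outer_root_sqr d i z :
  outer_root d i z ^+ 2 = \prod_(k <- iota 0 n | outer d i k) (z - q k).
Proof. by rewrite -prodrXl; apply: eq_bigr => k _; rewrite sr_sqr. Qed.

Lemma branch_poly_outer0 i z : (i < n)%N ->
  branch_poly p z = (z - q i) * outer_root 0 i z ^+ 2.
Proof.
move=> iN; rewrite branch_polyE outer_root_sqr (bigD1_seq i) ?iota_uniq ?mem_iota //=.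
by congr (_ * _); apply: eq_bigl => k; rewrite /outer addn0 neq_ltn.
Qed.

Lemma outer1_0 i z : (i.+1 < n)%N -> outer_root 0 i z = outer_root 1 i z * sr false i.+1 z.
Proof.
move=> iN; rewrite /outer_root [LHS]big_mkcond [in RHS]big_mkcond /= mulrC.
rewrite (bigD1_seq i.+1) ?iota_uniq ?mem_iota //= [in RHS](bigD1_seq i.+1) ?iota_uniq ?mem_iota //=.
rewrite /outer addn0 addn1 ltnn ltnS leqnn orbT ltnNge leqnSn /= mul1r; congr (_ * _).
apply: eq_bigr => k ki; congr (if _ || _ then _ else _).
by rewrite [RHS]ltn_neqAle eq_sym ki.
Qed.

(** With [z = q i + t ^+ 2], the parameter [t] uniformizes both sheets over the strip around [q i],
    because the other factors of [branch_poly] have the holomorphic root [outer_root 0 i] there. *)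
Definition t_dom (i : nat) : set C := [set t | strip 0 i (q i + t ^+ 2)].

Definition t_map (i : nat) (t : C) : T :=
  mkpt p false (q i + t ^+ 2, t * outer_root 0 i (q i + t ^+ 2)).

Definition t_chart (i : nat) : chart R T := @Chart R T (t_dom i) (t_map i).

Definition t_inv (i : nat) (Q : T) : C := (crd false Q).2 / outer_root 0 i (crd false Q).1.

Lemma crd_t_map i t : (i < n)%N ->
  crd false (t_map i t) = (q i + t ^+ 2, t * outer_root 0 i (q i + t ^+ 2)).
Proof.
move=> iN; apply: (mkpt_spec (b := false) _).2 => /=.
by rewrite (branch_poly_outer0 _ iN) exprMn addrAC subrr add0r.
Qed.

Lemma piece_t_map i t : piece false (t_map i t). Proof. exact: piece_mkaff. Qed.

Lemma t_inv_sqr i Q : (i < n)%N -> piece false Q -> strip 0 i (crd false Q).1 ->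
  q i + t_inv i Q ^+ 2 = (crd false Q).1.
Proof.
move=> iN aQ sQ; rewrite /t_inv expr_div_n coord_eq // /curve_eq (branch_poly_outer0 _ iN).
by rewrite mulfK ?expf_neq0 ?outer_root_neq0 // addrC subrK.
Qed.

Lemma t_invK i Q : (i < n)%N -> piece false Q -> strip 0 i (crd false Q).1 ->
  t_dom i (t_inv i Q) /\ t_map i (t_inv i Q) = Q.
Proof.
move=> iN aQ sQ; have E := t_inv_sqr iN aQ sQ; split; first by rewrite /t_dom /= E.
apply: (coord_inj (piece_t_map _ _) aQ); rewrite crd_t_map // E /t_inv divfK ?outer_root_neq0 //.
by case: (crd false Q).
Qed.

Lemma t_dom_open i : open (t_dom i).
Proof.
rewrite openE => t Dt; have c : cts (fun t : C => q i + t ^+ 2) t.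
  by apply: ctsD; [exact: cts_cst|apply: ctsX; exact: idCc].
exact: strip_near c Dt.
Qed.

Lemma t_mapK i t : (i < n)%N -> t_dom i t -> t_inv i (t_map i t) = t.
Proof. by move=> iN Dt; rewrite /t_inv crd_t_map //= mulfK // outer_root_neq0. Qed.

Lemma t_inv_smooth i (c : bool) (V : topologicalType) (j : V -> C) (h : V -> T) x :
  (i < n)%N -> (forall y, cts j y) -> strip 0 i (crd false (h x)).1 ->
  smooth_curve c j false h x -> smo c j (fun y => t_inv i (h y)) x.
Proof.
move=> iN jc sx [_ s1 s2]; apply: smoM => //; apply: smoV => //.
  exact: outer_root_neq0.
by apply: smo_comp => //; exact: outer_root_C1.
Qed.

Lemma t_chart_good i : (i < n)%N -> good_chart (t_chart i) (t_inv i).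
Proof.
move=> iN; have ic := @idCc R.
have E1 : (fun s => (crd false (t_map i s)).1) = (fun s => q i + s ^+ 2).
  by apply/funext => s; rewrite crd_t_map.
have E2 : (fun s => (crd false (t_map i s)).2) =
    (fun s => s * outer_root 0 i (q i + s ^+ 2)).
  by apply/funext => s; rewrite crd_t_map.
have XC t : C1at id (fun s => q i + s ^+ 2) t.
  by apply: C1D; [exact: C1_cst|apply: (C1X ic); exact: C1_j].
have RC t : t_dom i t -> C1at id (fun s => outer_root 0 i (q i + s ^+ 2)) t.
  by move=> Dt; apply: (C1_comp ic (XC t)); exact: outer_root_C1.
apply: (@mk_good_chart _ _ _ _ _ false) => /=.
- exact: t_dom_open.
- move=> t Dt; split.
    split; first by near=> s; exact: piece_t_map.
    + by rewrite E1; exact: XC.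
    + by rewrite E2; apply: (C1M ic); [exact: C1_j|exact: RC].
  have [e he] := C1_has_d (RC t Dt).
  have := has_dM ic (has_d_j id t) he; rewrite mul1r -E2 => h2.
  have := has_dD (has_d_cst id (q i) t) (has_dM ic (has_d_j id t) (has_d_j id t)).
  rewrite mul1r mulr1 add0r => h1.
  exists (t + t), (outer_root 0 i (q i + t ^+ 2) + t * e); split=> //.
    by rewrite E1.
  (* The derivative [t + t] of the first coordinate vanishes at the branch point only, where that of
     the second is the nonzero value of [outer_root]. *)
  have [t0|t0] := eqVneq t 0.
    right; have := outer_root_neq0 (Dt : strip 0 i (q i + t ^+ 2)).
    by rewrite t0 mul0r addr0.
  by left; rewrite -mulr2n mulrn_eq0.
- by move=> t; exact: t_mapK.
- move=> t Dt; have aP := piece_t_map i t; have [c1 _] := cts_coord aP.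
  have sP : strip 0 i (crd false (t_map i t)).1 by rewrite crd_t_map.
  apply: filterS2 (near_piece aP) (strip_near c1 sP) => Q aQ sQ.
  exact: t_invK.
- move=> t Dt; have [c1 c2] := cts_coord (piece_t_map i t).
  have sP : strip 0 i (crd false (t_map i t)).1 by rewrite crd_t_map.
  apply: ctsM => //; apply: ctsV; first exact: outer_root_neq0.
  by apply: cts_compC => //; apply: (C1_cont ic); exact: outer_root_C1.
- move=> t c V j h x Dt jc ji hx hs; apply: t_inv_smooth => //.
  by rewrite hx crd_t_map.
Unshelve. all: by end_near. Qed.

Lemma strip_q d i k : (i <= k <= i + d)%N -> (i + d < n)%N -> strip d i (q k).
Proof.
move=> /andP[ik kd] iN l lN; rewrite /outer /side; case: ltnP => [li _|il /= dl].
  by apply: q_sorted; [exact: leq_trans ik|exact: leq_ltn_trans iN].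
by apply: q_sorted => //; exact: leq_ltn_trans dl.
Qed.

(** The last branch point not beyond [z] serves, or the first one when there is none. *)
Lemma strip_cover z : exists2 i, (i < n)%N & strip 0 i z.
Proof.
have n0 : (0 < n)%N by lia.
have [/existsP[i0 i0z]|/existsPn H] := boolP [exists i : 'I_n, ell (q i) <= ell z]; last first.
  exists 0%N => // k kn _ /=; have := H (Ordinal kn); rewrite /= -ltNge /side.
  by [].
pose i := [arg max_(i > i0 | ell (q i) <= ell z) (i : nat)].
have [iz imax] : ell (q i) <= ell z /\ forall j : 'I_n, ell (q j) <= ell z -> (j <= i)%N.
  by rewrite /i; case: arg_maxnP => // j jz H; split=> // k /H.
exists i => // k kn; rewrite /outer /side addn0; case: ltnP => [ki _|ik /=].
  exact: lt_le_trans (q_sorted ki (ltn_ord i)) iz.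
move=> ik'; rewrite ltNge; apply/negP => /(imax (Ordinal kn)) /=.
by rewrite leqNgt ik'.
Qed.

End SortedCharts.

(** * Singular chains *)

Section IntegralLift.
Context (K : choiceType) (W : zmodType).

Definition zlift (f : K -> W) (c : {freeg K / int}) : W := fglift (f : K -> zmodule W) c.

Lemma zliftB (f : K -> W) (c d : {freeg K / int}) :
  zlift f (c - d) = zlift f c - zlift f d.
Proof. exact: (@lift_is_additive int K (zmodule W) f c d). Qed.

Lemma zlift0 f : zlift f 0 = 0.
Proof. by have := zliftB f 0 0; rewrite !subrr. Qed.

Lemma zliftN f (c : {freeg K / int}) : zlift f (- c) = - zlift f c.
Proof. by have := zliftB f 0 c; rewrite zlift0 !sub0r. Qed.

Lemma zliftD f (c d : {freeg K / int}) : zlift f (c + d) = zlift f c + zlift f d.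
Proof. by rewrite -{1}[d]opprK zliftB zliftN opprK. Qed.

Lemma zliftU f (k : int) x : zlift f << k *g x >> = f x *~ k.
Proof. exact: (@liftU int (zmodule W) K f k x). Qed.

Lemma zliftU1 f x : zlift f << x >> = f x.
Proof. by rewrite zliftU. Qed.

Lemma zlift_sum f (I : Type) (r : seq I) (F : I -> {freeg K / int}) :
  zlift f (\sum_(i <- r) F i) = \sum_(i <- r) zlift f (F i).
Proof.
elim: r => [|i r IH]; first by rewrite !big_nil zlift0.
by rewrite !big_cons zliftD IH.
Qed.

Lemma zliftE f c : zlift f c = \sum_(k <- dom c) f k *~ coeff k c.
Proof.
rewrite -{1}[c]freeg_sumE zlift_sum; apply: eq_bigr => k _; exact: zliftU.
Qed.

Lemma zliftZ f (k : int) c : zlift f (k *: c) = zlift f c *~ k.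
Proof.
have zl n : zlift f (c *+ n) = zlift f c *+ n.
  by elim: n => [|n IH]; rewrite ?mulr0n ?zlift0 // !mulrS zliftD IH.
have zE : k *: c = c *~ k by rewrite -[k in LHS]intz scaler_int.
rewrite zE; case: k {zE} => n; first exact: zl.
by rewrite NegzE !mulrNz zliftN; congr (- _); exact: zl.
Qed.

End IntegralLift.

(** * Classes of paths modulo boundaries *)

Section Chains.
Context (R : realType) (T : topologicalType) (G : nzRingType) (S : set T).
Local Notation chain := {freeg (R -> T) / G}.
Implicit Types (c d : chain) (s : R -> T).

Definition bnd : {pred chain} := fun c =>
  `[< exists l : seq (G * (R * R -> T)), (forall k, k \in l -> singular2 S k.2) /\
        c = \sum_(k <- l) k.1 *: bd2 G k.2 >].

Lemma bnd_zmod : zmod_closed bnd.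
Proof.
split=> [|x y /asboolP[l [ls xE]] /asboolP[m [ms yE]]]; apply/asboolP.
  by exists [::]; rewrite big_nil; split.
exists (l ++ [seq (- k.1, k.2) | k <- m]); split=> [k|].
  by rewrite mem_cat => /orP[/ls//|/mapP[k' /ms ? ->]].
rewrite xE yE big_cat big_map /= -sumrN.
by congr (_ + _); apply: eq_bigr => k _; rewrite scaleNr.
Qed.

HB.instance Definition _ := GRing.isZmodClosed.Build chain bnd bnd_zmod.

(** Chains modulo boundaries with no cycle condition: single paths have classes here, so loops can
    be cut into pieces. The homology group embeds by [emb]. *)
Definition Q1 : Type := Quotient.quot bnd.
HB.instance Definition _ := GRing.Zmodule.on Q1.

Definition cl (c : chain) : Q1 := \pi_(Quotient.quot bnd) c.

Lemma cl_eq c d : cl c = cl d <-> c - d \in bnd.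
Proof.
by split=> [/eqP|cd]; rewrite /cl -?Quotient.idealrBE //; apply/eqP; rewrite -Quotient.idealrBE.
Qed.

Lemma clB c d : cl (c - d) = cl c - cl d.
Proof. exact: (raddfB (\pi_(Quotient.quot bnd))). Qed.

Lemma cl0 : cl 0 = 0. Proof. by rewrite -(subrr 0) clB subrr. Qed.

Lemma clN c : cl (- c) = - cl c. Proof. by rewrite -sub0r clB cl0 sub0r. Qed.

Lemma clD c d : cl (c + d) = cl c + cl d.
Proof. by rewrite -{1}[d]opprK clB clN opprK. Qed.

Lemma cl_bnd c : c \in bnd -> cl c = 0.
Proof. by move=> cb; rewrite -cl0; apply/cl_eq; rewrite subr0. Qed.

Lemma boundary1_bnd z : (z \in boundary1 (R := R) (G := G) (S := S)) = (val z \in bnd).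
Proof. by []. Qed.

Lemma hclassP (c : chain) : c \in cycle1 S ->
  hrepr (hclass S c) \in cycle1 S /\ hrepr (hclass S c) - c \in bnd.
Proof.
move=> cc; rewrite /hrepr /hclass; set z : Z1 R G S := insubd 0 c.
have zE : val z = c by exact: insubdK.
set w := repr _; split; first exact: valP.
have : w - z \in boundary1 (R := R) (G := G) (S := S).
  by rewrite Quotient.idealrBE reprK.
by rewrite boundary1_bnd raddfB /= zE.
Qed.

Lemma hreprK (h : H1 R T G S) : hrepr h \in cycle1 S /\ hclass S (hrepr h) = h.
Proof.
rewrite /hrepr /hclass; split; first exact: valP.
by rewrite valKd reprK.
Qed.

Definition emb (h : H1 R T G S) : Q1 := cl (hrepr h).

Lemma emb_hclass c : c \in cycle1 S -> emb (hclass S c) = cl c.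
Proof. by move=> /hclassP[_ cb]; apply/cl_eq. Qed.

Lemma hclass_eq c d : c \in cycle1 S -> d \in cycle1 S ->
  c - d \in bnd -> hclass S c = hclass S d.
Proof.
move=> cc dc cd; rewrite /hclass; apply/eqP; rewrite -Quotient.idealrBE.
have cE : val (insubd 0 c : Z1 R G S) = c by exact: insubdK.
have dE : val (insubd 0 d : Z1 R G S) = d by exact: insubdK.
by rewrite boundary1_bnd raddfB /= cE dE.
Qed.

Lemma emb_inj : injective emb.
Proof.
move=> h k /cl_eq E; have [hc <-] := hreprK h; have [kc <-] := hreprK k.
exact: hclass_eq.
Qed.

Lemma hclassB c d : c \in cycle1 S -> d \in cycle1 S ->
  hclass S (c - d) = hclass S c - hclass S d.
Proof.
move=> cc dc; rewrite /hclass.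
rewrite -(raddfB (\pi_(Quotient.quot (boundary1 (R := R) (G := G) (S := S))))) /=.
congr (\pi_ _ _); apply: val_inj; rewrite raddfB /= !insubdK //.
exact: rpredB.
Qed.

Lemma embB h k : emb (h - k) = emb h - emb k.
Proof.
have [hc {1}<-] := hreprK h; have [kc {1}<-] := hreprK k.
by rewrite -hclassB // emb_hclass ?clB //; exact: rpredB.
Qed.

Lemma emb0 : emb 0 = 0. Proof. by rewrite -(subrr 0) embB subrr. Qed.

Lemma within_continuousP (X : topologicalType) (A : set X) (f : X -> T) :
  {within A, continuous f} <-> forall x, A x -> forall U, nbhs (f x) U ->
    \forall y \near x, A y -> U (f y).
Proof.
split=> [/subspace_continuousP fc x Ax U HU|H]; first exact: (fc x Ax U HU).
by apply/subspace_continuousP => x Ax U HU; exact: (H x Ax U HU).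
Qed.

Lemma continuous_pair (X Y Z : topologicalType) (f : X -> Y) (h : X -> Z) (x : X) :
  {for x, continuous f} -> {for x, continuous h} ->
  {for x, continuous (fun y => (f y, h y))}.
Proof. by move=> fc hc; exact: (cvg_pair fc hc). Qed.

Definition path_in (s : R -> T) : Prop := continuous s /\ forall x, S (s x).

Definition pc (s : R -> T) : Q1 := cl << s >>.

Lemma path_in_singular1 s : path_in s -> singular1 S s.
Proof. by move=> [sc sS]; split; [exact: continuous_subspaceT|move=> x _; exact: sS]. Qed.

Lemma bd2_bnd (s : R * R -> T) : singular2 S s -> bd2 G s \in bnd.
Proof.
move=> ss; apply/asboolP; exists [:: (1, s)]; split=> [k|].
  by rewrite inE => /eqP->.
by rewrite big_seq1 scale1r.
Qed.

Lemma pc_bd2 (s : R * R -> T) : singular2 S s ->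
  pc (fun x => s (1 - x, x)) - pc (fun x => s (0, x)) + pc (fun x => s (x, 0)) = 0.
Proof. by move=> /bd2_bnd /cl_bnd; rewrite /bd2 clD clB. Qed.

Lemma continuous_singular2 (s : R * R -> T) : continuous s -> (forall x, S (s x)) ->
  singular2 S s.
Proof. by move=> sc sS; split; [exact: continuous_subspaceT|move=> x _; exact: sS]. Qed.

Lemma pc_cst (x : T) : S x -> pc (fun=> x) = 0.
Proof.
move=> Sx; have := @pc_bd2 (fun=> x); rewrite subrr add0r; apply.
by apply: continuous_singular2 => //; exact: cst_continuous.
Qed.

(** Simplices are total functions, so [s] and [s'] may be different generators. The triangle [f]
    depends on the second coordinate only, except that [s'] replaces [s] where the first one is 0;
    its edges are [s], [s'] and a constant. *)
Lemma pc_eq s s' : singular1 S s -> (forall x, 0 <= x <= 1 -> s x = s' x) -> pc s = pc s'.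
Proof.
move=> [sc sS] E.
pose f (x : R * R) := if x.1 == 0 then s' x.2 else s x.2.
have fE x : std_simplex2 x -> f x = s x.2.
  case: x => a b [/= a0 [b0 ab]]; rewrite /f /=; case: eqP => // _.
  by rewrite E // b0 /=; lra.
have fs : singular2 S f.
  split; last by move=> x xs; rewrite fE //; apply: sS; case: xs => /= ? [? ?]; lra.
  move/within_continuousP in sc; apply/within_continuousP => x xs U.
  have x01 : `[0, 1]%classic x.2 by rewrite /= in_itv /=; case: xs => ? [? ?]; lra.
  rewrite fE // => /(sc _ x01) => nU.
  have : \forall y \near x, `[0, 1]%classic y.2 -> U (s y.2) by exact: (cvg_snd nU).
  apply: filterS => y yU ys; rewrite fE //; apply: yU.
  by rewrite /= in_itv /=; case: ys => ? [? ?]; lra.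
have := pc_bd2 fs; rewrite /f /=.
have -> : (fun x => if 1 - x == 0 then s' x else s x) = s.
  apply/funext => x; case: eqP => // /eqP; rewrite subr_eq0 => /eqP <-.
  by rewrite E // ler01 lexx.
have -> : (fun x : R => if x == 0 then s' 0 else s 0) = (fun=> s 0).
  by apply/funext => x; case: eqP => // _; rewrite E // ler01 lexx.
rewrite eqxx pc_cst ?addr0 => [/eqP|]; first by rewrite subr_eq0 => /eqP.
by apply: sS; rewrite ler01 lexx.
Qed.

Definition sub (s : R -> T) (a b : R) : R -> T := fun x => s (a + (b - a) * x).

Lemma sub01 s : sub s 0 1 = s.
Proof. by apply/funext => x; rewrite /sub add0r subr0 mul1r. Qed.

Lemma sub0 s a b : sub s a b 0 = s a.
Proof. by rewrite /sub mulr0 addr0. Qed.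

Lemma sub1 s a b : sub s a b 1 = s b.
Proof. by rewrite /sub mulr1 addrC subrK. Qed.

Lemma path_in_sub s a b : path_in s -> path_in (sub s a b).
Proof.
move=> [sc sS]; split=> [x|x]; last exact: sS.
apply: (@continuous_comp _ _ _ (fun x : R => a + (b - a) * x)); last exact: sc.
by apply: continuousD; [exact: cst_continuous|apply: continuousM; [exact: cst_continuous|exact: cvg_id]].
Qed.

(** The triangle is [s] after the affine function with values [a], [b], [c] at the vertices. *)
Lemma pc_sub s a b (c : R) : path_in s -> pc (sub s a c) = pc (sub s a b) + pc (sub s b c).
Proof.
move=> [sc sS]; pose f (x : R * R) := s (a + (b - a) * x.1 + (c - a) * x.2).
have fs : singular2 S f.
  apply: continuous_singular2 => [x|x]; last exact: sS.
  apply: (@continuous_comp _ _ _ (fun x : R * R => a + (b - a) * x.1 + (c - a) * x.2)); last exact: sc.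
  apply: continuousD; [apply: continuousD; [exact: cst_continuous|]|];
    apply: continuousM; try exact: cst_continuous; [exact: cvg_fst|exact: cvg_snd].
have := pc_bd2 fs; rewrite /f /=.
have -> : (fun x => s (a + (b - a) * (1 - x) + (c - a) * x)) = sub s b c.
  by apply/funext => x; rewrite /sub; congr s; ring.
have -> : (fun x => s (a + (b - a) * 0 + (c - a) * x)) = sub s a c.
  by apply/funext => x; rewrite /sub; congr s; ring.
have -> : (fun x => s (a + (b - a) * x + (c - a) * 0)) = sub s a b.
  by apply/funext => x; rewrite /sub; congr s; ring.
by move=> /eqP; rewrite addrAC subr_eq0 addrC => /eqP.
Qed.

Lemma pc_sub0 s a : path_in s -> pc (sub s a a) = 0.
Proof.
by move=> sp; apply: (addrI (pc (sub s a a))); rewrite -pc_sub // addr0.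
Qed.

Lemma pc_subN s a b : path_in s -> pc (sub s b a) = - pc (sub s a b).
Proof.
by move=> sp; apply/eqP; rewrite -addr_eq0 addrC -pc_sub // pc_sub0.
Qed.

(** The square is cut along its diagonal into the triangles [f] and [h], whose common edge
    cancels. *)
Lemma pc_square (F : R * R -> T) : continuous F -> (forall x, S (F x)) ->
  pc (fun x => F (x, 0)) + pc (fun x => F (1, x)) =
  pc (fun x => F (0, x)) + pc (fun x => F (x, 1)).
Proof.
move=> Fc FS; pose f (x : R * R) := F (x.1 + x.2, x.2); pose h (x : R * R) := F (x.2, x.1 + x.2).
have sum_c : continuous (fun x : R * R => x.1 + x.2).
  by move=> x; apply: continuousD; [exact: cvg_fst|exact: cvg_snd].
have fs : singular2 S f.
  apply: continuous_singular2 => [x|x]; last exact: FS.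
  apply: (@continuous_comp _ _ _ (fun x : R * R => (x.1 + x.2, x.2))); last exact: Fc.
  by apply: continuous_pair; [exact: sum_c|exact: cvg_snd].
have hs : singular2 S h.
  apply: continuous_singular2 => [x|x]; last exact: FS.
  apply: (@continuous_comp _ _ _ (fun x : R * R => (x.2, x.1 + x.2))); last exact: Fc.
  by apply: continuous_pair; [exact: cvg_snd|exact: sum_c].
have := pc_bd2 fs; have := pc_bd2 hs; rewrite /f /h /=.
have -> : (fun x => F (x, 1 - x + x)) = (fun x => F (x, 1)) by apply/funext => x; rewrite subrK.
have -> : (fun x => F (1 - x + x, x)) = (fun x => F (1, x)) by apply/funext => x; rewrite subrK.
have -> : (fun x => F (0 + x, x)) = (fun x => F (x, x)) by apply/funext => x; rewrite add0r.
have -> : (fun x => F (x, 0 + x)) = (fun x => F (x, x)) by apply/funext => x; rewrite add0r.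
have -> : (fun x => F (x + 0, 0)) = (fun x => F (x, 0)) by apply/funext => x; rewrite addr0.
have -> : (fun x => F (0, x + 0)) = (fun x => F (0, x)) by apply/funext => x; rewrite addr0.
move=> /eqP; rewrite addrAC subr_eq0 => /eqP E1 /eqP; rewrite addrAC subr_eq0 => /eqP E2.
by rewrite addrC E2 -E1 addrC.
Qed.

(** Composition with this retraction makes a singular simplex continuous on the whole line without
    changing its class ([singular1_clamp]). *)
Definition clamp (x : R) : R := Num.max 0 (Num.min 1 x).

Lemma clamp01 x : 0 <= clamp x <= 1.
Proof. by rewrite /clamp le_max lexx /= ge_max ler01 ge_min lexx. Qed.

Lemma clamp_id x : 0 <= x <= 1 -> clamp x = x.
Proof. by move=> /andP[x0 x1]; rewrite /clamp (min_idPr x1) (max_idPr x0). Qed.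

Lemma clamp_continuous : continuous clamp.
Proof.
move=> x; apply: (@continuous_max R R (cst 0) (fun x => Num.min 1 x) x).
  exact: cst_continuous.
by apply: (@continuous_min R R (cst 1) id x); [exact: cst_continuous|exact: cvg_id].
Qed.

Lemma singular1_clamp s : singular1 S s -> path_in (s \o clamp) /\ pc s = pc (s \o clamp).
Proof.
move=> ss; have [/within_continuousP sc sS] := ss; split; last first.
  by apply: pc_eq => // x x01; rewrite /= clamp_id.
split=> [x|x]; last by apply: sS; exact: clamp01.
have c01 y : `[0, 1]%classic (clamp y) by rewrite /= in_itv /=; exact: clamp01.
move=> U HU; have H := sc _ (c01 x) _ HU.
have H' : \forall y \near x, `[0, 1]%classic (clamp y) -> U (s (clamp y)).
  exact: (clamp_continuous H).
by apply: filterS H' => y; apply; exact: c01.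
Qed.

End Chains.

(** * A reflexive tactic for identities in abelian groups *)

Section AbelianGroupIdentities.

Inductive aexpr := AVar of nat | AZero | AAdd of aexpr & aexpr | AOpp of aexpr.

Fixpoint aeval (V : zmodType) (env : seq V) (e : aexpr) : V :=
  match e with
  | AVar i => env`_i
  | AZero => 0
  | AAdd a b => aeval env a + aeval env b
  | AOpp a => - aeval env a
  end.

Fixpoint acoef (e : aexpr) (i : nat) : int :=
  match e with
  | AVar j => (i == j)%:Z
  | AZero => 0
  | AAdd a b => acoef a i + acoef b i
  | AOpp a => - acoef a i
  end.

Fixpoint avars (n : nat) (e : aexpr) : bool :=
  match e with
  | AVar j => (j < n)%N
  | AZero => true
  | AAdd a b => avars n a && avars n b
  | AOpp a => avars n a
  end.

Lemma aevalE (V : zmodType) (env : seq V) e : avars (size env) e ->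
  aeval env e = \sum_(i < size env) env`_i *~ acoef e i.
Proof.
elim: e => [j /= jn|_|a IHa b IHb /= /andP[/IHa-> /IHb->]|a IHa /= /IHa->].
- rewrite (bigD1 (Ordinal jn)) //= eqxx mulr1z big1 ?addr0 // => i /negPf ij.
  by rewrite -[(i : nat) == j]/(i == Ordinal jn) ij mulr0z.
- by rewrite big1 // => i _; rewrite mulr0z.
- by rewrite -big_split; apply: eq_bigr => i _; rewrite mulrzDr.
- by rewrite -sumrN; apply: eq_bigr => i _; rewrite mulrNz.
Qed.

Lemma abel_correct (V : zmodType) (env : seq V) e1 e2 :
  [&& avars (size env) e1, avars (size env) e2 &
      all (fun i => acoef e1 i == acoef e2 i) (iota 0 (size env))] ->
  aeval env e1 = aeval env e2.
Proof.
case/and3P => v1 v2 /allP H; rewrite !aevalE //; apply: eq_bigr => i _.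
by rewrite (eqP (H i _)) // mem_iota ltn_ord.
Qed.

End AbelianGroupIdentities.

Ltac abel_index x env :=
  lazymatch env with
  | x :: _ => constr:(0%N)
  | _ :: ?env' => let i := abel_index x env' in constr:(i.+1)
  end.

Ltac abel_atoms t env :=
  lazymatch t with
  | GRing.add ?a ?b => let env := abel_atoms a env in abel_atoms b env
  | GRing.opp ?a => abel_atoms a env
  | GRing.zero => env
  | _ => match env with
         | context [t :: _] => env
         | _ => constr:(t :: env)
         end
  end.

Ltac abel_reify t env :=
  lazymatch t with
  | GRing.add ?a ?b =>
    let a := abel_reify a env in let b := abel_reify b env in constr:(AAdd a b)
  | GRing.opp ?a => let a := abel_reify a env in constr:(AOpp a)
  | GRing.zero => constr:(AZero)
  | _ => let i := abel_index t env in constr:(AVar i)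
  end.

Ltac abel :=
  lazymatch goal with
  | |- @eq ?T ?a ?b =>
    let env := abel_atoms a (@nil T) in let env := abel_atoms b env in
    let ea := abel_reify a env in let eb := abel_reify b env in
    exact: (@abel_correct _ env ea eb isT)
  end.

(** * Generators of the first homology group *)

Section IntervalInduction.
Context (R : realType).

(** Real induction in place of a subdivision: the supremum of the points reachable from 0 is itself
    reachable and cannot be less than 1. *)
Lemma interval_induction (P : R -> R -> Prop) :
  (forall a b c, a <= b -> b <= c -> P a b -> P b c -> P a c) ->
  (forall t, 0 <= t <= 1 -> exists2 e, 0 < e & forall a b, t - e < a -> a <= b ->
     b < t + e -> 0 <= a -> b <= 1 -> P a b) ->
  P 0 1.
Proof.
move=> Ptrans Ploc; pose A := [set x | 0 <= x <= 1 /\ P 0 x].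
have A0 : A 0.
  split; first by rewrite lexx ler01.
  by have [|e e0] := Ploc 0; [rewrite lexx ler01|apply; rewrite ?lexx ?ler01 ?sub0r ?add0r ?oppr_lt0].
have supA : has_sup A.
  by split; [exists 0|exists 1 => x [/andP[]]].
have s0 : 0 <= sup A by apply: ub_le_sup => //; case: supA.
have s1 : sup A <= 1 by apply: ge_sup; [exists 0|move=> x [/andP[]]].
have [|e e0 He] := Ploc (sup A); first by rewrite s0.
have [x [/andP[x0 x1] Px] xs] := sup_adherent e0 supA.
have xsup : x <= sup A by apply: ub_le_sup; [case: supA|split=> //; rewrite x0].
have ext y : x <= y -> y < sup A + e -> y <= 1 -> P 0 y.
  by move=> xy ys y1; apply: (Ptrans _ x) => //; apply: He.
have [s_lt1|] := ltP (sup A) 1; last first.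
  by move=> s_ge1; apply: ext => //; apply: le_lt_trans s_ge1 _; rewrite ltrDl.
pose y := Num.min 1 (sup A + e / 2).
have ys : sup A < y by rewrite lt_min s_lt1 ltrDl divr_gt0.
have : y <= sup A.
  apply: ub_le_sup; first by case: supA.
  split; first by rewrite ge_min lexx /= andbT (le_trans s0) // ltW.
  apply: ext; first by rewrite (le_trans xsup) // ltW.
    by rewrite gt_min ltrD2l gtr_pMr // invf_lt1 ?ltr1n ?orbT.
  by rewrite ge_min lexx.
by rewrite leNgt ys.
Qed.

End IntervalInduction.

(** * Potentials for classes of paths *)

Section Cone.
Context (R : realType) (g : nat) (p : 'I_(2 * g + 2) -> R[i]^o).
Local Notation C := (R[i]^o).
Local Notation T := (curve p).
Local Notation PC := (pc int [set: T]).
Local Notation pathT := (@path_in R T [set: T]).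
Context (psi : chart R T) (inv : T -> C).
Hypothesis gc : good_chart psi inv.
Hypothesis star : forall t (r : R), 0 <= r <= 1 -> chart_dom psi t ->
  chart_dom psi (toC r * t).

Definition chart_img : set T := [set Q | chart_dom psi (inv Q) /\ psi (inv Q) = Q].

Lemma chart_img_nbhs Q : chart_img Q -> nbhs Q chart_img.
Proof. by move=> [D E]; rewrite -E; exact: gc_near gc _ D. Qed.

Definition ray (Q : T) : R -> T := fun r => psi (toC (clamp r) * inv Q).

Lemma cone_continuous (V : topologicalType) (r : V -> R) (h : V -> T) x :
  chart_img (h x) -> {for x, continuous r} -> {for x, continuous h} ->
  {for x, continuous (fun y => psi (toC (clamp (r y)) * inv (h y)))}.
Proof.
move=> [D E] rc hc.
have tc : cts (fun y => toC (clamp (r y)) * inv (h y)) x.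
  apply: ctsM; last by apply: cts_comp hc _; rewrite -E; exact: gc_cts gc _ D.
  by apply: cts_toC; apply: continuous_comp rc _; exact: clamp_continuous.
move/ctsP in tc; apply: (continuous_comp tc).
by apply: (atlas_continuous (gc_atlas gc)); apply: star => //; exact: clamp01.
Qed.

Lemma toC0 : toC 0 = 0 :> C. Proof. by []. Qed.
Lemma toC1 : toC 1 = 1 :> C. Proof. by []. Qed.

Lemma clamp0 : clamp 0 = 0 :> R. Proof. by rewrite clamp_id // lexx ler01. Qed.
Lemma clamp1 : clamp 1 = 1 :> R. Proof. by rewrite clamp_id // lexx ler01. Qed.

(** The square [F] is the cone over [s] in a star-shaped chart: its bottom collapses to the center
    and its sides are the rays to the ends of [s]. So the rays form a potential for the paths in the
    chart. *)
Lemma pc_cone s : pathT s -> (forall r, 0 <= r <= 1 -> chart_img (s r)) ->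
  PC s = PC (ray (s 1)) - PC (ray (s 0)).
Proof.
move=> [sc _] sU.
pose F (x : R * R) := psi (toC (clamp x.2) * inv (s (clamp x.1))).
have Fc : continuous F.
  move=> x; apply: (@cone_continuous _ snd (fun x => s (clamp x.1)) x).
  - by apply: sU; exact: clamp01.
  - exact: cvg_snd.
  - apply: (continuous_comp (g := s)); last exact: sc.
    by apply: (@continuous_comp _ _ _ fst (@clamp R) x); [exact: cvg_fst|exact: clamp_continuous].
have := pc_square int Fc (fun x => I : [set: T] (F x)); rewrite /F /=.
have -> : (fun x : R => psi (toC (clamp 0) * inv (s (clamp x)))) = (fun=> psi 0).
  by apply/funext => x; rewrite clamp0 toC0 mul0r.
rewrite pc_cst // add0r clamp0 !clamp1 => ->; rewrite addrAC subrr add0r.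
apply: pc_eq; first by apply: path_in_singular1; split.
move=> x x01; rewrite (clamp_id x01) toC1 mul1r.
by have [_ ->] := sU x x01.
Qed.

End Cone.

Section PathInduction.
Context (R : realType) (T : topologicalType).
Local Notation PC := (pc int [set: T]).
Local Notation pathT := (@path_in R T [set: T]).
Local Notation Q := (@Q1 R T int [set: T]).
Context (pot : T -> Q) (B : zmodClosed Q).

Definition potential_mod (s : R -> T) : Prop := PC s - (pot (s 1) - pot (s 0)) \in B.

Lemma path_induction s : pathT s ->
  (forall r, 0 <= r <= 1 -> exists2 A, nbhs (s r) A &
    forall s', pathT s' -> (forall x, 0 <= x <= 1 -> A (s' x)) -> potential_mod s') ->
  potential_mod s.
Proof.
move=> sp H; rewrite -[s]sub01; apply: (@interval_induction _ (fun a b => potential_mod (sub s a b))).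
  move=> a b c ab bc; rewrite /potential_mod !sub0 !sub1 (pc_sub _ a b c sp) => Hab Hbc.
  rewrite (_ : _ - _ = (PC (sub s a b) - (pot (s b) - pot (s a))) +
    (PC (sub s b c) - (pot (s c) - pot (s b)))); first exact: rpredD.
  by rewrite addrACA -opprD; congr (_ - _); rewrite [RHS]addrC addrA subrK.
move=> t t01; have [A nA HA] := H t t01; have [sc _] := sp.
have /nbhs_ballP[e /= e0 He] := sc t _ nA; exists e => // a b ta ab bt _ _.
apply: (HA _ (path_in_sub a b sp)).
move=> x /andP[x0 x1]; apply: (He (a + (b - a) * x)); rewrite /ball /= ltr_norml.
by apply/andP; split; nra.
Qed.

(** Summed over the simplices of a cycle, the differences of [pot] cancel because the boundary
    vanishes; what is left of each simplex lies in [B]. *)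
Lemma cycle_induction (c : {freeg (R -> T) / int}) : c \in cycle1 [set: T] ->
  (forall s, pathT s -> potential_mod s) -> cl [set: T] c \in B.
Proof.
move=> /asboolP[cs bc] H.
pose pd (s : R -> T) := pot (s 1) - pot (s 0).
have pd0 : zlift pd c = 0.
  have -> : zlift pd c = zlift pot (bd1 c).
    rewrite /bd1 -[in RHS](freeg_sumE c) zliftE.
    pose Fl := fglift (fun s : R -> T => << s 1 >> - << s 0 >> : {freeg T / int}).
    have FlB a b : Fl (a - b) = Fl a - Fl b by exact: lift_is_additive.
    have Fl0 : Fl 0 = 0 by have := FlB 0 0; rewrite !subrr.
    have FlD a b : Fl (a + b) = Fl a + Fl b.
      have FlN : Fl (- b) = - Fl b by have := FlB 0 b; rewrite Fl0 !sub0r.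
      by have := FlB a (- b); rewrite FlN !opprK.
    have FlE : Fl (\sum_(z <- dom c) << coeff z c *g z >>) =
        \sum_(z <- dom c) coeff z c *: (<< z 1 >> - << z 0 >>).
      elim: (dom c) => [|s r IH]; first by rewrite !big_nil Fl0.
      by rewrite !big_cons FlD IH; congr (_ + _); exact: liftU.
    transitivity (zlift pot (\sum_(z <- dom c) coeff z c *: (<< z 1 >> - << z 0 >>)));
      last by congr (zlift pot _); exact: esym FlE.
    rewrite zlift_sum; apply: eq_bigr => s _; rewrite zliftZ zliftB !zliftU1.
    by [].
  by rewrite bc zlift0.
have -> : cl [set: T] c = zlift PC c.
  rewrite -{1}[c]freeg_sumE zliftE.
  elim: (dom c) => [|s r IH]; first by rewrite !big_nil cl0.
  rewrite !big_cons clD IH; congr (_ + _).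
  have -> : << coeff s c *g s >> = << s >> *~ coeff s c :> {freeg (R -> T) / int}.
    by rewrite freegU_mulz intz.
  have cln n : cl [set: T] (<< s >> *+ n) = PC s *+ n.
    by elim: n => [|n IHn]; rewrite ?mulr0n ?cl0 // !mulrS clD IHn.
  case: (coeff s c) => n; first exact: cln.
  by rewrite NegzE !mulrNz clN; congr (- _); exact: cln.
have -> : zlift PC c = zlift (fun s => PC s - pd s) c.
  rewrite -[LHS]subr0 -pd0 !zliftE -sumrB; apply: eq_bigr => s _.
  by rewrite -mulNrz -mulrzDl.
rewrite zliftE big_seq; apply: rpred_sum => s; rewrite mem_dom => /cs ss.
apply: rpredMz; have [sp sE] := singular1_clamp int ss.
have := H _ sp; rewrite /potential_mod -sE /= /pd.
by rewrite (clamp_id (x := 1)) ?(clamp_id (x := 0)) // ?lexx ?ler01.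
Qed.

End PathInduction.

(** * Loops over the segments between consecutive branch points *)

Section Loops.
Context (R : realType) (g : nat) (p : 'I_(2 * g + 2) -> R[i]^o).
Local Notation C := (R[i]^o).
Local Notation T := (curve p).
Local Notation n := (2 * g + 2)%N.
Context (q : nat -> C) (rot : C).
Hypothesis rot0 : rot != 0.
Hypothesis q_sorted : forall i j, (i < j)%N -> (j < n)%N ->
  ell rot (q i) < ell rot (q j).
Hypothesis branch_polyE : forall z, branch_poly p z = \prod_(k <- iota 0 n) (z - q k).
Local Notation strip := (strip g q rot).
Local Notation oroot := (outer_root g q rot).
Local Notation pi := (trigo.pi : R).
Implicit Types (b s : R) (i k : nat).

Definition iC : C := 'i.

Lemma iC_sqr : iC * iC = -1 :> C.
Proof. by rewrite -expr2; exact: sqr_i. Qed.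

(* [sin] and [cos] of the complex number [pi s + i argsinh b]. *)
Definition csin b s : C := (sin (pi * s) * Num.sqrt (1 + b ^+ 2)) +i* (cos (pi * s) * b).
Definition ccos b s : C := (cos (pi * s) * Num.sqrt (1 + b ^+ 2)) +i* (- (sin (pi * s) * b)).

Lemma sqrt1D b : Num.sqrt (1 + b ^+ 2) * Num.sqrt (1 + b ^+ 2) = 1 + b * b.
Proof. by rewrite -expr2 sqr_sqrtr ?expr2 // addr_ge0 // -expr2 sqr_ge0. Qed.

Lemma csin2Dccos2 b s : csin b s ^+ 2 + ccos b s ^+ 2 = 1.
Proof.
have A2 := sqrt1D b; have SC : cos (pi * s) * cos (pi * s) + sin (pi * s) * sin (pi * s) = 1.
  by rewrite -!expr2 cos2Dsin2.
rewrite !expr2; apply/eqP; rewrite eq_complex cReD cImD !cReM !cImM /=.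
set A := Num.sqrt _ in A2 *; set c := cos _ in SC *; set S := sin _ in SC *.
apply/andP; split; apply/eqP; last by ring.
transitivity ((A * A - b * b) * (c * c + S * S)); first by ring.
by rewrite A2 SC; ring.
Qed.

Lemma csin_shift b s : csin b (s + 1) = - csin b s.
Proof.
apply/eqP; rewrite eq_complex /csin raddfN [complex.Im (- _)]raddfN /= mulrDr mulr1 sinDpi cosDpi.
by rewrite !mulNr !eqxx.
Qed.

Lemma ccos_shift b s : ccos b (s + 1) = - ccos b s.
Proof.
apply/eqP; rewrite eq_complex /ccos raddfN [complex.Im (- _)]raddfN /= mulrDr mulr1 sinDpi cosDpi.
by rewrite !mulNr !eqxx.
Qed.

Definition edge i : C := q i.+1 - q i.

Definition loop_z i b s : C := q i + edge i * csin b s ^+ 2.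

(** On this curve [z - q i] is [edge i * csin b s ^+ 2] and [z - q i.+1] is
    [- (edge i * ccos b s ^+ 2)], so that [iC * edge i * csin b s * ccos b s] is a root of their
    product. *)
Definition loop_w i b s : C := iC * edge i * csin b s * ccos b s * oroot 1 i (loop_z i b s).

(* [loop i b] lies over an ellipse with foci [q i] and [q i.+1], which for [b = 0] degenerates
   to the segment between them, run forth and back. *)
Definition loop i b s : T := mkpt p false (loop_z i b s, loop_w i b s).

Lemma loopE i b s : loop i b s = mkpt p false (loop_z i b s, loop_w i b s).
Proof. by []. Qed.

Lemma branch_poly_outer1 i z : (i.+1 < n)%N ->
  branch_poly p z = (z - q i) * (z - q i.+1) * oroot 1 i z ^+ 2.
Proof.
move=> iN; rewrite (branch_poly_outer0 rot0 branch_polyE _ (ltnW iN)).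
rewrite outer1_0 // exprMn (sr_sqr _ rot0) -mulrA; congr (_ * _).
exact: mulrC.
Qed.

Lemma loop_zB i b s : loop_z i b s - q i.+1 = - (edge i * ccos b s ^+ 2).
Proof.
have E : ccos b s ^+ 2 = 1 - csin b s ^+ 2 by rewrite -(csin2Dccos2 b s) addrC addKr.
by rewrite E /loop_z /edge; ring.
Qed.

Lemma loop_eq i b s : (i.+1 < n)%N -> loop_w i b s ^+ 2 = branch_poly p (loop_z i b s).
Proof.
move=> iN; have E1 : loop_z i b s - q i = edge i * csin b s ^+ 2.
  by rewrite /loop_z (addrC (q i)) addrK.
rewrite (branch_poly_outer1 _ iN) loop_zB E1 /loop_w; set z := loop_z _ _ _.
transitivity ((iC * iC) * (edge i * edge i) * (csin b s ^+ 2) * (ccos b s ^+ 2) * oroot 1 i z ^+ 2).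
  by ring.
by rewrite iC_sqr; ring.
Qed.

Lemma crd_loop i b s : (i.+1 < n)%N ->
  crd false (loop i b s) = (loop_z i b s, loop_w i b s).
Proof. by move=> iN; apply: (mkpt_spec (b := false) _).2; rewrite /= loop_eq. Qed.

Lemma piece_loop i b s : piece false (loop i b s). Proof. exact: piece_mkaff. Qed.

Lemma loop_z_periodic i b s : loop_z i b (s + 1) = loop_z i b s.
Proof. by rewrite /loop_z csin_shift sqrrN. Qed.

Lemma loop_periodic i b s : loop i b (s + 1) = loop i b s.
Proof.
rewrite /loop /loop_w loop_z_periodic csin_shift ccos_shift; congr (mkpt p false (_, _)).
by ring.
Qed.

Lemma csin0 s : csin 0 s = toC (sin (pi * s)).
Proof. by rewrite /csin expr0n addr0 sqrtr1 mulr1 mulr0. Qed.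

Lemma ccos0 s : ccos 0 s = toC (cos (pi * s)).
Proof. by rewrite /ccos expr0n addr0 sqrtr1 mulr1 mulr0 oppr0. Qed.

Lemma loop_z0 i s : loop_z i 0 s = q i + toC (sin (pi * s) ^+ 2) * (q i.+1 - q i).
Proof. by rewrite /loop_z csin0 /toC rmorphXn mulrC. Qed.

Lemma loop_strip0 i s : (i.+1 < n)%N -> strip 1 i (loop_z i 0 s).
Proof.
move=> iN; rewrite loop_z0; apply: strip_convex.
- by rewrite sqr_ge0 -(cos2Dsin2 (pi * s)) lerDr sqr_ge0.
- by apply: (strip_q q_sorted); rewrite ?addn1 // leqnn leqnSn.
- by apply: (strip_q q_sorted); rewrite ?addn1 // leqnn leqnSn.
Qed.

Lemma nrm_csin2B b s : 0 <= b <= 1 -> nrm (csin b s ^+ 2 - csin 0 s ^+ 2) <= 6 * b.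
Proof.
move=> /andP[b0 b1]; have A2 := sqrt1D b.
have A0 : 0 <= Num.sqrt (1 + b ^+ 2) by exact: sqrtr_ge0.
have A_le2 : Num.sqrt (1 + b ^+ 2) <= 2 by nra.
have SC : cos (pi * s) * cos (pi * s) + sin (pi * s) * sin (pi * s) = 1.
  by rewrite -!expr2 cos2Dsin2.
apply: le_trans (nrm_le_ReIm _) _.
rewrite csin0 !expr2 cReB cImB !cReM !cImM /=.
set A := Num.sqrt _ in A2 A0 A_le2 *; set c := cos _ in SC *; set S := sin _ in SC *.
have -> : S * A * (S * A) - c * b * (c * b) - (S * S - 0 * 0) = b * b * (S * S - c * c).
  transitivity (A * A * (S * S) - c * b * (c * b) - S * S); first by ring.
  by rewrite A2; ring.
have -> : S * A * (c * b) + c * b * (S * A) - (S * 0 + 0 * S) = 2 * A * b * (S * c) by ring.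
have h1 : `|b * b * (S * S - c * c)| <= b.
  rewrite normrM (ger0_norm (mulr_ge0 b0 b0)).
  have : `|S * S - c * c| <= 1 by rewrite ler_norml; apply/andP; split; nra.
  have := normr_ge0 (S * S - c * c); nra.
have h2 : `|2 * A * b * (S * c)| <= 4 * b.
  rewrite normrM ger0_norm ?mulr_ge0 //.
  have : `|S * c| <= 1 by rewrite ler_norml; apply/andP; split; nra.
  have := normr_ge0 (S * c); have : 0 <= A * b by rewrite mulr_ge0.
  have : A * b <= 2 * b by rewrite ler_wpM2r.
  by nra.
by lra.
Qed.

Lemma ell_le (z : C) : `|ell rot z| <= nrm rot * nrm z.
Proof. by rewrite -nrmM; exact: Re_le_nrm. Qed.

(** The ellipse departs from the segment by at most a multiple of [b], uniformly in [s], and on the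
    segment [ell] keeps the distance [m] from the branch points outside it. *)
Lemma loop_strip_side i k : (i.+1 < n)%N -> (k < n)%N -> outer 1 i k ->
  exists2 e, 0 < e <= 1 & forall b s, 0 <= b <= e -> side q rot (k < i)%N k (loop_z i b s).
Proof.
(* The factor 6 is that of [nrm_csin2B]; the summand 1 makes the estimate strict for [b > 0]. *)
move=> iN kN ok; pose M := nrm rot * nrm (edge i) * 6 + 1.
have M0 : 0 < M by rewrite ltr_wpDl // !mulr_ge0 // nrm_ge0.
pose m := if (k < i)%N then ell rot (q i) - ell rot (q k) else ell rot (q k) - ell rot (q i.+1).
have m0 : 0 < m.
  rewrite /m; move: ok; rewrite /outer; case: ltnP => [ki _|ik /= ok]; rewrite subr_gt0.
    by apply: q_sorted => //; exact: ltnW.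
  by apply: q_sorted => //; rewrite -addn1.
exists (Num.min 1 (m / M)); first by rewrite lt_min ltr01 divr_gt0 //= ge_min lexx.
move=> b s /andP[b0]; rewrite le_min => /andP[b1]; rewrite ler_pdivlMr // => bM.
have dz : `|ell rot (loop_z i b s) - ell rot (loop_z i 0 s)| < m \/ b = 0.
  have [->|bn0] := eqVneq b 0; first by right.
  left; rewrite -ellB; apply: le_lt_trans (ell_le _) _.
  have -> : loop_z i b s - loop_z i 0 s = edge i * (csin b s ^+ 2 - csin 0 s ^+ 2).
    by rewrite /loop_z opprD addrACA subrr add0r mulrBr.
  rewrite nrmM; apply: lt_le_trans bM; have b_gt0 : 0 < b by rewrite lt_neqAle eq_sym bn0.
  have h := nrm_csin2B s (_ : 0 <= b <= 1); rewrite b0 b1 in h; have {}h := h isT.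
  apply: (@le_lt_trans _ _ (nrm rot * (nrm (edge i) * (6 * b)))).
    by rewrite !ler_wpM2l // nrm_ge0.
  have -> : b * M = nrm rot * (nrm (edge i) * (6 * b)) + b by rewrite /M; ring.
  by rewrite ltrDl.
have base : if (k < i)%N then ell rot (q i) <= ell rot (loop_z i 0 s)
            else ell rot (loop_z i 0 s) <= ell rot (q i.+1).
  rewrite loop_z0 ellD ellZ ellB; have : ell rot (q i) < ell rot (q i.+1) by apply: q_sorted.
  have : 0 <= sin (pi * s) ^+ 2 <= 1.
    by rewrite sqr_ge0 -(cos2Dsin2 (pi * s)) lerDr sqr_ge0.
  by case: ifP => _ /andP[? ?] ?; nra.
move: base m0 dz; rewrite /side /m; case: ifP => _ base m0 [|->].
- by rewrite ltr_norml => /andP[]; lra.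
- by lra.
- by rewrite ltr_norml => /andP[]; lra.
- by lra.
Qed.

Lemma loop_strip i : (i.+1 < n)%N ->
  exists2 e, 0 < e <= 1 & forall b s, 0 <= b <= e -> strip 1 i (loop_z i b s).
Proof.
move=> iN.
suff H m : (m <= n)%N -> exists2 e, 0 < e <= 1 & forall b s, 0 <= b <= e ->
    forall k, (k < m)%N -> outer 1 i k -> side q rot (k < i)%N k (loop_z i b s).
  by have [e e0 He] := H n (leqnn n); exists e => // b s be k kn; exact: He.
elim: m => [|m IH] mn; first by exists 1; rewrite ?ltr01 ?lexx.
have [e e01 He] := IH (ltnW mn).
have [om|nom] := boolP (outer 1 i m); last first.
  exists e => // b s be k; rewrite ltnS leq_eqVlt => /orP[/eqP->|]; last exact: He.
  by rewrite (negPf nom).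
have [e' e'01 He'] := loop_strip_side iN mn om.
exists (Num.min e e').
  by move: e01 e'01 => /andP[? ?] /andP[? ?]; rewrite lt_min ge_min; apply/andP; split; [apply/andP|apply/orP; left].
move=> b s /andP[b0]; rewrite le_min => /andP[be be'] k.
rewrite ltnS leq_eqVlt => /orP[/eqP-> _|km]; first by apply: He'; rewrite b0.
by apply: He => //; rewrite b0.
Qed.

Lemma contM (V : topologicalType) (f h : V -> R) x : {for x, continuous f} ->
  {for x, continuous h} -> {for x, continuous (fun y => f y * h y)}.
Proof. by move=> fc hc; exact: (cvgM fc hc). Qed.

Lemma contD (V : topologicalType) (f h : V -> R) x : {for x, continuous f} ->
  {for x, continuous h} -> {for x, continuous (fun y => f y + h y)}.
Proof. by move=> fc hc; exact: (cvgD fc hc). Qed.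

Lemma contN (V : topologicalType) (f : V -> R) x : {for x, continuous f} ->
  {for x, continuous (fun y => - f y)}.
Proof. by move=> fc; exact: (cvgN fc). Qed.

Lemma cont_comp (V : topologicalType) (f : V -> R) (h : R -> R) x :
  {for x, continuous f} -> continuous h -> {for x, continuous (fun y => h (f y))}.
Proof. by move=> fc hc; exact: (continuous_comp fc (hc _)). Qed.

Lemma cont_cst (V : topologicalType) (c : R) (x : V) : {for x, continuous (fun=> c)}.
Proof. exact: cst_continuous. Qed.

Lemma cont_id (x : R) : {for x, continuous (fun y : R => y)}.
Proof. exact: cvg_id. Qed.

Lemma cont_pi (V : topologicalType) (f : V -> R) x : {for x, continuous f} ->
  {for x, continuous (fun y => pi * f y)}.
Proof. by apply: contM; exact: cont_cst. Qed.

Lemma C1_sin s : C1at (@toC R) (fun s => toC (sin (pi * s))) s.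
Proof.
apply: (@C1_toC _ _ (fun s => cos (pi * s) * pi)).
  move=> y; apply: (@is_derive1_comp _ sin (fun s => pi * s)).
  by rewrite -[X in is_derive _ _ _ X]mulr1; exact: is_deriveZ.
move=> x; suff : {for x, continuous (fun s => cos (pi * s) * pi)} by [].
apply: contM; last exact: cont_cst.
by apply: (@cont_comp _ (fun y => pi * y) cos x); [by apply: contM; [exact: cont_cst|exact: cont_id]|exact: continuous_cos].
Qed.

Lemma C1_cos s : C1at (@toC R) (fun s => toC (cos (pi * s))) s.
Proof.
apply: (@C1_toC _ _ (fun s => - sin (pi * s) * pi)).
  move=> y; apply: (@is_derive1_comp _ cos (fun s => pi * s)).
  by rewrite -[X in is_derive _ _ _ X]mulr1; exact: is_deriveZ.
move=> x; suff : {for x, continuous (fun s => - sin (pi * s) * pi)} by [].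
apply: contM; last exact: cont_cst.
by apply: contN; apply: (@cont_comp _ (fun y => pi * y) sin x); [by apply: contM; [exact: cont_cst|exact: cont_id]|exact: continuous_sin].
Qed.

Lemma C1_csin b s : C1at (@toC R) (csin b) s.
Proof.
have -> : csin b = fun s => toC (Num.sqrt (1 + b ^+ 2)) * toC (sin (pi * s)) +
    iC * (toC b * toC (cos (pi * s))).
  apply/funext => y; apply/eqP; rewrite eq_complex cReD cImD !cReM !cImM /=.
  by apply/andP; split; apply/eqP; ring.
have tc := @toCc R; have sC := C1_sin s; have cC := C1_cos s.
apply: C1D; first by apply: (C1M tc) => //; exact: C1_cst.
apply: (C1M tc); first exact: C1_cst.
by apply: (C1M tc) => //; exact: C1_cst.
Qed.

Lemma C1_ccos b s : C1at (@toC R) (ccos b) s.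
Proof.
have -> : ccos b = fun s => toC (Num.sqrt (1 + b ^+ 2)) * toC (cos (pi * s)) +
    iC * (toC (- b) * toC (sin (pi * s))).
  apply/funext => y; apply/eqP; rewrite eq_complex cReD cImD !cReM !cImM /=.
  by apply/andP; split; apply/eqP; ring.
have tc := @toCc R; have sC := C1_sin s; have cC := C1_cos s.
apply: C1D; first by apply: (C1M tc) => //; exact: C1_cst.
apply: (C1M tc); first exact: C1_cst.
by apply: (C1M tc) => //; exact: C1_cst.
Qed.

Lemma crd_loop1 i b : (i.+1 < n)%N ->
  (fun s => (crd false (loop i b s)).1) = loop_z i b /\
  (fun s => (crd false (loop i b s)).2) = loop_w i b.
Proof. by move=> iN; split; apply/funext => s; rewrite crd_loop. Qed.

Lemma loop_smooth i b s : (i.+1 < n)%N -> strip 1 i (loop_z i b s) ->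
  smooth_curve true (@toC R) false (loop i b) s.
Proof.
move=> iN sz; have [E1 E2] := crd_loop1 b iN; have tc := @toCc R.
have sC := C1_csin b s; have cC := C1_ccos b s.
have zC : C1at (@toC R) (loop_z i b) s.
  apply: C1D; first exact: C1_cst.
  by apply: (C1M tc); [exact: C1_cst|exact: (C1X tc)].
split; first by near=> y; exact: piece_loop.
  by rewrite E1.
rewrite E2; apply: (C1M tc); last by apply: (C1_comp tc zC); exact: outer_root_C1.
apply: (C1M tc) => //; apply: (C1M tc) => //; exact: C1_cst.
Unshelve. all: by end_near. Qed.

Lemma cts_csin (V : topologicalType) (u v : V -> R) x : {for x, continuous u} ->
  {for x, continuous v} -> cts (fun y => csin (u y) (v y)) x.
Proof.
move=> uc vc; apply: cts_Complex; apply: contM => //.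
- by apply: cont_comp; [exact: cont_pi|exact: continuous_sin].
- apply: cont_comp; last by move=> y; exact: sqrt_continuous.
  by apply: contD; [exact: cont_cst|exact: contM].
- by apply: cont_comp; [exact: cont_pi|exact: continuous_cos].
Qed.

Lemma cts_ccos (V : topologicalType) (u v : V -> R) x : {for x, continuous u} ->
  {for x, continuous v} -> cts (fun y => ccos (u y) (v y)) x.
Proof.
move=> uc vc; apply: cts_Complex; [apply: contM|apply: contN; apply: contM] => //.
- by apply: cont_comp; [exact: cont_pi|exact: continuous_cos].
- apply: cont_comp; last by move=> y; exact: sqrt_continuous.
  by apply: contD; [exact: cont_cst|exact: contM].
- by apply: cont_comp; [exact: cont_pi|exact: continuous_sin].
Qed.

Local Notation PC := (pc int [set: T]).
Local Notation pathT := (@path_in R T [set: T]).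

(** The two vertical sides of the homotopy square are equal by periodicity, so they cancel. *)
Lemma loop_homotopy i e : (i.+1 < n)%N -> 0 <= e ->
  (forall b s, 0 <= b <= e -> strip 1 i (loop_z i b s)) -> PC (loop i e) = PC (loop i 0).
Proof.
move=> iN e0 He; pose F (x : R * R) := loop i (e * clamp x.2) x.1.
have Fc : continuous F.
  move=> x; have uc : {for x, continuous (fun x : R * R => e * clamp x.2)}.
    apply: contM; first exact: cont_cst.
    by apply: cont_comp; [exact: cvg_snd|exact: clamp_continuous].
  have vc : {for x, continuous (fun x : R * R => x.1)} by exact: cvg_fst.
  have zc : cts (fun x : R * R => loop_z i (e * clamp x.2) x.1) x.
    apply: ctsD; first exact: cts_cst.
    by apply: ctsM; [exact: cts_cst|apply: ctsX; exact: cts_csin].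
  apply: (@continuous_curve _ _ _ false).
  - by near=> y; exact: piece_loop.
  - rewrite (_ : (fun y => _) = (fun x : R * R => loop_z i (e * clamp x.2) x.1)); first exact: zc.
    by apply/funext => y; rewrite crd_loop.
  - rewrite (_ : (fun y => _) = (fun x : R * R => loop_w i (e * clamp x.2) x.1)); last first.
      by apply/funext => y; rewrite crd_loop.
    apply: ctsM; last first.
      apply: (cts_compC zc); apply: (C1_cont (@idCc R)); apply: outer_root_C1.
      by apply: He; have /andP[c0 c1] := clamp01 x.2; rewrite mulr_ge0 //= ler_piMr.
    apply: ctsM; last exact: cts_ccos.
    by apply: ctsM; [exact: cts_cst|exact: cts_csin].
have := pc_square int Fc (fun x => I : [set: T] (F x)); rewrite /F /=.
rewrite clamp0 clamp1 mulr0 mulr1.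
have -> : (fun x => loop i (e * clamp x) 1) = (fun x => loop i (e * clamp x) 0).
  by apply/funext => x; rewrite -{1}[1]add0r loop_periodic.
by rewrite addrC => /addrI.
Unshelve. all: by end_near. Qed.

Lemma loop_path i e : (i.+1 < n)%N -> (forall s, strip 1 i (loop_z i e s)) ->
  pathT (loop i e).
Proof.
move=> iN He; split=> // s; have := loop_smooth iN (He s).
by apply: smooth_curve_continuous; exact: toCc.
Qed.

Lemma loop0_path i : (i.+1 < n)%N -> pathT (loop i 0).
Proof. by move=> iN; apply: loop_path => // s; exact: loop_strip0. Qed.

Lemma closed_cycle (X : topologicalType) (G : nzRingType) (S : set X) (s : R -> X) :
  singular1 S s -> s 0 = s 1 -> (<< s >> : {freeg (R -> X) / G}) \in cycle1 S.
Proof.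
move=> sp s01; apply/asboolP; split=> [s'|].
  rewrite coeffU; case: (s =P s') => [<- _ //|_]; by rewrite mulr0 eqxx.
by rewrite /bd1 liftU scale1r s01 subrr.
Qed.

End Loops.

(** * Generation of the homology group by the loops *)

Section Generation.
Context (R : realType) (g : nat) (p : 'I_(2 * g + 2) -> R[i]^o).
Local Notation C := (R[i]^o).
Local Notation T := (curve p).
Local Notation n := (2 * g + 2)%N.
Context (q : nat -> C) (rot : C).
Hypothesis rot0 : rot != 0.
Hypothesis q_sorted : forall i j, (i < j)%N -> (j < n)%N ->
  ell rot (q i) < ell rot (q j).
Hypothesis branch_polyE : forall z, branch_poly p z = \prod_(k <- iota 0 n) (z - q k).
Local Notation strip := (strip g q rot).
Local Notation oroot := (outer_root g q rot).
Local Notation pi := (trigo.pi : R).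
Local Notation PC := (pc int [set: T]).
Local Notation pathT := (@path_in R T [set: T]).
Local Notation loop := (loop p q rot).
Local Notation Q := (@Q1 R T int [set: T]).
Implicit Types (b s : R) (i k : nat) (P : T).

Lemma csinN b s : csin b (- s) = - csin (- b) s.
Proof.
apply/eqP; rewrite eq_complex /csin raddfN [complex.Im (- _)]raddfN /= mulrN sinN cosN sqrrN.
by rewrite !mulNr !mulrN opprK !eqxx.
Qed.

Lemma ccosN b s : ccos b (- s) = ccos (- b) s.
Proof. by rewrite /ccos mulrN sinN cosN sqrrN !mulNr !mulrN. Qed.

(** At [b = 0] the function [csin] is odd and [ccos] even in [s], and the shift by 1 negates both;
    so [z] is kept and [w] changes sign. *)
Lemma loop_invol i s : (i.+1 < n)%N -> loop i 0 (1 - s) = invol (loop i 0 s).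
Proof.
move=> iN; apply: (@coord_inj _ _ _ false); rewrite ?piece_invol; try exact: piece_loop.
rewrite coord_invol !(crd_loop rot0 branch_polyE) //= addrC /loop_w /loop_z.
rewrite csin_shift ccos_shift csinN ccosN oppr0 opprK; congr (_, _).
by ring.
Qed.

Lemma t_star i t (r : R) : (i < n)%N -> 0 <= r <= 1 -> chart_dom (t_chart p q rot i) t ->
  chart_dom (t_chart p q rot i) (toC r * t).
Proof.
move=> iN /andP[r0 r1] Dt; rewrite /= /t_dom /=.
have -> : q i + (toC r * t) ^+ 2 = q i + toC (r ^+ 2) * ((q i + t ^+ 2) - q i).
  by rewrite addrAC subrr add0r exprMn /toC rmorphXn.
apply: strip_convex => //; first by rewrite sqr_ge0 expr_le1.
by apply: (strip_q q_sorted); rewrite addn0 // leqnn.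
Qed.

Local Notation timg i := (chart_img (t_chart p q rot i) (t_inv q rot i)).

Lemma timgP i P : (i < n)%N -> timg i P <-> piece false P /\ strip 0 i (crd false P).1.
Proof.
move=> iN; split=> [[D E]|[aP sP]]; last exact: t_invK.
split; first by rewrite -E; exact: piece_t_map.
by rewrite -E crd_t_map.
Qed.

Local Notation tray i P := (ray (t_chart p q rot i) (t_inv q rot i) P).

(** By [tcone] this is a potential for the paths in the chart at [q i]; it vanishes at the branch
    point. *)
Definition cpot i P : Q := PC (tray i P).

Lemma tcone i (s : R -> T) : (i < n)%N -> pathT s -> (forall r, 0 <= r <= 1 -> timg i (s r)) ->
  PC s = cpot i (s 1) - cpot i (s 0).
Proof.
move=> iN sp sU; apply: pc_cone => //; first exact: t_chart_good.
by move=> t r r01; exact: t_star.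
Qed.

Lemma cpot_center i P : t_inv q rot i P = 0 -> cpot i P = 0.
Proof.
move=> E; rewrite /cpot; rewrite (_ : tray i P = fun=> t_map p q rot i 0) ?pc_cst //.
by apply/funext => r; rewrite /ray E mulr0.
Qed.

Lemma loop_timg i s : (i.+1 < n)%N -> sin (pi * s) ^+ 2 < 1 -> timg i (loop i 0 s).
Proof.
move=> iN s1; apply/timgP; first exact: ltnW.
split; first exact: piece_loop.
rewrite crd_loop //= => k kn ok; have := loop_strip0 q_sorted s iN kn.
have [->|ki] := eqVneq k i.+1; last first.
  apply; move: ok; rewrite /outer addn0 addn1 => /orP[->//|ik]; apply/orP; right.
  by rewrite ltn_neqAle eq_sym ki.
move=> _; rewrite /side ltnNge leqnSn /= loop_z0 ellD ellZ ellB.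
have := q_sorted (ltnSn i) iN; have := sqr_ge0 (sin (pi * s)); nra.
Qed.

Lemma loop_timgS i s : (i.+1 < n)%N -> 0 < sin (pi * s) ^+ 2 -> timg i.+1 (loop i 0 s).
Proof.
move=> iN s0; apply/timgP => //; split; first exact: piece_loop.
rewrite crd_loop //= => k kn ok; have := loop_strip0 q_sorted s iN kn.
have s1 : sin (pi * s) ^+ 2 <= 1 by rewrite -(cos2Dsin2 (pi * s)) lerDr sqr_ge0.
have [->|ki] := eqVneq k i.
  move=> _; rewrite /side ltnSn loop_z0 ellD ellZ ellB.
  have := q_sorted (ltnSn i) iN; nra.
have kE : (k < i.+1)%N = (k < i)%N by rewrite ltnS leq_eqVlt (negPf ki).
rewrite kE; apply; move: ok; rewrite /outer addn0 addn1.
by rewrite kE.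
Qed.

Definition half i : Q := PC (sub (loop i 0) 0 2^-1).

Lemma sin_sq_lt1 s : - 2^-1 < s < 2^-1 -> sin (pi * s) ^+ 2 < 1.
Proof.
move=> /andP[s0 s1]; rewrite -(cos2Dsin2 (pi * s)) ltrDr exprn_gt0 //.
apply: cos_gt0_pihalf; have := pi_gt0 R => p0; apply/andP; split; nra.
Qed.

Lemma sin_sq_gt0 s : 0 < s < 1 -> 0 < sin (pi * s) ^+ 2.
Proof.
move=> /andP[s0 s1]; rewrite exprn_gt0 //; apply: sin_gt0_pi.
have := pi_gt0 R => p0; apply/andP; split; nra.
Qed.

Lemma sin_sq_shift s : sin (pi * (s + 1)) ^+ 2 = sin (pi * s) ^+ 2.
Proof. by rewrite mulrDr mulr1 sinDpi sqrrN. Qed.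

Lemma loop_ends i : (i.+1 < n)%N -> t_inv q rot i (loop i 0 0) = 0 /\
  t_inv q rot i (loop i 0 1) = 0 /\ t_inv q rot i.+1 (loop i 0 2^-1) = 0.
Proof.
move=> iN; have -> : loop i 0 1 = loop i 0 0 by rewrite -{1}[1]add0r loop_periodic.
rewrite /t_inv !crd_loop //= /loop_w.
rewrite (csin0 0) (ccos0 2^-1) mulr0 sin0 cos_pihalf toC0.
by rewrite !(mulr0, mul0r).
Qed.

(** Half a loop joins the center of chart [i] to that of chart [i.+1], where the respective
    potentials vanish. It is cut at [4^-1], a time at which the loop is in both charts. *)
Lemma halfE i : (i.+1 < n)%N ->
  half i = cpot i (loop i 0 4^-1) - cpot i.+1 (loop i 0 4^-1).
Proof.
move=> iN; have lp := loop0_path rot0 q_sorted branch_polyE iN.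
have [e0 [e1 e2]] := loop_ends iN.
rewrite /half (pc_sub int 0 4^-1 2^-1 lp).
rewrite (tcone (ltnW iN) (path_in_sub 0 4^-1 lp)); last first.
  move=> r /andP[r0 r1]; apply: loop_timg => //; apply: sin_sq_lt1; apply/andP; split; lra.
rewrite (tcone iN (path_in_sub 4^-1 2^-1 lp)); last first.
  move=> r /andP[r0 r1]; apply: loop_timgS => //; apply: sin_sq_gt0; apply/andP; split; lra.
by rewrite !sub0 !sub1 (cpot_center e0) (cpot_center e2) subr0 sub0r.
Qed.

Lemma half2E i : (i.+1 < n)%N -> PC (loop i 0) - half i =
  cpot i.+1 (loop i 0 (1 - 4^-1)) - cpot i (loop i 0 (1 - 4^-1)).
Proof.
move=> iN; have lp := loop0_path rot0 q_sorted branch_polyE iN.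
have [e0 [e1 e2]] := loop_ends iN.
rewrite /half -{1}(sub01 (loop i 0)) (pc_sub int 0 2^-1 1 lp) addrAC subrr add0r.
rewrite (pc_sub int 2^-1 (1 - 4^-1) 1 lp).
rewrite (tcone iN (path_in_sub 2^-1 (1 - 4^-1) lp)); last first.
  move=> r /andP[r0 r1]; apply: loop_timgS => //; apply: sin_sq_gt0; apply/andP; split; lra.
rewrite (tcone (ltnW iN) (path_in_sub (1 - 4^-1) 1 lp)); last first.
  move=> r /andP[r0 r1]; apply: loop_timg => //.
  rewrite -[X in sin (pi * X)](subrK 1) sin_sq_shift; apply: sin_sq_lt1; apply/andP; split; lra.
by rewrite !sub0 !sub1 (cpot_center e1) (cpot_center e2) subr0 sub0r.
Qed.

Lemma eq_mem_in (A : {pred Q}) x y : x \in A -> x = y -> y \in A.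
Proof. by move=> xA <-. Qed.

Definition loop_span : {pred Q} :=
  generated_subgroup [set x | exists2 k, (k.+1 < n)%N & x = PC (loop k 0)].

Lemma mem_loop_span k : (k.+1 < n)%N -> PC (loop k 0) \in loop_span.
Proof. by move=> kn; apply/asboolP => B _; apply; exists k. Qed.

(** A root of [branch_poly] that is holomorphic on the band between [q i] and [q i.+1]; over this
    convex band the two sheets are separate. *)
Definition sheet_root i z : C := oroot 1 i z * sr q rot true i z * sr q rot false i.+1 z.

Definition between i z : Prop := strip 0 i z /\ strip 0 i.+1 z.

Lemma between_strip1 i z : (i.+1 < n)%N -> between i z ->
  [/\ strip 1 i z, side q rot true i z & side q rot false i.+1 z].
Proof.
move=> iN [s1 s2]; split.
- move=> k kn; rewrite /outer addn1 => /orP[ki|ik]; first by apply: s1; rewrite /outer ?ki.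
  by apply: s1; rewrite /outer ?addn0 // (ltnW ik) orbT.
- have := s2 i (ltnW iN); rewrite /outer ltnSn; exact.
- by have := s1 i.+1 iN; rewrite /outer addn0 ltnSn orbT ltnNge leqnSn; exact.
Qed.

Lemma sheet_root_sqr i z : (i.+1 < n)%N -> sheet_root i z ^+ 2 = branch_poly p z.
Proof.
move=> iN; rewrite (branch_poly_outer1 rot0 branch_polyE _ iN) /sheet_root.
rewrite (exprMn 2 (oroot 1 i z * _)) (exprMn 2 (oroot 1 i z)).
by rewrite !(sr_sqr _ rot0) -mulrA mulrC.
Qed.

Lemma between_convex i z w (r : R) : 0 <= r <= 1 -> between i z -> between i w ->
  between i (z + toC r * (w - z)).
Proof. by move=> r01 [? ?] [? ?]; split; exact: strip_convex. Qed.

(** The lifted segment from [P] to [P'] stays on one sheet over the band and inside both charts, so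
    either potential computes its class. *)
Lemma ray_transport i (P P' : T) (e : C) : (i.+1 < n)%N -> e ^+ 2 = 1 ->
  piece false P -> piece false P' ->
  between i (crd false P).1 -> between i (crd false P').1 ->
  (crd false P).2 = e * sheet_root i (crd false P).1 ->
  (crd false P').2 = e * sheet_root i (crd false P').1 ->
  cpot i P' - cpot i.+1 P' = cpot i P - cpot i.+1 P.
Proof.
move=> iN e2 aP aP' bP bP' wP wP'.
set z := (crd false P).1 in bP wP; set z' := (crd false P').1 in bP' wP'.
pose zr (r : R) : C := z + toC (clamp r) * (z' - z).
pose s (r : R) : T := mkpt p false (zr r, e * sheet_root i (zr r)).
have bz r : between i (zr r) by apply: between_convex => //; exact: clamp01.
have crd_s r : crd false (s r) = (zr r, e * sheet_root i (zr r)).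
  by apply: (mkpt_spec (b := false) _).2; rewrite /= exprMn e2 mul1r sheet_root_sqr.
have aS r : piece false (s r) by exact: piece_mkaff.
have zc r : cts zr r.
  apply: ctsD; first exact: cts_cst; apply: ctsM; last exact: cts_cst.
  by apply: cts_toC; exact: clamp_continuous.
have sp : pathT s.
  split=> // r; apply: (@continuous_curve _ _ _ false).
  - by near=> y; exact: aS.
  - by rewrite (_ : (fun y => _) = zr); [exact: zc|apply/funext => y; rewrite crd_s].
  - rewrite (_ : (fun y => _) = (fun r => e * sheet_root i (zr r))); last first.
      by apply/funext => y; rewrite crd_s.
    apply: ctsM; first exact: cts_cst.
    have [b1 b2 b3] := between_strip1 iN (bz r); have ic := @idCc R.
    apply: (cts_compC (zc r)); apply: (C1_cont ic); apply: (C1M ic).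
      by apply: (C1M ic); [exact: outer_root_C1|exact: sr_C1].
    exact: sr_C1.
have s0 : s 0 = P.
  by apply: (coord_inj (aS 0) aP); rewrite crd_s /zr clamp0 toC0 mul0r addr0 -wP /z -surjective_pairing.
have s1 : s 1 = P'.
  apply: (coord_inj (aS 1) aP'); rewrite crd_s /zr clamp1 toC1 mul1r addrC subrK -wP' /z'; by case: (crd false P').
have E1 := tcone (ltnW iN) sp (fun r _ => (timgP _ (ltnW iN)).2 (conj (aS r) _)).
have E2 := tcone iN sp (fun r _ => (timgP _ iN).2 (conj (aS r) _)).
have {}E1 : PC s = cpot i P' - cpot i P.
  by rewrite -[X in cpot i X - _]s1 -[X in _ - cpot i X]s0; apply: E1 => r; rewrite crd_s; case: (bz r).
have {}E2 : PC s = cpot i.+1 P' - cpot i.+1 P.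
  by rewrite -[X in cpot _ X - _]s1 -[X in _ - cpot _ X]s0; apply: E2 => r; rewrite crd_s; case: (bz r).
move: E1; rewrite E2 => /eqP; rewrite subr_eq addrAC eq_sym subr_eq => /eqP E.
apply: (addIr (cpot i.+1 P' + cpot i.+1 P)); transitivity (cpot i P' + cpot i.+1 P); first by abel.
by rewrite E; abel.
Unshelve. all: by end_near. Qed.

(** The difference of the two potentials is constant on each sheet over the band. At the midpoints
    of the two halves of the loop it is [half i] and [half i] minus the class of the loop. *)
Lemma ray_step i P : (i.+1 < n)%N -> piece false P -> between i (crd false P).1 ->
  cpot i P - cpot i.+1 P - half i \in loop_span.
Proof.
move=> iN aP bP; set m := loop i 0 4^-1; set m' := loop i 0 (1 - 4^-1).
have am : piece false m by exact: piece_loop.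
have am' : piece false m' by exact: piece_loop.
have q1 : sin (pi * 4^-1) ^+ 2 < 1 by apply: sin_sq_lt1; apply/andP; split; lra.
have q0 : 0 < sin (pi * 4^-1) ^+ 2 by apply: sin_sq_gt0; apply/andP; split; lra.
have bm : between i (crd false m).1.
  have /timgP[|_ s1] := loop_timg iN q1; first exact: ltnW.
  by have /timgP[//|_ s2] := loop_timgS iN q0.
have m'E : m' = invol m by exact: loop_invol.
have bm' : between i (crd false m').1 by rewrite m'E coord_invol.
have [b eb] : exists b : bool, (crd false m).2 = (-1) ^+ b * sheet_root i (crd false m).1.
  by apply: sqr_eq_sign; rewrite coord_eq // sheet_root_sqr.
have [b' eb'] : exists b : bool, (crd false P).2 = (-1) ^+ b * sheet_root i (crd false P).1.
  by apply: sqr_eq_sign; rewrite coord_eq // sheet_root_sqr.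
have [bb|bb] := eqVneq b' b.
  rewrite bb in eb'; rewrite (ray_transport iN (sqrr_sign _ b) am aP bm bP eb eb').
  by rewrite -/m -halfE // subrr; exact: rpred0.
have eb'' : (crd false m').2 = (-1) ^+ b' * sheet_root i (crd false m').1.
  rewrite m'E coord_invol /= eb -mulNr; congr (_ * _).
  by case: b b' bb {eb eb'} => -[]; rewrite // expr1 ?opprK.
rewrite (ray_transport iN (sqrr_sign _ b') am' aP bm' bP eb'' eb').
have E := half2E iN; rewrite -/m' in E.
have -> : cpot i m' - cpot i.+1 m' - half i = - PC (loop i 0).
  by rewrite -[X in X - _]opprB -E opprB addrAC subrr sub0r.
by rewrite rpredN; exact: mem_loop_span.
Qed.

(** Otherwise [q i.+1] would have to lie beyond [z] for the strip of [i] and before [z] for the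
    strip of [j]. *)
Lemma strip_adjacent i j z : (i < j)%N -> (j < n)%N -> strip 0 i z -> strip 0 j z ->
  j = i.+1.
Proof.
move=> ij jN si sj; apply/eqP; rewrite eqn_leq ij andbT leqNgt; apply/negP => ij1.
have := si i.+1 (ltn_trans ij1 jN); have := sj i.+1 (ltn_trans ij1 jN).
rewrite /outer !addn0 ij1 ltnSn orbT (ltnNge _ i) leqnSn /= => /(_ isT) h1 /(_ isT) h2.
by have := lt_trans h1 h2; rewrite ltxx.
Qed.

(* The half loops join the centers of consecutive [t_chart]s. *)
Definition halves i : Q := \sum_(k < i) half k.

Definition strip_idx z : nat := s2val (cid2 (strip_cover rot0 q_sorted z)).

Lemma strip_idxP z : (strip_idx z < n)%N /\ strip 0 (strip_idx z) z.
Proof. by rewrite /strip_idx; case: cid2 => i iN si. Qed.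

(** Half loops lead from [q 0] to the branch point of a strip containing [z], and a ray leads from
    there to [P]. By [ray_step] the choice of the strip affects the class by loops only. *)
Definition affpot P : Q :=
  let i := strip_idx (crd false P).1 in halves i + cpot i P.

Lemma halvesS i P : (i.+1 < n)%N -> piece false P -> between i (crd false P).1 ->
  (halves i + cpot i P) - (halves i.+1 + cpot i.+1 P) \in loop_span.
Proof.
move=> iN aP bP; have -> : halves i.+1 = halves i + half i by rewrite /halves big_ord_recr.
by apply: eq_mem_in (ray_step iN aP bP) _; abel.
Qed.

Lemma affpot_strip i P : (i < n)%N -> piece false P -> strip 0 i (crd false P).1 ->
  affpot P - (halves i + cpot i P) \in loop_span.
Proof.
move=> iN aP si; rewrite /affpot; have [jN sj] := strip_idxP (crd false P).1.
set j := strip_idx _ in jN sj *.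
case: (ltngtP i j) => ij; last by rewrite ij subrr; exact: rpred0.
  have jE := strip_adjacent ij jN si sj; rewrite jE in jN sj *.
  by rewrite -opprB rpredN; exact: halvesS.
have iE := strip_adjacent ij iN sj si; rewrite iE in iN si *.
exact: halvesS.
Qed.

Lemma affpot_local r (s : R -> T) : piece false (s r) -> exists2 A, nbhs (s r) A &
  forall s' : R -> T, pathT s' -> (forall x, 0 <= x <= 1 -> A (s' x)) ->
    potential_mod affpot loop_span s'.
Proof.
move=> aP; have [iN si] := strip_idxP (crd false (s r)).1; set i := strip_idx _ in iN si.
exists (timg i).
  by apply: chart_img_nbhs; [exact: t_chart_good|apply/timgP].
move=> s' sp sU; rewrite /potential_mod (tcone iN sp sU).
have h (x : R) : 0 <= x <= 1 -> affpot (s' x) - (halves i + cpot i (s' x)) \in loop_span.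
  by move=> /sU /(timgP _ iN)[? ?]; exact: affpot_strip.
have h0 := h 0 (_ : 0 <= 0 <= 1); have h1 := h 1 (_ : 0 <= 1 <= 1).
rewrite lexx ler01 in h0; rewrite lexx ler01 in h1.
apply: eq_mem_in (rpredB (h0 isT) (h1 isT)) _.
abel.
Qed.

Lemma affpot_path (s : R -> T) : pathT s -> (forall r, 0 <= r <= 1 -> piece false (s r)) ->
  potential_mod affpot loop_span s.
Proof.
by move=> sp sa; apply: path_induction => // r r01; apply: affpot_local; exact: sa.
Qed.

(** * The two points at infinity *)

Local Notation ichart b := (inf_chart p b).
Local Notation iinv := (fun P : T => (crd true P).1).
Local Notation iimg b := (chart_img (ichart b) iinv).

Lemma inf_convex z w (r : R) : 0 <= r <= 1 -> inf_dom p z -> inf_dom p w ->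
  inf_dom p (z + toC r * (w - z)).
Proof.
move=> /andP[r0 r1] zD wD k; have := zD k; have := wD k.
have -> : complex.Re (1 - p k * (z + toC r * (w - z))) =
    (1 - r) * complex.Re (1 - p k * z) + r * complex.Re (1 - p k * w).
  by case: (p k) z w {zD wD} => [a b] [c d] [e f] /=; ring.
move=> h1 h2; have [->|rn0] := eqVneq r 0; first by rewrite subr0 mul1r mul0r addr0.
have rp : 0 < r by rewrite lt_neqAle eq_sym rn0.
by rewrite ltr_wpDl ?mulr_gt0 // mulr_ge0 ?subr_ge0 // ltW.
Qed.

Lemma inf_dom0 : inf_dom p 0.
Proof. by move=> k; rewrite mulr0 subr0 ltr01. Qed.

Lemma inf_star t (r : R) (b : bool) : 0 <= r <= 1 -> chart_dom (ichart b) t ->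
  chart_dom (ichart b) (toC r * t).
Proof.
move=> r01 Dt; rewrite -[_ * _]add0r -[X in _ * X]subr0.
by apply: inf_convex => //; exact: inf_dom0.
Qed.

Lemma crd_ichart (b : bool) u : piece true (ichart b u) /\
  crd true (ichart b u) = (u, inf_branch p b u).
Proof. by apply: crd_graph_chart => t; rewrite inf_branch_sqr. Qed.

Lemma iimg_ichart (b : bool) u : inf_dom p u -> iimg b (ichart b u).
Proof. by move=> Du; have [_ E] := crd_ichart b u; split; rewrite E. Qed.

Definition ipot (b : bool) P : Q := PC (ray (ichart b) iinv P).

Lemma icone (b : bool) (s : R -> T) : pathT s -> (forall r, 0 <= r <= 1 -> iimg b (s r)) ->
  PC s = ipot b (s 1) - ipot b (s 0).
Proof.
move=> sp sU; apply: (@pc_cone R g p (ichart b) iinv) => //; first exact: inf_chart_good.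
by move=> t r r01; exact: inf_star.
Qed.

Lemma ichart_aff (b : bool) u : u != 0 -> piece false (ichart b u).
Proof.
by move=> u0; have [bt E] := crd_ichart b u; apply/(piece_neq bt); rewrite E.
Qed.

Lemma ichart_path (b : bool) z w : inf_dom p z -> inf_dom p w ->
  pathT (fun r => ichart b (z + toC (clamp r) * (w - z))).
Proof.
move=> Dz Dw; split=> // r.
have tc : cts (fun r => z + toC (clamp r) * (w - z)) r.
  apply: ctsD; first exact: cts_cst; apply: ctsM; last exact: cts_cst.
  by apply: cts_toC; exact: clamp_continuous.
move/ctsP in tc; apply: (continuous_comp tc).
apply: (atlas_continuous (gc_atlas (inf_chart_good p b))).
by apply: inf_convex => //; exact: clamp01.
Qed.

Definition idiff (b : bool) u : Q := affpot (ichart b u) - ipot b (ichart b u).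

Lemma idiff_segment (b : bool) z w : inf_dom p z -> inf_dom p w ->
  (forall r : R, 0 <= r <= 1 -> z + toC r * (w - z) != 0) ->
  idiff b w - idiff b z \in loop_span.
Proof.
move=> Dz Dw H; have sp := ichart_path b Dz Dw.
have := @affpot_path _ sp (fun r _ => ichart_aff b (H _ (clamp01 r))).
rewrite /potential_mod (@icone b _ sp); last first.
  by move=> r _; apply: iimg_ichart; apply: inf_convex => //; exact: clamp01.
rewrite clamp0 clamp1 toC0 toC1 mul0r mul1r addr0 (addrC z) subrK => h.
rewrite -rpredN in h; apply: eq_mem_in h _.
rewrite /idiff; abel.
Qed.

Lemma inf_base : exists2 e : R, 0 < e & inf_dom p (toC e) /\ inf_dom p (iC R * toC e).
Proof.
have /nbhsC_nrm[e e0 He] : nbhs (0 : C) (inf_dom p).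
  by apply: open_nbhs_nbhs; split; [exact: open_inf_dom|exact: inf_dom0].
have e2 : nrm (toC (e / 2)) < e.
  by rewrite nrm_real ger0_norm ?divr_ge0 ?ltW // ltr_pdivrMr // ltr_pMr // ltr1n.
exists (e / 2); first by rewrite divr_gt0.
split; apply: He; rewrite subr0 // nrmM (_ : nrm (iC R) = 1) ?mul1r //.
by rewrite /iC /= expr0n expr1n add0r sqrtr1.
Qed.

Definition ieps : R := s2val (cid2 inf_base).

Lemma iepsP : [/\ 0 < ieps, inf_dom p (toC ieps) & inf_dom p (iC R * toC ieps)].
Proof. by rewrite /ieps; case: cid2 => e /= e0 []. Qed.

(** The segment from [ieps] to [u] avoids the center 0 unless [u] is real, and then the detour
    through [iC R * toC ieps] does. Thus going around a point at infinity yields nothing beyond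
    [loop_span]. *)
Lemma idiff_cst (b : bool) u : inf_dom p u -> u != 0 ->
  idiff b u - idiff b (toC ieps) \in loop_span.
Proof.
move=> Du u0; have [e0 De Die] := iepsP.
have [imu|imu] := eqVneq (complex.Im u) 0; last first.
  apply: idiff_segment => // r /andP[r0 r1]; apply/negP => /eqP E.
  have := congr1 (@complex.Im R) E; have := congr1 (@complex.Re R) E.
  rewrite cReD cImD Re_toCM Im_toCM cReB cImB /= subr0 add0r => E1 /eqP.
  rewrite mulf_eq0 (negPf imu) orbF => /eqP r_0; move: E1; rewrite r_0 mul0r addr0 => E1.
  by rewrite E1 ltxx in e0.
have h1 : idiff b (iC R * toC ieps) - idiff b (toC ieps) \in loop_span.
  apply: idiff_segment => // r /andP[r0 r1]; apply/negP => /eqP E.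
  have := congr1 (@complex.Im R) E; have := congr1 (@complex.Re R) E.
  rewrite cReD cImD Re_toCM Im_toCM cReB cImB cReM cImM /= => E1 E2.
  have r_0 : r = 0 by nra.
  by move: E1; rewrite r_0; nra.
have h2 : idiff b u - idiff b (iC R * toC ieps) \in loop_span; last first.
  by apply: eq_mem_in (rpredD h2 h1) _; abel.
apply: idiff_segment => // r /andP[r0 r1]; apply/negP => /eqP E.
have := congr1 (@complex.Im R) E; have := congr1 (@complex.Re R) E.
rewrite cReD cImD Re_toCM Im_toCM cReB cImB cReM cImM /= imu => E1 E2.
have r_1 : r = 1 by nra.
have ru : complex.Re u = 0 by move: E1; rewrite r_1; nra.
by move: u0; rewrite eq_complex imu ru eqxx.
Qed.

Definition icenter (b : bool) : T := ichart b 0.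

Lemma inf_branch0 (b : bool) : inf_branch p b 0 = (-1) ^+ b.
Proof.
rewrite /inf_branch big1 ?mulr1 // => i _.
by rewrite mulr0 subr0 sqrtc1.
Qed.

Lemma icenter_neq : icenter true <> icenter false.
Proof.
move=> E; have [_ E1] := crd_ichart true 0; have [_ E0] := crd_ichart false 0.
have := congr1 snd (etrans (esym E1) (etrans (congr1 (crd true) E) E0)).
rewrite /= !inf_branch0 expr1 expr0 => /eqP; rewrite -subr_eq0 -opprD oppr_eq0.
by rewrite -mulr2n pnatr_eq0.
Qed.

Lemma icenterP P : ~ piece false P -> exists b : bool, P = icenter b.
Proof.
move=> nP; have bP : piece true P by case: (piece_or P).
have x0 : (crd true P).1 = 0.
  by apply: contrapT => /eqP/(piece_neq bP).
have [b eb] : exists b : bool, (crd true P).2 = (-1) ^+ b * 1.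
  apply: sqr_eq_sign; rewrite (coord_eq bP) x0 expr1n /= /recip_poly big1 // => i _.
  by rewrite mulr0 subr0.
exists b; have [bc E] := crd_ichart b 0; apply: (coord_inj bP bc).
by rewrite E inf_branch0 [LHS]surjective_pairing x0 eb mulr1.
Qed.

Lemma icenter_inf (b : bool) : ~ piece false (icenter b).
Proof. by have [bc E] := crd_ichart b 0; move=> /(piece_neq bc); rewrite E eqxx. Qed.

(** At a point at infinity [ipot] vanishes, so this value continues the difference [pot - ipot],
    constant around the point modulo loops. *)
Definition pot P : Q :=
  if `[< piece false P >] then affpot P
  else idiff `[< P = icenter true >] (toC ieps).

Lemma pot_aff P : piece false P -> pot P = affpot P.
Proof. by move=> aP; rewrite /pot; case: asboolP. Qed.

Lemma pot_inf (b : bool) P : iimg b P -> pot P - ipot b P - idiff b (toC ieps) \in loop_span.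
Proof.
move=> [DP EP]; have [u0|u0] := eqVneq (crd true P).1 0; last first.
  rewrite -EP pot_aff; first exact: idiff_cst.
  exact: ichart_aff.
have PE : P = icenter b by rewrite -EP u0.
have -> : ipot b P = 0.
  have -> : ipot b P = PC (fun=> icenter b); last exact: pc_cst.
  by congr PC; apply/funext => r; rewrite /ray u0 mulr0.
have -> : pot P = idiff b (toC ieps).
  rewrite /pot PE asboolF; last exact: icenter_inf.
  suff -> : `[< icenter b = icenter true >] = b by [].
  case: (b); first by rewrite asboolT.
  by rewrite asboolF // => /esym/icenter_neq.
rewrite subr0 subrr; exact: rpred0.
Qed.

Lemma pot_path (s : R -> T) : pathT s -> potential_mod pot loop_span s.
Proof.
move=> sp; apply: path_induction => // r _.
have [aP|/icenterP[b bP]] := pselect (piece false (s r)).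
  have [A nA HA] := affpot_local aP; exists (A `&` piece false).
    by apply: filterI => //; exact: near_piece.
  move=> s' sp' sA; have := HA s' sp' (fun x x01 => (sA x x01).1).
  by rewrite /potential_mod !pot_aff //; apply: (sA _ _).2; rewrite ?lexx ?ler01.
exists (iimg b).
  apply: chart_img_nbhs; first exact: inf_chart_good.
  by rewrite bP; apply: iimg_ichart; exact: inf_dom0.
move=> s' sp' sU; rewrite /potential_mod (icone sp' sU).
have h (x : R) : 0 <= x <= 1 -> pot (s' x) - ipot b (s' x) - idiff b (toC ieps) \in loop_span.
  by move=> /sU; exact: pot_inf.
have h0 := h 0 (_ : 0 <= 0 <= 1); have h1 := h 1 (_ : 0 <= 1 <= 1).
rewrite lexx ler01 in h0; rewrite lexx ler01 in h1.
apply: eq_mem_in (rpredB (h0 isT) (h1 isT)) _.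
move: (pot _) (pot _) (ipot _ _) (ipot _ _) (idiff _ _) => a1 a0 i1 i0 d.
abel.
Qed.

(** By [pot_path] every path is a difference of [pot] modulo the loops, so [cycle_induction] puts
    every cycle in their span; [emb_inj] returns to homology. *)
Theorem H1_generated (A : {pred H1 R T int [set: T]}) : zmod_closed A ->
  (forall k, (k.+1 < n)%N -> hclass [set: T] << loop k 0 >> \in A) -> forall h, h \in A.
Proof.
move=> [A0 AB] HA h; have [hc hE] := hreprK h.
have := cycle_induction hc pot_path; rewrite -/(emb h).
have AC : zmod_closed (fun x : Q => `[< exists2 h, h \in A & x = emb h >]).
  split; first by apply/asboolP; exists 0 => //; rewrite emb0.
  move=> x y /asboolP[a aA ->] /asboolP[b bA ->]; apply/asboolP; exists (a - b); first exact: AB.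
  by rewrite embB.
move=> /asboolP/(_ _ AC) H.
have /asboolP[h' h'A E] : emb h \in (fun x : Q => `[< exists2 h, h \in A & x = emb h >]).
  apply: H => y [k kn ->]; apply/asboolP; exists (hclass [set: T] << loop k 0 >>); first exact: HA.
  rewrite emb_hclass //; apply: closed_cycle.
    by apply: path_in_singular1; exact: loop0_path.
  by rewrite -[X in _ = loop _ _ X]add0r loop_periodic.
by rewrite (emb_inj E).
Qed.

End Generation.

(** * Harmonic functions in the plane *)

Section PlaneAnalysis.
Context (R : realType).
Local Notation C := (R[i]^o).
Implicit Types (F : C -> R) (t : C) (s h : R).

Lemma is_derive_carR (f : R -> R) (a d : R) : is_derive a (1 : R) f d <->
  exists phi : R -> R, [/\ {for a, continuous phi}, phi a = d &
    forall y, f y - f a = (y - a) * phi y].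
Proof. exact: (@is_derive_caratheodory R). Qed.

Lemma is_derive_near (f h : R -> R) (a d : R) : (\forall y \near a, f y = h y) ->
  is_derive a (1 : R) f d -> is_derive a (1 : R) h d.
Proof. by move=> E; apply: near_eq_is_derive => //; exact: oner_neq0. Qed.

Lemma mvt_closed (f f' : R -> R) (a b : R) : a < b ->
  (forall x, a <= x <= b -> is_derive x (1 : R) f (f' x)) ->
  exists2 c, a < c < b & f b - f a = f' c * (b - a).
Proof.
move=> ab fd.
have [c] : exists2 c, c \in `]a, b[%R & f b - f a = f' c * (b - a).
  apply: MVT => // [x|].
    by rewrite in_itv /= => /andP[ax xb]; apply: fd; rewrite !ltW.
  apply/within_continuousP => x; rewrite /= in_itv /= => /fd [df _] U HU.
  have /differentiable_continuous fc : differentiable f x by exact/derivable1_diffP.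
  have H : \forall y \near x, U (f y) := fc U HU.
  by apply: filterS H => y ? _.
by rewrite in_itv /= => cab E; exists c.
Qed.

(** At the maximum [f'] vanishes, so a positive [f2] would make [f'] positive and [f] increasing
    just to its right. *)
Lemma max_second_derivative (f f' : R -> R) (f2 : R) :
  (\forall s \near (0 : R), is_derive s (1 : R) f (f' s)) -> is_derive (0 : R) (1 : R) f' f2 ->
  (\forall s \near (0 : R), f s <= f 0) -> f2 <= 0.
Proof.
move=> fd /is_derive_carR[phi [phic <- phiE]] fmax; rewrite leNgt; apply/negP => p0.
have f'0 : f' 0 = 0.
  have /is_derive_carR[psi [psic psi0 psiE]] := nbhs_singleton fd.
  rewrite -psi0; apply/eqP; rewrite eq_le; apply/andP; split; rewrite leNgt; apply/negP => q0.
    have /nbhs_ballP[e /= e0 He] : \forall s \near (0 : R), f s <= f 0 /\ 0 < psi s.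
      by apply: filterS2 fmax (near_gt psic q0) => s; split.
    have := He (e / 2); rewrite /ball /= sub0r normrN ger0_norm ?divr_ge0 ?(ltW e0) // => -[].
      by rewrite ltr_pdivrMr // ltr_pMr // ltr1n.
    move=> h1 h2; have := psiE (e / 2); rewrite subr0 => E; have e2 : 0 < e / 2 by rewrite divr_gt0.
    by have := mulr_gt0 e2 h2; lra.
  have /nbhs_ballP[e /= e0 He] : \forall s \near (0 : R), f s <= f 0 /\ psi s < 0.
      by apply: filterS2 fmax (near_lt psic q0) => s; split.
  have := He (- (e / 2)); rewrite /ball /= sub0r opprK ger0_norm ?divr_ge0 ?(ltW e0) // => -[].
    by rewrite ltr_pdivrMr // ltr_pMr // ltr1n.
  move=> h1 h2; have := psiE (- (e / 2)); rewrite subr0 => E; have e2 : 0 < e / 2 by rewrite divr_gt0.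
  have : 0 < - (e / 2) * psi (- (e / 2)) by rewrite nmulr_rgt0 // oppr_lt0.
  by lra.
have /nbhs_ballP[e /= e0 He] : \forall s \near (0 : R),
    (f s <= f 0 /\ is_derive s (1 : R) f (f' s)) /\ 0 < phi s.
  by apply: filterS3 fmax fd (near_gt phic p0) => s; split.
have ball_in s : 0 <= s -> s < e -> ball (0 : R) e s.
  by move=> s0 se; rewrite /ball /= sub0r normrN ger0_norm.
have e2 : 0 < e / 2 by rewrite divr_gt0.
have ee : e / 2 < e by rewrite ltr_pdivrMr // ltr_pMr // ltr1n.
have fder x : 0 <= x <= e / 2 -> is_derive x (1 : R) f (f' x).
  by move=> /andP[x0 xe]; have [[]] := He x (ball_in x x0 (le_lt_trans xe ee)).
have [c /andP[c0 ce]] := mvt_closed e2 fder; rewrite subr0 => E.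
have [_ pc] := He c (ball_in c (ltW c0) (lt_trans ce ee)).
have [[fm _] _] := He (e / 2) (ball_in _ (ltW e2) ee).
have := phiE c; rewrite f'0 !subr0 => E2; have := mulr_gt0 c0 pc; rewrite -E2 => f'c.
by have := mulr_gt0 f'c e2; rewrite -E; lra.
Qed.

Definition jx : R -> C := fun s => s%:C.
Definition jy : R -> C := fun s => s *i.
(** The common properties of the two coordinate directions, so that both partial derivatives are
    handled by the same lemmas. *)
Definition jdir (j : R -> C) : Prop :=
  [/\ forall s h, j (s + h) = j s + j h, forall s, nrm (j s) = `|s|, j 0 = 0 & continuous j].

Definition line (j : R -> C) F t : R -> R := fun s => F (t + j s).
Definition partial (j : R -> C) F t : R := derive1 (line j F t) 0.

Lemma jxP : jdir jx.
Proof.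
split=> [s h|s|//|s]; first by rewrite /jx rmorphD.
  by rewrite /jx nrm_real.
suff : {for s, continuous jx} by [].
by apply/ctsP; exact: toCc.
Qed.

Lemma jyP : jdir jy.
Proof.
split=> [s h|s|//|s]; first by apply/eqP; rewrite eq_complex /jy /= addr0 !eqxx.
  by rewrite /jy /= expr0n add0r sqrtr_sqr.
suff : {for s, continuous jy} by [].
apply/ctsP; rewrite /jy; apply: cts_Complex; first exact: cont_cst.
exact: cont_id.
Qed.

Section Direction.
Context (j : R -> C).
Hypothesis jP : jdir j.

Lemma line_shift F t s h : line j F (t + j s) h = line j F t (s + h).
Proof. by case: jP => jD _ _ _; rewrite /line jD addrA. Qed.

Lemma line_derive F t s : derivable (line j F (t + j s)) 0 1 ->
  is_derive s (1 : R) (line j F t) (partial j F (t + j s)).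
Proof.
move=> Fd; have : is_derive (0 : R) (1 : R) (line j F (t + j s)) (partial j F (t + j s)).
  by rewrite /partial derive1E; apply: DeriveDef.
move=> /is_derive_carR[phi [pc p0 pE]]; apply/is_derive_carR.
exists (fun y => phi (y - s)); split=> [||y].
- apply: (@continuous_comp _ _ _ (fun y => y - s) phi); last by rewrite /= subrr.
  by apply: contD; [exact: cont_id|exact: cont_cst].
- by rewrite subrr.
- by have := pE (y - s); rewrite !line_shift // addr0 subr0 [s + _]addrC subrK.
Qed.

Lemma line_mvt F t h : 0 < h ->
  (forall s, 0 <= s <= h -> derivable (line j F (t + j s)) 0 1) ->
  exists2 c, 0 < c < h & F (t + j h) - F t = h * partial j F (t + j c).
Proof.
move=> h0 Fd.
have fder x : 0 <= x <= h -> is_derive x (1 : R) (line j F t) (partial j F (t + j x)).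
  by move=> /Fd; exact: line_derive.
have [c ch] := mvt_closed h0 fder; rewrite subr0 /line mulrC => E; exists c => //.
by rewrite -E; case: jP => _ _ -> _; rewrite addr0.
Qed.

End Direction.

(** The mean value theorem is used twice: in the direction [j] for the increment of [F] along [k],
    then in the direction [k] for the partial derivative. *)
Lemma mixed_difference (j k : R -> C) F t h (e : R) : jdir j -> jdir k -> 0 < h -> h + h < e ->
  (forall y, nrm (y - t) < e -> derivable (line j F y) 0 1) ->
  (forall y, nrm (y - t) < e -> derivable (line k (partial j F) y) 0 1) ->
  exists2 y, nrm (y - t) <= h + h &
    F (t + j h + k h) - F (t + j h) - (F (t + k h) - F t) = h * h * partial k (partial j F) y.
Proof.
move=> jP kP h0 he Hj Hk.
have [jD jn j0 _] := jP; have [kD kn k0 _] := kP.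
have near_t s r : 0 <= s <= h -> 0 <= r <= h -> nrm (t + j s + k r - t) <= h + h.
  move=> /andP[s0 sh] /andP[r0 rh]; have -> : t + j s + k r - t = j s + k r by ring.
  apply: le_trans (nrmD _ _) _; rewrite jn kn !ger0_norm //.
  exact: lerD.
have h_in : 0 <= h <= h by rewrite lexx ltW.
have z_in : (0 : R) <= 0 <= h by rewrite lexx ltW.
pose G y := F (y + k h) - F y.
have Gd s : 0 <= s <= h -> is_derive s (1 : R) (line j G t)
    (partial j F (t + j s + k h) - partial j F (t + j s)).
  move=> sh.
  have d1 : is_derive s (1 : R) (line j F (t + k h)) (partial j F (t + k h + j s)).
    by apply: line_derive => //; apply: Hj; rewrite (addrAC t); apply: le_lt_trans he; exact: near_t.
  have d2 : is_derive s (1 : R) (line j F t) (partial j F (t + j s)).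
    apply: line_derive => //; apply: Hj; apply: le_lt_trans he.
    by have := near_t s 0 sh z_in; rewrite k0 addr0.
  have := is_deriveB d1 d2; rewrite (addrAC t (k h)); congr is_derive.
  by apply/funext => y; rewrite /line /G /= addrAC.
have [c /andP[c0 ch]] := mvt_closed h0 Gd; rewrite subr0 => E.
have c_in : 0 <= c <= h by rewrite !ltW.
have [d /andP[d0 dh] E2] : exists2 d, 0 < d < h &
    partial j F (t + j c + k h) - partial j F (t + j c) =
    h * partial k (partial j F) (t + j c + k d).
  by apply: line_mvt => // s sh; apply: Hk; apply: le_lt_trans he; exact: near_t.
exists (t + j c + k d); first by apply: near_t => //; rewrite !ltW.
move: E; rewrite E2 /line /G j0 addr0 => ->.
by ring.
Qed.

Lemma close_absurd (a a' b c : R) : a = a' -> `|a - b| < `|b - c| / 2 ->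
  `|a' - c| < `|b - c| / 2 -> ~ 0 < `|b - c|.
Proof.
move=> <-; rewrite distrC => h1 h2 _.
have := ler_normD (b - a) (a - c); rewrite addrA subrK leNgt => /negP; apply.
by rewrite [ltRHS]splitr; exact: ltrD.
Qed.

Lemma mixed_cancel (e a a' b c d x y : R) : e != 0 -> a = a' ->
  a - b - (c - d) = e * e * x -> a' - c - (b - d) = e * e * y -> x = y.
Proof.
move=> e0 <- E1 E2; apply: (mulfI (mulf_neq0 e0 e0)); rewrite -E1 -E2; ring.
Qed.

(** The second difference over a small square is symmetric in the two directions, so the mixed
    derivatives take equal values at two points near [t]. A gap [D] at [t] is excluded once both
    vary by less than [D / 2]. *)
Lemma schwarz (j k : R -> C) F t : jdir j -> jdir k ->
  (\forall y \near t, derivable (line j F y) 0 1 /\ derivable (line k F y) 0 1) ->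
  (\forall y \near t, derivable (line k (partial j F) y) 0 1) ->
  (\forall y \near t, derivable (line j (partial k F) y) 0 1) ->
  {for t, continuous (partial k (partial j F))} ->
  {for t, continuous (partial j (partial k F))} ->
  partial k (partial j F) t = partial j (partial k F) t.
Proof.
move=> jP kP d1 d2 d3 /continuousRP c1 /continuousRP c2.
apply/eqP; rewrite -subr_eq0; apply/negPn/negP; rewrite -normr_gt0.
set D := `| _ |; move=> D0; have D2 : 0 < D / 2 by rewrite divr_gt0.
have /nbhsC_nrm[e e0 He] : \forall y \near t,
    ((derivable (line j F y) 0 1 /\ derivable (line k F y) 0 1) /\
     derivable (line k (partial j F) y) 0 1 /\ derivable (line j (partial k F) y) 0 1) /\
    `|partial k (partial j F) y - partial k (partial j F) t| < D / 2 /\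
    `|partial j (partial k F) y - partial j (partial k F) t| < D / 2.
  have N := c2 _ D2; have M := c1 _ D2.
  have {}N : \forall y \near t, derivable (line j (partial k F) y) 0 1 /\
      `|partial j (partial k F) y - partial j (partial k F) t| < D / 2.
    by apply: filterS2 d3 N => y; split.
  have {}M : \forall y \near t, derivable (line k (partial j F) y) 0 1 /\
      `|partial k (partial j F) y - partial k (partial j F) t| < D / 2.
    by apply: filterS2 d2 M => y; split.
  by apply: filterS3 d1 M N => y ? [? ?] [? ?]; split.
have e4 : 0 < e / 4 by rewrite divr_gt0.
have he : e / 4 + e / 4 < e by lra.
have [y1 n1 E1] := @mixed_difference j k F t (e / 4) e jP kP e4 he
  (fun y yt => (He y yt).1.1.1) (fun y yt => (He y yt).1.2.1).
have [y2 n2 E2] := @mixed_difference k j F t (e / 4) e kP jP e4 he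
  (fun y yt => (He y yt).1.1.2) (fun y yt => (He y yt).1.2.2).
have E : partial k (partial j F) y1 = partial j (partial k F) y2.
  apply: mixed_cancel (lt0r_neq0 e4) _ E1 E2.
  by congr F; exact: addrAC.
have h1 := (He y1 (le_lt_trans n1 he)).2.1; have h2 := (He y2 (le_lt_trans n2 he)).2.2.
exact: (close_absurd E h1 h2 D0).
Qed.

Lemma partial_near (j : R -> C) F G t : jdir j -> (\forall y \near t, F y = G y) ->
  \forall s \near (0 : R), line j F t s = line j G t s.
Proof.
move=> [_ _ j0 jc] E.
have tc : {for (0 : R), continuous (fun s => t + j s)}.
  by apply/ctsP; apply: ctsD; [exact: cts_cst|apply/ctsP; exact: jc].
have H : \forall y \near t + j 0, F y = G y by rewrite j0 addr0.
exact: (tc _ H).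
Qed.

End PlaneAnalysis.

(** * A maximum principle with finitely many exceptional points *)

Section MaximumPrinciple.
Context (R : realType).
Local Notation C := (R[i]^o).
Implicit Types (f : R -> R) (z w : C).

Lemma near_all (T : topologicalType) (x : T) (P : T -> Prop) :
  (forall y, P y) -> \forall y \near x, P y.
Proof. by move=> H; apply: filterE. Qed.

Lemma cont_sum (V : topologicalType) (I : eqType) (r : seq I) (f : I -> V -> R) (x : V) :
  (forall i, i \in r -> {for x, continuous (f i)}) ->
  {for x, continuous (fun y => \sum_(i <- r) f i y)}.
Proof.
elim: r => [_|i r IH H].
  have -> : (fun y => \sum_(i <- [::]) f i y) = fun=> 0 by apply/funext => y; rewrite big_nil.
  exact: cont_cst.
have -> : (fun y => \sum_(k <- i :: r) f k y) = fun y => f i y + \sum_(k <- r) f k y.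
  by apply/funext => y; rewrite big_cons.
apply: contD; first by apply: H; rewrite mem_head.
by apply: IH => k kr; apply: H; rewrite inE kr orbT.
Qed.

Definition second_derivative f (a : R) : Prop := exists2 f' : R -> R,
  \forall s \near (0 : R), is_derive s (1 : R) f (f' s) & is_derive (0 : R) (1 : R) f' a.

Lemma second_derivative_le0 f a : second_derivative f a ->
  (\forall s \near (0 : R), f s <= f 0) -> a <= 0.
Proof. by move=> [f' fd f'd] fm; exact: max_second_derivative fd f'd fm. Qed.

Lemma second_derivativeD f h a b : second_derivative f a -> second_derivative h b ->
  second_derivative (fun s => f s + h s) (a + b).
Proof.
move=> [f' fd f'd] [h' hd h'd]; exists (fun s => f' s + h' s); last exact: is_deriveD.
by apply: filterS2 fd hd => s ? ?; exact: is_deriveD.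
Qed.

Lemma second_derivativeZ (k : R) f a : second_derivative f a ->
  second_derivative (fun s => k * f s) (k * a).
Proof.
move=> [f' fd f'd]; exists (fun s => k * f' s); last exact: is_deriveZ.
by apply: filterS fd => s ?; exact: is_deriveZ.
Qed.

Lemma second_derivative_near f h a : (\forall s \near (0 : R), f s = h s) ->
  second_derivative f a -> second_derivative h a.
Proof.
move=> /near_join E [f' fd f'd]; exists f' => //.
by apply: filterS2 E fd => s; exact: is_derive_near.
Qed.

Lemma is_derive_shift (X s : R) : is_derive s (1 : R) (fun s : R => X + s) 1.
Proof. by rewrite -[X in is_derive _ _ _ X]add0r; apply: is_deriveD. Qed.

Lemma is_derive_sqr (X s c : R) :
  is_derive s (1 : R) (fun s : R => (X + s) * (X + s) + c) ((X + s) + (X + s)).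
Proof.
have h := is_derive_shift X s.
have := is_deriveD (is_deriveM h h) (@is_derive_cst R R R c s 1).
by rewrite addr0 /GRing.scale /= !mulr1.
Qed.

Lemma second_derivative_sqr (X c : R) :
  second_derivative (fun s => (X + s) * (X + s) + c) 2.
Proof.
exists (fun s => (X + s) + (X + s)); first by apply: near_all => s; exact: is_derive_sqr.
by have := is_deriveD (is_derive_shift X 0) (is_derive_shift X 0).
Qed.

Lemma second_derivative_ln (X c D : R) : 0 < D -> 0 <= c -> 0 < X * X + c ->
  second_derivative (fun s => ln (((X + s) * (X + s) + c) / D))
    (2 / (X * X + c) - (2 * X * (2 * X)) / ((X * X + c) * (X * X + c))).
Proof.
move=> D0 c0 Xc.
have near_pos : \forall s \near (0 : R), 0 < (X + s) * (X + s) + c.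
  apply: near_gt; last by rewrite addr0.
  apply: contD; last exact: cont_cst.
  by apply: contM; (apply: contD; [exact: cont_cst|exact: cont_id]).
pose f1 s := ((X + s) + (X + s)) / ((X + s) * (X + s) + c).
exists f1.
  apply: filterS near_pos => s s0; have D' : D != 0 by rewrite gt_eqF.
  have q0 : 0 < ((X + s) * (X + s) + c) / D by rewrite divr_gt0.
  have q_d : is_derive s (1 : R) (fun s : R => ((X + s) * (X + s) + c) / D)
      (((X + s) + (X + s)) / D).
    have := is_deriveZ D^-1 (is_derive_sqr X s c); rewrite /GRing.scale /= mulrC.
    by congr is_derive; apply/funext => y /=; rewrite /GRing.scale /= mulrC.
  have := @is_derive1_comp R (@ln R) (fun s => ((X + s) * (X + s) + c) / D) s _ _ (is_derive1_ln q0) q_d; rewrite /f1.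
  rewrite (_ : _^-1 * _ = (X + s + (X + s)) / ((X + s) * (X + s) + c)) //.
  by field; rewrite gt_eqF //= gt_eqF.
have n0 : (X + 0) * (X + 0) + c != 0 by rewrite addr0 gt_eqF.
have h1 : is_derive (0 : R) (1 : R) (fun s : R => (X + s) + (X + s)) 2.
  by have := is_deriveD (is_derive_shift X 0) (is_derive_shift X 0).
have h2 := is_deriveV (n0 : (fun s : R => (X + s) * (X + s) + c) 0 != 0) (is_derive_sqr X 0 c).
have := is_deriveM h1 h2; rewrite /GRing.scale /= !addr0.
rewrite (_ : _ + _ = 2 / (X * X + c) - 2 * X * (2 * X) / ((X * X + c) * (X * X + c))) //.
by rewrite addr0 in n0; field.
Qed.

Definition sqdist z w : R :=
  (complex.Re z - complex.Re w) * (complex.Re z - complex.Re w) +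
  (complex.Im z - complex.Im w) * (complex.Im z - complex.Im w).

Lemma sqdistE z w : sqdist z w = nrm (z - w) ^+ 2.
Proof. by rewrite nrm_sqr cReB cImB !expr2. Qed.

Lemma sqdist_gt0 z w : z != w -> 0 < sqdist z w.
Proof. by move=> zw; rewrite sqdistE exprn_gt0 // nrm_gt0 subr_eq0. Qed.

Lemma sqdist_cts z w : {for z, continuous (fun z => sqdist z w)}.
Proof.
have rc : {for z, continuous (fun z => complex.Re z - complex.Re w)}.
  by apply: contD; [apply: cts_Re; exact: idCc|exact: cont_cst].
have ic : {for z, continuous (fun z => complex.Im z - complex.Im w)}.
  by apply: contD; [apply: cts_Im; exact: idCc|exact: cont_cst].
by apply: contD; apply: contM.
Qed.

Lemma line_sqdist_x z w s : line (@jx R) (fun z => sqdist z w) z s =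
  (complex.Re z - complex.Re w + s) * (complex.Re z - complex.Re w + s) +
  (complex.Im z - complex.Im w) * (complex.Im z - complex.Im w).
Proof. by rewrite /line /sqdist /jx cReD cImD /= addr0; ring. Qed.

Lemma line_sqdist_y z w s : line (@jy R) (fun z => sqdist z w) z s =
  (complex.Im z - complex.Im w + s) * (complex.Im z - complex.Im w + s) +
  (complex.Re z - complex.Re w) * (complex.Re z - complex.Re w).
Proof. by rewrite /line /sqdist /jy cReD cImD /= addr0; ring. Qed.

Definition laplacian (A : C -> R) z (l : R) : Prop := exists a b,
  [/\ second_derivative (line (@jx R) A z) a, second_derivative (line (@jy R) A z) b &
      a + b = l].

Lemma laplacianD A B z l m : laplacian A z l -> laplacian B z m ->
  laplacian (fun z => A z + B z) z (l + m).
Proof.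
move=> [a [b [? ? <-]]] [c [d [? ? <-]]]; exists (a + c), (b + d); split.
- exact: (@second_derivativeD (line (@jx R) A z) (line (@jx R) B z)).
- exact: (@second_derivativeD (line (@jy R) A z) (line (@jy R) B z)).
- by rewrite addrACA.
Qed.

Lemma laplacianZ (k : R) A z l : laplacian A z l -> laplacian (fun z => k * A z) z (k * l).
Proof.
move=> [a [b [? ? <-]]]; exists (k * a), (k * b); split; last by rewrite mulrDr.
  exact: (@second_derivativeZ k (line (@jx R) A z)).
exact: (@second_derivativeZ k (line (@jy R) A z)).
Qed.

Lemma laplacian_sum (I : eqType) (r : seq I) (A : I -> C -> R) z :
  (forall i, i \in r -> laplacian (A i) z 0) -> laplacian (fun z => \sum_(i <- r) A i z) z 0.
Proof.
elim: r => [_|i r IH H].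
  rewrite (_ : (fun z => _) = fun=> 0); last by apply/funext => y; rewrite big_nil.
  exists 0, 0; split; last by rewrite addr0.
    by exists (cst 0); [apply: near_all => s|]; exact: is_derive_cst.
  by exists (cst 0); [apply: near_all => s|]; exact: is_derive_cst.
rewrite (_ : (fun z => _) = fun z => A i z + \sum_(k <- r) A k z).
  rewrite -[X in laplacian _ _ X]addr0; apply: laplacianD; first by apply: H; rewrite mem_head.
  by apply: IH => k kr; apply: H; rewrite inE kr orbT.
by apply/funext => y; rewrite big_cons.
Qed.

Lemma laplacian_sqdist z w : laplacian (fun z => sqdist z w) z 4.
Proof.
exists 2, 2; split; last by ring.
  by rewrite (funext (line_sqdist_x z w)); exact: second_derivative_sqr.
by rewrite (funext (line_sqdist_y z w)); exact: second_derivative_sqr.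
Qed.

Lemma laplacian_ln (D : R) z w : 0 < D -> z != w ->
  laplacian (fun z => ln (sqdist z w / D)) z 0.
Proof.
move=> D0 /sqdist_gt0; rewrite /sqdist; set X := complex.Re z - _; set Y := complex.Im z - _ => XY.
have YX : 0 < Y * Y + X * X by rewrite addrC.
have sq0 (x : R) : 0 <= x * x by rewrite -expr2 sqr_ge0.
exists (2 / (X * X + Y * Y) - (2 * X * (2 * X)) / ((X * X + Y * Y) * (X * X + Y * Y))),
  (2 / (Y * Y + X * X) - (2 * Y * (2 * Y)) / ((Y * Y + X * X) * (Y * Y + X * X))); split.
- rewrite (_ : line _ _ _ = fun s => ln (line (@jx R) (fun z => sqdist z w) z s / D)) //.
  by rewrite (funext (line_sqdist_x z w)); exact: second_derivative_ln.
- rewrite (_ : line _ _ _ = fun s => ln (line (@jy R) (fun z => sqdist z w) z s / D)) //.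
  by rewrite (funext (line_sqdist_y z w)); exact: second_derivative_ln.
- by field; rewrite !gt_eqF.
Qed.

Lemma square_compact (r : R) :
  compact [set z : C | `|complex.Re z| <= r /\ `|complex.Im z| <= r].
Proof.
have -> : [set z : C | `|complex.Re z| <= r /\ `|complex.Im z| <= r] =
    (fun x : R * R => x.1 +i* x.2) @` (`[- r, r]%classic `*` `[- r, r]%classic).
  apply/seteqP; split=> [[x y] /= [xr yr]|_ [[x y] /= [xr yr] <-]] /=.
    by exists (x, y) => //=; rewrite !in_itv /= -!ler_norml.
  by rewrite !ler_norml; move: xr yr; rewrite !in_itv /=.
apply: continuous_compact; last by apply: compact_setX; exact: segment_compact.
apply: continuous_subspaceT => x; suff : {for x, continuous (fun x : R * R => (x.1 +i* x.2 : C))} by [].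
by apply: continuous_Complex; [exact: cvg_fst|exact: cvg_snd].
Qed.

Lemma near_notin (ps : seq C) z : z \notin ps -> \forall y \near z, y \notin ps.
Proof.
elim: ps => [_|w ps IH]; first exact: near_all.
rewrite inE negb_or => /andP[zw /IH H]; rewrite -subr_eq0 in zw.
have wc : cts (fun y : C => y - w) z by apply: ctsB; [exact: idCc|exact: cts_cst].
by apply: filterS2 (cts_near_neq0 wc zw) H => y; rewrite subr_eq0 inE negb_or => -> ->.
Qed.

Lemma near_nrm z (e : R) : 0 < e -> \forall y \near z, nrm (y - z) < e.
Proof. by move=> e0; apply/nbhsC_nrm; exists e. Qed.

Section Barrier.
Context (A : C -> R) (ps : seq C).
Hypothesis Ac : forall z, z \notin ps -> {for z, continuous A}.
Hypothesis Aharm : forall z, z \notin ps -> laplacian A z 0.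
Hypothesis Abnd : forall w, w \in ps -> exists M, \forall z \near w, z \notin ps -> A z <= M.
Hypothesis Adecay : forall c, 0 < c -> exists r, forall z, r <= nrm z -> z \notin ps -> A z <= c.

(* A small multiple of the logarithm of the distances to the points of [ps] absorbs the behaviour
   of [A] there. *)
Lemma maximum_principle z : z \notin ps -> A z <= 0.
Proof.
move=> z_ps; rewrite leNgt; apply/negP; set c := A z => c0.
have [r0 r0P] : exists r, forall z, r <= nrm z -> z \notin ps -> A z <= c / 2.
  by apply: Adecay; rewrite divr_gt0.
(* Beyond this radius [A] is at most [c / 2]; the disc contains [z] and all the exceptional
   points. *)
pose r := `|r0| + nrm z + \sum_(w <- ps) nrm w + 1.
have sum0 : 0 <= \sum_(w <- ps) nrm w by apply: sumr_ge0 => w _; exact: nrm_ge0.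
have r_gt0 : 0 < r by rewrite ltr_wpDl // !addr_ge0 ?nrm_ge0.
have zr : nrm z < r by rewrite /r; have := normr_ge0 r0; lra.
have r0r : r0 <= r by rewrite /r; have := ler_norm r0; have := nrm_ge0 z; lra.
have psr w : w \in ps -> nrm w <= r.
  move=> wps; have : nrm w <= \sum_(w <- ps) nrm w.
    by rewrite (big_rem w) //= lerDl sumr_ge0 // => *; exact: nrm_ge0.
  by rewrite /r; have := normr_ge0 r0; have := nrm_ge0 z; lra.
(* For [nrm y <= 2 * r] the distance from [y] to a point of [ps] is at most [3 * r], so all the
   logarithms are nonpositive. *)
pose D := 9 * r ^+ 2; have D0 : 0 < D by rewrite mulr_gt0 // exprn_gt0.
have ln_le0 y w : nrm y <= 2 * r -> w \in ps -> ln (sqdist y w / D) <= 0.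
  move=> yr wps; apply: ln_le0; rewrite ler_pdivrMr // mul1r sqdistE /D.
  have -> : 9 * r ^+ 2 = (3 * r) ^+ 2 by ring.
  rewrite ler_pXn2r ?nnegrE ?nrm_ge0 ?mulr_ge0 ?(ltW r_gt0) //.
  by have := nrmD y (- w); rewrite nrmN; have := psr w wps; lra.
pose L y := \sum_(w <- ps) ln (sqdist y w / D).
have L_le0 y : nrm y <= 2 * r -> L y <= 0.
  by move=> yr; rewrite /L big_seq; apply: sumr_le0 => w; exact: ln_le0.
(* The logarithms cost at most [c / 8] at [z], and the quadratic term adds at most [c / 8] as long
   as [nrm y <= 2 * r]. So [u z] is at least [c * (7 / 8)], while [u] is at most [c / 2 + c / 8 = m]
   between the radii [r] and [2 * r]. The quadratic term makes [u] strictly subharmonic. *)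
pose eps := c / 8 / (1 + `|L z|); pose k := c / 8 / (4 * r ^+ 2).
have eps0 : 0 < eps by rewrite !divr_gt0 // ltr_wpDr.
have k0 : 0 < k by rewrite !divr_gt0 // mulr_gt0 // exprn_gt0.
pose u y := A y + eps * L y + k * sqdist y 0; pose m := c * (5 / 8).
have k_le y : nrm y <= 2 * r -> k * sqdist y 0 <= c / 8.
  move=> yr; rewrite sqdistE subr0 /k mulrAC ler_pdivrMr ?mulr_gt0 ?exprn_gt0 //.
  rewrite ler_wpM2l ?divr_ge0 ?(ltW c0) // (_ : 4 * r ^+ 2 = (2 * r) ^+ 2); last by ring.
  by rewrite ler_pXn2r ?nnegrE ?nrm_ge0 ?mulr_ge0 ?(ltW r_gt0).
have uz : m < u z.
  have : - (c / 8) <= eps * L z.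
    rewrite lerNl -mulrN /eps mulrAC ler_pdivrMr ?ltr_wpDr //.
    rewrite ler_wpM2l ?divr_ge0 ?(ltW c0) //; have := ler_norm (- L z); rewrite normrN; lra.
  have : 0 <= k * sqdist z 0 by rewrite mulr_ge0 ?(ltW k0) // sqdistE sqr_ge0.
  by rewrite /u /m -/c; lra.
have uc y : y \notin ps -> {for y, continuous u}.
  move=> y_ps; apply: contD; last by apply: contM; [exact: cont_cst|exact: sqdist_cts].
  apply: contD; first exact: Ac.
  apply: contM; first exact: cont_cst.
  have : forall w, w \in ps -> {for y, continuous (fun y => ln (sqdist y w / D))}.
    move=> w wps; have yw : y != w by apply: contraNneq y_ps => ->.
    apply: (@continuous_comp _ _ _ (fun y => sqdist y w / D) (@ln R)).
      by apply: contM; [exact: sqdist_cts|exact: cont_cst].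
    by apply: continuous_ln; rewrite divr_gt0 // sqdist_gt0.
  exact: cont_sum.
(* Near [ps] the logarithms push [u] below [m]. So [U] is continuous everywhere and attains a
   maximum on the compact square, which exceeds [m] because of [z]. *)
pose U y := if y \in ps then m else Num.max m (u y).
have near_ps w : w \in ps -> \forall y \near w, U y = m.
  move=> wps; have [M HM] := Abnd wps; pose K := (m - M - c / 8) / eps.
  pose e := Num.min r (Num.sqrt (D * expR K)).
  have DK : 0 < D * expR K by rewrite mulr_gt0 // expR_gt0.
  have e0 : 0 < e by rewrite lt_min r_gt0 sqrtr_gt0.
  apply: filterS2 HM (near_nrm w e0) => y yM ye; rewrite /U; case: ifPn => // y_ps.
  apply/max_idPl; have {}yM := yM y_ps.
  have yr : nrm y <= 2 * r.
    have := nrmD (y - w) w; rewrite subrK; have := psr w wps.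
    by move: ye; rewrite lt_min => /andP[? _]; lra.
  have yw : y != w by apply: contraNneq y_ps => ->.
  have LK : L y <= K.
    rewrite /L (big_rem w) //=; apply: (@le_trans _ _ (ln (sqdist y w / D) + 0)).
      rewrite lerD2l big_seq; apply: sumr_le0 => v vs; apply: ln_le0 => //.
      exact: mem_rem vs.
    rewrite addr0 -(expRK K) ler_ln ?posrE ?divr_gt0 ?sqdist_gt0 ?expR_gt0 //.
    rewrite ler_pdivrMr // mulrC sqdistE -[leRHS]sqr_sqrtr ?(ltW DK) //.
    rewrite ler_pXn2r ?nnegrE ?nrm_ge0 ?sqrtr_ge0 //.
    by move: ye; rewrite lt_min => /andP[_ /ltW].
  have : eps * L y <= m - M - c / 8.
    by rewrite mulrC -ler_pdivlMr.
  by have := k_le y yr; rewrite /u; lra.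
have Uc y : {for y, continuous U}.
  have [y_ps|y_ps] := boolP (y \in ps).
    have E := near_ps y y_ps; apply/continuousRP => e e0.
    by apply: filterS E => x ->; rewrite (nbhs_singleton (near_ps y y_ps)) subrr normr0.
  have E := near_notin y_ps; apply/continuousRP => e e0.
  have mc : {for y, continuous (fun y => Num.max m (u y))}.
    by apply: (@continuous_max _ _ (cst m) u); [exact: cont_cst|exact: uc].
  move/continuousRP : mc => /(_ e e0); apply: filterS2 E => x x_ps.
  by rewrite /U (negPf x_ps) (negPf y_ps).
pose S := [set z : C | `|complex.Re z| <= r /\ `|complex.Im z| <= r].
have Sz : S z.
  by split; [apply: le_trans (Re_le_nrm z) _|apply: le_trans (Im_le_nrm z) _]; exact: ltW.
have [y] := @compact_EVT_max _ R U S (ex_intro _ z Sz) (square_compact (r := r))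
  (continuous_subspaceT Uc).
rewrite inE => -[Sy1 Sy2] ymax; have Uzy : U z <= U y by apply: ymax; rewrite inE.
have Uz : U z = u z by rewrite /U (negPf z_ps); apply/max_idPr/ltW.
have mUy : m < U y by apply: lt_le_trans Uzy; rewrite Uz.
have y_ps : y \notin ps.
  by apply: contraTN mUy => y_ps; rewrite /U y_ps ltxx.
have Uy : U y = u y.
  move: mUy; rewrite /U (negPf y_ps) lt_max ltxx /= => /ltW ?.
  exact/max_idPr.
have y2r : nrm y <= 2 * r by apply: le_trans (nrm_le_ReIm y) _; lra.
have yr : nrm y < r.
  rewrite ltNge; apply/negP => ry; have := r0P y (le_trans r0r ry) y_ps.
  move: mUy; rewrite Uy /u; have := k_le y y2r.
  have : eps * L y <= 0 by rewrite pmulr_rle0 // L_le0.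
  by rewrite /m; lra.
have loc_max : \forall x \near y, u x <= u y.
  have e0 : 0 < r - nrm y by rewrite subr_gt0.
  apply: filterS2 (near_notin y_ps) (near_nrm y e0) => x x_ps xy.
  have xr : nrm x <= r by have := nrmD (x - y) y; rewrite subrK; lra.
  have : U x <= U y.
    by apply: ymax; rewrite inE; split; [apply: le_trans (Re_le_nrm x) _|apply: le_trans (Im_le_nrm x) _].
  by rewrite Uy /U (negPf x_ps) ge_max => /andP[].
have [a [b [ha hb ab]]] : laplacian u y (0 + eps * 0 + k * 4).
  apply: laplacianD; last by apply: laplacianZ; exact: laplacian_sqdist.
  apply: laplacianD; first exact: Aharm.
  apply: laplacianZ; apply: laplacian_sum => w wps; apply: laplacian_ln => //.
  by apply: contraNneq y_ps => ->.
have near_line (j : R -> C) : jdir j -> \forall s \near (0 : R), line j u y s <= line j u y 0.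
  move=> [_ _ j0 jc]; rewrite /line j0 addr0.
  have tc : {for (0 : R), continuous (fun s => y + j s)}.
    by apply/ctsP; apply: ctsD; [exact: cts_cst|apply/ctsP; exact: jc].
  have H : \forall x \near y + j 0, u x <= u y by rewrite j0 addr0.
  exact: (tc _ H).
(* At the maximum both second derivatives are nonpositive, but their sum is [k * 4 > 0]. *)
have a0 := second_derivative_le0 ha (near_line _ (@jxP R)).
have b0 := second_derivative_le0 hb (near_line _ (@jyP R)).
by move: ab; lra.
Qed.

End Barrier.

End MaximumPrinciple.

(** * Forms and the hyperelliptic involution *)

Section SmoothFunctions.
Context (R : realType).
Local Notation C := (R[i]^o).
Implicit Types (F G : C -> R) (V : set C) (c : R).

Lemma line_near (j : R -> C) V F G t : jdir j -> open V -> V t ->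
  (forall s, V s -> F s = G s) -> \forall s \near (0 : R), line j F t s = line j G t s.
Proof.
move=> jP oV Vt E; apply: partial_near => //.
by apply: filterS (open_nbhs_nbhs (conj oV Vt)) => s; exact: E.
Qed.

Lemma derivable_line (j : R -> C) F t : derivable (line j F t) 0 1 <->
  is_derive (0 : R) (1 : R) (line j F t) (partial j F t).
Proof.
split=> [d|[]//]; rewrite /partial derive1E; exact: DeriveDef.
Qed.

Lemma partial_ext (j : R -> C) V F G t : jdir j -> open V -> V t ->
  (forall s, V s -> F s = G s) -> derivable (line j F t) 0 1 ->
  derivable (line j G t) 0 1 /\ partial j G t = partial j F t.
Proof.
move=> jP oV Vt E /derivable_line d.
have dG := is_derive_near (line_near jP oV Vt E) d; split; first by case: dG.
by rewrite {1}/partial derive1E; case: dG.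
Qed.

Lemma partial_lin (j : R -> C) F G c t : derivable (line j F t) 0 1 ->
  derivable (line j G t) 0 1 ->
  derivable (line j (fun s => F s + c * G s) t) 0 1 /\
  partial j (fun s => F s + c * G s) t = partial j F t + c * partial j G t.
Proof.
move=> /derivable_line dF /derivable_line dG.
have d := is_deriveD dF (is_deriveZ c dG); split; first by case: d.
by rewrite {1}/partial derive1E; case: d.
Qed.

Lemma Ck_ext k V F G : open V -> (forall s, V s -> F s = G s) -> Ck k V F -> Ck k V G.
Proof.
move=> oV; elim: k F G => [|k IH] F G E /=.
  move=> Fc t Vt; have /continuousRP Ft := Fc t Vt; apply/continuousRP => e /Ft.
  by apply: filterS2 (open_nbhs_nbhs (conj oV Vt)) => s Vs; rewrite -(E s Vs) -(E t Vt).
move=> [d cx cy]; split.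
- move=> t Vt; have [dx dy] := d t Vt.
  by split; [case: (partial_ext (@jxP R) oV Vt E dx)|case: (partial_ext (@jyP R) oV Vt E dy)].
- apply: IH cx => t Vt; have [dx _] := d t Vt.
  by have [_ e] := partial_ext (@jxP R) oV Vt E dx; rewrite -[RHS]/(partial (@jx R) G t) e.
- apply: IH cy => t Vt; have [_ dy] := d t Vt.
  by have [_ e] := partial_ext (@jyP R) oV Vt E dy; rewrite -[RHS]/(partial (@jy R) G t) e.
Qed.

Lemma Ck_lin k V F G c : open V -> Ck k V F -> Ck k V G -> Ck k V (fun s => F s + c * G s).
Proof.
move=> oV; elim: k F G => [|k IH] F G /=.
  by move=> Fc Gc t Vt; apply: contD; [exact: Fc|apply: contM; [exact: cont_cst|exact: Gc]].
move=> [dF Fx Fy] [dG Gx Gy]; split.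
- move=> t Vt; have [fx fy] := dF t Vt; have [gx gy] := dG t Vt.
  by split; [exact: (partial_lin (j := @jx R) c fx gx).1|exact: (partial_lin (j := @jy R) c fy gy).1].
- apply: (Ck_ext oV _ (IH _ _ Fx Gx)) => t Vt; have [fx _] := dF t Vt; have [gx _] := dG t Vt.
  exact: esym (partial_lin (j := @jx R) c fx gx).2.
- apply: (Ck_ext oV _ (IH _ _ Fy Gy)) => t Vt; have [_ fy] := dF t Vt; have [_ gy] := dG t Vt.
  exact: esym (partial_lin (j := @jy R) c fy gy).2.
Qed.

Lemma smooth_lin V F G c : open V -> smooth_on V F -> smooth_on V G ->
  smooth_on V (fun s => F s + c * G s).
Proof. by move=> oV sF sG k; exact: Ck_lin. Qed.

Lemma smooth_cont V F t : smooth_on V F -> V t -> {for t, continuous F}.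
Proof. by move=> /(_ 0%N); apply. Qed.

Lemma smooth_derivable V F t : smooth_on V F -> V t ->
  derivable (line (@jx R) F t) 0 1 /\ derivable (line (@jy R) F t) 0 1.
Proof. by move=> /(_ 1%N)[d _ _] /d. Qed.

Lemma smooth_partial V F : smooth_on V F ->
  smooth_on V (partial (@jx R) F) /\ smooth_on V (partial (@jy R) F).
Proof. by move=> sF; split=> k; have [] := sF k.+1. Qed.

Lemma smooth_schwarz V F t : open V -> smooth_on V F -> V t ->
  partial (@jy R) (partial (@jx R) F) t = partial (@jx R) (partial (@jy R) F) t.
Proof.
move=> oV sF Vt; have nV := open_nbhs_nbhs (conj oV Vt).
have [sx sy] := smooth_partial sF; have [_ sxy] := smooth_partial sx.
have [syx _] := smooth_partial sy.
apply: schwarz; [exact: jxP|exact: jyP| | | | |].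
- by apply: filterS nV => y Vy; exact: smooth_derivable sF Vy.
- by apply: filterS nV => y Vy; case: (smooth_derivable sx Vy).
- by apply: filterS nV => y Vy; case: (smooth_derivable sy Vy).
- exact: smooth_cont sxy Vt.
- exact: smooth_cont syx Vt.
Qed.

Lemma near_line (j : R -> C) V t : jdir j -> open V -> V t ->
  \forall s \near (0 : R), V (t + j s).
Proof.
move=> [_ _ j0 jc] oV Vt.
have tc : {for (0 : R), continuous (fun s => t + j s)}.
  by apply/ctsP; apply: ctsD; [exact: cts_cst|apply/ctsP; exact: jc].
have H : nbhs (t + j 0) V by rewrite j0 addr0; exact: open_nbhs_nbhs.
exact: (tc _ H).
Qed.

Lemma smooth_second_derivative (j : R -> C) V F t : jdir j -> open V -> V t ->
  (forall s, V s -> derivable (line j F s) 0 1) ->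
  (forall s, V s -> derivable (line j (partial j F) s) 0 1) ->
  second_derivative (line j F t) (partial j (partial j F) t).
Proof.
move=> jP oV Vt d1 d2; exists (fun s => partial j F (t + j s)).
  by apply: filterS (near_line jP oV Vt) => s Vs; apply: line_derive => //; exact: d1.
by apply/derivable_line; exact: d2.
Qed.

Lemma smooth_laplacian V F t l : open V -> V t -> smooth_on V F ->
  partial (@jx R) (partial (@jx R) F) t + partial (@jy R) (partial (@jy R) F) t = l ->
  laplacian F t l.
Proof.
move=> oV Vt sF E; have [sx sy] := smooth_partial sF.
exists (partial (@jx R) (partial (@jx R) F) t), (partial (@jy R) (partial (@jy R) F) t).
split=> //.
  apply: (smooth_second_derivative (@jxP R) oV Vt) => s Vs.
    by case: (smooth_derivable sF Vs).
  by case: (smooth_derivable sx Vs).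
apply: (smooth_second_derivative (@jyP R) oV Vt) => s Vs.
  by case: (smooth_derivable sF Vs).
by case: (smooth_derivable sy Vs).
Qed.

Lemma line_lipschitz (j : R -> C) F t (h K : R) : jdir j -> 0 <= K ->
  (forall s, nrm (s - t) <= `|h| -> derivable (line j F s) 0 1 /\ `|partial j F s| <= K) ->
  `|F (t + j h) - F t| <= K * `|h|.
Proof.
move=> jP K0 H; have [jD jn j0 _] := jP.
case: (ltgtP h 0) => h0; last by rewrite h0 j0 addr0 subrr normr0 mulr0.
  have t'E : t + j h + j (- h) = t by rewrite -addrA -jD subrr j0 addr0.
  have n' s : 0 <= s <= - h -> nrm (t + j h + j s - t) <= `|h|.
    move=> /andP[s0 sh]; have -> : t + j h + j s - t = j (h + s) by rewrite jD; ring.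
    rewrite jn (ltr0_norm h0) ler_norml.
    by apply/andP; split; lra.
  have hN : 0 < - h by rewrite oppr_gt0.
  have [c /andP[c0 ch]] := @line_mvt _ j jP F (t + j h) (- h) hN (fun s sh => (H _ (n' s sh)).1).
  rewrite t'E => E; rewrite distrC E normrM normrN mulrC ler_wpM2r //.
  by apply: (H _ (n' _ _)).2; rewrite !ltW.
have n' s : 0 <= s <= h -> nrm (t + j s - t) <= `|h|.
  by move=> /andP[s0 sh]; rewrite addrAC subrr add0r jn !ger0_norm // ltW.
have [c /andP[c0 ch] E] := @line_mvt _ j jP F t h h0 (fun s sh => (H _ (n' s sh)).1).
rewrite E normrM mulrC ler_wpM2r //.
by apply: (H _ (n' _ _)).2; rewrite !ltW.
Qed.

Lemma cont_bounded (f : C -> R) t : {for t, continuous f} ->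
  exists2 M, 0 <= M & \forall s \near t, `|f s| <= M.
Proof.
move=> /continuousRP /(_ 1 ltr01) H; exists (`|f t| + 1); first by rewrite addr_ge0.
apply: filterS H => s fs; rewrite -(subrK (f t) (f s)) addrC.
by apply: le_trans (ler_normD _ _) _; rewrite lerD2l ltW.
Qed.

(** Used at the center of a branch chart, where an invariant form vanishes: the linear bound there
    absorbs the pole of the change of parameter. *)
Lemma smooth_lipschitz V F t : open V -> V t -> smooth_on V F ->
  exists2 K, 0 <= K & \forall s \near t, `|F s - F t| <= K * nrm (s - t).
Proof.
move=> oV Vt sF; have [sx sy] := smooth_partial sF.
have [Kx Kx0 Hx] := cont_bounded (smooth_cont sx Vt).
have [Ky Ky0 Hy] := cont_bounded (smooth_cont sy Vt).
have /nbhsC_nrm[e e0 He] : \forall s \near t, [/\ V s, `|partial (@jx R) F s| <= Kx &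
    `|partial (@jy R) F s| <= Ky].
  by apply: filterS3 (open_nbhs_nbhs (conj oV Vt)) Hx Hy => s; split.
exists (Kx + Ky); first exact: addr_ge0.
have e2 : 0 < e / 2 by rewrite divr_gt0.
apply: filterS (near_nrm t e2) => s st.
set x := complex.Re (s - t); set y := complex.Im (s - t).
have xle := Re_le_nrm (s - t); have yle := Im_le_nrm (s - t); rewrite -/x -/y in xle yle.
have sE : t + jx x + jy y = s.
  rewrite -[RHS](subrK t) [RHS]addrC -addrA; congr (_ + _).
  by apply/eqP; rewrite eq_complex /jx /jy /= addr0 add0r !eqxx.
have h1 : `|F (t + jx x) - F t| <= Kx * `|x|.
  apply: (line_lipschitz (@jxP R)) => // r rt.
  have [|Vr Hr _] := He r; first by lra.
  by split=> //; case: (smooth_derivable sF Vr).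
have h2 : `|F (t + jx x + jy y) - F (t + jx x)| <= Ky * `|y|.
  apply: (line_lipschitz (@jyP R)) => // r rt.
  have [|Vr _ Hr] := He r.
    have -> : r - t = (r - (t + jx x)) + jx x by rewrite opprD addrA subrK.
    have [_ jn _ _] := @jxP R; have := nrmD (r - (t + jx x)) (jx x); rewrite jn.
    by lra.
  by split=> //; case: (smooth_derivable sF Vr).
rewrite -sE -(subrK (F (t + jx x)) (F _)) -addrA.
apply: le_trans (ler_normD _ _) _; rewrite [X in _ <= _ * nrm (X - _)]sE.
by have := ler_wpM2l Kx0 xle; have := ler_wpM2l Ky0 yle; rewrite mulrDl; lra.
Qed.

End SmoothFunctions.

(** * Operations on forms and the Cauchy-Riemann equations *)

Section FormAlgebra.
Context (R : realType) (g : nat) (p : 'I_(2 * g + 2) -> R[i]^o).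
Local Notation C := (R[i]^o).
Local Notation T := (curve p).
Local Notation form := (form1 R T).
Local Notation is_form := (is_form1 (@curve_atlas R g p)).
Implicit Types (w a b : form) (psi phi : chart R T) (t l : C).

Lemma atlas_open psi : curve_atlas psi -> open (chart_dom psi).
Proof. by case. Qed.

Lemma form_lin w psi t l : is_form w -> curve_atlas psi -> chart_dom psi t ->
  w psi t l = complex.Re l * w psi t 1 + complex.Im l * w psi t 'i.
Proof.
move=> [wl _ _] ap Dt.
have w0 : w psi t 0 = 0.
  have := wl psi t 1 0 0 ap Dt; rewrite mulr0 addr0 mul1r => /eqP.
  by rewrite -subr_eq0 opprD addrA subrr sub0r oppr_eq0 => /eqP.
have lE : l = (complex.Re l)%:C * 1 + ((complex.Im l)%:C * 'i + 0).
  apply/eqP; rewrite eq_complex; case: l => x y /=.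
  by rewrite !(mul0r, mulr0, mulr1, addr0, add0r, subr0) !eqxx.
by rewrite {1}lE !wl // w0 addr0.
Qed.

Lemma form_opp w psi t l : is_form w -> curve_atlas psi -> chart_dom psi t ->
  w psi t (- l) = - w psi t l.
Proof.
by move=> wf ap Dt; rewrite (form_lin (- l) wf ap Dt) (form_lin l wf ap Dt) !raddfN /= !mulNr -opprD.
Qed.

Lemma form_bound w psi t l : is_form w -> curve_atlas psi -> chart_dom psi t ->
  `|w psi t l| <= nrm l * (`|w psi t 1| + `|w psi t 'i|).
Proof.
move=> wf ap Dt; rewrite (form_lin l wf ap Dt) mulrDr.
apply: le_trans (ler_normD _ _) _; rewrite !normrM; apply: lerD; apply: ler_wpM2r => //.
  exact: Re_le_nrm.
exact: Im_le_nrm.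
Qed.

Definition flin (c : R) a b : form := fun psi t l => a psi t l + c * b psi t l.

Definition fpull w : form := fun psi t l => w (invol_chart psi) t l.

Lemma flin_form c a b : is_form a -> is_form b -> is_form (flin c a b).
Proof.
move=> [al ai asm] [bl bi bsm]; split.
- by move=> psi t r l m ap Dt; rewrite /flin al // bl //; ring.
- move=> psi phi t tau d ap aph Dt Dtau E dt l.
  by rewrite /flin (ai psi phi t tau d) // (bi psi phi t tau d).
- move=> psi ap; have [a1 a2] := asm psi ap; have [b1 b2] := bsm psi ap.
  by split; apply: smooth_lin => //; exact: atlas_open.
Qed.

Lemma fpull_form w : is_form w -> is_form (fpull w).
Proof.
move=> [wl wi wsm]; split.
- by move=> psi t r l m ap Dt; exact: (wl _ t r l m (invol_chart_atlas ap) Dt).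
- move=> psi phi t tau d ap aph Dt Dtau E dt l.
  have E' : \forall s \near t, invol_chart phi (tau s) = invol_chart psi s.
    by apply: filterS E => s /= ->.
  exact: (wi _ _ t tau d (invol_chart_atlas ap) (invol_chart_atlas aph) Dt Dtau E' dt).
- by move=> psi ap; have [] := wsm _ (invol_chart_atlas ap).
Qed.

Lemma smooth_opp V (F : C -> R) : open V -> smooth_on V F -> smooth_on V (fun s => - F s).
Proof.
(* Negation is written [F + (-2) * F], the shape to which linearity applies. *)
move=> oV sF k; apply: (Ck_ext oV _ (Ck_lin (-2) oV (sF k) (sF k))) => s _.
by rewrite mulNr mulr_natl mulr2n opprD addrA subrr add0r.
Qed.

Lemma hodge_form w : is_form w -> is_form (hodge w).
Proof.
move=> wf; have [wl wi wsm] := wf; split.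
- move=> psi t r l m ap Dt; rewrite /hodge mulrDr.
  have -> : 'i * (r%:C * l) = r%:C * ('i * l) :> C by rewrite mulrCA.
  by rewrite wl // opprD mulrN.
- move=> psi phi t tau d ap aph Dt Dtau E dt l; rewrite /hodge.
  have -> : 'i * (d * l) = d * ('i * l) :> C by rewrite mulrCA.
  by rewrite (wi psi phi t tau d ap aph Dt Dtau E dt).
- move=> psi ap; have [w1 wi'] := wsm psi ap; have oD := atlas_open ap; split.
    have -> : (fun t => hodge w psi t 1) = (fun t => - w psi t 'i).
      by apply/funext => t; rewrite /hodge mulr1.
    exact: smooth_opp.
  move=> k; apply: (Ck_ext oD _ (w1 k)) => t Dt.
  by rewrite /hodge -expr2 sqr_i form_opp // opprK.
Qed.

Lemma form_smooth w psi : is_form w -> curve_atlas psi ->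
  smooth_on (chart_dom psi) (fun t => w psi t 1) /\
  smooth_on (chart_dom psi) (fun t => w psi t 'i).
Proof. by case=> _ _; apply. Qed.

Lemma ext_d_lin c a b psi t : is_form a -> is_form b -> curve_atlas psi ->
  chart_dom psi t -> ext_d (flin c a b) psi t = ext_d a psi t + c * ext_d b psi t.
Proof.
move=> fa fb ap Dt; have [a1 ai] := form_smooth fa ap; have [b1 bi] := form_smooth fb ap.
have [d1 _] := smooth_derivable ai Dt; have [e1 _] := smooth_derivable bi Dt.
have [_ d2] := smooth_derivable a1 Dt; have [_ e2] := smooth_derivable b1 Dt.
have [_ E1] := partial_lin c d1 e1; have [_ E2] := partial_lin c d2 e2.
rewrite /ext_d -[partial_x _ _]/(partial (@jx R) (fun s => a psi s 'i + c * b psi s 'i) t) E1.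
rewrite -[X in _ - X]/(partial (@jy R) (fun s => a psi s 1 + c * b psi s 1) t) E2.
rewrite /partial_x /partial_y /partial /line_x /line_y /line /jx /jy; ring.
Qed.

(** Closedness of the form and of its Hodge dual are the Cauchy-Riemann equations for the pair
    [w psi t 1], [- w psi t 'i]. *)
Lemma harmonic_CR w psi t : Defs.harmonic (@curve_atlas R g p) w -> curve_atlas psi ->
  chart_dom psi t ->
  partial (@jx R) (fun s => w psi s 'i) t = partial (@jy R) (fun s => w psi s 1) t /\
  partial (@jx R) (fun s => w psi s 1) t = - partial (@jy R) (fun s => w psi s 'i) t.
Proof.
move=> [[wf wc] hc] ap Dt; have [w1 wi] := form_smooth wf ap; have oD := atlas_open ap.
have [d1x d1y] := smooth_derivable w1 Dt; have [dix diy] := smooth_derivable wi Dt.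
split.
  by have := wc psi t ap Dt; rewrite /ext_d => /eqP; rewrite subr_eq0 => /eqP.
have := hc psi t ap Dt; rewrite /ext_d /hodge.
have ii : 'i * 'i = - 1 :> C by rewrite -expr2; exact: sqr_i.
have Ex s : chart_dom psi s -> w psi s 1 = - w psi s ('i * 'i).
  by move=> Ds; rewrite ii form_opp // opprK.
have [_ E1] := partial_ext (@jxP R) oD Dt Ex d1x.
have dN := partial_lin (-1) d1x d1x.
have Ey s : chart_dom psi s -> w psi s 'i + (-2) * w psi s 'i = - w psi s ('i * 1).
  by move=> Ds; rewrite mulr1; ring.
have [dl E2] := partial_lin (-2) diy diy.
have [_ E3] := partial_ext (@jyP R) oD Dt Ey dl.
rewrite -[partial_x _ _]/(partial (@jx R) (fun s => - w psi s ('i * 'i)) t) E1.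
rewrite -[partial_y _ _]/(partial (@jy R) (fun s => - w psi s ('i * 1)) t) E3 E2.
by move=> /eqP; rewrite subr_eq0 => /eqP ->; ring.
Qed.

(** The Cauchy-Riemann equations are differentiated once more, and the mixed derivatives cancel by
    [smooth_schwarz]. *)
Lemma harmonic_laplacian w psi t : Defs.harmonic (@curve_atlas R g p) w -> curve_atlas psi ->
  chart_dom psi t ->
  laplacian (fun s => w psi s 1) t 0 /\ laplacian (fun s => w psi s 'i) t 0.
Proof.
move=> hw ap Dt; have [[wf _] _] := hw; have [w1 wi] := form_smooth wf ap.
have oD := atlas_open ap.
have [x1 y1] := smooth_partial w1; have [xi yi] := smooth_partial wi.
have CR s (Ds : chart_dom psi s) := harmonic_CR hw ap Ds.
have neg (F : C -> R) (j : R -> C) : derivable (line j F t) 0 1 ->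
    derivable (line j (fun s => F s + (-2) * F s) t) 0 1 /\
    partial j (fun s => F s + (-2) * F s) t = - partial j F t.
  move=> d; have [d' E] := partial_lin (-2) d d; split=> //.
  by rewrite E; ring.
have [dx1 dy1] := smooth_derivable x1 Dt; have [dx1' dy1'] := smooth_derivable y1 Dt.
have [dxi dyi] := smooth_derivable xi Dt; have [dxi' dyi'] := smooth_derivable yi Dt.
have N1 s (Ds : chart_dom psi s) : partial (@jy R) (fun s => w psi s 'i) s +
    (-2) * partial (@jy R) (fun s => w psi s 'i) s = partial (@jx R) (fun s => w psi s 1) s.
  by rewrite (CR s Ds).2; ring.
have N2 s (Ds : chart_dom psi s) : partial (@jx R) (fun s => w psi s 'i) s =
    partial (@jy R) (fun s => w psi s 1) s by exact: (CR s Ds).1.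
have N3 s (Ds : chart_dom psi s) : partial (@jx R) (fun s => w psi s 1) s +
    (-2) * partial (@jx R) (fun s => w psi s 1) s = partial (@jy R) (fun s => w psi s 'i) s.
  by rewrite (CR s Ds).2; ring.
split; apply: (smooth_laplacian oD Dt) => //.
  have [d1 e1] := neg _ _ dxi'; have [_ ->] := partial_ext (@jxP R) oD Dt N1 d1.
  have [_ ->] := partial_ext (@jyP R) oD Dt N2 dyi.
  by rewrite e1 (smooth_schwarz oD wi Dt) addNr.
have [d1 e1] := neg _ _ dy1; have [_ ->] := partial_ext (@jyP R) oD Dt N3 d1.
have N2' s (Ds : chart_dom psi s) : partial (@jy R) (fun s => w psi s 1) s =
    partial (@jx R) (fun s => w psi s 'i) s by rewrite N2.
have [_ ->] := partial_ext (@jxP R) oD Dt N2' dx1'.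
by rewrite e1 (smooth_schwarz oD w1 Dt) subrr.
Qed.

Lemma fpull_harmonic w : Defs.harmonic (@curve_atlas R g p) w ->
  Defs.harmonic (@curve_atlas R g p) (fpull w).
Proof.
move=> [[wf wc] hc]; split; first split; first exact: fpull_form.
  by move=> psi t ap Dt; exact: (wc _ t (invol_chart_atlas ap) Dt).
by move=> psi t ap Dt; exact: (hc _ t (invol_chart_atlas ap) Dt).
Qed.

Lemma harmonic_lin c a b : Defs.harmonic (@curve_atlas R g p) a ->
  Defs.harmonic (@curve_atlas R g p) b -> Defs.harmonic (@curve_atlas R g p) (flin c a b).
Proof.
move=> [[fa ca] ha] [[fb cb] hb]; split; first split; first exact: flin_form.
  by move=> phi s aph Ds; rewrite ext_d_lin // ca // cb // mulr0 addr0.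
move=> phi s aph Ds.
have -> : hodge (flin c a b) = flin c (hodge a) (hodge b).
  apply/funext => psi; apply/funext => t; apply/funext => l.
  by rewrite /hodge /flin opprD mulrN.
by rewrite ext_d_lin //; [rewrite ha // hb // mulr0 addr0|exact: hodge_form|exact: hodge_form].
Qed.

Lemma invol_chartK psi : invol_chart (invol_chart psi) = psi.
Proof.
by case: psi => D f; congr Chart; apply/funext => x; rewrite /= involK.
Qed.

End FormAlgebra.

(** * Invariant harmonic forms in the coordinate z *)

Section FormTransitions.
Context (R : realType) (g : nat) (p : 'I_(2 * g + 2) -> R[i]^o).
Local Notation C := (R[i]^o).
Local Notation T := (curve p).
Local Notation n := (2 * g + 2)%N.
Local Notation form := (form1 R T).
Local Notation is_form := (is_form1 (@curve_atlas R g p)).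
Context (q : nat -> C) (rot : C).
Hypothesis rot0 : rot != 0.
Hypothesis q_sorted : forall i j, (i < j)%N -> (j < n)%N ->
  ell rot (q i) < ell rot (q j).
Hypothesis branch_polyE : forall z, branch_poly p z = \prod_(k <- iota 0 n) (z - q k).
Local Notation strip := (strip g q rot).
Local Notation tchart i := (t_chart p q rot i).
Implicit Types (w : form) (psi phi : chart R T) (t l z : C) (P : T).

(** A good target has a differentiable inverse, which supplies the derivative needed for invariance
    under changes of charts. The factor [d] is the same for all forms. *)
Lemma form_transition psi phi inv t : curve_atlas psi -> chart_dom psi t ->
  good_chart phi inv -> chart_dom phi (inv (psi t)) -> phi (inv (psi t)) = psi t ->
  exists2 d, has_d id (fun s : C => inv (psi s)) t d &
    forall w, is_form w -> forall l, w psi t l = w phi (inv (psi t)) (d * l).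
Proof.
move=> ap Dt gc Di E; have [b sb] := atlas_smooth ap Dt.
have [d dd] := gc_smooth gc Di (@idCc R) (@inj_id C) (esym E) sb.
exists d => // w [_ wi _] l.
have near_eq : \forall s \near t, phi (inv (psi s)) = psi s.
  have H := gc_near gc Di; rewrite E in H.
  have {}H : \forall Q \near psi t, phi (inv Q) = Q by apply: filterS H => Q [].
  exact: (atlas_continuous ap Dt H).
by apply: (wi psi phi t _ d ap (gc_atlas gc) Dt Di near_eq); apply/has_d_is_derive.
Qed.

Definition zlike psi z : Prop := piece false (psi z) /\
  \forall s \near z, (crd false (psi s)).1 = s.

Lemma zlike_crd psi z : zlike psi z -> (crd false (psi z)).1 = z.
Proof. by move=> [_ /nbhs_singleton]. Qed.

Lemma zlike_invol psi z : zlike psi z -> zlike (invol_chart psi) z.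
Proof.
move=> [aP nz]; split; first by rewrite /= piece_invol.
by apply: filterS nz => s sE; rewrite /= coord_invol.
Qed.

Lemma id_derivative (f : C -> C) z d : (\forall s \near z, f s = s) -> has_d id f z d -> d = 1.
Proof.
move=> E fd; apply: (has_d_uniqC fd); apply: has_d_near (has_d_j id z) => //.
by apply: filterS E => s ->.
Qed.

Lemma transition_z psi z (w0 : C) : curve_atlas psi -> chart_dom psi z -> zlike psi z ->
  w0 != 0 -> z_dom p w0 z -> z_chart p w0 z = psi z ->
  forall w, is_form w -> forall l, w psi z l = w (z_chart p w0) z l.
Proof.
move=> ap Dz zl w00 zD E w wf l; have [aP nz] := zl.
have D' : chart_dom (z_chart p w0) (crd false (psi z)).1 by rewrite zlike_crd.
have E' : z_chart p w0 (crd false (psi z)).1 = psi z by rewrite zlike_crd.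
have [d dd H] := form_transition (inv := fun Q => (crd false Q).1) ap Dz (z_chart_good p w00) D' E'.
by rewrite (H w wf l) zlike_crd // (id_derivative nz dd) mul1r.
Qed.

(** Differentiating [t ^+ 2 = z - q i] gives [dt = dz / (2 * t)]; in particular [t] is nonzero, so
    no chart has [z] as its parameter at a branch point. *)
Lemma transition_t psi z i : curve_atlas psi -> chart_dom psi z -> zlike psi z ->
  (i < n)%N -> strip 0 i z ->
  exists2 t, t ^+ 2 = z - q i & [/\ t + t != 0, t_dom g q rot i t &
    forall w, is_form w -> forall l, w psi z l = w (tchart i) t ((t + t)^-1 * l)].
Proof.
move=> ap Dz zl iN sz; have [aP nz] := zl.
have sP : strip 0 i (crd false (psi z)).1 by rewrite zlike_crd.
have [Dt Et] := t_invK rot0 branch_polyE iN aP sP.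
have [d dd H] := form_transition ap Dz (t_chart_good rot0 branch_polyE iN) Dt Et.
exists (t_inv q rot i (psi z)).
  have := t_inv_sqr rot0 branch_polyE iN aP sP; rewrite zlike_crd // => E.
  by apply/esym/eqP; rewrite subr_eq addrC E.
have sq_near : \forall s \near z, q i + t_inv q rot i (psi s) * t_inv q rot i (psi s) = s.
  have [na n1 _] := cts_coord_comp aP (atlas_continuous ap Dz).
  have ns := strip_near n1 sP.
  apply: filterS3 na ns nz => s as_ ss sE.
  by have := t_inv_sqr rot0 branch_polyE iN as_ ss; rewrite sE expr2.
have := id_derivative sq_near (has_dD (has_d_cst id (q i) z) (has_dM (@idCc R) dd dd)).
rewrite add0r; set t := t_inv _ _ _ _ => E.
have t0 : t + t != 0.
  apply/eqP => t20; have : d * t + t * d = 0 by rewrite (mulrC t) -mulrDr t20 mulr0.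
  by rewrite E => /eqP; rewrite oner_eq0.
split=> // w wf l; rewrite (H w wf l); congr (w _ _ (_ * _)).
by apply: (mulfI t0); rewrite divff // -E mulrDl (mulrC d).
Qed.

(** Here [u = z^-1], so [du = - dz / z ^+ 2]. The flag [b] tells which of the two points at infinity
    the sheet of [psi] belongs to. *)
Lemma transition_inf psi z : curve_atlas psi -> chart_dom psi z -> zlike psi z ->
  z != 0 -> inf_dom p z^-1 -> exists b : bool,
    forall w, is_form w -> forall l, w psi z l = w (inf_chart p b) z^-1 (- (z ^- 2) * l).
Proof.
move=> ap Dz zl z0 Du; have [aP nz] := zl; have zE := zlike_crd zl.
have bP : piece true (psi z) by apply/(piece_neq aP); rewrite zE.
have crdE s : piece false (psi s) -> (crd false (psi s)).1 = s -> s != 0 ->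
    (crd true (psi s)).1 = s^-1.
  move=> as_ sE s0; have bs : piece true (psi s) by apply/(piece_neq as_); rewrite sE.
  by rewrite (coord_swap as_ bs) /swap /= sE.
have uE := crdE z aP zE z0.
have [b eb] : exists b : bool, (crd true (psi z)).2 = (-1) ^+ b * inf_branch p false z^-1.
  by apply: sqr_eq_sign; rewrite inf_branch_sqr (coord_eq bP) /= uE.
have PE : inf_chart p b (crd true (psi z)).1 = psi z.
  have [bc E] := crd_ichart p b z^-1; rewrite uE; apply: (coord_inj bc bP).
  by rewrite E [RHS]surjective_pairing uE eb /inf_branch expr0 mul1r.
have Di : chart_dom (inf_chart p b) (crd true (psi z)).1 by rewrite uE.
have [d dd H] := form_transition (inv := fun Q => (crd true Q).1) ap Dz (inf_chart_good p b) Di PE.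
exists b => w wf l; rewrite (H w wf l) uE; congr (w _ _ (_ * _)).
apply: (has_d_uniqC dd).
have := cts_has_dV (@idCc R) z0 (has_d_j id z); rewrite mulr1; apply: has_d_near => //.
have [na _ _] := cts_coord_comp aP (atlas_continuous ap Dz).
have n0 : \forall s \near z, s != 0 by apply: cts_near_neq0 z0; exact: idCc.
by apply: filterS3 na nz n0 => s as_ sE s0; rewrite crdE.
Qed.

Lemma near_sqrt i (N : C -> Prop) : (\forall t \near (0 : C), N t) ->
  \forall z \near q i, forall t, t ^+ 2 = z - q i -> N t.
Proof.
move=> /nbhsC_nrm[e e0 He]; apply/nbhsC_nrm; exists (e ^+ 2); first exact: exprn_gt0.
move=> z zq t tE; apply: He; rewrite subr0.
by rewrite -(@ltr_pXn2r _ 2) ?nnegrE ?nrm_ge0 ?ltW // -nrmX tE.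
Qed.

Lemma near_infinity (N : C -> Prop) : (\forall u \near (0 : C), N u) ->
  exists2 r, 0 < r & forall z, r <= nrm z -> z != 0 /\ N z^-1.
Proof.
move=> /nbhsC_nrm[e e0 He]; exists (2 / e); first exact: divr_gt0.
move=> z zr; have z0 : 0 < nrm z by apply: lt_le_trans zr; exact: divr_gt0.
split; first by rewrite -nrm_gt0.
apply: He; rewrite subr0 nrmV; apply: (@le_lt_trans _ _ (e / 2)).
  by rewrite -[leRHS]invf_div lef_pV2 ?posrE // divr_gt0.
by rewrite ltr_pdivrMr // ltr_pMr // ltr1n.
Qed.

Definition branch_points : seq C := [seq q k | k <- iota 0 n].

Lemma branch_pointsP z : (z \notin branch_points) = (branch_poly p z != 0).
Proof.
rewrite branch_polyE prodf_seq_neq0; apply/idP/allP => [H k kn|H].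
  by apply: contra H; rewrite subr_eq0 => /eqP ->; exact: map_f.
by apply/mapP => -[k kn zq]; have := H k kn; rewrite zq subrr eqxx.
Qed.

Lemma z_chart_crd (w0 : C) s : w0 != 0 -> piece false (z_chart p w0 s) /\
  crd false (z_chart p w0 s) = (s, z_branch p w0 s).
Proof.
move=> w00; apply: crd_graph_chart => t; rewrite /z_branch exprMn sqr_sqrtc mulrC divfK //.
by rewrite expf_neq0.
Qed.

Lemma z_chartP (w0 : C) z : w0 != 0 -> w0 ^+ 2 = branch_poly p z ->
  [/\ curve_atlas (z_chart p w0), chart_dom (z_chart p w0) z, zlike (z_chart p w0) z &
      crd false (z_chart p w0 z) = (z, w0)].
Proof.
move=> w00 wE; have gc := z_chart_good p w00.
have D1 : branch_poly p z / w0 ^+ 2 = 1 by rewrite -wE divff // expf_neq0.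
have crdE s := z_chart_crd s w00.
split; first exact: gc_atlas gc.
- by rewrite /= /z_dom /= D1 ltr01.
- split; first by case: (crdE z).
  by apply: near_all => s; case: (crdE s) => _ ->.
- by have [_ ->] := crdE z; rewrite /z_branch D1 sqrtc1 mulr1.
Qed.

Lemma form_continuous w psi t l : is_form w -> curve_atlas psi -> chart_dom psi t ->
  {for t, continuous (fun s => w psi s l)}.
Proof.
move=> wf ap Dt; have [w1 wi] := form_smooth wf ap.
have c : {for t, continuous (fun s => complex.Re l * w psi s 1 + complex.Im l * w psi s 'i)}.
  apply: contD; apply: contM; try exact: cont_cst.
    exact: smooth_cont w1 Dt.
  exact: smooth_cont wi Dt.
move/continuousRP in c; apply/continuousRP => e /c.
apply: filterS2 (atlas_near ap Dt) => s Ds.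
by rewrite -!form_lin.
Qed.

Lemma punctured_zero (F : C -> R) t : {for t, continuous F} ->
  (\forall s \near t, s != t -> F s = 0) -> F t = 0.
Proof.
move=> /continuousRP Fc F0; apply/eqP/negPn/negP => Ft.
have Ft0 : 0 < `|F t| by rewrite normr_gt0.
have H : \forall s \near t, `|F s - F t| < `|F t| /\ (s != t -> F s = 0).
  by apply: filterS2 (Fc _ Ft0) F0 => s; split.
have [s [sF s0] st] := idC_nonisolated H.
by move: sF; rewrite s0 // sub0r normrN ltxx.
Qed.

(** The points over the branch points and over infinity are isolated. Each is the center of a good
    chart, and a continuous coefficient that vanishes around the center vanishes at it. *)
Lemma form_vanishes w : is_form w ->
  (forall (w0 z l : C), w0 != 0 -> w0 ^+ 2 = branch_poly p z -> w (z_chart p w0) z l = 0) ->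
  forall psi t l, curve_atlas psi -> chart_dom psi t -> w psi t l = 0.
Proof.
move=> wf H.
have off psi t l : curve_atlas psi -> chart_dom psi t -> piece false (psi t) ->
    (crd false (psi t)).2 != 0 -> w psi t l = 0.
  move=> ap Dt aP w0; have wE := coord_eq aP.
  have [_ Dz zl crdE] := z_chartP w0 wE.
  have E : z_chart p (crd false (psi t)).2 (crd false (psi t)).1 = psi t.
    by apply: (coord_inj zl.1 aP); rewrite crdE -surjective_pairing.
  have [d _ ->] := form_transition (inv := fun Q => (crd false Q).1) ap Dt
    (z_chart_good p w0) Dz E; last exact: wf.
  exact: H.
have center phi inv s psi t l : curve_atlas psi -> chart_dom psi t ->
    good_chart phi inv -> chart_dom phi s -> phi s = psi t ->
    (\forall r \near s, r != s -> piece false (phi r) /\ (crd false (phi r)).2 != 0) ->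
    w psi t l = 0.
  move=> ap Dt gc Ds E nr; have invE : inv (psi t) = s by rewrite -E (gc_inv gc Ds).
  have phi0 m : w phi s m = 0.
    have cF := form_continuous (l := m) wf (gc_atlas gc) Ds.
    have pz := punctured_zero cF; cbv beta in pz; apply: pz.
    apply: filterS2 nr (atlas_near (gc_atlas gc) Ds) => r rr Dr rs.
    by have [? ?] := rr rs; apply: off => //; exact: gc_atlas gc.
  have [|//|d _ ->//] := form_transition ap Dt gc _ _; rewrite invE //.
move=> psi t l ap Dt; have [aP|nP] := pselect (piece false (psi t)); last first.
  have [b bE] := icenterP nP.
  apply: (center (inf_chart p b) (fun Q => (crd true Q).1) 0) => //.
  - exact: inf_chart_good.
  - exact: (@inf_dom0 _ _ p).
  have nD := open_nbhs_nbhs (conj (@open_inf_dom _ _ p) (@inf_dom0 _ _ p)).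
  apply: filterS nD => u Du u0; have au := ichart_aff p b u0; split=> //.
  have [bu E] := crd_ichart p b u; have := coord_eq au; apply: contraPneq => ->.
  rewrite expr0n /= => /esym/eqP; apply/negP; rewrite -branch_pointsP.
  rewrite (coord_swap bu au) E /swap /=; apply/mapP => -[k]; rewrite mem_iota => /andP[_ kn] uE.
  have : inf_branch p b u ^+ 2 = 0.
    rewrite inf_branch_sqr recip_polyE // uE branch_polyE.
    by rewrite (bigD1_seq k) ?iota_uniq ?mem_iota //= subrr mul0r mulr0.
  move=> /eqP; rewrite expf_eq0 /= /inf_branch mulf_eq0 signr_eq0 /= => /prodf_eq0[i _].
  by rewrite sqrtc_eq0; apply/negP; apply: Re_gt0_neq0; exact: Du.
have [w0|] := eqVneq (crd false (psi t)).2 0; last exact: off.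
have : branch_poly p (crd false (psi t)).1 = 0.
  by have := coord_eq aP; rewrite w0 expr0n.
move=> /eqP; rewrite -[_ == _]negbK -branch_pointsP negbK => /mapP[k].
rewrite mem_iota => /andP[_ kn] kE.
have D0 : t_dom g q rot k 0.
  by rewrite /t_dom /= expr0n addr0; apply: (strip_q q_sorted); rewrite addn0 // leqnn.
apply: (center (tchart k) (t_inv q rot k) 0) => //.
- exact: t_chart_good.
- apply: (coord_inj (piece_t_map p q rot k 0) aP); rewrite crd_t_map //.
  by rewrite mul0r expr0n addr0 [RHS]surjective_pairing kE w0.
have nD := open_nbhs_nbhs (conj (@t_dom_open _ g q rot k) D0).
apply: filterS nD => s Ds s0; split; first exact: piece_t_map.
have -> : tchart k s = t_map p q rot k s by [].
by rewrite crd_t_map //= mulf_neq0 // outer_root_neq0.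
Qed.

Definition wroot z : C := sqrtc (branch_poly p z).

Lemma wroot_sqr z : wroot z ^+ 2 = branch_poly p z.
Proof. exact: sqr_sqrtc. Qed.

Lemma wroot_neq0 z : branch_poly p z != 0 -> wroot z != 0.
Proof. by rewrite sqrtc_eq0. Qed.

(** An invariant form has the same value on both sheets, so the jumps of [wroot] across the cut of
    [sqrtc] do not show: near each point [zval] is the coefficient in one fixed chart
    ([zval_near]). *)
Definition zval w z l : R := w (z_chart p (wroot z)) z l.

Lemma near_strip i : (i < n)%N -> \forall z \near q i, strip 0 i z.
Proof.
move=> iN; apply: (strip_near (f := fun z : C => z) (@idCc R (q i))).
by apply: (strip_q q_sorted); rewrite addn0 // leqnn.
Qed.

Lemma laplacian_near (A B : C -> R) z (l : R) : (\forall y \near z, A y = B y) ->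
  laplacian A z l -> laplacian B z l.
Proof.
move=> E [a [b [ha hb ab]]]; exists a, b; split=> //.
  by apply: second_derivative_near ha; apply: partial_near => //; exact: jxP.
by apply: second_derivative_near hb; apply: partial_near => //; exact: jyP.
Qed.

Section InvariantForm.
Context (w : form).
Hypothesis wh : Defs.harmonic (@curve_atlas R g p) w.
Hypothesis wi : forall psi t l, curve_atlas psi -> chart_dom psi t ->
  w (invol_chart psi) t l = w psi t l.

Let wf : is_form w. Proof. by case: wh => -[]. Qed.

Lemma zval_chart psi z l : branch_poly p z != 0 -> curve_atlas psi -> chart_dom psi z ->
  zlike psi z -> w psi z l = zval w z l.
Proof.
move=> bz ap Dz zl; have r0 := wroot_neq0 bz.
have [ac Dc zc crdE] := z_chartP r0 (wroot_sqr z).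
have [b eb] : exists b : bool, (crd false (psi z)).2 = (-1) ^+ b * wroot z.
  by apply: sqr_eq_sign; rewrite (coord_eq zl.1) zlike_crd // wroot_sqr.
case: b eb => eb; last first.
  apply: (transition_z ap Dz zl r0 Dc _ wf); apply: (coord_inj zc.1 zl.1).
  by rewrite crdE [RHS]surjective_pairing eb expr0 mul1r zlike_crd.
rewrite -(wi l ap Dz).
have zl' := zlike_invol zl.
apply: (transition_z (invol_chart_atlas ap) Dz zl' r0 Dc _ wf).
apply: (coord_inj zc.1 zl'.1).
by rewrite crdE /= coord_invol [RHS]surjective_pairing /= eb expr1 mulN1r opprK zlike_crd.
Qed.

Lemma zval_near z l : branch_poly p z != 0 ->
  \forall y \near z, w (z_chart p (wroot z)) y l = zval w y l.
Proof.
move=> bz; have [ac Dc zc _] := z_chartP (wroot_neq0 bz) (wroot_sqr z).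
have bn : \forall y \near z, branch_poly p y != 0.
  by apply: cts_near_neq0 bz; apply: (C1_cont (@idCc R)); exact: branch_poly_C1.
have crdE s := z_chart_crd s (wroot_neq0 bz).
apply: filterS2 bn (atlas_near ac Dc) => y b_y Dy.
have zl_y : zlike (z_chart p (wroot z)) y.
  by split; [case: (crdE y)|apply: near_all => s; case: (crdE s) => _ ->].
exact: (zval_chart l b_y ac Dy zl_y).
Qed.

Lemma zval_continuous z l : branch_poly p z != 0 -> {for z, continuous (zval w ^~ l)}.
Proof.
move=> bz; have [ac Dc _ _] := z_chartP (wroot_neq0 bz) (wroot_sqr z).
have /continuousRP c := form_continuous (l := l) wf ac Dc.
have E := zval_near l bz; have Ez := nbhs_singleton E; apply/continuousRP => e /c.
by apply: filterS2 (E) => y Ey; rewrite Ey Ez.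
Qed.

Lemma zval_laplacian z : branch_poly p z != 0 ->
  laplacian (zval w ^~ 1) z 0 /\ laplacian (zval w ^~ 'i) z 0.
Proof.
move=> bz; have [ac Dc _ _] := z_chartP (wroot_neq0 bz) (wroot_sqr z).
have [l1 li] := harmonic_laplacian wh ac Dc.
split; [apply: laplacian_near l1|apply: laplacian_near li]; exact: zval_near.
Qed.

(** In this chart the involution is [t -> - t], so at its fixed point 0 an invariant form equals its
    negative. *)
Lemma t_chart_center_zero i l : (i < n)%N -> w (tchart i) 0 l = 0.
Proof.
move=> iN; have gc := t_chart_good rot0 branch_polyE iN.
have D0 : chart_dom (tchart i) 0.
  by rewrite /= /t_dom /= expr0n addr0; apply: (strip_q q_sorted); rewrite addn0 // leqnn.
have [_ inv _] := wf.
have := inv (invol_chart (tchart i)) (tchart i) 0 (fun s : C => - s) (- 1 : C)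
  (invol_chart_atlas (gc_atlas gc)) (gc_atlas gc) D0.
rewrite oppr0 => /(_ D0) H.
have E : w (invol_chart (tchart i)) 0 l = w (tchart i) 0 (- 1 * l).
  have dN : has_d id (fun s : C => - s) 0 (- 1) := has_dN (has_d_j id 0).
  refine (H _ (proj1 (has_d_is_derive _ _ _) dN) l).
  apply: near_all => s; suff : t_map p q rot i (- s) = invol (t_map p q rot i s) by [].
  apply: (@coord_inj _ _ _ false); rewrite ?piece_invol; try exact: piece_t_map.
  by rewrite coord_invol !crd_t_map // sqrrN mulNr.
move: E; rewrite (wi l (gc_atlas gc) D0) mulN1r (form_opp _ wf (gc_atlas gc) D0) => /eqP.
by rewrite -addr_eq0 -mulr2n mulrn_eq0 => /eqP.
Qed.

(** By [t_chart_center_zero] the coefficient in the parameter [t] is at most a multiple of [nrm t],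
    which compensates the factor [(t + t)^-1] of the change to [z]. *)
Lemma zval_bounded i l : (i < n)%N ->
  exists M, \forall z \near q i, z \notin branch_points -> `|zval w z l| <= M.
Proof.
move=> iN; have gc := t_chart_good rot0 branch_polyE iN; have ac := gc_atlas gc.
have D0 : chart_dom (tchart i) 0.
  by rewrite /= /t_dom /= expr0n addr0; apply: (strip_q q_sorted); rewrite addn0 // leqnn.
have [w1 w2] := form_smooth wf ac; have oD := atlas_open ac.
have [K K0 HK] := smooth_lipschitz oD D0 w1; have [L L0 HL] := smooth_lipschitz oD D0 w2.
exists (nrm l * (K + L)).
have N : \forall t \near (0 : C), `|w (tchart i) t 1| <= K * nrm t /\
    `|w (tchart i) t 'i| <= L * nrm t.
  by apply: filterS2 HK HL => t; rewrite !t_chart_center_zero // !subr0.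
apply: filterS2 (near_strip iN) (near_sqrt i N) => z sz Hz zb.
have zq : z != q i.
  by apply: contraNneq zb => ->; apply: map_f; rewrite mem_iota.
rewrite branch_pointsP in zb.
have [ap Dz zl _] := z_chartP (wroot_neq0 zb) (wroot_sqr z).
have [t tE [_ Dt H]] := transition_t ap Dz zl iN sz.
rewrite /zval (H _ wf); apply: le_trans (form_bound _ wf ac Dt) _.
have [h1 h2] := Hz t tE.
have t0 : 0 < nrm t by rewrite nrm_gt0; apply: contraNneq zq => t0; rewrite -subr_eq0 -tE t0 expr0n.
rewrite nrmM nrmV (_ : nrm (t + t) = 2 * nrm t); last first.
  by rewrite (_ : t + t = toC 2 * t) ?nrmM ?nrm_real ?ger0_norm //; rewrite /toC rmorphMn /= mulr_natl mulr2n.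
have t2 : 0 < 2 * nrm t by rewrite mulr_gt0.
rewrite -mulrA mulrCA; apply: ler_wpM2l; first exact: nrm_ge0.
rewrite ler_pdivrMl //.
have := mulr_ge0 (addr_ge0 K0 L0) (ltW t0); move: h1 h2; rewrite mulrDl.
by move: (w _ t 1) (w _ t 'i) => x y; nra.
Qed.

(** The coefficients in [u = z^-1] are bounded near 0, and the change of parameter contributes the
    factor [- (z ^- 2)]. *)
Lemma zval_decay l (c : R) : 0 < c -> exists r, forall z, r <= nrm z ->
  z \notin branch_points -> `|zval w z l| <= c.
Proof.
move=> c0; have D0 := @inf_dom0 R g p.
have ac (b : bool) := gc_atlas (inf_chart_good p b).
have bnd (b : bool) : exists2 M, 0 <= M & \forall u \near (0 : C),
    `|w (inf_chart p b) u 1| + `|w (inf_chart p b) u 'i| <= M.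
  have [M M0 HM] := cont_bounded (form_continuous (l := 1) wf (ac b) D0).
  have [L L0 HL] := cont_bounded (form_continuous (l := 'i) wf (ac b) D0).
  by exists (M + L); [exact: addr_ge0|apply: filterS2 HM HL => u *; exact: lerD].
have [M M0 HM] := bnd true; have [L L0 HL] := bnd false.
have [e e0 He] : exists2 e : R, 0 < e & e ^+ 2 * nrm l * (M + L) <= c.
  exists (Num.sqrt (c / (nrm l * (M + L) + 1))).
    by rewrite sqrtr_gt0 divr_gt0 // ltr_wpDl // mulr_ge0 ?nrm_ge0 ?addr_ge0.
  have p1 : 0 < nrm l * (M + L) + 1 by rewrite ltr_wpDl // mulr_ge0 ?nrm_ge0 ?addr_ge0.
  rewrite sqr_sqrtr ?divr_ge0 ?(ltW c0) ?(ltW p1) // -mulrA mulrAC ler_pdivrMr //.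
  by rewrite ler_wpM2l ?(ltW c0) // lerDl.
have N : \forall u \near (0 : C), [/\ inf_dom p u, nrm u < e &
    forall b : bool, `|w (inf_chart p b) u 1| + `|w (inf_chart p b) u 'i| <= M + L].
  have nD := open_nbhs_nbhs (conj (@open_inf_dom _ _ p) D0).
  have ne := near_nrm (0 : C) e0.
  have nb : \forall u \near (0 : C), forall b : bool,
      `|w (inf_chart p b) u 1| + `|w (inf_chart p b) u 'i| <= M + L.
    by apply: filterS2 HM HL => u h1 h2 []; lra.
  by apply: filterS3 nD ne nb => u; rewrite subr0; split.
have [r r0 Hr] := near_infinity N; exists r => z zr; rewrite branch_pointsP => bz.
have [z0 [Du ue Hu]] := Hr z zr.
have [ap Dz zl _] := z_chartP (wroot_neq0 bz) (wroot_sqr z).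
have [b Hb] := transition_inf ap Dz zl z0 Du.
rewrite /zval (Hb _ wf); apply: le_trans (form_bound _ wf (ac b) Du) _.
rewrite nrmM nrmN nrmV nrmX -exprVn -nrmV; apply: le_trans He.
apply: ler_pM (Hu b); rewrite ?mulr_ge0 ?exprn_ge0 ?nrm_ge0 ?addr_ge0 //.
apply: ler_wpM2r; first exact: nrm_ge0.
by rewrite ler_pXn2r ?nnegrE ?nrm_ge0 ?ltW.
Qed.

(** The maximum principle is applied to each coefficient and to its negative. *)
Lemma zval_zero z : branch_poly p z != 0 -> zval w z 1 = 0 /\ zval w z 'i = 0.
Proof.
rewrite -branch_pointsP => zb.
have mp (c : R) l : `|c| = 1 -> (forall z, z \notin branch_points ->
    laplacian (zval w ^~ l) z 0) -> c * zval w z l <= 0.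
  move=> c1 lap; have absE y : `|c * zval w y l| = `|zval w y l| by rewrite normrM c1 mul1r.
  apply: (@maximum_principle R (fun y => c * zval w y l) branch_points) => // [y yb|y yb|y|e e0].
  - by apply: contM; [exact: cont_cst|apply: zval_continuous; rewrite -branch_pointsP].
  - by rewrite -[X in laplacian _ _ X](mulr0 c); apply: laplacianZ; exact: lap.
  - move=> /mapP[k]; rewrite mem_iota => /andP[_ kn] ->.
    have [M HM] := zval_bounded l kn; exists M; apply: filterS HM => s Hs sb.
    by apply: le_trans (ler_norm _) _; rewrite absE; exact: Hs.
  - have [r Hr] := zval_decay l e0; exists r => s sr sb.
    by apply: le_trans (ler_norm _) _; rewrite absE; exact: Hr.
have zero l : (forall z, z \notin branch_points -> laplacian (zval w ^~ l) z 0) ->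
    zval w z l = 0.
  move=> lap; have h1 := mp 1 l (normr1 _) lap; have h2 := mp (-1) l (normrN1 _) lap.
  by apply/eqP; rewrite eq_le -oppr_le0 -mulN1r h2 andbT; rewrite mul1r in h1.
by split; apply: zero => y; rewrite branch_pointsP => /zval_laplacian[].
Qed.

Lemma invariant_harmonic_zero psi t l : curve_atlas psi -> chart_dom psi t -> w psi t l = 0.
Proof.
apply: form_vanishes => // w0 z m w00 wE.
have bz : branch_poly p z != 0 by rewrite -wE expf_neq0.
have [ap Dz zl _] := z_chartP w00 wE.
rewrite zval_chart // /zval.
have [aq Dq _ _] := z_chartP (wroot_neq0 bz) (wroot_sqr z).
have [h1 h2] := zval_zero bz.
by rewrite (form_lin m wf aq Dq) [w _ z 1]h1 [w _ z 'i]h2 !mulr0 addr0.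
Qed.

End InvariantForm.

Lemma harmonic_anti_invariant w psi t l : Defs.harmonic (@curve_atlas R g p) w ->
  curve_atlas psi -> chart_dom psi t -> w (invol_chart psi) t l = - w psi t l.
Proof.
move=> wh ap Dt; have fh := fpull_harmonic wh; have sum_h := harmonic_lin 1 wh fh.
have inv phi s m : curve_atlas phi -> chart_dom phi s ->
    flin 1 w (fpull w) (invol_chart phi) s m = flin 1 w (fpull w) phi s m.
  by move=> aph Ds; rewrite /flin /fpull !mul1r addrC invol_chartK.
have := invariant_harmonic_zero sum_h inv l ap Dt.
by rewrite /flin /fpull mul1r => /eqP; rewrite addrC addr_eq0 => /eqP.
Qed.

End FormTransitions.

(** * Domination by integrable functions on the plane *)

Section Domination.
Context (R : realType).
Local Notation C := (R[i]^o).
Local Notation RR := (measurableTypeR R * measurableTypeR R)%type.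
Local Notation leb2 := (lebesgue_measure \x lebesgue_measure)%E.
Implicit Types (z c : C) (S : set C) (J : C -> R).

Definition plane (q : R * R) : C := q.1 +i* q.2.

Definition square c (r : R) : set C :=
  [set z | `|complex.Re z - complex.Re c| <= r /\ `|complex.Im z - complex.Im c| <= r].

Definition box2 c (r : R) : set (R * R) :=
  `[complex.Re c - r, complex.Re c + r]%classic `*` `[complex.Im c - r, complex.Im c + r]%classic.

Lemma box2P c r q : box2 c r q <-> square c r (plane q).
Proof.
case: q => x y; rewrite /box2 /square /plane /= !in_itv /= !ler_distl.
by split=> -[].
Qed.

Lemma measurable_box2 c r : measurable (box2 c r).
Proof. by apply: measurableX; exact: measurable_itv. Qed.

Lemma measure_box2 c r : 0 < r -> leb2 (box2 c r) = ((2 * r) ^+ 2)%:E.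
Proof.
move=> r0; rewrite product_measure1E; try exact: measurable_itv.
have side (x : R) : lebesgue_measure `[x - r, x + r]%classic = (2 * r)%:E.
  rewrite lebesgue_measure_itv /= lte_fin (_ : (x - r < x + r)%R); last by lra.
  by rewrite -EFinB; congr EFin; ring.
transitivity ((2 * r)%:E * (2 * r)%:E)%E; first by congr mule; exact: side.
by rewrite -EFinM expr2.
Qed.

(** The integral of a nonnegative function is a supremum over the simple functions below it. In this
    form monotonicity applies to integrands that are defined through choices of charts. *)
Lemma mono_integral (f h : RR -> \bar R) : (forall x, 0 <= f x)%E ->
  (forall x, f x <= h x)%E -> (\int[leb2]_x f x <= \int[leb2]_x h x)%E.
Proof.
move=> f0 fh; have h0 x : (0 <= h x)%E by exact: le_trans (fh x).
rewrite !ge0_integralTE //; apply: ereal_sup_le => _ [s sf <-].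
by exists s => // x; exact: le_trans (fh x).
Qed.

(** Measurability is asked of the bound [G] alone, since [J] will be [sheet_sum], whose values come
    from chosen charts. *)
Definition dominated J S : Prop := exists G : RR -> \bar R,
  [/\ forall q, (0 <= G q)%E, measurable_fun setT G, (\int[leb2]_q G q < +oo)%E &
      forall q, S (plane q) -> ((J (plane q))%:E <= G q)%E].

Lemma dominatedS J S S' : S `<=` S' -> dominated J S' -> dominated J S.
Proof. by move=> SS' [G [G0 mG iG JG]]; exists G; split=> // q /SS'; exact: JG. Qed.

Lemma dominatedU J S S' : dominated J S -> dominated J S' -> dominated J (S `|` S').
Proof.
move=> [G [G0 mG iG JG]] [H [H0 mH iH JH]]; exists (fun q : RR => G q + H q)%E; split.
- by move=> q; exact: adde_ge0.
- exact: emeasurable_funD.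
- by rewrite ge0_integralD // lte_add_pinfty.
- move=> q [/JG|/JH] h; first by apply: le_trans h _; rewrite leeDl.
  by apply: le_trans h _; rewrite leeDr.
Qed.

Lemma scaled_indic_integral (c : R) z r : 0 <= c -> 0 < r ->
  (\int[leb2]_q (c%:E * (\1_(box2 z r) q)%:E) = (c * (2 * r) ^+ 2)%:E)%E.
Proof.
move=> c0 r0; rewrite ge0_integralZl //=; last first.
  apply/measurable_EFinP; exact: measurable_indic (measurable_box2 z r).
have -> : (\int[leb2]_q (\1_(box2 z r) q)%:E = leb2 (box2 z r))%E.
  by rewrite -[RHS](congr1 _ (setIT (box2 z r))); apply: integral_indic; [exact: measurableT|exact: measurable_box2].
by rewrite measure_box2.
Qed.

Lemma dominated_bounded J S z (M : R) : (forall y, S y -> J y <= M) ->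
  dominated J (S `&` square z 1).
Proof.
move=> JM; pose N := Num.max 0 M; have N0 : 0 <= N by rewrite le_max lexx.
exists (fun q : RR => N%:E * (\1_(box2 z 1) q)%:E)%E; split.
- by move=> q; rewrite -EFinM lee_fin mulr_ge0.
- apply: measurable_funeM; apply/measurable_EFinP.
  exact: measurable_indic (measurable_box2 z 1).
- by rewrite scaled_indic_integral // ltry.
- move=> q [/JM Jq /box2P bq]; rewrite indicE mem_set // mule1 lee_fin.
  by rewrite (le_trans Jq) // le_max lexx orbT.
Qed.

(** The products of the bounds [c n] with the areas of the squares are summable like a geometric
    series, so the series of scaled indicator functions is an integrable bound. *)
Lemma dominated_dyadic J S z (r c : nat -> R) (a : R) : (forall n, 0 < r n) ->
  (forall n, 0 <= c n) -> (forall n, c n * (2 * r n) ^+ 2 <= a / (2 ^ n.+1)%:R) ->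
  (forall y, S y -> exists n, square z (r n) y /\ J y <= c n) -> dominated J S.
Proof.
move=> r0 c0 ca HS.
pose G n (q : RR) := ((c n)%:E * (\1_(box2 z (r n)) q)%:E)%E.
have G0 n q : (0 <= G n q)%E by rewrite /G -EFinM lee_fin mulr_ge0.
have mG n : measurable_fun setT (G n).
  apply: measurable_funeM; apply/measurable_EFinP.
  exact: measurable_indic (measurable_box2 z (r n)).
exists (fun q : RR => \sum_(0 <= n <oo) G n q)%E; split.
- by move=> q; apply: nneseries_ge0 => n _ _; exact: G0.
- by apply: ge0_emeasurable_sum => // n q _ _; exact: G0.
- rewrite integral_nneseries //.
  apply: (@le_lt_trans _ _ (\sum_(0 <= n <oo) (a / (2 ^ n.+1)%:R)%:E)%E).
    apply: lee_nneseries => [n _ _|n _]; first exact: integral_ge0.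
    by rewrite /G scaled_indic_integral // lee_fin.
  have := @cvg_geometric_eseries_half R a 0; move=> /cvg_lim.
  rewrite /eseries /= => H.
  have -> : (\sum_(0 <= n <oo) (a / (2 ^ n.+1)%:R)%:E)%E = (a / 2 ^+ 0)%:E.
    rewrite -H //; congr (limn _); apply/funext => n /=.
    by apply: eq_bigr => i _; rewrite addn1.
  exact: ltry.
- move=> q /HS[n [/box2P bq Jc]].
  apply: (@le_trans _ _ (G n q)); first by rewrite /G indicE mem_set // mule1 lee_fin.
  have := @nneseries_lim_ge R (G^~ q) xpredT 0 n.+1 (fun k _ _ => G0 k q).
  apply: le_trans; rewrite big_nat_recr //= leeDr //.
  by apply: sume_ge0 => k _; exact: G0.
Qed.

Lemma dyadic_small (r s : R) : 0 < s -> s <= r ->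
  exists n, r / 2 ^+ n.+1 < s /\ s <= r / 2 ^+ n.
Proof.
move=> s0 sr; have r0 : 0 < r by exact: lt_le_trans sr.
have ex : exists n, r / 2 ^+ n.+1 < s.
  have [n Hn] : exists n, r / s < 2 ^+ n.
    pose m := (Num.bound (r / s)); exists m.
    have h1 : r / s < m%:R by apply: archi_boundP; rewrite divr_ge0 // ltW.
    apply: lt_trans h1 _; rewrite -natrX ltr_nat; exact: ltn_expl.
  exists n; rewrite ltr_pdivrMr ?exprn_gt0 // mulrC -ltr_pdivrMr //.
  by apply: lt_trans Hn _; rewrite exprS ltr_pMl ?exprn_gt0 // ltr1n.
have [n Hn minn] := ex_minnP ex; exists n; split=> //.
case: n Hn minn => [_ _|n _ minn]; first by rewrite expr0 divr1.
by rewrite leNgt; apply/negP => /minn; rewrite ltnn.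
Qed.

Lemma dyadic_large (r s : R) : 0 < r -> r < s ->
  exists n, r * 2 ^+ n < s /\ s <= r * 2 ^+ n.+1.
Proof.
move=> r0 rs; have ex : exists n, s <= r * 2 ^+ n.+1.
  pose m := (Num.bound (s / r)); exists m.
  have h1 : s / r < m%:R by apply: archi_boundP; rewrite divr_ge0 // ?ltW // (lt_trans r0).
  rewrite mulrC -ler_pdivrMr //; apply: le_trans (ltW h1) _.
  rewrite -natrX ler_nat; apply: ltnW; apply: leq_trans (ltn_expl m (ltnSn 1)) _.
  by rewrite leq_exp2l.
have [n Hn minn] := ex_minnP ex; exists n; split=> //.
case: n Hn minn => [_ _|n _ minn]; first by rewrite expr0 mulr1.
by rewrite ltNge; apply/negP => /minn; rewrite ltnn.
Qed.

Definition supnorm z c : R :=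
  Num.max `|complex.Re z - complex.Re c| `|complex.Im z - complex.Im c|.

Lemma supnorm_square z c r : square c r z <-> supnorm z c <= r.
Proof. by rewrite /supnorm ge_max; split=> [[-> ->]//|/andP[]]. Qed.

Lemma supnorm_le z c : supnorm z c <= nrm (z - c).
Proof. by rewrite /supnorm ge_max -cReB -cImB Re_le_nrm Im_le_nrm. Qed.

Lemma nrm_le_supnorm z c : nrm (z - c) <= 2 * supnorm z c.
Proof.
apply: le_trans (nrm_le_ReIm _) _; rewrite cReB cImB mulr_natl mulr2n.
by apply: lerD; rewrite /supnorm le_max lexx ?orbT.
Qed.

Lemma supnorm_gt0 z c : z != c -> 0 < supnorm z c.
Proof.
move=> zc; have : 0 < nrm (z - c) by rewrite nrm_gt0 subr_eq0.
by move=> h; have := lt_le_trans h (nrm_le_supnorm z c); rewrite pmulr_rgt0.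
Qed.

(** Over the rings of sup radius between [rho / 2 ^+ n.+1] and [rho / 2 ^+ n] the bound doubles from
    one ring to the next, whereas the area is divided by 4. *)
Lemma dominated_pole J c (r M : R) : 0 < r -> 0 <= M -> J c <= 0 ->
  (forall z, z != c -> nrm (z - c) < r -> J z <= M / nrm (z - c)) ->
  dominated J (square c (r / 4)).
Proof.
move=> r0 M0 Jc HJ; pose rho := r / 4; have rho0 : 0 < rho by rewrite divr_gt0.
have rhoE : r = 4 * rho by rewrite /rho mulrC divfK.
apply: (@dominated_dyadic J _ c (fun n => rho / 2 ^+ n) (fun n => M * 2 ^+ n.+1 / rho)
  (16 * M * rho)).
- by move=> n; rewrite divr_gt0 // exprn_gt0.
- by move=> n; rewrite divr_ge0 ?(ltW rho0) // mulr_ge0 // exprn_ge0.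
- move=> n; rewrite natrX le_eqVlt; apply/orP; left; apply/eqP; rewrite !exprS expr0.
  by field; rewrite !gt_eqF // exprn_gt0.
- move=> z sz; have [->|zc] := eqVneq z c.
    exists 0; split; first by rewrite /square /= !subrr normr0 expr0 divr1 (ltW rho0).
    by apply: le_trans Jc _; rewrite divr_ge0 ?(ltW rho0) // mulr_ge0 // exprn_ge0.
  have s0 := supnorm_gt0 zc; have [n [n1 n2]] := dyadic_small s0 ((supnorm_square z c rho).1 sz).
  exists n; split; first exact/supnorm_square.
  have nz : nrm (z - c) < r.
    apply: le_lt_trans (nrm_le_supnorm z c) _; rewrite rhoE.
    by have := (supnorm_square z c rho).1 sz; lra.
  apply: le_trans (HJ z zc nz) _; rewrite -mulrA ler_wpM2l //.
  have p2 : 0 < 2 ^+ n.+1 :> R by rewrite exprn_gt0.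
  rewrite -[leRHS]invf_div lef_pV2 ?posrE ?divr_gt0 //; last first.
    exact: lt_le_trans s0 (supnorm_le z c).
  by apply: le_trans (ltW n1) _; exact: supnorm_le.
Qed.

(** From one dyadic ring to the next the bound is divided by 16 and the area multiplied by 4. *)
Lemma dominated_infinity J (r M : R) : 0 < r -> 0 <= M ->
  (forall z, r <= nrm z -> J z <= M / nrm z ^+ 4) ->
  dominated J (~` square 0 r).
Proof.
move=> r0 M0 HJ.
apply: (@dominated_dyadic J _ 0 (fun n => r * 2 ^+ n.+1) (fun n => M / (r * 2 ^+ n) ^+ 4)
  (32 * M / r ^+ 2)).
- by move=> n; rewrite mulr_gt0 // exprn_gt0.
- by move=> n; rewrite divr_ge0 // exprn_ge0 // mulr_ge0 ?(ltW r0) // exprn_ge0.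
- move=> n; rewrite natrX !exprS expr0; set x := 2 ^+ n.
  have x1 : 1 <= x by rewrite exprn_ege1 // ler1n.
  have x0 : 0 < x by exact: lt_le_trans x1.
  have -> : M / (r * x * (r * x * (r * x * (r * x * 1)))) *
      (2 * (r * (2 * x)) * (2 * (r * (2 * x)) * 1)) = (16 * M / (r * r) / x) / x.
    by field; rewrite !gt_eqF.
  have -> : 32 * M / (r * (r * 1)) / (2 * x) = (16 * M / (r * r)) / x.
    by field; rewrite !gt_eqF.
  have k0 : 0 <= 16 * M / (r * r) by rewrite divr_ge0 ?mulr_ge0 ?(ltW r0).
  by rewrite ler_wpM2r ?invr_ge0 ?(ltW x0) // ler_piMr // invf_le1.
- move=> z nz; have rs : r < supnorm z 0 by rewrite ltNge; apply/negP => /supnorm_square.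
  have [n [n1 n2]] := dyadic_large r0 rs; exists n; split; first exact/supnorm_square.
  have zn := supnorm_le z 0; rewrite subr0 in zn.
  apply: le_trans (HJ z _) _; first by rewrite (le_trans _ zn) // ltW.
  have p2 : 0 < r * 2 ^+ n by rewrite mulr_gt0 // exprn_gt0.
  rewrite ler_wpM2l // lef_pV2 ?posrE ?exprn_gt0 //; last first.
    exact: lt_le_trans (lt_trans p2 n1) zn.
  rewrite ler_pXn2r ?nnegrE ?nrm_ge0 ?(ltW p2) //.
  exact: le_trans (ltW n1) zn.
Qed.

Lemma dominated_compact J (K : set C) : compact K ->
  (forall z, K z -> exists2 U, nbhs z U & dominated J U) -> dominated J K.
Proof.
move=> cK HU; apply: contrapT => nK.
(* If [K] were not dominated, the sets off which it is dominated would form a proper filter; a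
   cluster point in [K] then contradicts the local hypothesis. *)
pose F := [set A : set C | dominated J (K `\` A)].
have d0 : dominated J set0.
  have := @dominated_bounded J set0 0 0 (fun y (H : set0 y) => False_ind _ H).
  by rewrite set0I.
have FF : ProperFilter F.
  split; last split.
  - by rewrite /F /= setD0.
  - by rewrite /F /= setDT.
  - move=> A B FA FB; rewrite /F /= setDIr; exact: dominatedU.
  - by move=> A B AB FA; apply: dominatedS FA => z [Kz nB]; split=> // /AB.
have FK : F K by rewrite /F /= setDv.
have [z [Kz cz]] := cK F FF FK; have [U nU dU] := HU z Kz.
have FU : F (~` U) by apply: dominatedS dU => y [_ /contrapT].
by have [y [nUy Uy]] := cz _ _ FU nU.
Qed.

Lemma square0 (r : R) : square 0 r = [set z : C | `|complex.Re z| <= r /\ `|complex.Im z| <= r].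
Proof. by apply/seteqP; split=> z; rewrite /square /= !subr0. Qed.

Lemma square_nbhs c r : 0 < r -> nbhs c (square c r).
Proof.
move=> r0; apply/nbhsC_nrm; exists r => // y yr; apply/supnorm_square.
by apply: le_trans (supnorm_le y c) _; exact: ltW.
Qed.

(** [fine] sends an infinite integral to 0 as well, and domination excludes this case. A lower bound
    [e] on a square would then make the integral positive. *)
Lemma zero_integral_zero J z0 : (forall z, 0 <= J z) -> dominated J setT ->
  fine (\int[leb2]_q (J (plane q))%:E) = 0 ->
  forall e, 0 < e -> ~ (\forall z \near z0, e <= J z).
Proof.
move=> J0 [G [G0 mG iG JG]] int0 e e0 /nbhsC_nrm[r rpos Hr].
have Jfin : (\int[leb2]_q (J (plane q))%:E < +oo)%E.
  apply: le_lt_trans iG; apply: mono_integral => q; first by rewrite lee_fin.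
  exact: JG.
have Jge : (0 <= \int[leb2]_q (J (plane q))%:E)%E by apply: integral_ge0 => q _; rewrite lee_fin.
have J_0 : (\int[leb2]_q (J (plane q))%:E = 0)%E.
  by rewrite -(fineK (x := \int[leb2]_q _)) ?int0 // ge0_fin_numE.
have r4 : 0 < r / 4 by rewrite divr_gt0.
have : ((e * (2 * (r / 4)) ^+ 2)%:E <= 0)%E.
  rewrite -J_0 -(scaled_indic_integral z0 (ltW e0) r4); apply: mono_integral => q.
    by rewrite -EFinM lee_fin mulr_ge0 // ltW.
  rewrite indicE; case: (boolP (q \in box2 z0 (r / 4))) => [|_]; last by rewrite mule0 lee_fin.
  rewrite inE mule1 lee_fin => /box2P /supnorm_square sq; apply: Hr.
  by apply: le_lt_trans (nrm_le_supnorm _ _) _; lra.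
rewrite lee_fin leNgt => /negP; apply.
by rewrite mulr_gt0 // exprn_gt0 // mulr_gt0.
Qed.

End Domination.

(** * Invariance of the primitive [eta] *)

Section InvariantPrimitive.
Context (R : realType) (g : nat) (p : 'I_(2 * g + 2) -> R[i]^o).
Local Notation C := (R[i]^o).
Local Notation T := (curve p).
Local Notation n := (2 * g + 2)%N.
Local Notation form := (form1 R T).
Local Notation is_form := (is_form1 (@curve_atlas R g p)).
Context (q : nat -> C) (rot : C).
Hypothesis rot0 : rot != 0.
Hypothesis q_sorted : forall i j, (i < j)%N -> (j < n)%N ->
  ell rot (q i) < ell rot (q j).
Hypothesis branch_polyE : forall z, branch_poly p z = \prod_(k <- iota 0 n) (z - q k).
Local Notation strip := (strip g q rot).
Local Notation tchart i := (t_chart p q rot i).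
Context (eta : form).
Hypothesis eta_form : is_form eta.
Hypothesis eta_d : forall psi t, curve_atlas psi -> chart_dom psi t ->
  ext_d eta (invol_chart psi) t = ext_d eta psi t.
Hypothesis eta_ortho : forall alpha, closed_form1 (@curve_atlas R g p) alpha ->
  curve_integral (wedge eta (hodge alpha)) = 0.
Implicit Types (psi : chart R T) (t l z : C).

Let beta : form := flin (-1) eta (fpull eta).

Let beta_form : is_form beta.
Proof. by apply: flin_form => //; exact: fpull_form. Qed.

Let beta_closed : closed_form1 (@curve_atlas R g p) beta.
Proof.
split=> // psi t ap Dt; rewrite ext_d_lin //; last exact: fpull_form.
have -> : ext_d (fpull eta) psi t = ext_d eta (invol_chart psi) t by [].
by rewrite eta_d // mulN1r subrr.
Qed.

Let W := wedge eta (hodge beta).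

Lemma W_expand psi t : curve_atlas psi -> chart_dom psi t ->
  W psi t = eta psi t 1 * beta psi t 1 + eta psi t 'i * beta psi t 'i.
Proof.
move=> ap Dt; rewrite /W /wedge /hodge -expr2 sqr_i mulr1 (form_opp _ beta_form ap Dt).
by rewrite opprK mulrN opprK.
Qed.

Lemma beta_invol psi t l : beta (invol_chart psi) t l = - beta psi t l.
Proof. by rewrite /beta /flin /fpull invol_chartK; ring. Qed.

Definition sqval psi z : R := beta psi z 1 * beta psi z 1 + beta psi z 'i * beta psi z 'i.

Definition sheet_sum z : R := density_z W (sheet p false z) + density_z W (sheet p true z).

Lemma crd_sheet (b : bool) z : piece false (sheet p b z) /\
  crd false (sheet p b z) = (z, (-1) ^+ b * sqrtC (branch_poly p z)).
Proof. by []. Qed.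

Lemma density_witness (b : bool) z psi t : curve_atlas psi ->
  (forall s, chart_dom psi s -> piece false (psi s) /\ (crd false (psi s)).1 = s) ->
  chart_dom psi t -> psi t = sheet p b z -> t = z /\ zlike psi z.
Proof.
move=> ap H Dt E; have [aP tE] := H t Dt; have [_ cE] := crd_sheet b z.
have tz : t = z by rewrite -tE E cE.
split=> //; rewrite -tz; split=> //.
by apply: filterS (atlas_near ap Dt) => s Ds; case: (H s Ds).
Qed.

(** No chart has [z] as its parameter at a branch point, so [density_z] takes its default value 0
    there. *)
Lemma sheet_sum_branch i : (i < n)%N -> sheet_sum (q i) = 0.
Proof.
move=> iN; have sq : strip 0 i (q i) by apply: (strip_q q_sorted); rewrite addn0 // leqnn.
have d0 b : density_z W (sheet p b (q i)) = 0.
  rewrite /density_z; case: xgetP => // y _ [psi [t [ap H Dt E _]]].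
  have [tE zl] := density_witness ap H Dt E; rewrite tE in Dt.
  have [s] := transition_t rot0 branch_polyE ap Dt zl iN sq.
  by rewrite subrr => /eqP; rewrite expf_eq0 /= => /eqP -> []; rewrite addr0 eqxx.
by rewrite /sheet_sum !d0 addr0.
Qed.

(** Any two charts with parameter [z] at the point give the same value, so the chart chosen in
    [density_z] may be replaced by [z_chart]. *)
Lemma density_sheet (b : bool) z : let w0 := (-1) ^+ b * sqrtC (branch_poly p z) : C in
  branch_poly p z != 0 -> density_z W (sheet p b z) = W (z_chart p w0) z.
Proof.
move=> w0 bz; have w02 : w0 ^+ 2 = branch_poly p z by rewrite exprMn sqrr_sign mul1r sqrtCK.
have w00 : w0 != 0 by apply: contraNneq bz => w00; rewrite -w02 w00 expr0n.
have [ac Dc zc crdE] := z_chartP w00 w02.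
have Pc : z_chart p w0 z = sheet p b z.
  by have [aP cE] := crd_sheet b z; apply: (coord_inj zc.1 aP); rewrite crdE cE.
rewrite /density_z; case: xgetP => [y _ [psi [t [ap H Dt E ->]]]|/(_ (W (z_chart p w0) z)) []].
  have [tE zl] := density_witness ap H Dt E; rewrite tE in Dt *.
  rewrite !W_expand //; have E' : z_chart p w0 z = psi z by rewrite Pc -E tE.
  by rewrite !(transition_z ap Dt zl w00 Dc E').
exists (z_chart p w0), z; split=> // s _; have [? cE] := z_chart_crd p s w00.
by rewrite cE.
Qed.

(* On the other sheet [beta] changes sign and [eta] becomes its pullback, so the two values of
   [eta * beta] add up to [beta * beta]. *)
Lemma sheet_sum_chart psi z : branch_poly p z != 0 -> curve_atlas psi -> chart_dom psi z ->
  zlike psi z -> sheet_sum z = sqval psi z.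
Proof.
move=> bz ap Dz zl; rewrite /sheet_sum !density_sheet // expr0 expr1 mul1r mulN1r.
set w0 : C := sqrtC _; have w02 : w0 ^+ 2 = branch_poly p z by rewrite sqrtCK.
have w00 : w0 != 0 by apply: contraNneq bz => w00; rewrite -w02 w00 expr0n.
have Nw0 : - w0 != 0 by rewrite oppr_eq0.
have Nw2 : (- w0) ^+ 2 = branch_poly p z by rewrite sqrrN.
have [ac Dc zc crdE] := z_chartP w00 w02.
have [ac' Dc' zc' crdE'] := z_chartP Nw0 Nw2.
have zi := zlike_invol zc.
have E : z_chart p (- w0) z = invol_chart (z_chart p w0) z.
  apply: (coord_inj zc'.1 zi.1); rewrite crdE'.
  have -> : crd false (invol_chart (z_chart p w0) z) = _ := coord_invol false (z_chart p w0 z).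
  by rewrite crdE.
have tr := transition_z (invol_chart_atlas ac) Dc zi Nw0 Dc' E.
have -> : sqval psi z = sqval (z_chart p w0) z.
  have [b eb] : exists b : bool, (crd false (psi z)).2 = (-1) ^+ b * w0.
    by apply: sqr_eq_sign; rewrite (coord_eq zl.1) zlike_crd // w02.
  case: b eb; rewrite ?expr0 ?expr1 ?mul1r ?mulN1r => eb.
    have Ez : z_chart p (- w0) z = psi z.
      by apply: (coord_inj zc'.1 zl.1); rewrite crdE' [RHS]surjective_pairing eb zlike_crd.
    rewrite /sqval !(transition_z ap Dz zl Nw0 Dc' Ez) // -!tr //.
    by rewrite !beta_invol !mulrNN.
  have Ez : z_chart p w0 z = psi z.
    by apply: (coord_inj zc.1 zl.1); rewrite crdE [RHS]surjective_pairing eb zlike_crd.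
  by rewrite /sqval !(transition_z ap Dz zl w00 Dc Ez).
rewrite !W_expand // -!(tr eta) // -!(tr beta) // !beta_invol /sqval.
have bE l : beta (z_chart p w0) z l = eta (z_chart p w0) z l - eta (invol_chart (z_chart p w0)) z l.
  by rewrite /beta /flin /fpull mulN1r.
by rewrite !bE; ring.
Qed.

Lemma sqval_ge0 psi z : 0 <= sqval psi z.
Proof. by rewrite /sqval addr_ge0 // -expr2 sqr_ge0. Qed.

Lemma branchE z : branch_poly p z = 0 -> exists2 i, (i < n)%N & z = q i.
Proof.
move=> bz; have := branch_pointsP branch_polyE z; rewrite bz eqxx => /negbFE/mapP[k].
by rewrite mem_iota => /andP[_ kn] ->; exists k.
Qed.

Lemma sheet_sum_ge0 z : 0 <= sheet_sum z.
Proof.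
have [/branchE[i iN ->]|bz] := eqVneq (branch_poly p z) 0; first by rewrite sheet_sum_branch.
have [ac Dc zc _] := z_chartP (wroot_neq0 bz) (wroot_sqr p z).
by rewrite (sheet_sum_chart bz ac Dc zc) sqval_ge0.
Qed.

Lemma sqval_bound psi z (m : C) (phi : chart R T) s (K : R) :
  (forall l, beta psi z l = beta phi s (m * l)) -> curve_atlas phi -> chart_dom phi s ->
  `|beta phi s 1| + `|beta phi s 'i| <= K -> sqval psi z <= 2 * K ^+ 2 * nrm m ^+ 2.
Proof.
move=> E ap Ds HK; have b l : nrm l = 1 -> `|beta psi z l| <= nrm m * K.
  move=> l1; rewrite E; apply: le_trans (form_bound _ beta_form ap Ds) _.
  by rewrite nrmM l1 mulr1 ler_wpM2l // nrm_ge0.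
have K0 : 0 <= K by apply: le_trans HK; rewrite addr_ge0.
have sq l : nrm l = 1 -> beta psi z l * beta psi z l <= (nrm m * K) ^+ 2.
  move=> /b h; rewrite -expr2 -real_normK ?num_real // ler_pXn2r ?nnegrE //.
  by rewrite mulr_ge0 ?nrm_ge0.
have n1 : nrm (1 : C) = 1 by exact: ComplexField.Normc.normc1.
have ni : nrm ('i : C) = 1 by rewrite /= expr0n expr1n add0r sqrtr1.
have := sq _ n1; have := sq _ ni; rewrite /sqval exprMn; lra.
Qed.

(** The coefficients of [beta] in [t] are bounded and enter squared, with the factor
    [nrm (t + t) ^- 2], while [nrm t ^+ 2] is [nrm (z - q i)]. *)
Lemma sheet_sum_pole i : (i < n)%N -> exists r M, [/\ 0 < r, 0 <= M &
  forall z, z != q i -> nrm (z - q i) < r -> sheet_sum z <= M / nrm (z - q i)].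
Proof.
move=> iN; have ac := gc_atlas (t_chart_good rot0 branch_polyE iN).
have D0 : chart_dom (tchart i) 0.
  by rewrite /= /t_dom /= expr0n addr0; apply: (strip_q q_sorted); rewrite addn0 // leqnn.
have [K K0 HK] := cont_bounded (form_continuous (l := 1) beta_form ac D0).
have [L L0 HL] := cont_bounded (form_continuous (l := 'i) beta_form ac D0).
have N : \forall t \near (0 : C), `|beta (tchart i) t 1| + `|beta (tchart i) t 'i| <= K + L.
  by apply: filterS2 HK HL => t *; exact: lerD.
have /nbhsC_nrm[r r0 Hr] : \forall z \near q i, strip 0 i z /\ forall t, t ^+ 2 = z - q i ->
    `|beta (tchart i) t 1| + `|beta (tchart i) t 'i| <= K + L.
  by apply: filterS2 (near_strip q_sorted iN) (near_sqrt q i N) => z; split.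
exists r, ((K + L) ^+ 2); split=> //; first exact: sqr_ge0.
move=> z zq zr; have [sz Hz] := Hr z zr.
have bz : branch_poly p z != 0.
  rewrite (branch_poly_outer0 rot0 branch_polyE z iN) mulf_neq0 ?subr_eq0 //.
  by rewrite expf_neq0 // outer_root_neq0.
have [ap Dz zl _] := z_chartP (wroot_neq0 bz) (wroot_sqr p z).
have [t tE [t0 Dt H]] := transition_t rot0 branch_polyE ap Dz zl iN sz.
rewrite (sheet_sum_chart bz ap Dz zl).
apply: le_trans (sqval_bound (H beta beta_form) ac Dt (Hz t tE)) _.
rewrite nrmV -tE nrmX.
have tt : nrm (t + t) = 2 * nrm t.
  by rewrite (_ : t + t = toC 2 * t) ?nrmM ?nrm_real ?ger0_norm // /toC rmorphMn /= mulr_natl mulr2n.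
have nt : 0 < nrm t by rewrite -nrm_gt0 tt pmulr_rgt0 in t0.
rewrite tt; have -> : 2 * (K + L) ^+ 2 * (2 * nrm t)^-1 ^+ 2 = (K + L) ^+ 2 / nrm t ^+ 2 / 2.
  by field; rewrite gt_eqF.
have : 0 <= (K + L) ^+ 2 / nrm t ^+ 2 by rewrite divr_ge0 ?sqr_ge0.
by lra.
Qed.

(** The factor [- (z ^- 2)] of the change to [u = z^-1] enters squared, which gives the fourth
    power. *)
Lemma sheet_sum_infinity : exists r M, [/\ 0 < r, 0 <= M &
  forall z, r <= nrm z -> sheet_sum z <= M / nrm z ^+ 4].
Proof.
have D0 := @inf_dom0 R g p; have ac (b : bool) := gc_atlas (inf_chart_good p b).
have bnd (b : bool) : exists2 M, 0 <= M & \forall u \near (0 : C),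
    `|beta (inf_chart p b) u 1| + `|beta (inf_chart p b) u 'i| <= M.
  have [M M0 HM] := cont_bounded (form_continuous (l := 1) beta_form (ac b) D0).
  have [L L0 HL] := cont_bounded (form_continuous (l := 'i) beta_form (ac b) D0).
  by exists (M + L); [exact: addr_ge0|apply: filterS2 HM HL => u *; exact: lerD].
have [M M0 HM] := bnd true; have [L L0 HL] := bnd false.
have N : \forall u \near (0 : C), inf_dom p u /\
    forall b : bool, `|beta (inf_chart p b) u 1| + `|beta (inf_chart p b) u 'i| <= M + L.
  have nD := open_nbhs_nbhs (conj (@open_inf_dom _ _ p) D0).
  have nb : \forall u \near (0 : C), forall b : bool,
      `|beta (inf_chart p b) u 1| + `|beta (inf_chart p b) u 'i| <= M + L.
    by apply: filterS2 HM HL => u h1 h2 []; lra.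
  by apply: filterS2 nD nb => u; split.
have [r r0 Hr] := near_infinity N; exists r, (2 * (M + L) ^+ 2); split=> //.
  by rewrite mulr_ge0 // sqr_ge0.
move=> z zr; have [z0 [Du Hu]] := Hr z zr.
have [/branchE[i iN ->]|bz] := eqVneq (branch_poly p z) 0.
  by rewrite sheet_sum_branch // divr_ge0 ?exprn_ge0 ?nrm_ge0 // mulr_ge0 // sqr_ge0.
have [ap Dz zl _] := z_chartP (wroot_neq0 bz) (wroot_sqr p z).
have [b Hb] := transition_inf ap Dz zl z0 Du.
rewrite (sheet_sum_chart bz ap Dz zl).
apply: le_trans (sqval_bound (Hb beta beta_form) (ac b) Du (Hu b)) _.
by rewrite nrmN nrmV nrmX exprVn -exprM.
Qed.

Lemma sheet_sum_near z : branch_poly p z != 0 ->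
  \forall y \near z, sheet_sum y = sqval (z_chart p (wroot p z)) y.
Proof.
move=> bz; have [ac Dc _ _] := z_chartP (wroot_neq0 bz) (wroot_sqr p z).
have bn : \forall y \near z, branch_poly p y != 0.
  by apply: cts_near_neq0 bz; apply: (C1_cont (@idCc R)); exact: branch_poly_C1.
have crdE s := z_chart_crd p s (wroot_neq0 bz).
apply: filterS2 bn (atlas_near ac Dc) => y b_y Dy.
have zl_y : zlike (z_chart p (wroot p z)) y.
  by split; [case: (crdE y)|apply: near_all => s; case: (crdE s) => _ ->].
exact: (sheet_sum_chart b_y ac Dy zl_y).
Qed.

Lemma sqval_continuous z : branch_poly p z != 0 ->
  {for z, continuous (sqval (z_chart p (wroot p z)))}.
Proof.
move=> bz; have [ac Dc _ _] := z_chartP (wroot_neq0 bz) (wroot_sqr p z).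
by apply: contD; apply: contM; exact: form_continuous beta_form ac Dc.
Qed.

Lemma sheet_sum_dominated : dominated sheet_sum [set: C].
Proof.
have [r [M [r0 M0 HM]]] := sheet_sum_infinity.
rewrite -(setUv (square 0 r)); apply: dominatedU; last exact: dominated_infinity HM.
apply: dominated_compact; first by rewrite square0; exact: square_compact.
move=> z _; have [/branchE[i iN ->]|bz] := eqVneq (branch_poly p z) 0.
  have [e [L [e0 L0 HL]]] := sheet_sum_pole iN.
  exists (square (q i) (e / 4)); first by apply: square_nbhs; rewrite divr_gt0.
  by apply: dominated_pole HL; rewrite ?sheet_sum_branch.
have [L L0 HL] := cont_bounded (sqval_continuous bz).
have dL : dominated sheet_sum ([set y | sheet_sum y <= L] `&` square z 1).
  by apply: (@dominated_bounded _ _ _ _ L) => y.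
exists ([set y | sheet_sum y <= L] `&` square z 1) => //.
apply: filterI; last exact: square_nbhs.
by apply: filterS2 HL (sheet_sum_near bz) => y h E; move: h; rewrite ger0_norm ?sqval_ge0 // -E.
Qed.

Lemma sheet_sum_zero z : branch_poly p z != 0 -> sheet_sum z = 0.
Proof.
move=> bz; apply/eqP; rewrite eq_le sheet_sum_ge0 andbT leNgt; apply/negP => J0.
(* By definition [curve_integral W] is the integral of [sheet_sum] over the plane. *)
have int0 := eta_ortho beta_closed.
have e0 : 0 < sheet_sum z / 2 by rewrite divr_gt0.
apply: (zero_integral_zero sheet_sum_ge0 sheet_sum_dominated int0 e0).
have E := sheet_sum_near bz.
have lt : sheet_sum z / 2 < sqval (z_chart p (wroot p z)) z.
  by rewrite -(nbhs_singleton E) ltr_pdivrMr // ltr_pMr // ltr1n.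
by apply: filterS2 E (near_gt (sqval_continuous bz) lt) => y -> /ltW.
Qed.

Lemma invariant_primitive psi t l : curve_atlas psi -> chart_dom psi t ->
  eta (invol_chart psi) t l = eta psi t l.
Proof.
move=> ap Dt; suff : beta psi t l = 0.
  by rewrite /beta /flin /fpull mulN1r => /eqP; rewrite subr_eq0 => /eqP.
apply: (form_vanishes rot0 q_sorted branch_polyE beta_form _ l ap Dt) => w0 z m w00 wE.
have bz : branch_poly p z != 0 by rewrite -wE expf_neq0.
have [aq Dq zl _] := z_chartP w00 wE.
have := sheet_sum_zero bz; rewrite (sheet_sum_chart bz aq Dq zl) /sqval => /eqP.
rewrite paddr_eq0 -?expr2 ?sqr_ge0 // !expf_eq0 /= => /andP[/eqP b1 /eqP bi].
by rewrite (form_lin m beta_form aq Dq) b1 bi !mulr0 addr0.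
Qed.

End InvariantPrimitive.

(** * Iterated integrals along symmetric loops *)

Section Reflection.
Context (R : realType).
Local Notation mu := (@lebesgue_measure R).
Local Notation leb2 := (lebesgue_measure \x lebesgue_measure)%E.
Local Notation RR := (measurableTypeR R * measurableTypeR R)%type.
Implicit Types (f h : R -> R).

Definition refl (x : measurableTypeR R) : measurableTypeR R := 1 - (x : R).

Lemma measurable_refl : measurable_fun setT refl.
Proof. by apply: measurable_funB. Qed.

(** Lebesgue measure is determined by its values on half-open intervals, and reflection only
    exchanges the open end with the closed one. *)
Lemma lebesgue_measure_refl (A : set R) : measurable A ->
  pushforward mu refl A = mu A.
Proof.
move=> mA; apply/esym/lebesgue_measure_unique => //=; first exact: measurable_refl.
move=> _ _ [[a b]] _ <-; rewrite /pushforward.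
have -> : refl @^-1` `]a, b]%classic = `[1 - b, 1 - a[%classic.
  by apply/seteqP; split=> x /=; rewrite /refl !in_itv /=; lra.
rewrite !lebesgue_measure_itv /= !lte_fin.
have -> : (1 - b < 1 - a) = (a < b) by lra.
by case: ifP => // _; rewrite -!EFinD; congr (_%:E); lra.
Qed.

Lemma integral_refl (f : R -> \bar R) : measurable_fun setT f ->
  mu.-integrable setT (f \o refl) ->
  (\int[mu]_x f (1 - x)%R = \int[mu]_x f x)%E.
Proof.
move=> mf fi.
have := @integral_pushforward _ _ _ _ R refl measurable_refl mu setT f mf.
rewrite preimage_setT => /(_ fi measurableT) <-.
apply: eq_measure_integral; first exact: measurable_refl.
by move=> mr A mA _; exact: lebesgue_measure_refl.
Qed.

Definition bms f : Prop := [/\ measurable_fun setT f, exists M, forall x, `|f x| <= M &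
  forall x, ~ (0 <= x <= 1) -> f x = 0].

Lemma bms_integrable f : bms f -> mu.-integrable setT (EFin \o f).
Proof.
move=> [mf [M fM] f0].
pose S : set (measurableTypeR R) := `[0, 1]%classic.
have mS : measurable S by exact: measurable_itv.
have -> : EFin \o f = (EFin \o f) \_ S.
  apply/funext => x; rewrite /patch; case: ifPn => //; rewrite notin_setE /S /= in_itv /= => x1.
  by rewrite f0 // => x2; apply: x1; exact/andP.
apply: (proj1 (integrable_mkcond _ mS)).
apply: measurable_bounded_integrable => //.
- by rewrite /= lebesgue_measure_itv /= lte_fin ltr01 -EFinD ltry.
- exact: measurable_funTS.
- by exists M; split; [exact: num_real|move=> N MN x _; exact: le_trans (fM x) (ltW MN)].
Qed.

Lemma bms_refl f : bms f -> bms (fun x => f (1 - x)).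
Proof.
move=> [mf [M fM] f0]; split.
- exact: (measurableT_comp mf measurable_refl).
- by exists M => x; exact: fM.
- by move=> x x1; apply: f0 => x2; apply: x1; lra.
Qed.

Lemma Rint_refl f : bms f -> (\int[mu]_x (f (1 - x)%R)%:E = \int[mu]_x (f x)%:E)%E.
Proof.
move=> bf; apply: (@integral_refl (EFin \o f)).
  by case: bf => mf _ _; exact/measurable_EFinP.
exact: bms_integrable (bms_refl bf).
Qed.

(** The value [true] selects the triangle of the iterated integral, [false] the opposite one. *)
Definition tri (b : bool) f h (t : RR) : R :=
  if (if b then t.1 <= t.2 :> R else t.2 <= t.1 :> R) then f t.1 * h t.2 else 0.

Lemma tri_integrable b f h : bms f -> bms h -> leb2.-integrable setT (EFin \o tri b f h).
Proof.
move=> [mf [M fM] f0] [mh [N hN] h0].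
have M0 : 0 <= M by apply: le_trans (fM 0).
have N0 : 0 <= N by apply: le_trans (hN 0).
set S : set RR := `[0, 1]%classic `*` `[0, 1]%classic.
have mS : measurable S by apply: measurableX.
have -> : EFin \o tri b f h = (EFin \o tri b f h) \_ S.
  apply/funext => x; rewrite /patch; case: ifPn => //; rewrite notin_setE /= => x1.
  rewrite /tri; case: ifP => // _; case: (pselect (0 <= x.1 <= 1)) => [a1|/f0 ->]; last by rewrite mul0r.
  case: (pselect (0 <= x.2 <= 1)) => [a2|/h0 ->]; last by rewrite mulr0.
  by exfalso; apply: x1; rewrite /S /= !in_itv.
apply: (proj1 (integrable_mkcond _ mS)).
apply: measurable_bounded_integrable => //.
- change ((lebesgue_measure \x lebesgue_measure)%E S < +oo)%E.
  by rewrite product_measure1E //= !lebesgue_measure_itv /= lte_fin ltr01 -!EFinD -EFinM ltry.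
- apply: measurable_funTS; apply: measurable_fun_ifT.
  + by case: (b); apply: measurable_fun_ler.
  + apply: measurable_funM; first exact: (measurableT_comp mf measurable_fst).
    exact: (measurableT_comp mh measurable_snd).
  + exact: measurable_cst.
- exists (M * N); split; first exact: num_real.
  move=> L ML x _; apply: le_trans (ltW ML); rewrite /tri; case: ifP => _.
    by rewrite normrM; apply: ler_pM.
  by rewrite normr0 mulr_ge0.
Qed.

Lemma tri_row b y f h : bms f -> bms h -> bms (fun x => tri b f h (x, y)).
Proof.
move=> [mf [M fM] f0] [mh [N hN] h0]; split.
- apply: measurable_fun_ifT.
  + by case: b; apply: measurable_fun_ler; (try exact: measurable_id); exact: measurable_cst.
  + have hy : measurable_fun setT (cst (h y) : R -> R) by exact: measurable_cst.
    exact: measurable_funM mf hy.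
  + exact: measurable_cst.
- exists (M * N) => x; rewrite /tri; case: ifP => _ /=.
    by rewrite normrM; apply: ler_pM.
  by rewrite normr0 mulr_ge0 //; [apply: le_trans (fM 0)|apply: le_trans (hN 0)].
- by move=> x x1; rewrite /tri; case: ifP => //= _; rewrite f0 ?mul0r.
Qed.

Lemma tri_col b x f h : bms f -> bms h -> bms (fun y => tri b f h (x, y)).
Proof.
move=> bf bh; have := tri_row (~~ b) x bh bf.
suff -> : (fun y => tri b f h (x, y)) = (fun y => tri (~~ b) h f (y, x)) by [].
by apply/funext => y; rewrite /tri /= mulrC; case: b.
Qed.

(** Reflecting both variables exchanges the two triangles; by Fubini this amounts to one reflection
    in each variable. *)
Lemma tri_refl f h : bms f -> bms h -> (forall x, f (1 - x) = f x) ->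
  (forall x, h (1 - x) = h x) ->
  (\int[leb2]_t (tri true f h t)%:E = \int[leb2]_t (tri false f h t)%:E)%E.
Proof.
move=> bf bh fr hr.
have it := tri_integrable true bf bh; have ik := tri_integrable false bf bh.
pose G b := (fun x : measurableTypeR R => \int[mu]_y (tri b f h (x, y))%:E)%E.
have e1 : (\int[leb2]_t (tri true f h t)%:E = \int[mu]_x G true x)%E.
  by rewrite -(integral12_prod_meas1 it).
have e2 : (\int[leb2]_t (tri false f h t)%:E = \int[mu]_x G false x)%E.
  by rewrite -(integral12_prod_meas1 ik).
rewrite e1 e2.
have Gr : G false \o refl = G true.
  apply/funext => x; rewrite /G /= -(Rint_refl (tri_col _ _ bf bh)).
  apply: eq_integral => y _; rewrite /tri /refl /= fr hr.
  by have -> : (1 - y <= 1 - x) = (x <= y) by lra.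
have := @integral_refl (G false) (measurable_fubini_F ik).
rewrite Gr => /(_ (integrable_fubini_F it)) <-.
by rewrite -Gr.
Qed.

(** The two triangles have equal integrals and fill the square up to the diagonal, so twice one of
    them is the product. *)
Lemma chen_symmetric f h : bms f -> bms h -> (forall x, f (1 - x) = f x) ->
  (forall x, h (1 - x) = h x) ->
  2 * \int[leb2]_t tri true f h t = \int[mu]_x f x * \int[mu]_x h x.
Proof.
move=> bf bh fr hr.
have it := tri_integrable true bf bh; have ik := tri_integrable false bf bh.
have hi := bms_integrable bh; have fi := bms_integrable bf.
have key : ((\int[leb2]_t (tri true f h t)%:E + \int[leb2]_t (tri true f h t)%:E)%E =
    (\int[mu]_x (f x)%:E * \int[mu]_x (h x)%:E)%E).
  rewrite {2}(tri_refl bf bh fr hr) -integralD //.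
  rewrite -(integral21_prod_meas1 (integrableD measurableT it ik)) /=.
  have fE : (\int[mu]_x (f x)%:E)%E = (\int[mu]_x f x)%:E.
    by rewrite /Rintegral fineK //; exact: integrable_fin_num.
  rewrite fE -integralZl //; apply: eq_integral => y _.
  rewrite muleC -[RHS]/((h y)%:E * (\int[mu]_x f x)%:E)%E -fE -integralZl //.
  apply: ae_eq_integral => //=.
  - apply/measurable_EFinP; apply: measurable_funD.
      by case: (tri_row true y bf bh).
    by case: (tri_row false y bf bh).
  - by apply/measurable_EFinP; apply: measurable_funM => //; case: bf.
  (* Both triangles contain the diagonal, but on each row it is the single point [y], a null set. *)
  exists [set y]; split; [exact: measurable_set1|exact: lebesgue_measure_set1|].
  move=> x /= nx; apply: contrapT => xy; apply: nx => _.
  rewrite /tri /=; have [xy'|yx|xy'] := ltgtP x y; rewrite -?EFinD ?addr0 ?add0r ?EFinM 1?muleC //.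
have aF := integrable_fin_num measurableT it.
rewrite [in RHS]/Rintegral -fineM ?integrable_fin_num // -key fineD //.
by rewrite mulr_natl mulr2n.
Qed.

End Reflection.

Section Affine.
Context (R : realType) (a : R) (h : R -> R).
Local Notation C := (R[i]^o).
Hypothesis hE : forall x y, h x - h y = a * (x - y).

Lemma aff_cont s : {for s, continuous h}.
Proof.
have -> : h = (fun x => h 0 + a * x) by apply/funext => x; rewrite -[in RHS](subr0 x) -hE subrKC.
by apply: contD; [exact: cont_cst|apply: contM; [exact: cont_cst|exact: cont_id]].
Qed.

Lemma aff_has_d (c : R -> C) s v : has_d (@toC R) c (h s) v ->
  has_d (@toC R) (fun r => c (h r)) s (toC a * v).
Proof.
move=> /has_dP[phi [pc <- pE]]; apply/has_dP; exists (fun r => toC a * phi (h r)); split => //.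
  by apply: ctsM; [exact: cts_cst|exact: (cts_comp (h := h) (@aff_cont s) pc)].
move=> y; rewrite pE /toC; have -> : ((h y)%:C - (h s)%:C = (y%:C - s%:C) * a%:C :> C).
  by rewrite -!rmorphB -rmorphM hE mulrC.
by rewrite mulrA.
Qed.

Lemma aff_C1at (c : R -> C) s : C1at (@toC R) c (h s) -> C1at (@toC R) (fun r => c (h r)) s.
Proof.
move=> /C1P[v vP]; apply/C1P; exists (fun r => toC a * v (h r)).
have N : \forall r \near s, has_d (@toC R) c (h r) (v (h r)) /\ cts v (h r).
  exact: (aff_cont vP).
apply: filterS N => r [hd hc]; split; first exact: aff_has_d.
by apply: ctsM; [exact: cts_cst|exact: (cts_comp (h := h) (@aff_cont r) hc)].
Qed.

End Affine.

(** * Pullbacks of forms along piecewise differentiable paths *)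

Section Pullback.
Context (R : realType) (g : nat) (p : 'I_(2 * g + 2) -> R[i]^o).
Local Notation C := (R[i]^o).
Local Notation T := (curve p).
Local Notation n := (2 * g + 2)%N.
Local Notation form := (form1 R T).
Local Notation atlas := (@curve_atlas R g p).
Local Notation is_form := (is_form1 atlas).
Context (q : nat -> C) (rot : C).
Hypothesis rot0 : rot != 0.
Hypothesis q_sorted : forall i j, (i < j)%N -> (j < n)%N ->
  ell rot (q i) < ell rot (q j).
Hypothesis branch_polyE : forall z, branch_poly p z = \prod_(k <- iota 0 n) (z - q k).
Local Notation tchart i := (t_chart p q rot i).
Implicit Types (w : form) (psi phi : chart R T) (gamma : R -> T) (s t : R) (P : T).

Lemma good_cover P : exists psi inv, good_chart psi inv /\ chart_img psi inv P.
Proof.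
case: (pselect (piece false P)) => [aP|iP].
  have [i iN zi] := strip_cover rot0 q_sorted (crd false P).1.
  exists (tchart i), (t_inv q rot i); split; first exact: (t_chart_good rot0 branch_polyE iN).
  by apply/(timgP rot0 branch_polyE) => //.
have [b ->] := icenterP iP.
exists (inf_chart p b), (fun Q => (crd true Q).1); split; first exact: inf_chart_good.
exact: (iimg_ichart (p := p) b (inf_dom0 p)).
Qed.

Definition pulled w psi (c : R -> C) t : R := w psi (c t) (velocity c t).

Lemma pulled_good w psi (c : R -> C) t gamma phi inv : is_form w -> atlas psi ->
  C1_near c t -> chart_dom psi (c t) -> (\forall s \near t, gamma s = psi (c s)) ->
  good_chart phi inv -> chart_img phi inv (gamma t) ->
  exists2 v : C, has_d (@toC R) (fun s => inv (gamma s)) t v &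
    pulled w psi c t = w phi (inv (gamma t)) v.
Proof.
move=> wf aP cC dP gE gc [di pi].
have gt : gamma t = psi (c t) := nbhs_singleton gE.
rewrite gt in di pi.
have [d hd wE] := form_transition aP dP gc di pi.
exists (d * velocity c t); last by rewrite gt -wE.
have := has_d_comp (@toCc R) (C1_near_has_d cC) hd.
apply: (has_d_near (@toC_inj R)).
by apply: filterS gE => s ->.
Qed.

(** Two local expressions of [gamma] give the same value: seen in a good chart with inverse [inv],
    both are the form applied to the derivative of [inv \o gamma]. *)
Lemma pullbackE w psi (c : R -> C) t gamma : is_form w -> atlas psi ->
  C1_near c t -> chart_dom psi (c t) -> (\forall s \near t, gamma s = psi (c s)) ->
  pullback atlas gamma w t = pulled w psi c t.
Proof.
move=> wf aP cC dP gE.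
have [phi [inv [gc gi]]] := good_cover (gamma t).
have [v hv ->] := pulled_good wf aP cC dP gE gc gi.
rewrite /pullback; set S := [set y | _].
have Sn : S (pulled w psi c t) by exists psi, c.
have [psi' [c' [aP' cC' dP' gE' ->]]] : S (xget 0 S) := xgetPex 0 (ex_intro _ _ Sn).
have [v' hv' e'] := pulled_good wf aP' cC' dP' gE' gc gi.
by rewrite -/(pulled w psi' c' t) e' (has_d_uniqR hv hv').
Qed.

Lemma C1_near_cts (c : R -> C) t : C1_near c t -> cts c t.
Proof. by move/C1_near_has_d/has_d_cont => /(_ (@toCc R)). Qed.

Lemma continuous_near (f h : R -> R) t : (\forall s \near t, f s = h s) ->
  {for t, continuous f} -> {for t, continuous h}.
Proof.
move=> fh /continuousRP fc; apply/continuousRP => e /fc.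
by rewrite (nbhs_singleton fh); apply: filterS2 fh => s ->.
Qed.

Lemma pulled_continuous w psi (c : R -> C) t : is_form w -> atlas psi ->
  C1_near c t -> chart_dom psi (c t) -> {for t, continuous (pulled w psi c)}.
Proof.
move=> wf aP cC dP.
have ct : {for t, continuous c} by apply/ctsP; exact: C1_near_cts.
have near_dom : \forall s \near t, chart_dom psi (c s) := ct _ (atlas_near aP dP).
have [_ _ cre cim] := nbhs_singleton cC.
pose h s := complex.Re (velocity c s) * w psi (c s) 1 +
  complex.Im (velocity c s) * w psi (c s) 'i.
have hc : {for t, continuous h}.
  have wc (l : C) : {for t, continuous (fun s => w psi (c s) l)}.
    have /continuousRP H := form_continuous (l := l) wf aP dP.
    by apply/continuousRP => e e0; exact: (ct _ (H e e0)).
  by apply: contD; apply: contM.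
have hE : \forall s \near t, h s = pulled w psi c s.
  by apply: filterS near_dom => s ds; rewrite /pulled (form_lin _ wf aP ds).
exact: continuous_near hE hc.
Qed.

Lemma continuous_near_bounded (f : R -> R) t : {for t, continuous f} ->
  \forall s \near t, `|f s| <= `|f t| + 1.
Proof.
move=> /continuousRP /(_ 1 ltr01); apply: filterS => s fs.
rewrite -lerBlDl; apply: le_trans (ltW fs).
by rewrite lerBlDl; apply: le_trans (ler_normD _ _) => //; rewrite subrKC.
Qed.

(** The path may have a kink at [t], but on each side it follows one [C1_near] curve in a chart,
    whose pullback is continuous up to [t]. *)
Lemma pullback_near w gamma t : is_form w -> piecewise_C1 atlas gamma -> 0 <= t <= 1 ->
  exists M, \forall s \near t, s != t -> 0 < s < 1 ->
    {for s, continuous (pullback atlas gamma w)} /\ `|pullback atlas gamma w s| <= M.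
Proof.
move=> wf pg t01; have [psi [c [d [aP [cC dC] dc dd gE]]]] := pg t t01.
exists (Num.max (`|pulled w psi c t| + 1) (`|pulled w psi d t| + 1)).
have side (e : R -> C) (S : set R) : C1_near e t -> chart_dom psi (e t) -> open S ->
    (\forall s \near t, S s -> gamma s = psi (e s)) ->
    \forall s \near t, S s -> {for s, continuous (pullback atlas gamma w)} /\
      `|pullback atlas gamma w s| <= `|pulled w psi e t| + 1.
  move=> eC de oS egE.
  have ect : {for t, continuous e} by apply/ctsP; exact: C1_near_cts.
  have n1 : \forall s \near t, chart_dom psi (e s) := ect _ (atlas_near aP de).
  have n2 := near_join n1; have n3 : \forall s \near t, C1_near e s := near_join eC.
  have n33 := near_join n3. have n4 := near_join egE.
  have n5 := continuous_near_bounded (pulled_continuous wf aP eC de).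
  near=> s => Ss.
  have Sn : \forall r \near s, S r by exact: open_nbhs_nbhs.
  have h1 : \forall r \near s, chart_dom psi (e r) by near: s.
  have h3 : \forall r \near s, C1_near e r by near: s.
  have h4 : \forall r \near s, S r -> gamma r = psi (e r) by near: s.
  have h4' : \forall r \near s, gamma r = psi (e r) by apply: filterS2 Sn h4 => r Sr; exact.
  have h6 : \forall r \near s, pulled w psi e r = pullback atlas gamma w r.
    have h7 := near_join h4'; near=> r.
    symmetry; apply: (pullbackE wf aP); near: r => //.
  split; last first.
    by rewrite -(nbhs_singleton h6); near: s.
  apply: continuous_near h6 _.
  by apply: (pulled_continuous wf aP); [exact: nbhs_singleton h3|exact: nbhs_singleton h1].
have oI (a b : R) : open [set s | a < s < b].
  have -> : [set s | a < s < b] = `]a, b[%classic by apply/seteqP; split=> x /=; rewrite in_itv.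
  exact: interval_open.
have L : \forall s \near t, 0 < s < t -> {for s, continuous (pullback atlas gamma w)} /\
    `|pullback atlas gamma w s| <= `|pulled w psi c t| + 1.
  apply: (side c [set s | 0 < s < t] cC dc (oI _ _)).
  by apply: filterS gE => s [h _] /= st; apply: h; lra.
have U : \forall s \near t, t < s < 1 -> {for s, continuous (pullback atlas gamma w)} /\
    `|pullback atlas gamma w s| <= `|pulled w psi d t| + 1.
  apply: (side d [set s | t < s < 1] dC dd (oI _ _)).
  by apply: filterS gE => s [_ h] /= st; apply: h; lra.
apply: filterS2 L U => s L U st s01.
have [ts|ts|/eqP] := ltgtP t s; last by rewrite eq_sym (negPf st).
  have /U[fc fM] : t < s < 1 by lra.
  by split=> //; rewrite le_max fM orbT.
have /L[fc fM] : 0 < s < t by lra.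
by split=> //; rewrite le_max fM.
Unshelve. all: by end_near.
Qed.

(** By [interval_induction]: around each parameter the pullback is continuous and bounded except at
    the parameter itself, and both properties pass to adjacent intervals. *)
Lemma pullback_measurable w gamma : is_form w -> piecewise_C1 atlas gamma ->
  measurable_fun (`](0 : R), 1[%classic : set R) (pullback atlas gamma w) /\
  exists M, forall x, 0 < x < 1 -> `|pullback atlas gamma w x| <= M.
Proof.
move=> wf pg; set f := pullback atlas gamma w.
pose Pr a b := measurable_fun (`]a, b[%classic : set R) f /\
  exists M, forall x, a < x < b -> `|f x| <= M.
apply: (@interval_induction R Pr) => [a b c ab bc [ma [M fM]] [mb [N fN]]|t t01].
  split.
    apply: (@measurable_funS _ _ _ _ ((`]a, b[%classic : set R) `|` [set b] `|` (`]b, c[%classic : set R))).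
    - by apply: measurableU => //; apply: measurableU.
    - move=> x /=; rewrite !in_itv /=.
      by case: (ltgtP x b) => [xb|xb|->]; [left; left|right|left; right]; lra.
    - apply/measurable_funU => //; first exact: measurableU.
      by split => //; apply/measurable_funU => //; split=> //; exact: measurable_fun_set1.
  exists (Num.max (Num.max M N) `|f b|) => x xac; rewrite !le_max.
  case: (ltgtP x b) => [xb|xb|->]; last by rewrite lexx !orbT.
    by rewrite fM //; lra.
  by rewrite fN ?orbT //; lra.
have [M] := pullback_near wf pg t01.
move=> /nbhs_ballP[e /= e0 he]; exists e => // a b ta ab be a0 b1; split; last first.
  exists (Num.max M `|f t|) => x xab; rewrite le_max.
  have [->|xt] := eqVneq x t; first by rewrite lexx orbT.
  have [|//||_ ->//] := he x; last by lra.
  by rewrite /ball /= ltr_norml; lra.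
have piece_cont (S : set R) : open S -> ~ S t -> measurable_fun ((`]a, b[%classic : set R) `&` S) f.
  move=> oS St; apply: open_continuous_measurable_fun.
    by apply: openI => //; exact: interval_open.
  move=> x; rewrite inE => -[/=]; rewrite in_itv /= => xab Sx.
  have [|||//] := he x; last by lra.
    by rewrite /ball /= ltr_norml; lra.
  by apply/eqP => xt; apply: St; rewrite -xt.
apply: (@measurable_funS _ _ _ _ (((`]a, b[%classic : set R) `&` (`]-oo, t[%classic : set R)) `|` [set t] `|`
  ((`]a, b[%classic : set R) `&` (`]t, +oo[%classic : set R)))).
- apply: measurableU; last exact: measurableI.
  by apply: measurableU => //; exact: measurableI.
- move=> x /=; rewrite !in_itv /= andbT => xab.
  by case: (ltgtP x t) => [xt|xt|->]; [left; left|right|left; right].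
apply/measurable_funU; [|exact: measurableI|].
  by apply: measurableU => //; exact: measurableI.
split; last by apply: piece_cont; [exact: interval_open|rewrite /= in_itv /= ltxx].
apply/measurable_funU => //; first exact: measurableI.
split; last exact: measurable_fun_set1.
by apply: piece_cont; [exact: interval_open|rewrite /= in_itv /= ltxx].
Qed.

Definition cut (f : R -> R) (x : R) : R := if 0 <= x <= 1 then f x else 0.

Lemma pullback_bms w gamma : is_form w -> piecewise_C1 atlas gamma ->
  bms (cut (pullback atlas gamma w)).
Proof.
move=> wf pg; have [mf [M fM]] := pullback_measurable wf pg.
set f := pullback atlas gamma w in mf fM *.
split.
- pose S : set (measurableTypeR R) := `[0, 1]%classic.
  have mS : measurable S by exact: measurable_itv.
  have -> : cut f = f \_ S.
    apply/funext => x; rewrite /cut /patch.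
    by case: ifP => x01; case: ifPn => //; rewrite ?notin_setE ?inE /S /= in_itv /= x01.
  apply/(measurable_restrictT f mS).
  apply: (@measurable_funS _ _ _ _ ([set (0 : R)] `|` (`](0 : R), 1[%classic : set R) `|` [set 1])).
  + by apply: measurableU => //; apply: measurableU.
  + move=> x; rewrite /S /= !in_itv /= => /andP[x0 x1].
    by case: (ltgtP x 0) x0 => // [x0 _|-> _]; [|by left; left]; case: (ltgtP x 1) x1 => // [x1 _|-> _];
      [left; right|right].
  + apply/measurable_funU => //; first exact: measurableU.
    split; last exact: measurable_fun_set1.
    by apply/measurable_funU => //; split=> //; exact: measurable_fun_set1.
- exists (Num.max (Num.max M 0) (Num.max `|f 0| `|f 1|)) => x; rewrite !le_max /cut.
  case: ifP => [/andP[]|_]; last by rewrite normr0 lexx orbT.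
  case: (ltgtP x 0) => // [x0 _|-> _ _]; last by rewrite lexx !orbT.
  by case: (ltgtP x 1) => // [x1 _|-> _]; [rewrite fM // x0|rewrite lexx !orbT].
- by move=> x /negP/negPf; rewrite /cut => ->.
Qed.

Lemma path_integral_cut w gamma : path_integral atlas gamma w =
  \int[lebesgue_measure]_x cut (pullback atlas gamma w) x.
Proof.
rewrite /path_integral Rintegral_mkcond; apply: eq_Rintegral => x _.
rewrite /patch /cut.
by case: ifPn; [rewrite inE|rewrite notin_setE] => /=; rewrite in_itv /=; [move=> ->|move=> /negP/negPf ->].
Qed.

Lemma chen_integral_cut a b gamma : chen_integral atlas gamma a b =
  \int[(lebesgue_measure \x lebesgue_measure)%E]_t
    tri true (cut (pullback atlas gamma a)) (cut (pullback atlas gamma b)) t.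
Proof.
rewrite /chen_integral Rintegral_mkcond; apply: eq_Rintegral => x _.
rewrite /patch /tri /cut.
case: ifPn; [rewrite inE|rewrite notin_setE] => /=.
  move=> [x0 [xx x1]]; rewrite xx x0 x1 (le_trans xx x1).
  by rewrite (le_trans x0 xx).
move=> nx; case: ifP => // xx.
case: ifP => [/andP[x0 _]|_]; last by rewrite mul0r.
by case: ifP => [/andP[_ x1]|_]; [exfalso; apply: nx|rewrite mulr0].
Qed.
Section Symmetric.
Context (gamma : R -> T).
Hypothesis gamma_pw : piecewise_C1 atlas gamma.
Hypothesis gamma_sym : forall t, gamma (1 - t) = invol (gamma t).

Lemma refl_aff (x y : R) : (1 - x) - (1 - y) = -1 * (x - y).
Proof. by ring. Qed.

Lemma cont_refl s : {for s, continuous (fun x : R => 1 - x)}.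
Proof. exact: (aff_cont refl_aff). Qed.

Lemma refl_has_d (c : R -> C) s v : has_d (@toC R) c (1 - s) v ->
  has_d (@toC R) (fun r => c (1 - r)) s (- v).
Proof.
move=> /(aff_has_d refl_aff); have -> : toC (-1) * v = - v by rewrite /toC rmorphN mulN1r.
by [].
Qed.

Lemma refl_C1_near (c : R -> C) s : C1_near c (1 - s) -> C1_near (fun r => c (1 - r)) s.
Proof. by move=> /C1_near_C1at cC; apply/C1_near_C1at; exact: (aff_C1at refl_aff cC). Qed.

(** Reversing the parameter gives a minus sign and the involution the factor [(-1) ^+ b]. So
    anti-invariant forms pull back to symmetric functions and invariant ones to antisymmetric
    functions. *)
Lemma pullback_refl (w : form) (b : bool) t : is_form w ->
  (forall psi x l, atlas psi -> chart_dom psi x ->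
    w (invol_chart psi) x l = (-1) ^+ b * w psi x l) ->
  pullback atlas gamma w (1 - t) = - ((-1) ^+ b * pullback atlas gamma w t).
Proof.
move=> wf wi.
have key t' : (exists psi (c : R -> C), [/\ atlas psi, C1_near c t', chart_dom psi (c t') &
    \forall s \near t', gamma s = psi (c s)]) ->
  pullback atlas gamma w (1 - t') = - ((-1) ^+ b * pullback atlas gamma w t').
  move=> [psi [c [aP cC dP gE]]]; rewrite (pullbackE wf aP cC dP gE).
  have t'E : 1 - (1 - t') = t' by rewrite subKr.
  have cC' : C1_near (fun r => c (1 - r)) (1 - t') by apply: refl_C1_near; rewrite t'E.
  have dP' : chart_dom (invol_chart psi) (c (1 - (1 - t'))) by rewrite t'E.
  have gE' : \forall s \near 1 - t', gamma s = invol_chart psi (c (1 - s)).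
    have gE1 : nbhs (1 - (1 - t')) [set s | gamma s = psi (c s)] by rewrite t'E.
    have gE2 : \forall s \near 1 - t', gamma (1 - s) = psi (c (1 - s)) := cont_refl gE1.
    by apply: filterS gE2 => s /= <-; rewrite -gamma_sym subKr.
  rewrite (pullbackE wf (invol_chart_atlas aP) cC' dP' gE').
  have hd : has_d (@toC R) (fun r => c (1 - r)) (1 - t') (- velocity c t').
    by apply: refl_has_d; rewrite t'E; exact: C1_near_has_d.
  rewrite /pulled (has_d_velocity hd) t'E (wi _ _ _ aP dP) (form_opp _ wf aP dP).
  by rewrite mulrN.
have sgnK (x : R) : - ((-1) ^+ b * - ((-1) ^+ b * x)) = x.
  by rewrite mulrN opprK mulrA -expr2 sqrr_sign mul1r.
(* The identity is symmetric under [t -> 1 - t]. If [gamma] has a local expression at neither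
   parameter, both pullbacks take the default value 0. *)
case: (pselect (exists psi (c : R -> C), [/\ atlas psi, C1_near c t, chart_dom psi (c t) &
    \forall s \near t, gamma s = psi (c s)])) => [/key //|n1].
case: (pselect (exists psi (c : R -> C), [/\ atlas psi, C1_near c (1 - t),
    chart_dom psi (c (1 - t)) & \forall s \near 1 - t, gamma s = psi (c s)])) => [/key|n2].
  by rewrite subKr => ->; rewrite sgnK.
have pb0 t' : ~ (exists psi (c : R -> C), [/\ atlas psi, C1_near c t', chart_dom psi (c t') &
    \forall s \near t', gamma s = psi (c s)]) -> pullback atlas gamma w t' = 0.
  move=> n; rewrite /pullback; case: xgetP => // y _ [psi [c [a1 a2 a3 a4 _]]].
  by case: n; exists psi, c.
by rewrite !pb0 // mulr0 oppr0.
Qed.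

Lemma cut_refl f (e : R) : (forall t, f (1 - t) = e * f t) ->
  forall t, cut f (1 - t) = e * cut f t.
Proof.
move=> fe t; rewrite /cut fe; have -> : (0 <= 1 - t <= 1) = (0 <= t <= 1) by lra.
by case: ifP => // _; rewrite mulr0.
Qed.

Lemma path_integral_invariant (w : form) : is_form w ->
  (forall psi x l, atlas psi -> chart_dom psi x -> w (invol_chart psi) x l = w psi x l) ->
  path_integral atlas gamma w = 0.
Proof.
move=> wf wi; rewrite path_integral_cut.
have bf := pullback_bms wf gamma_pw; set f := cut _ in bf *.
have fr t : f (1 - t) = -1 * f t.
  apply: cut_refl => {}t; rewrite (@pullback_refl w false) //; first by rewrite mul1r mulN1r.
  by move=> psi x l a1 a2; rewrite mul1r wi.
have := Rint_refl bf; rewrite /Rintegral.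
have fi := bms_integrable bf; have fF := integrable_fin_num measurableT fi.
have -> : (\int[lebesgue_measure]_x (f (1 - x))%:E = - \int[lebesgue_measure]_x (f x)%:E)%E.
  under eq_integral do rewrite fr EFinM.
  by rewrite integralZl // mulN1e.
move=> /(congr1 fine); rewrite fineN //.
set x := fine _; lra.
Qed.

Lemma chen_anti_invariant (v w : form) : is_form v -> is_form w ->
  (forall psi x l, atlas psi -> chart_dom psi x -> v (invol_chart psi) x l = - v psi x l) ->
  (forall psi x l, atlas psi -> chart_dom psi x -> w (invol_chart psi) x l = - w psi x l) ->
  2 * chen_integral atlas gamma v w = path_integral atlas gamma v * path_integral atlas gamma w.
Proof.
move=> vf wf vi wi; rewrite chen_integral_cut !path_integral_cut.
have pr u t : is_form u -> (forall psi x l, atlas psi -> chart_dom psi x ->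
    u (invol_chart psi) x l = - u psi x l) ->
    cut (pullback atlas gamma u) (1 - t) = cut (pullback atlas gamma u) t.
  move=> uf ui; rewrite (@cut_refl _ 1) ?mul1r // => {}t.
  rewrite (@pullback_refl u true) ?expr1 ?mulN1r ?opprK ?mul1r //.
  by move=> psi x l a1 a2; rewrite mulN1r ui.
by apply: chen_symmetric; try exact: pullback_bms; move=> x; exact: pr.
Qed.

End Symmetric.
End Pullback.

(** * Symmetric loops through two branch points *)

Section Spine.
Context (R : realType) (g : nat) (p : 'I_(2 * g + 2) -> R[i]^o).
Local Notation C := (R[i]^o).
Local Notation T := (curve p).
Local Notation n := (2 * g + 2)%N.
Local Notation atlas := (@curve_atlas R g p).
Context (q : nat -> C) (rot : C).
Hypothesis rot0 : rot != 0.
Hypothesis q_sorted : forall i j, (i < j)%N -> (j < n)%N ->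
  ell rot (q i) < ell rot (q j).
Hypothesis branch_polyE : forall z, branch_poly p z = \prod_(k <- iota 0 n) (z - q k).
Local Notation loop := (loop p q rot).
Local Notation PC := (pc int [set: T]).
Local Notation pathT := (@path_in R T [set: T]).
Implicit Types (s t x y : R) (i j k : nat).

Lemma smooth_reparam (a : R) (h : R -> R) (f : R -> T) b s :
  (forall x y, h x - h y = a * (x - y)) -> smooth_curve true (@toC R) b f (h s) ->
  smooth_curve true (@toC R) b (fun r => f (h r)) s.
Proof.
move=> hE [n1 s1 s2]; split; first exact: (aff_cont hE n1).
- exact: (aff_C1at hE s1).
- exact: (aff_C1at hE s2).
Qed.

Lemma chart_curve psi inv (h : R -> T) b t : good_chart psi inv ->
  chart_img psi inv (h t) -> smooth_curve true (@toC R) b h t ->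
  C1_near (fun s => inv (h s)) t /\ \forall s \near t, h s = psi (inv (h s)).
Proof.
move=> gc [di pi] sh; split.
  by apply/C1_near_C1at; exact: (gc_smooth gc di (@toCc R) (@toC_inj R) (esym pi) sh).
have hc : {for t, continuous h} := smooth_curve_continuous (@toCc R) sh.
have N := gc_near gc di; rewrite pi in N.
have N' : \forall s \near t, chart_dom psi (inv (h s)) /\ psi (inv (h s)) = h s := hc _ N.
by apply: filterS N' => s [].
Qed.

Lemma piecewise_at (gamma h1 h2 : R -> T) b1 b2 t :
  smooth_curve true (@toC R) b1 h1 t -> smooth_curve true (@toC R) b2 h2 t -> h1 t = h2 t ->
  (\forall s \near t, (0 <= s <= t -> gamma s = h1 s) /\ (t <= s <= 1 -> gamma s = h2 s)) ->
  exists psi (c d : R -> C), [/\ atlas psi, C1_near c t /\ C1_near d t,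
    chart_dom psi (c t), chart_dom psi (d t) &
    \forall s \near t, (0 <= s <= t -> gamma s = psi (c s)) /\
      (t <= s <= 1 -> gamma s = psi (d s))].
Proof.
move=> s1 s2 h12 gE.
have [psi [inv [gc gi]]] := good_cover rot0 q_sorted branch_polyE (h1 t).
have [c1 e1] := chart_curve gc gi s1; rewrite h12 in gi.
have [c2 e2] := chart_curve gc gi s2.
exists psi, (fun s => inv (h1 s)), (fun s => inv (h2 s)); split => //.
- exact: gc_atlas gc.
- by rewrite h12; case: gi.
- by case: gi.
- by apply: filterS3 gE e1 e2 => s [g1 g2] <- <-.
Qed.

(** On [[j, j.+1]] this is the first half of [loop j 0], so the path is over [q j] at time [j]. *)
Fixpoint spine k x : T :=
  if k is k'.+1 then
    if x <= k'.+1%:R then spine k' x else loop k'.+1 0 ((x - k'.+1%:R) / 2)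
  else loop 0 0 (x / 2).

Lemma loop_start j : loop j 0 0 = mkpt p false (q j, 0).
Proof.
rewrite loopE /loop_w /loop_z csin0 mulr0 sin0 /toC !rmorph0.
by congr (mkpt p false (_, _)); rewrite ?expr0n /= ?mulr0 ?addr0 ?mul0r.
Qed.

Lemma loop_mid j : loop j 0 2^-1 = mkpt p false (q j.+1, 0).
Proof.
rewrite loopE /loop_w /loop_z csin0 ccos0 sin_pihalf cos_pihalf /toC rmorph0 rmorph1.
by congr (mkpt p false (_, _)); rewrite ?mulr0 ?mul0r // expr1n mulr1 /edge addrC subrK.
Qed.

Lemma loop_junction j : loop j 0 2^-1 = loop j.+1 0 0.
Proof. by rewrite loop_start loop_mid. Qed.

Lemma spine_seg k j x : (j <= k)%N -> j%:R <= x <= j.+1%:R ->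
  spine k x = loop j 0 ((x - j%:R) / 2).
Proof.
elim: k => [|k IH]; first by case: j => // _ _; rewrite /= subr0.
rewrite leq_eqVlt => /predU1P[->|jk] /andP[jx xj] /=.
  case: ifP => // xk; have {xk xj}-> : x = k.+1%:R by apply/eqP; rewrite eq_le xk jx.
  rewrite subrr mul0r -loop_junction.
  by case: k IH {jx} => [|k] IH /=; rewrite ?mul1r // ler_nat ltnn -natrB // subSnn mul1r.
have -> : x <= k.+1%:R by apply: le_trans xj _; rewrite ler_nat.
by apply: IH => //; rewrite jx.
Qed.

Lemma glue_continuous (X : topologicalType) (a : R) (f h : R -> X) : f a = h a ->
  continuous f -> continuous h -> continuous (fun x => if x <= a then f x else h x).
Proof.
move=> fha fc hc x U /=; case: (ltgtP x a) => [xa fU|ax hU|-> fU].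
- have N : \forall y \near x, y < a by exact: lt_nbhsl.
  apply: filterS2 N (fc x _ fU) => y ya /= fy; by rewrite (ltW ya).
- have N : \forall y \near x, a < y by exact: lt_nbhsr.
  apply: filterS2 N (hc x _ hU) => y ya /= fy; by rewrite leNgt ya.
have hU := fU; rewrite fha in hU.
have fN : \forall y \near a, U (f y) := fc a _ fU.
have hN : \forall y \near a, U (h y) := hc a _ hU.
by apply: filterS2 fN hN => y fy hy /=; case: ifP.
Qed.

Lemma half_aff j x y : (x - j%:R) / 2 - (y - j%:R) / 2 = 2^-1 * (x - y).
Proof. by ring. Qed.

Lemma spine_continuous k : (k.+1 < n)%N -> continuous (spine k).
Proof.
have lc j : (j.+1 < n)%N -> continuous (fun x => loop j 0 ((x - j%:R) / 2)).
  move=> jn x U lU; have [lcj _] := loop0_path rot0 q_sorted branch_polyE jn.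
  exact: (aff_cont (half_aff j) (lcj _ _ lU)).
elim: k => [kn|k IH kn].
  by have := lc 0 kn; rewrite (_ : (fun x => _) = spine 0) //; apply/funext => x; rewrite subr0.
apply: glue_continuous (IH _) (lc _ kn); last exact: ltnW.
by rewrite -(spine_seg (leqnn k.+1)) ?lexx ?ler_nat ?leqnSn //= lexx.
Qed.

(** At an integer time the segment ending there describes the path on the left and the segment
    starting there describes it on the right; hence the least index here and the greatest one in
    [spine_right]. *)
Lemma spine_left k x : 0 <= x <= k.+1%:R -> exists2 j, (j <= k)%N &
  \forall y \near x, 0 <= y <= x -> spine k y = loop j 0 ((y - j%:R) / 2).
Proof.
move=> /andP[x0 xk]; have ex : exists m : nat, x <= m.+1%:R by exists k.
have mP := ex_minnP ex; case: mP => -[|m] xm mmin.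
  exists 0%N => //; apply: near_all => y /andP[y0 yx].
  by apply: spine_seg => //; rewrite y0 (le_trans yx).
exists m.+1; first exact: mmin.
have N : \forall y \near x, m.+1%:R < y.
  by apply: lt_nbhsr; rewrite ltNge; apply/negP => /mmin; rewrite ltnn.
apply: filterS N => y ym /andP[y0 yx]; apply: spine_seg; first exact: mmin.
by rewrite (ltW ym) (le_trans yx).
Qed.

Lemma spine_right k x : 0 <= x <= k.+1%:R -> exists2 j, (j <= k)%N &
  \forall y \near x, x <= y <= k.+1%:R -> spine k y = loop j 0 ((y - j%:R) / 2).
Proof.
move=> /andP[x0 xk].
have ex : exists m : nat, (m <= k)%N && (m%:R <= x) by exists 0%N; rewrite x0.
have bd m : (m <= k)%N && (m%:R <= x) -> (m <= k)%N by case/andP.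
case: (ex_maxnP ex bd) => m /andP[mk mx] mmax; exists m => //.
have [km|km] := leqP k m.
  have mE : m = k by apply/eqP; rewrite eqn_leq mk km.
  rewrite mE in mx *; apply: near_all => y /andP[xy yk].
  by apply: spine_seg => //; rewrite (le_trans mx xy).
have N : \forall y \near x, y < m.+1%:R.
  apply: lt_nbhsl; rewrite ltNge; apply/negP => xm.
  by have := mmax m.+1; rewrite km xm ltnn => /(_ isT).
apply: filterS N => y ym /andP[xy yk]; apply: spine_seg => //.
by rewrite (le_trans mx xy) ltW.
Qed.

Lemma loop_seg_smooth j x : (j.+1 < n)%N ->
  smooth_curve true (@toC R) false (fun y => loop j 0 ((y - j%:R) / 2)) x.
Proof.
move=> jn; apply: (smooth_reparam (half_aff j)).
apply: (loop_smooth rot0 branch_polyE jn).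
exact: loop_strip0.
Qed.

Local Notation top := (2 * g)%N.
Local Notation Sp := (spine top).

Lemma top_lt j : (j <= top)%N -> (j.+1 < n)%N.
Proof. by move=> jt; rewrite addn2 !ltnS. Qed.

Lemma spine_nat j : (j < n)%N -> Sp j%:R = mkpt p false (q j, 0).
Proof.
rewrite addn2 ltnS leq_eqVlt => /predU1P[->|jt].
  rewrite (spine_seg (leqnn top)) ?lexx ?ler_nat ?leqnSn //.
  by rewrite -natrB // subSnn mul1r loop_mid.
rewrite (@spine_seg top j) ?lexx ?ler_nat ?leqnSn //.
by rewrite subrr mul0r loop_start.
Qed.

Lemma branch_pointE j : (j < n)%N -> piece false (mkpt p false (q j, 0)) /\
  crd false (mkpt p false (q j, 0)) = (q j, 0).
Proof.
move=> jn; apply: (@mkpt_spec R g p false) => /=.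
rewrite branch_polyE expr0n /= (bigD1_seq j) /= ?iota_uniq ?mem_iota //.
by rewrite subrr mul0r.
Qed.

Lemma spine_fixed j : (j < n)%N -> invol (Sp j%:R) = Sp j%:R.
Proof.
move=> jn; rewrite spine_nat //; have [h1 h2] := branch_pointE jn.
by apply: (@coord_inj R g p false) => //; rewrite ?piece_invol // coord_invol h2 oppr0.
Qed.

Section Double.
Context (a b : nat).
Hypothesis an : (a < n)%N.
Hypothesis bn : (b < n)%N.

Definition ramp t : R := a%:R + 2 * t * (b%:R - a%:R).
(** The loop M of the overview, for the branch points of ranks [a] and [b]; [ramp] runs backwards
    along the spine when [b < a]. *)
Definition dbl t : T := if t <= 2^-1 then Sp (ramp t) else invol (Sp (ramp (1 - t))).

Lemma ramp_half : ramp 2^-1 = b%:R.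
Proof. by rewrite /ramp mulfV ?mul1r ?subrKC // pnatr_eq0. Qed.

Lemma ramp_aff x y : ramp x - ramp y = (2 * (b%:R - a%:R)) * (x - y).
Proof. by rewrite /ramp; ring. Qed.

Lemma dbl_sym t : dbl (1 - t) = invol (dbl t).
Proof.
have hh : 1 - 2^-1 = 2^-1 :> R by lra.
rewrite /dbl subKr; case: (ltgtP t 2^-1) => [th|th|->]; last 1 first.
- by rewrite hh lexx ramp_half spine_fixed.
- by rewrite leNgt (_ : 2^-1 < 1 - t) //; lra.
- by rewrite (_ : 1 - t <= 2^-1) ?involK //; lra.
Qed.

Lemma dbl_continuous : continuous dbl.
Proof.
have sc := spine_continuous (top_lt (leqnn top)).
have rc : continuous (fun t => Sp (ramp t)).
  by move=> t U /sc; exact: (aff_cont ramp_aff).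
apply: glue_continuous => //.
  have -> : 1 - 2^-1 = 2^-1 :> R by lra.
  by rewrite ramp_half spine_fixed.
move=> t U /invol_continuous iU.
exact: (cont_refl (rc _ _ iU)).
Qed.

Lemma ramp_range t : 0 <= t <= 2^-1 -> 0 <= ramp t <= top.+1%:R.
Proof.
have a0 : 0 <= (a%:R : R) <= top.+1%:R by rewrite ler0n ler_nat -ltnS -addn2.
have b0 : 0 <= (b%:R : R) <= top.+1%:R by rewrite ler0n ler_nat -ltnS -addn2.
move=> t0; rewrite /ramp; set A := a%:R in a0 *; set B := b%:R in b0 *.
set N := _%:R in a0 b0 *; apply/andP; split; nra.
Qed.

Lemma dbl0 : dbl 0 = mkpt p false (q a, 0).
Proof.
rewrite /dbl invr_ge0 ler0n /ramp mulr0 mul0r addr0 spine_nat //.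
Qed.

Lemma dbl1 : dbl 1 = mkpt p false (q a, 0).
Proof.
have -> : (1 : R) = 1 - 0 by rewrite subr0.
by rewrite dbl_sym dbl0 -spine_nat // spine_fixed.
Qed.

Definition left_smooth (f : R -> T) (t c : R) : Prop := exists2 h : R -> T,
  smooth_curve true (@toC R) false h t & \forall s \near t, c <= s <= t -> f s = h s.
Definition right_smooth (f : R -> T) (t c : R) : Prop := exists2 h : R -> T,
  smooth_curve true (@toC R) false h t & \forall s \near t, t <= s <= c -> f s = h s.

Lemma ramp_smooth t : 0 <= t <= 2^-1 ->
  left_smooth (Sp \o ramp) t 0 /\ right_smooth (Sp \o ramp) t 2^-1.
Proof.
move=> t01; have xr := ramp_range t01.
have [j1 j1t L] := spine_left xr; have [j2 j2t U] := spine_right xr.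
have hs j : (j <= top)%N ->
    smooth_curve true (@toC R) false (fun s => loop j 0 ((ramp s - j%:R) / 2)) t.
  move=> jt; have ls := loop_seg_smooth (ramp t) (top_lt jt).
  exact: (smooth_reparam (h := ramp) ramp_aff ls).
have L' : \forall s \near t, 0 <= ramp s <= ramp t ->
  Sp (ramp s) = loop j1 0 ((ramp s - j1%:R) / 2) := aff_cont ramp_aff L.
have U' : \forall s \near t, ramp t <= ramp s <= top.+1%:R ->
  Sp (ramp s) = loop j2 0 ((ramp s - j2%:R) / 2) := aff_cont ramp_aff U.
have rE s : ramp s - ramp t = (2 * (b%:R - a%:R)) * (s - t) by exact: ramp_aff.
(* A decreasing ramp exchanges the left and the right side along the spine. *)
have [ab|ba] := leqP a b.
  have ab' : 0 <= (b%:R - a%:R : R) by rewrite subr_ge0 ler_nat.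
  split; [exists (fun s => loop j1 0 ((ramp s - j1%:R) / 2)); first exact: hs|
          exists (fun s => loop j2 0 ((ramp s - j2%:R) / 2)); first exact: hs].
    apply: filterS L' => s Ls st; apply: Ls.
    have /andP[-> _] : 0 <= ramp s <= top.+1%:R by apply: ramp_range; lra.
    by have := rE s; nra.
  apply: filterS U' => s Us st; apply: Us.
  have /andP[_ ->] : 0 <= ramp s <= top.+1%:R by apply: ramp_range; lra.
  by rewrite andbT; have := rE s; nra.
have ab' : (b%:R - a%:R : R) <= 0 by rewrite subr_le0 ler_nat ltnW.
split; [exists (fun s => loop j2 0 ((ramp s - j2%:R) / 2)); first exact: hs|
        exists (fun s => loop j1 0 ((ramp s - j1%:R) / 2)); first exact: hs].
  apply: filterS U' => s Us st; apply: Us.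
  have /andP[_ ->] : 0 <= ramp s <= top.+1%:R by apply: ramp_range; lra.
  by rewrite andbT; have := rE s; nra.
apply: filterS L' => s Ls st; apply: Ls.
have /andP[-> _] : 0 <= ramp s <= top.+1%:R by apply: ramp_range; lra.
by have := rE s; nra.
Qed.

Lemma smooth_refl (h : R -> T) t : smooth_curve true (@toC R) false h (1 - t) ->
  smooth_curve true (@toC R) false (fun s => invol (h (1 - s))) t.
Proof. by move=> hs; exact: (smooth_curve_invol (smooth_reparam (refl_aff (R := R)) hs)). Qed.

Lemma dbl_left t : 0 <= t <= 1 -> left_smooth dbl t 0.
Proof.
move=> t01; have [th|th] := leP t 2^-1.
  have [|[h hs hE] _] := @ramp_smooth t; first by lra.
  exists h => //; apply: filterS hE => s /= hE st.
  by rewrite -hE // /dbl (le_trans _ th) //; lra.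
have [|_ [h hs hE]] := @ramp_smooth (1 - t); first by lra.
exists (fun s => invol (h (1 - s))); first exact: smooth_refl.
have hE' : \forall s \near t, 1 - t <= 1 - s <= 2^-1 -> (Sp \o ramp) (1 - s) = h (1 - s).
  exact: (cont_refl hE).
have N : \forall s \near t, 2^-1 < s by exact: lt_nbhsr.
apply: filterS2 N hE' => s hs' /= hE' st.
by rewrite /dbl leNgt hs' /= hE' //; lra.
Qed.

Lemma dbl_right t : 0 <= t <= 1 -> right_smooth dbl t 1.
Proof.
move=> t01; have [|h hs hE] := @dbl_left (1 - t); first by lra.
exists (fun s => invol (h (1 - s))); first exact: smooth_refl.
have hE' : \forall s \near t, 0 <= 1 - s <= 1 - t -> dbl (1 - s) = h (1 - s).
  exact: (cont_refl hE).
apply: filterS hE' => s hE' st.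
by rewrite -hE' ?dbl_sym ?involK //; lra.
Qed.

Lemma dbl_piecewise : piecewise_C1 atlas dbl.
Proof.
move=> t t01; have [h1 s1 e1] := dbl_left t01; have [h2 s2 e2] := dbl_right t01.
have [t0 t1] := andP t01.
apply: (piecewise_at s1 s2).
  by rewrite -(nbhs_singleton e1) ?t0 ?lexx // -(nbhs_singleton e2) // lexx t1.
by apply: filterS2 e1 e2 => s; split.
Qed.

Lemma dbl_is_loop : is_loop atlas dbl.
Proof. by split; [exact: dbl_piecewise|rewrite dbl0 dbl1]. Qed.

Lemma dbl_path : pathT dbl.
Proof. by split; [exact: dbl_continuous|]. Qed.

Lemma spine_path : pathT Sp.
Proof. by split; [exact: (spine_continuous (top_lt (leqnn top)))|]. Qed.

Lemma invol_path (f : R -> T) : pathT f -> pathT (fun t => invol (f t)).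
Proof. by move=> [fc _]; split => // t U /invol_continuous; exact: fc. Qed.

End Double.

(** The class of the spine between two times minus that of its image under [invol]. It is additive
    in the interval and gives the class of [dbl] at integer times. *)
Definition spine_diff (a b : R) : @Q1 R T int [set: T] :=
  PC (sub Sp a b) - PC (sub (fun t => invol (Sp t)) a b).

Lemma pc_dbl a b : (a < n)%N -> (b < n)%N -> PC (dbl a b) = spine_diff a%:R b%:R.
Proof.
move=> an bn; have dp := dbl_path a bn; have sp := spine_path; have ip := invol_path sp.
rewrite -(sub01 (dbl a b)) (pc_sub int 0 2^-1 1 dp); congr (_ + _).
  apply: pc_eq; first exact: path_in_singular1 (path_in_sub _ _ dp).
  move=> x x01; rewrite /sub subr0 add0r /dbl (_ : 2^-1 * x <= 2^-1); last by lra.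
  by congr (Sp _); rewrite /ramp; field.
rewrite -pc_subN //.
apply: pc_eq; first exact: path_in_singular1 (path_in_sub _ _ dp).
move=> x x01; rewrite /sub /dbl; case: ifP => xh.
  have {x01 xh}-> : x = 0 by lra.
  by rewrite !mulr0 !addr0 ramp_half spine_fixed.
by congr (invol (Sp _)); rewrite /ramp; field.
Qed.

Lemma spine_diffD (a b c : R) : spine_diff a c = spine_diff a b + spine_diff b c.
Proof.
have sp := spine_path; have ip := invol_path sp.
by rewrite /spine_diff (pc_sub int a b c sp) (pc_sub int a b c ip) opprD addrACA.
Qed.

Lemma spine_diff0 (a : R) : spine_diff a a = 0.
Proof.
have sp := spine_path; have ip := invol_path sp.
by rewrite /spine_diff !pc_sub0 // subrr.
Qed.

(** The second half of the loop is the image of the first half, run backwards ([loop_invol]). *)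
Lemma spine_diff_step k : (k.+1 < n)%N -> spine_diff k%:R k.+1%:R = PC (loop k 0).
Proof.
move=> kn; have lp := loop0_path rot0 q_sorted branch_polyE kn.
have kt : (k <= top)%N by rewrite addn2 !ltnS in kn.
have d1 : k.+1%:R - k%:R = 1 :> R by rewrite -natrB // subSnn.
have seg x : 0 <= x <= 1 -> Sp (k%:R + x) = loop k 0 (x / 2).
  move=> x01; have xE : k%:R + x - k%:R = x by rewrite addrAC subrr add0r.
  rewrite (spine_seg kt) ?xE // -(subrK k%:R k.+1%:R) d1.
  by set K := (k%:R : R); lra.
rewrite /spine_diff -(sub01 (loop k 0)) (pc_sub int 0 2^-1 1 lp); congr (_ + _).
  apply: pc_eq; first exact: path_in_singular1 (path_in_sub _ _ spine_path).
  by move=> x x01; rewrite /sub d1 mul1r seg // subr0 add0r mulrC.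
rewrite -pc_subN; last exact: invol_path spine_path.
apply: pc_eq; first exact: path_in_singular1 (path_in_sub _ _ (invol_path spine_path)).
move=> x x01; rewrite /sub.
have -> : k.+1%:R + (k%:R - k.+1%:R) * x = k%:R + (1 - x) :> R.
  by rewrite -(opprB k.+1%:R) d1 -(subrK k%:R k.+1%:R) d1; ring.
rewrite seg; last by lra.
rewrite -(loop_invol rot0 branch_polyE _ kn).
by congr (loop k 0 _); field.
Qed.

Section Basis.
Context (a : nat).
Hypothesis an : (a < n)%N.

Definition dbl_class (b : nat) : H1 R T int [set: T] := hclass [set: T] << dbl a b >>.

Lemma dbl_cycle b : (b < n)%N -> (<< dbl a b >> : {freeg (R -> T) / int}) \in cycle1 [set: T].
Proof.
move=> bn; apply: closed_cycle; first exact: (path_in_singular1 (dbl_path a bn)).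
by rewrite dbl0 // dbl1.
Qed.

Lemma dbl_class_start : dbl_class a = 0.
Proof.
by apply: emb_inj; rewrite emb_hclass ?dbl_cycle // -/(PC (dbl a a)) pc_dbl // spine_diff0 emb0.
Qed.

Lemma loop_cycle k : (k.+1 < n)%N ->
  (<< loop k 0 >> : {freeg (R -> T) / int}) \in cycle1 [set: T].
Proof.
move=> kn; apply: closed_cycle.
  exact: (path_in_singular1 (loop0_path rot0 q_sorted branch_polyE kn)).
by rewrite -[1]add0r loop_periodic.
Qed.

Lemma dbl_class_step k : (k.+1 < n)%N ->
  dbl_class k.+1 - dbl_class k = hclass [set: T] << loop k 0 >>.
Proof.
move=> kn; have kn' : (k < n)%N by exact: ltnW.
apply: emb_inj; rewrite embB !emb_hclass ?dbl_cycle ?loop_cycle //.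
rewrite -/(PC (dbl a k)) -/(PC (dbl a k.+1)) -/(PC (loop k 0)) !pc_dbl //.
rewrite (spine_diffD _ k%:R k.+1%:R) spine_diff_step //.
by abel.
Qed.

Lemma dbl_class_ind (P : nat -> H1 R T int [set: T] -> Prop) : P a 0 ->
  (forall k h, (k.+1 < n)%N -> P k h -> P k.+1 (h + hclass [set: T] << loop k 0 >>)) ->
  (forall k h, (k.+1 < n)%N -> P k.+1 h -> P k (h - hclass [set: T] << loop k 0 >>)) ->
  forall b, (b < n)%N -> P b (dbl_class b).
Proof.
move=> P0 up down b bn; have Pa : P a (dbl_class a) by rewrite dbl_class_start.
have [ab|/ltnW ba] := leqP a b.
  elim: b ab bn => [|b IH]; first by rewrite leqn0 => /eqP aE _; rewrite -aE.
  rewrite leq_eqVlt => /predU1P[aE _|ab bn]; first by rewrite -aE.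
  by rewrite -(subrK (dbl_class b) (dbl_class b.+1)) dbl_class_step // addrC;
    apply: up => //; apply: IH => //; exact: ltnW.
move: {2}(a - b)%N (erefl (a - b)%N) => m; elim: m b ba {bn} => [|m IH] b ba abm.
  by have -> : b = a by lia.
have bS : (b.+1 < n)%N by apply: leq_ltn_trans an; lia.
have -> : dbl_class b = dbl_class b.+1 - hclass [set: T] << loop b 0 >>.
  by rewrite -dbl_class_step // subKr.
by apply: down => //; apply: IH; lia.
Qed.

End Basis.
End Spine.

(** * Intersection numbers of the generators *)

Section Crossings.
Context (R : realType) (g : nat) (p : 'I_(2 * g + 2) -> R[i]^o).
Local Notation C := (R[i]^o).
Local Notation T := (curve p).
Local Notation n := (2 * g + 2)%N.
Local Notation atlas := (@curve_atlas R g p).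
Context (q : nat -> C) (rot : C).
Hypothesis rot0 : rot != 0.
Hypothesis q_sorted : forall i j, (i < j)%N -> (j < n)%N ->
  ell rot (q i) < ell rot (q j).
Hypothesis branch_polyE : forall z, branch_poly p z = \prod_(k <- iota 0 n) (z - q k).
Local Notation loop := (loop p q rot).
Local Notation strip := (strip g q rot).
Local Notation tchart i := (t_chart p q rot i).
Local Notation tinv i := (t_inv q rot i).
Local Notation pi := (trigo.pi : R).
Implicit Types (b s t x y : R) (i j k : nat).

Lemma loop_closed_C1 i b : (i.+1 < n)%N -> (forall s, strip 1 i (loop_z q i b s)) ->
  closed_C1_curve atlas (loop i b).
Proof.
move=> iN st; split=> t; first exact: loop_periodic.
have [psi [inv [gc gi]]] := good_cover rot0 q_sorted branch_polyE (loop i b t).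
have [c1 e1] := chart_curve gc gi (loop_smooth rot0 branch_polyE iN (st t)).
exists psi, (fun s => inv (loop i b s)); split => //; first exact: gc_atlas gc.
by case: gi.
Qed.

Lemma loop_ell i s : (i.+1 < n)%N -> ell rot (loop_z q i 0 s) =
  ell rot (q i) + sin (pi * s) ^+ 2 * (ell rot (q i.+1) - ell rot (q i)).
Proof. by move=> iN; rewrite loop_z0 ellD ellZ ellB. Qed.

Lemma ell_ltS i : (i.+1 < n)%N -> ell rot (q i) < ell rot (q i.+1).
Proof. by move=> iN; apply: q_sorted. Qed.

Lemma sin_sq_le1 s : sin (pi * s) ^+ 2 <= 1.
Proof. by rewrite -(cos2Dsin2 (pi * s)) lerDr sqr_ge0. Qed.

Lemma loop_ell_range i s : (i.+1 < n)%N ->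
  ell rot (q i) <= ell rot (loop_z q i 0 s) <= ell rot (q i.+1).
Proof.
move=> iN; rewrite loop_ell //; have := ell_ltS iN; have := sin_sq_le1 s.
have := sqr_ge0 (sin (pi * s)); set S := _ ^+ 2; set a := ell _ _; set c := ell _ _.
by move=> S0 S1 ac; apply/andP; split; nra.
Qed.

(** The values of [ell] on the two projections lie in disjoint intervals. *)
Lemma loop_disjoint i k s t : (i.+1 < k)%N -> (k.+1 < n)%N -> loop i 0 s <> loop k 0 t.
Proof.
move=> ik kN e; have iN : (i.+1 < n)%N by lia.
have := congr1 (fun P => (crd false P).1) e; rewrite !(crd_loop rot0 branch_polyE) //= => ze.
have /andP[_] := loop_ell_range s iN; rewrite ze; have /andP[l _] := loop_ell_range t kN.
by move/(le_trans l); apply/negP; rewrite -ltNge; apply: q_sorted => //; lia.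
Qed.

(** Already the projections are disjoint: a nondegenerate ellipse does not meet the segment between
    its foci. *)
Lemma loop_pushed_disjoint i e s t : (i.+1 < n)%N -> 0 < e -> loop i e s <> loop i 0 t.
Proof.
move=> iN e0 E.
have := congr1 (fun P => (crd false P).1) E; rewrite !(crd_loop rot0 branch_polyE) //=.
rewrite /loop_z => /addrI; have eN : edge q i != 0.
  rewrite /edge subr_eq0; apply/eqP => qe; have := ell_ltS iN.
  by rewrite qe ltxx.
move=> /(mulfI eN); rewrite csin0 expr2 [RHS]expr2 => E2.
have := congr1 (@complex.Im R) E2; have := congr1 (@complex.Re R) E2.
rewrite !cReM !cImM /= !mulr0 !mul0r subr0 addr0.
have r2 := sqrt1D e; have xy := cos2Dsin2 (pi * s); have S1 := sin_sq_le1 t.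
have r0 : 0 < Num.sqrt (1 + e ^+ 2) by rewrite sqrtr_gt0; nra.
rewrite !expr2 in xy S1.
set x := sin (pi * s) in xy *; set y := cos (pi * s) in xy *; set r := Num.sqrt _ in r2 r0 *.
set S := sin (pi * t) in S1 * => re im.
have /eqP : x * y * (2 * r * e) = 0 by rewrite -[RHS]im; ring.
rewrite !mulf_eq0 pnatr_eq0 (gt_eqF r0) (gt_eqF e0) !orbF => /orP[/eqP x0|/eqP y0].
  by rewrite x0 in re xy; nra.
have x2 : x * x = 1 by rewrite -[RHS]xy y0; ring.
have : x * r * (x * r) = 1 + e * e by rewrite mulrACA x2 mul1r r2.
by rewrite y0 in re; nra.
Qed.

Lemma loop_pushed_class i e : (i.+1 < n)%N -> 0 <= e ->
  (forall b s, 0 <= b <= e -> strip 1 i (loop_z q i b s)) ->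
  loop_class int (loop i e) = loop_class int (loop i 0).
Proof.
move=> iN e0 st; have st' s : strip 1 i (loop_z q i e s) by apply: st; rewrite e0 lexx.
apply: emb_inj; rewrite !emb_hclass.
- exact: (loop_homotopy rot0 branch_polyE iN e0 st).
- exact: (loop_cycle rot0 q_sorted branch_polyE iN).
apply: closed_cycle.
  exact: (path_in_singular1 (loop_path rot0 branch_polyE iN st')).
by rewrite -[1]add0r loop_periodic.
Qed.

(** The local parameter is known through its square only. Near a common zero the relation
    [f y ^+ 2 = k * h y ^+ 2] passes to the squares of the Carathéodory factors, and by continuity
    to their values. *)
Lemma velocity_sqr (f h : R -> C) x (v u k : C) : has_d (@toC R) f x v -> has_d (@toC R) h x u ->
  f x = 0 -> h x = 0 -> (\forall y \near x, f y ^+ 2 = k * h y ^+ 2) -> v ^+ 2 = k * u ^+ 2.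
Proof.
move=> /has_dP[phi [pc <- pE]] /has_dP[psi [sc <- sE]] f0 h0 N.
pose G y := phi y ^+ 2 - k * psi y ^+ 2.
have Gc : cts G x by apply: ctsB; [exact: ctsX|apply: ctsM; [exact: cts_cst|exact: ctsX]].
apply/eqP; rewrite -subr_eq0; apply/negP => /negP G0.
have [y [G0' fh] yx] := toC_nonisolated (filterI (cts_near_neq0 Gc G0) N).
have := pE y; have := sE y; rewrite f0 h0 !subr0 => hy fy.
move: fh; rewrite /= fy hy !exprMn [RHS]mulrCA => fh.
case/eqP: G0'; rewrite /G (mulfI _ fh) ?subrr //.
by apply: expf_neq0; rewrite subr_eq0.
Qed.

Lemma has_d_csin0 s : has_d (@toC R) (csin 0) s (toC (cos (pi * s) * pi)).
Proof.
have -> : csin 0 = (fun s => toC (sin (pi * s))) by apply/funext => x; exact: csin0.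
apply: has_d_toC; apply: (@is_derive1_comp _ sin (fun s => pi * s)).
by rewrite -[X in is_derive _ _ _ X]mulr1; exact: is_deriveZ.
Qed.

Lemma has_d_ccos0 s : has_d (@toC R) (ccos 0) s (toC (- sin (pi * s) * pi)).
Proof.
have -> : ccos 0 = (fun s => toC (cos (pi * s))) by apply/funext => x; exact: ccos0.
apply: has_d_toC; apply: (@is_derive1_comp _ cos (fun s => pi * s)).
by rewrite -[X in is_derive _ _ _ X]mulr1; exact: is_deriveZ.
Qed.

Lemma tinv_loopS_sqr i s : (i.+1 < n)%N -> 0 < sin (pi * s) ^+ 2 ->
  tinv i.+1 (loop i 0 s) ^+ 2 = - edge q i * ccos 0 s ^+ 2.
Proof.
move=> iN s0; have [_ st] := (timgP rot0 branch_polyE (loop i 0 s) iN).1 (loop_timgS rot0 q_sorted branch_polyE iN s0).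
have := t_inv_sqr rot0 branch_polyE iN (piece_loop p q rot i 0 s) st.
rewrite (crd_loop rot0 branch_polyE) //= => e.
by apply: (addrI (q i.+1)); rewrite e -(subrK (q i.+1) (loop_z q i 0 s)) loop_zB addrC mulNr.
Qed.

Lemma tinv_loop_sqr i s : (i.+1 < n)%N -> sin (pi * s) ^+ 2 < 1 ->
  tinv i (loop i 0 s) ^+ 2 = edge q i * csin 0 s ^+ 2.
Proof.
move=> iN s1; have iN' : (i < n)%N by exact: ltnW.
have [_ st] := (timgP rot0 branch_polyE (loop i 0 s) iN').1 (loop_timg rot0 q_sorted branch_polyE iN s1).
have := t_inv_sqr rot0 branch_polyE iN' (piece_loop p q rot i 0 s) st.
by rewrite (crd_loop rot0 branch_polyE) //= => /addrI.
Qed.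

Lemma sin_sq_cont y : {for y, continuous (fun s => sin (pi * s) ^+ 2)}.
Proof.
have sc : {for y, continuous (fun s => sin (pi * s))}.
  by apply: (@cont_comp _ _ (fun y => pi * y) sin y); [exact: cont_pi (@cont_id _ _)|exact: continuous_sin].
have -> : (fun s => sin (pi * s) ^+ 2) = (fun s => sin (pi * s) * sin (pi * s)).
  by apply/funext => x; rewrite expr2.
exact: contM.
Qed.

Lemma parallel (v w : C) : complex.Im (v^* * w) = 0 ->
  w * toC (nrm v ^+ 2) = v * toC (complex.Re (v^* * w)).
Proof.
rewrite nrm_sqr; case: v w => [x y] [z t]; rewrite /toC /= => D0.
apply/eqP; rewrite eq_complex; apply/andP; split; apply/eqP; rewrite /=.
  transitivity (x * (x * z - - y * t) - y * (x * t + - y * z)); first by ring.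
  by rewrite D0; ring.
transitivity (y * (x * z - - y * t) + x * (x * t + - y * z)); first by ring.
by rewrite D0; ring.
Qed.

Lemma ell_sqrM (z : C) (a : R) : ell rot ((z * toC a) ^+ 2) = a ^+ 2 * ell rot (z ^+ 2).
Proof. by rewrite exprMn mulrC -ellZ /toC rmorphXn. Qed.

(** Squares of parallel vectors agree up to nonnegative real factors, which the signs of [ell]
    exclude. *)
Lemma not_parallel (v w : C) : ell rot (v ^+ 2) < 0 -> 0 < ell rot (w ^+ 2) ->
  complex.Im (v^* * w) != 0.
Proof.
move=> lv lw; apply/eqP => /parallel/(congr1 (fun z => ell rot (z ^+ 2))).
rewrite !ell_sqrM; set N := (X in X * _ = _); set r := (X in _ = X * _) => E.
have N0 : 0 <= N by exact: sqr_ge0.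
have r0 : 0 <= r by exact: sqr_ge0.
have {E r0} : N = 0 by nra.
move=> /eqP; rewrite /N !expf_eq0 /= nrm_eq0 => /eqP v0.
by move: lv; rewrite v0 expr0n /= /ell mulr0 ltxx.
Qed.

(* The squares of the two velocities in [t_chart i.+1] are [- pi^2 (q i.+1 - q i)] and
   [pi^2 (q i.+2 - q i.+1)]; the velocities are not parallel, as [ell] is positive on both edges. *)
Lemma loop_crossing i : (i.+2 < n)%N -> let c := fun s => tinv i.+1 (loop i 0 s) in
  let d := fun s => tinv i.+1 (loop i.+1 0 s) in
  [/\ C1_near c 2^-1, C1_near d 0, c 2^-1 = d 0, chart_dom (tchart i.+1) (c 2^-1) &
    [/\ \forall s \near (2^-1 : R), loop i 0 s = tchart i.+1 (c s),
        \forall s \near (0 : R), loop i.+1 0 s = tchart i.+1 (d s) &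
        complex.Im ((velocity c 2^-1)^* * velocity d 0) != 0]].
Proof.
move=> iN c d; have iN' : (i.+1 < n)%N by exact: ltnW.
have gc := t_chart_good rot0 branch_polyE iN'.
have s1 : sin (pi * 2^-1) ^+ 2 = 1 by rewrite sin_pihalf expr1n.
have s0 : sin (pi * 0) ^+ 2 = 0 by rewrite mulr0 sin0 expr0n.
have gi1 := loop_timgS (s := 2^-1) rot0 q_sorted branch_polyE iN'; rewrite s1 in gi1.
have {}gi1 := gi1 ltr01.
have gi2 := loop_timg (s := 0) rot0 q_sorted branch_polyE iN; rewrite s0 in gi2.
have {}gi2 := gi2 ltr01.
have [c1 e1] := chart_curve gc gi1 (loop_smooth rot0 branch_polyE iN' (loop_strip0 q_sorted _ iN')).
have [c2 e2] := chart_curve gc gi2 (loop_smooth rot0 branch_polyE iN (loop_strip0 q_sorted _ iN)).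
have [_ [_ z1]] := loop_ends rot0 branch_polyE iN'.
have [z2 _] := loop_ends rot0 branch_polyE iN.
have v1 : velocity c 2^-1 ^+ 2 = - edge q i * toC (pi ^+ 2).
  have N : \forall s \near (2^-1 : R), c s ^+ 2 = - edge q i * ccos 0 s ^+ 2.
    have s1' : 0 < sin (pi * 2^-1) ^+ 2 by rewrite s1.
    by apply: filterS (near_gt (@sin_sq_cont _) s1') => s; exact: tinv_loopS_sqr.
  rewrite (velocity_sqr (C1_near_has_d c1) (has_d_ccos0 _) z1 _ N); last first.
    by rewrite ccos0 cos_pihalf.
  by rewrite sin_pihalf mulN1r /toC -rmorphXn sqrrN.
have v2 : velocity d 0 ^+ 2 = edge q i.+1 * toC (pi ^+ 2).
  have N : \forall s \near (0 : R), d s ^+ 2 = edge q i.+1 * csin 0 s ^+ 2.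
    have s0' : sin (pi * 0) ^+ 2 < 1 by rewrite s0.
    by apply: filterS (near_lt (@sin_sq_cont _) s0') => s; exact: tinv_loop_sqr.
  rewrite (velocity_sqr (C1_near_has_d c2) (has_d_csin0 _) z2 _ N); last first.
    by rewrite csin0 mulr0 sin0.
  by rewrite mulr0 cos0 mul1r /toC -rmorphXn.
split; rewrite /c /d ?z1 ?z2 //; first by case: gi1; rewrite z1.
split=> //.
set v := velocity _ _ in v1 *; set w := velocity _ _ in v2 *.
have l1 := ell_ltS iN'; have l2 := ell_ltS iN.
have p2 : 0 < pi ^+ 2 by rewrite exprn_gt0 // pi_gt0.
apply: not_parallel.
  rewrite v1 mulNr mulrC -mulrN ellZ /edge opprB ellB.
  by rewrite pmulr_rlt0 // subr_lt0.
by rewrite v2 mulrC ellZ pmulr_rgt0 // ellB subr_gt0.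
Qed.

(** * Pairings of the loops over the segments *)

Section Pairing.
Context (B : intersection_pairing atlas).
Local Notation lc i := (loop_class int (loop i 0)).

Lemma loop0_closed_C1 i : (i.+1 < n)%N -> closed_C1_curve atlas (loop i 0).
Proof. by move=> iN; apply: loop_closed_C1 => // s; exact: loop_strip0. Qed.

Lemma pairing_disjoint (gamma delta : R -> T) : closed_C1_curve atlas gamma ->
  closed_C1_curve atlas delta -> (forall s t, gamma s <> delta t) ->
  B (loop_class int gamma) (loop_class int delta) = 0.
Proof.
move=> gc dc gd; rewrite (@pairing_crossings _ _ _ B gamma delta [::] (fun=> 0)) ?big_nil //.
by move=> s t _ _; split => // e; case: (gd s t).
Qed.

Lemma pairing_far i k : (i.+1 < k)%N -> (k.+1 < n)%N -> B (lc i) (lc k) = 0 /\ B (lc k) (lc i) = 0.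
Proof.
move=> ik kN; have iN : (i.+1 < n)%N by lia.
split; apply: pairing_disjoint; try exact: loop0_closed_C1.
  by move=> s t; exact: loop_disjoint.
by move=> s t /esym; exact: loop_disjoint.
Qed.

(** A loop meets itself at all parameters, so one copy is first moved, within its class, to a
    disjoint loop over an ellipse. *)
Lemma pairing_self i : (i.+1 < n)%N -> B (lc i) (lc i) = 0.
Proof.
move=> iN; have [e /andP[e0 e1] st] := loop_strip q_sorted iN.
rewrite -{1}(loop_pushed_class iN (ltW e0) st).
apply: pairing_disjoint; [|exact: loop0_closed_C1|].
  by apply: loop_closed_C1 => // s; apply: st; rewrite ltW // lexx.
by move=> s t; exact: loop_pushed_disjoint.
Qed.

Lemma pairing_sign (gamma delta : R -> T) s t (e : int) : closed_C1_curve atlas gamma ->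
  closed_C1_curve atlas delta -> 0 <= s < 1 -> 0 <= t < 1 ->
  (forall x y, 0 <= x < 1 -> 0 <= y < 1 -> (gamma x = delta y <-> x = s /\ y = t)) ->
  crosses_with_sign atlas gamma delta s t e ->
  B (loop_class int gamma) (loop_class int delta) = e.
Proof.
move=> gc dc s01 t01 gd ce.
rewrite (@pairing_crossings _ _ _ B gamma delta [:: (s, t)] (fun=> e)) ?big_seq1 //.
- move=> x y x01 y01; rewrite gd // inE; split=> [[-> ->]|/eqP[-> ->]] //.
- by move=> x; rewrite inE => /eqP ->.
Qed.

Lemma sin_sq_eq1 s : 0 <= s < 1 -> sin (pi * s) ^+ 2 = 1 -> s = 2^-1.
Proof.
move=> s01 s1; case: (ltgtP s 2^-1) => // sh.
  have : sin (pi * s) ^+ 2 < 1 by apply: sin_sq_lt1; lra.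
  by rewrite s1 ltxx.
have : sin (pi * (s - 1)) ^+ 2 < 1 by apply: sin_sq_lt1; lra.
by rewrite -sin_sq_shift subrK s1 ltxx.
Qed.

Lemma sin_sq_eq0 s : 0 <= s < 1 -> sin (pi * s) ^+ 2 = 0 -> s = 0.
Proof.
move=> s01 /eqP s0; apply/eqP; rewrite eq_le; case/andP: s01 => -> s1; rewrite andbT leNgt.
by apply/negP => sp; have := sin_sq_gt0 (s := s); rewrite sp s1 (eqP s0) ltxx => /(_ isT).
Qed.

(** The ranges of [ell] on the two loops share only the value at [q i.+1], which each loop takes
    once per period. *)
Lemma loop_meet i s t : (i.+2 < n)%N -> 0 <= s < 1 -> 0 <= t < 1 ->
  loop i 0 s = loop i.+1 0 t <-> s = 2^-1 /\ t = 0.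
Proof.
move=> iN s01 t01; have iN' : (i.+1 < n)%N by exact: ltnW.
split=> [e|[-> ->]]; last exact: loop_junction.
have := congr1 (fun P => ell rot (crd false P).1) e; rewrite !(crd_loop rot0 branch_polyE) //=.
have /andP[_ h1] := loop_ell_range s iN'; have /andP[h2 _] := loop_ell_range t iN.
have l1 := ell_ltS iN'; have l2 := ell_ltS iN => ee.
have e1 : ell rot (loop_z q i 0 s) = ell rot (q i.+1) by apply/eqP; rewrite eq_le h1 ee h2.
have e2 : ell rot (loop_z q i.+1 0 t) = ell rot (q i.+1) by rewrite -ee.
move: e1 e2; rewrite !loop_ell //; set a := ell _ _ in l1 *; set b := ell _ _ in l1 l2 *.
set c := ell _ _ in l2 * => e1 e2; split.
  apply: sin_sq_eq1 => //; apply: (@mulIf _ (b - a)); first by rewrite subr_eq0 gt_eqF.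
  by apply: (addrI a); rewrite e1 mul1r subrKC.
apply: sin_sq_eq0 => //; apply: (@mulIf _ (c - b)); first by rewrite subr_eq0 gt_eqF.
by rewrite mul0r; apply: (addrI b); rewrite addr0.
Qed.

Lemma sgz_odd (x : R) : x != 0 -> odd `|sgz x|%N.
Proof. by move=> /negPf x0; rewrite /sgz x0; case: ifP. Qed.

Lemma crossing_signs (gamma delta : R -> T) s t psi (c d : R -> C) : atlas psi ->
  C1_near c s -> C1_near d t -> c s = d t -> chart_dom psi (c s) ->
  (\forall r \near s, gamma r = psi (c r)) -> (\forall r \near t, delta r = psi (d r)) ->
  complex.Im ((velocity c s)^* * velocity d t) != 0 ->
  (exists2 e : int, odd `|e|%N & crosses_with_sign atlas gamma delta s t e) /\
  (exists2 e : int, odd `|e|%N & crosses_with_sign atlas delta gamma t s e).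
Proof.
move=> aP c1 d1 cd dc gE dE D0; split.
  exists (sgz (complex.Im ((velocity c s)^* * velocity d t))); first exact: (sgz_odd D0).
  by exists psi, c, d; split.
have D0' : complex.Im ((velocity d t)^* * velocity c s) != 0.
  apply: contra_neq D0 => D0'; apply: oppr_inj; rewrite oppr0 -[RHS]D0'.
  by case: (velocity _ _) => x y; case: (velocity _ _) => z v /=; ring.
exists (sgz (complex.Im ((velocity d t)^* * velocity c s))); first exact: (sgz_odd D0').
by exists psi, d, c; split => //; rewrite -cd.
Qed.

(** The single transversal crossing contributes 1 or -1; its parity is all that enters below. *)
Lemma pairing_adjacent i : (i.+2 < n)%N ->
  odd `|B (lc i) (lc i.+1)|%N /\ odd `|B (lc i.+1) (lc i)|%N.
Proof.
move=> iN; have iN' : (i.+1 < n)%N by exact: ltnW.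
have h01 : 0 <= (2^-1 : R) < 1 by lra.
have z01 : 0 <= (0 : R) < 1 by rewrite lexx ltr01.
have [c1 c2 cd dc [e1 e2 D0]] := loop_crossing iN.
have aP := gc_atlas (t_chart_good rot0 branch_polyE iN').
have [[e oe ce] [f of_ cf]] := crossing_signs aP c1 c2 cd dc e1 e2 D0.
split.
  rewrite (pairing_sign (loop0_closed_C1 iN') (loop0_closed_C1 iN) h01 z01 _ ce) //.
  by move=> x y; exact: loop_meet.
rewrite (pairing_sign (loop0_closed_C1 iN) (loop0_closed_C1 iN') z01 h01 _ cf) //.
by move=> x y x01 y01; split=> [/esym/(loop_meet iN y01 x01)[]|[-> ->]] //; rewrite loop_junction.
Qed.

End Pairing.
End Crossings.

(** * Monodromy of square roots *)

Section SquareRootLift.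
Context (R : realType).
Local Notation C := (R[i]^o).
Implicit Types (s t : R).

(* The root is the product of the principal roots of the ratios of [h] at nearby times. *)
Lemma sqrt_homotopy (V : topologicalType) (D : set V) (h : R * V -> C) : compact D ->
  (forall t x, D x -> cts h (t, x)) -> (forall t x, h (t, x) != 0) ->
  exists G : V -> C, forall x, D x -> cts G x /\ G x ^+ 2 = h (1, x) / h (0, x).
Proof.
move=> cD hc h0.
pose P a b := exists G : V -> C, forall x, D x -> cts G x /\ G x ^+ 2 = h (b, x) / h (a, x).
have hcx t x : D x -> cts (fun y => h (t, y)) x.
  move=> Dx; apply: (cts_comp (h := fun y => (t, y)) _ (hc t x Dx)).
  by apply: continuous_pair; [exact: cvg_cst|exact: id].
apply: (@interval_induction R P) => [a b c _ _ [G GP] [F FP]|t _].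
  exists (fun x => G x * F x) => x Dx; have [g1 g2] := GP x Dx; have [f1 f2] := FP x Dx.
  by split; [exact: ctsM|rewrite exprMn g2 f2 mulrC mulrA divfK].
have N : \forall a \near t, D `<=` [set x | 0 < complex.Re (h (a, x) / h (t, x))].
  apply: ((compact_near_coveringP D).1 cD R (nbhs t)
    (fun a x => 0 < complex.Re (h (a, x) / h (t, x)))) => x Dx.
  have [c1 c2] : cts (fun y : V * R => h (y.2, y.1) / h (t, y.1)) (x, t) /\
      0 < complex.Re (h (t, x) / h (t, x)).
    split; last by rewrite divff // ltr01.
    apply: ctsM; last first.
      apply: ctsV => //=; apply: (@cts_comp R _ _ (fun y : V * R => y.1) (fun y => h (t, y))).
        exact: cvg_fst.
      exact: hcx.
    apply: (@cts_comp R _ _ (fun y : V * R => (y.2, y.1)) h); last exact: hc.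
    by apply: continuous_pair; [exact: cvg_snd|exact: cvg_fst].
  have := near_gt (cts_Re c1) c2.
  by case=> -[U1 U2] /= [n1 n2] sub; exists (U1, U2).
have /nbhs_ballP[e /= e0 he] := N.
have near_e a : t - e < a -> a < t + e -> forall x, D x -> 0 < complex.Re (h (a, x) / h (t, x)).
  move=> h1 h2 x Dx; apply: (he a) => //=.
  by rewrite /ball /= ltr_norml; lra.
exists e => // a b ta ab tb _ _.
exists (fun x => sqrtc (h (b, x) / h (t, x)) * (sqrtc (h (a, x) / h (t, x)))^-1) => x Dx.
have pa : 0 < complex.Re (h (a, x) / h (t, x)) by apply: near_e => //; lra.
have pb : 0 < complex.Re (h (b, x) / h (t, x)) by apply: near_e => //; lra.
have hq a' : cts (fun y => h (a', y) / h (t, y)) x.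
  by apply: ctsM; [exact: hcx|apply: ctsV => //; exact: hcx].
split; last first.
  rewrite exprMn exprVn !sqr_sqrtc invf_div mulrA divfK //.
apply: ctsM; first exact: (cts_compC (hq b) (cts_sqrtc pb)).
apply: ctsV; first exact: (Re_gt0_neq0 (Re_sqrtc_gt0 pa)).
exact: (cts_compC (hq a) (cts_sqrtc pa)).
Qed.

(** A continuous retraction of the plane onto the standard simplex. *)
Definition clamp2 (x : R * R) : R * R :=
  (clamp x.1, Num.min (clamp x.2) (1 - clamp x.1)).

Lemma clamp2_cont : continuous clamp2.
Proof.
move=> x.
have c1 : {for x, continuous (fun y : R * R => clamp y.1)}.
  by apply: (@cont_comp R _ (fun y : R * R => y.1) (@clamp R) x); [exact: cvg_fst|exact: clamp_continuous].
have c2 : {for x, continuous (fun y : R * R => clamp y.2)}.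
  by apply: (@cont_comp R _ (fun y : R * R => y.2) (@clamp R) x); [exact: cvg_snd|exact: clamp_continuous].
apply: (continuous_pair c1).
apply: continuous_min => //; apply: contD; [exact: cont_cst|exact: contN].
Qed.

Lemma clamp2_simplex x : @std_simplex2 R (clamp2 x).
Proof.
rewrite /std_simplex2 /clamp2 /=; have := clamp01 x.1; have := clamp01 x.2.
set a := clamp _; set b := clamp _ => /andP[a0 a1] /andP[b0 b1].
by split=> //; split; [rewrite le_min a0; lra|rewrite -lerBrDl ge_min lexx orbT].
Qed.

Lemma clamp2_id x : @std_simplex2 R x -> clamp2 x = x.
Proof.
case: x => a b [/= a0 [b0 ab]]; rewrite /clamp2 /= !clamp_id; try by apply/andP; split; lra.
by congr (_, _); apply/min_idPl; lra.
Qed.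

End SquareRootLift.

(** * The sign change of a square root as a character of homology mod 2 *)

Section Monodromy.
Context (R : realType) (T : topologicalType) (S : set T).
Local Notation C := (R[i]^o).
Context (phi : T -> C).
Hypothesis phi_cts : forall x, S x -> cts phi x.
Hypothesis phi_neq0 : forall x, S x -> phi x != 0.
Implicit Types (s : R -> T) (f : R -> C).

Definition rlift s f : Prop := (forall x, cts f x) /\
  forall x, f x ^+ 2 = phi (s (clamp x)).

Definition base_root (P : T) : C := sqrtc (phi P).

Lemma rlift_neq0 s f x : singular1 S s -> rlift s f -> f x != 0.
Proof.
move=> [_ sS] [_ f2]; rewrite -sqrf_eq0 f2; apply: phi_neq0; apply: sS; exact: clamp01.
Qed.

(** The ratio of two lifts is continuous with values 1 and -1, hence locally constant;
    [interval_induction] compares it at the two ends. *)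
Lemma rlift_uniq s f f' : singular1 S s -> rlift s f -> rlift s f' -> f 1 * f' 0 = f 0 * f' 1.
Proof.
move=> ss lf lf'; have f0 x := rlift_neq0 x ss lf; have f0' x := rlift_neq0 x ss lf'.
apply: (@interval_induction R (fun a b => f b * f' a = f a * f' b)) => [a b c _ _ e1 e2|t _].
  by apply: (mulIf (f0' b)); rewrite mulrAC e2 mulrAC e1 mulrAC.
pose u y := f y / f' y.
have u2 y : u y ^+ 2 = 1.
  by rewrite expr_div_n lf.2 lf'.2 divff // -lf.2 sqrf_eq0.
have uc : cts u t by apply: ctsM; [exact: lf.1|apply: ctsV => //; exact: lf'.1].
have ut : 0 < nrm (u t) by rewrite nrm_gt0 -sqrf_eq0 u2 oner_eq0.
have /nbhs_ballP[e /= e0 he] := (ctsE u t).1 uc _ ut.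
have uE a : t - e < a -> a < t + e -> u a = u t.
  move=> h1 h2; apply: sqr_near_eq; rewrite ?u2 //; apply: he.
  by rewrite /ball /= ltr_norml; lra.
exists e => // a b ta ab tb _ _.
have : u a = u b by rewrite !uE //; lra.
by rewrite /u => /(congr1 (fun z => z * f' a * f' b)); rewrite divfK // mulrAC divfK // => ->.
Qed.

(* Whether continuation along [s] exchanges the two roots of [phi], as compared with the choice
   [base_root] at both ends. *)
Definition mono s : bool :=
  ~~ `[< exists2 f, rlift s f & f 1 * base_root (s 0) = f 0 * base_root (s 1) >].

Lemma sign_neq (b : bool) (z : C) : z != 0 -> (-1) ^+ b * z = z -> b = false.
Proof.
case: b => // z0; rewrite mulN1r => e; exfalso; move/eqP: z0; apply.
have : z + z = 0 by rewrite -{1}e addNr.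
by move/eqP; rewrite -mulr2n mulrn_eq0 /= => /eqP.
Qed.

Lemma sign_addb (a b : bool) : (-1) ^+ a * (-1) ^+ b = (-1) ^+ (a (+) b) :> C.
Proof. by case: a; case: b; rewrite !(expr0, expr1) ?mul1r ?mulr1 ?mulrNN ?mulr1. Qed.

Lemma base_root_sqr P : base_root P ^+ 2 = phi P.
Proof. exact: sqr_sqrtc. Qed.

Lemma monoE s f (b : bool) : singular1 S s -> rlift s f ->
  f 1 * base_root (s 0) = (-1) ^+ b * (f 0 * base_root (s 1)) -> mono s = b.
Proof.
move=> ss lf e; have sS1 : S (s 1) by apply: ss.2; rewrite ler01 lexx.
have r1 : base_root (s 1) != 0 by rewrite -sqrf_eq0 base_root_sqr; exact: phi_neq0.
have f0 := rlift_neq0 0 ss lf.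
rewrite /mono; case: b e => e; last first.
  by apply: negbTE; rewrite negbK; apply/asboolP; exists f; rewrite // e expr0 mul1r.
apply/negP => /asboolP[f' lf' e'].
have u := rlift_uniq ss lf lf'; have f0' := rlift_neq0 0 ss lf'.
have : (-1) ^+ true * (f 0 * base_root (s 1) * f' 0) = f 0 * base_root (s 1) * f' 0.
  transitivity (f 1 * f' 0 * base_root (s 0)); first by rewrite mulrA -e mulrAC.
  by rewrite u -[LHS]mulrA e' mulrA mulrAC.
have /sign_neq sn : f 0 * base_root (s 1) * f' 0 != 0 by rewrite !mulf_neq0.
by move/(sn true).
Qed.

Lemma mono_ends s f (a b : bool) : singular1 S s -> rlift s f ->
  f 0 = (-1) ^+ a * base_root (s 0) -> f 1 = (-1) ^+ b * base_root (s 1) -> mono s = a (+) b.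
Proof.
move=> ss lf e0 e1; apply: (monoE ss lf); rewrite e0 e1 -!mulrA.
by rewrite (mulrA ((-1) ^+ (a (+) b))) sign_addb addbAC addbb; congr (_ * _); rewrite mulrC.
Qed.

Lemma mono_closed s f (b : bool) : singular1 S s -> s 0 = s 1 -> rlift s f ->
  f 1 = (-1) ^+ b * f 0 -> mono s = b.
Proof. by move=> ss s01 lf e; apply: (monoE ss lf); rewrite e s01 mulrA. Qed.

Lemma edge_singular1 (sigma : R * R -> T) (u : R -> R * R) : singular2 S sigma ->
  continuous u -> (forall x, 0 <= x <= 1 -> @std_simplex2 R (u x)) ->
  singular1 S (fun x => sigma (u x)).
Proof.
move=> [sc sS] uc uS; split; last by move=> x /uS; exact: sS.
apply/within_continuousP => x; rewrite /= in_itv /= => x01 U HU.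
have := (within_continuousP _ _).1 sc (u x) (uS x x01) U HU.
move=> H.
have N : \forall y \near x, @std_simplex2 R (u y) -> U (sigma (u y)) := uc x _ H.
by apply: filterS N => y h; rewrite in_itv /= => y01; exact: h (uS y y01).
Qed.

(** A root [F] of [phi] exists on the whole triangle. Each edge has as [mono] the sum of the signs
    of [F] against [base_root] at its two ends, and every vertex occurs twice. *)
Lemma mono_boundary (sigma : R * R -> T) : singular2 S sigma ->
  mono (fun x => sigma (1 - x, x)) (+) mono (fun x => sigma (0, x)) (+)
  mono (fun x => sigma (x, 0)) = false.
Proof.
move=> ss; have [sc sS] := ss.
pose sg x := sigma (clamp2 x).
have sgc : continuous sg.
  move=> x U HU; have H := (within_continuousP _ _).1 sc _ (clamp2_simplex x) U HU.
  have N : \forall y \near x, @std_simplex2 R (clamp2 y) -> U (sg y) := @clamp2_cont R x _ H.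
  by apply: filterS N => y; apply; exact: clamp2_simplex.
have sgS x : S (sg x) by apply: sS; exact: clamp2_simplex.
(* The contraction of the triangle to the vertex [(0, 0)], along which [sqrt_homotopy] extends the
   root from that vertex. *)
pose h (y : R * (R * R)) := phi (sg (y.1 * y.2.1, y.1 * y.2.2)).
have hc t x : cts h (t, x).
  apply: (@cts_comp R _ _ (fun y : R * (R * R) => sg (y.1 * y.2.1, y.1 * y.2.2)) phi);
    last exact: phi_cts.
  have c1 : {for (t, x), continuous (fun y : R * (R * R) => y.1)} by exact: cvg_fst.
  have c2 : {for (t, x), continuous (fun y : R * (R * R) => y.2)} by exact: cvg_snd.
  have c21 : {for (t, x), continuous (fun y : R * (R * R) => y.2.1)}.
    by move=> U HU; exact: (c2 _ (cvg_fst HU)).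
  have c22 : {for (t, x), continuous (fun y : R * (R * R) => y.2.2)}.
    by move=> U HU; exact: (c2 _ (cvg_snd HU)).
  have mc := continuous_pair (contM c1 c21) (contM c1 c22).
  by move=> U /sgc; exact: mc.
have h0 t x : h (t, x) != 0 by exact: phi_neq0.
have cD := compact_setX (@segment_compact R 0 1) (@segment_compact R 0 1).
have [G GP] := sqrt_homotopy cD (fun t x _ => hc t x) h0.
have inD (x : R * R) : (`[0, 1] `*` `[0, 1])%classic (clamp2 x).
  case: (clamp2 x) (clamp2_simplex x) => a b [/= a0 [b0 ab]].
  by split; rewrite /= in_itv /=; apply/andP; split=> //; lra.
pose F x := base_root (sg (0, 0)) * G (clamp2 x).
have Fc x : cts F x.
  apply: ctsM; first exact: cts_cst.
  apply: (cts_comp (h := @clamp2 R) (@clamp2_cont R x)).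
  by have [] := GP _ (inD x).
have F2 x : F x ^+ 2 = phi (sigma (clamp2 x)).
  rewrite exprMn base_root_sqr; have [_ ->] := GP _ (inD x).
  have -> : h (1, clamp2 x) = phi (sg (clamp2 x)).
    by case: (clamp2 x) => a b; rewrite /h /= !mul1r.
  have -> : h (0, clamp2 x) = phi (sg (0, 0)) by rewrite /h /= !mul0r.
  rewrite mulrC divfK; first by rewrite /sg clamp2_id //; exact: clamp2_simplex.
  exact: phi_neq0.
have edge (u : R -> R * R) : continuous u -> (forall x, 0 <= x <= 1 -> @std_simplex2 R (u x)) ->
    forall a b : bool, F (u 0) = (-1) ^+ a * base_root (sigma (u 0)) ->
    F (u 1) = (-1) ^+ b * base_root (sigma (u 1)) -> mono (fun x => sigma (u x)) = a (+) b.
  move=> uc uS a b e0 e1; apply: (@mono_ends _ (fun x => F (u (clamp x)))).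
  - exact: edge_singular1.
  - split=> x; last by rewrite F2 clamp2_id //; apply: uS; exact: clamp01.
    apply: (@cts_comp R _ _ (fun x => u (clamp x)) F); last exact: Fc.
    by move=> U /uc; exact: clamp_continuous.
  - by rewrite clamp0.
  - by rewrite clamp1.
have root P : @std_simplex2 R P -> exists a : bool, F P = (-1) ^+ a * base_root (sigma P).
  by move=> PD; apply: sqr_eq_sign; rewrite F2 base_root_sqr clamp2_id.
have [a00 e00] : exists a : bool, F (0, 0) = (-1) ^+ a * base_root (sigma (0, 0)).
  by apply: root; rewrite /std_simplex2 /=; split=> //; split=> //; lra.
have [a10 e10] : exists a : bool, F (1, 0) = (-1) ^+ a * base_root (sigma (1, 0)).
  by apply: root; rewrite /std_simplex2 /=; split=> //; split=> //; lra.
have [a01 e01] : exists a : bool, F (0, 1) = (-1) ^+ a * base_root (sigma (0, 1)).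
  by apply: root; rewrite /std_simplex2 /=; split=> //; split=> //; lra.
have idc : continuous (fun x : R => x) by move=> x; exact: cont_id.
have cc (a : R) : continuous (fun _ : R => a) by move=> x; exact: cont_cst.
have rc : continuous (fun x : R => 1 - x) by move=> x; apply: contD; [exact: cc|apply: contN; exact: idc].
rewrite (@edge (fun x => (1 - x, x)) _ _ a10 a01); last 4 first.
- by move=> x; exact: (continuous_pair (rc x) (idc x)).
- by move=> x x01; rewrite /std_simplex2 /=; split; [lra|split; lra].
- by rewrite subr0.
- by rewrite subrr.
rewrite (@edge (fun x => (0, x)) _ _ a00 a01) //; last 2 first.
- by move=> x; exact: (continuous_pair (cc 0 x) (idc x)).
- by move=> x x01; rewrite /std_simplex2 /=; split; [lra|split; lra].
rewrite (@edge (fun x => (x, 0)) _ _ a00 a10) //; last 2 first.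
- by move=> x; exact: (continuous_pair (idc x) (cc 0 x)).
- by move=> x x01; rewrite /std_simplex2 /=; split; [lra|split; lra].
by case: a00 {e00}; case: a10 {e10}; case: a01 {e01}.
Qed.

Definition mono_chain (c : {freeg (R -> T) / 'F_2}) : 'F_2 :=
  fglift (fun s => (mono s)%:R : ('F_2)^o) c.

Lemma mono_chainB c d : mono_chain (c - d) = mono_chain c - mono_chain d.
Proof. exact: (@lift_is_additive 'F_2 (R -> T) ('F_2)^o). Qed.

Lemma mono_chainU s : mono_chain << s >> = (mono s)%:R.
Proof. by rewrite /mono_chain liftU scale1r. Qed.

Lemma mono_chain0 : mono_chain 0 = 0.
Proof. by have := mono_chainB 0 0; rewrite !subrr. Qed.

Lemma mono_chainD c d : mono_chain (c + d) = mono_chain c + mono_chain d.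
Proof. by rewrite -{1}[d]opprK mono_chainB -(sub0r d) mono_chainB mono_chain0 sub0r opprK. Qed.

Lemma F2_cases (k : 'F_2) : k = 0 \/ k = 1.
Proof. by case: k => [[|[|//]] i]; [left|right]; apply/val_inj. Qed.

Lemma natF2D (a b : bool) : (a%:R + b%:R : 'F_2) = (a (+) b)%:R.
Proof. by case: a; case: b; apply/val_inj. Qed.

Lemma natF2N (a : bool) : - (a%:R : 'F_2) = a%:R.
Proof. by case: a; apply/val_inj. Qed.

Lemma mono_bnd (c : {freeg (R -> T) / 'F_2}) : c \in @bnd R T 'F_2 S -> mono_chain c = 0.
Proof.
move=> /asboolP[l [lS ->]]; elim: l lS => [|k l IH] lS; first by rewrite big_nil mono_chain0.
rewrite big_cons mono_chainD IH ?addr0; last by move=> k' k'l; apply: lS; rewrite inE k'l orbT.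
case: (F2_cases k.1) => ->; first by rewrite scale0r mono_chain0.
rewrite scale1r /bd2 mono_chainD mono_chainB !mono_chainU natF2N !natF2D mono_boundary //.
by apply: lS; rewrite inE eqxx.
Qed.

Definition mono_class (h : H1 R T 'F_2 S) : 'F_2 := mono_chain (hrepr h).

Lemma mono_class_hclass c : c \in cycle1 S -> mono_class (hclass S c) = mono_chain c.
Proof.
by move=> /hclassP[_ /mono_bnd]; rewrite mono_chainB => /eqP; rewrite subr_eq0 => /eqP.
Qed.

Lemma mono_classB (h k : H1 R T 'F_2 S) : mono_class (h - k) = mono_class h - mono_class k.
Proof.
have := embB h k; rewrite /emb -clB => /cl_eq /mono_bnd; rewrite !mono_chainB.
by move/eqP; rewrite subr_eq0 => /eqP.
Qed.

Lemma mono_loop s : singular1 S s -> s 0 = s 1 -> mono_class (hclass S << s >>) = (mono s)%:R.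
Proof. by move=> ss s01; rewrite mono_class_hclass ?mono_chainU //; exact: closed_cycle. Qed.

End Monodromy.

(** * Reduction mod 2 on homology *)

Section ReductionMod2.
Context (R : realType) (T : topologicalType) (S : set T).
Local Notation chain G := {freeg (R -> T) / G}.

Lemma zlift_additive (K : choiceType) (U W : zmodType) (h : U -> W) (f : K -> U)
    (c : {freeg K / int}) : (forall x y, h (x - y) = h x - h y) ->
  h (zlift f c) = zlift (fun k => h (f k)) c.
Proof.
move=> hB; pose h' : {additive U -> W} := HB.pack h (GRing.isZmodMorphism.Build U W h hB).
rewrite !zliftE -[LHS]/(h' _) raddf_sum; apply: eq_bigr => k _.
by rewrite raddfMz.
Qed.

Lemma zlift_id (K : choiceType) (c : {freeg K / int}) : zlift (fun k => << k >>) c = c.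
Proof.
rewrite zliftE -[RHS]freeg_sumE; apply: eq_bigr => k _.
by apply/eqP/freeg_eqP => x; rewrite raddfMz /= !coeffU mul1r -mulrzr intz mulrC.
Qed.

Definition redc (K : choiceType) (c : {freeg K / int}) : {freeg K / 'F_2} :=
  zlift (fun k => << k >>) c.

Lemma redcB (K : choiceType) (c d : {freeg K / int}) : redc (c - d) = redc c - redc d.
Proof. exact: zliftB. Qed.

Lemma redcU (K : choiceType) (k : K) : redc << k >> = << k >>.
Proof. exact: zliftU1. Qed.

Lemma redcE (c : chain int) :
  \sum_(s <- dom c) << (coeff s c)%:~R *g s >> = redc c :> chain 'F_2.
Proof.
rewrite /redc zliftE; apply: eq_bigr => s _.
by apply/eqP/freeg_eqP => x; rewrite raddfMz /= !coeffU mul1r mulrzl.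
Qed.

Lemma bd1_redc (c : chain int) : bd1 (redc c) = redc (bd1 c).
Proof.
rewrite (zlift_additive _ _ (@bd1B R T 'F_2)) -{2}(zlift_id c).
have hB (x y : chain int) : redc (bd1 (x - y)) = redc (bd1 x) - redc (bd1 y).
  by rewrite bd1B redcB.
rewrite (zlift_additive _ _ hB); congr (zlift _ c); apply/funext => s.
by rewrite /bd1 !liftU !scale1r redcB !redcU.
Qed.

Lemma redc_cycle (c : chain int) : c \in cycle1 S -> redc c \in cycle1 S.
Proof.
move=> /asboolP[cS c0]; apply/asboolP; split; last by rewrite bd1_redc c0 /redc zlift0.
move=> s; have [s0|/cS //] := eqVneq (coeff s c) 0.
suff -> : coeff s (redc c) = 0 by rewrite eqxx.
rewrite -redcE raddf_sum big1_seq // => k /andP[_ kc].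
rewrite /= coeffU; have [ks|_] := eqVneq k s; last by rewrite mulr0.
by rewrite ks s0 mul0r.
Qed.

Lemma redc_bnd (c : chain int) : c \in @bnd R T int S -> redc c \in @bnd R T 'F_2 S.
Proof.
move=> /asboolP[l [lS ->]]; rewrite /redc zlift_sum.
rewrite big_seq; apply: rpred_sum => k kl; rewrite zliftZ; apply: rpredMz.
have -> : zlift (fun s => << s >>) (bd2 int k.2) = bd2 'F_2 k.2.
  by rewrite /bd2 zliftD zliftB !zliftU1.
by apply: bd2_bnd; exact: lS.
Qed.

(** [red2] works on a chosen representative; as reduction maps boundaries to boundaries, any other
    one gives the same class. *)
Lemma red2_hclass (c : chain int) : c \in cycle1 S -> red2 (hclass S c) = hclass S (redc c).
Proof.
move=> cS; have [h1 h2] := hclassP cS; rewrite /red2 redcE.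
by apply: hclass_eq; try exact: redc_cycle; rewrite -redcB; exact: redc_bnd.
Qed.

Lemma red2B (x y : H1 R T int S) : red2 (x - y) = red2 x - red2 y.
Proof.
have [cx <-] := hreprK x; have [cy <-] := hreprK y.
rewrite -hclassB // !red2_hclass ?rpredB // redcB hclassB //; exact: redc_cycle.
Qed.

End ReductionMod2.

(** * Sign characters on the punctured sphere *)

Section RootQuotient.
Context (R : realType) (g : nat) (p : 'I_(2 * g + 2) -> R[i]^o).
Local Notation C := (R[i]^o).
Local Notation off := (~` branch_locus p).
Implicit Types (i j k : 'I_(2 * g + 2)) (z : C) (P : sphere R).

(* The ratio, unlike [z - a], has a nonzero finite value at infinity, the point [None]. *)
Definition quot (a b : C) P : C := if P is Some z then (z - a) / (z - b) else 1.

Lemma quot_neq0 i j P : off P -> quot (p i) (p j) P != 0.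
Proof.
case: P => [z|_]; last exact: oner_neq0.
move=> zB; apply: mulf_neq0; first by rewrite subr_eq0; apply/eqP => zi; apply: zB; exists i; rewrite zi.
by rewrite invr_eq0 subr_eq0; apply/eqP => zi; apply: zB; exists j; rewrite zi.
Qed.

Lemma cts_some (f : C -> C) (h : sphere R -> C) z : (forall x, h (Some x) = f x) -> cts f z ->
  cts h (Some z : sphere R).
Proof.
move=> hf /ctsE fc; apply/ctsE => e e0.
by have := fc e e0; rewrite hf; apply: filterS => x; rewrite /= hf.
Qed.

Lemma quot_cts i j P : off P -> cts (quot (p i) (p j)) P.
Proof.
case: P => [z zB|_].
  apply: (@cts_some (fun z => (z - p i) / (z - p j))) => //.
  apply: ctsM; first by apply: ctsB; [exact: idCc|exact: cts_cst].
  apply: ctsV; last by apply: ctsB; [exact: idCc|exact: cts_cst].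
  by rewrite subr_eq0; apply/eqP => zi; apply: zB; exists j; rewrite zi.
apply/ctsE => e e0.
(* Outside the square of this radius [quot - 1], which is [(p j - p i) / (z - p j)], has norm less
   than [e]. *)
pose r := nrm (p j) + nrm (p j - p i) / e + 1.
exists [set z : C | `|complex.Re z| <= r /\ `|complex.Im z| <= r].
  split; [exact: square_compact|apply: compact_closed; [exact: norm_hausdorff|exact: square_compact]].
move=> P [[z /= zr <-]|->] /=; last first.
  by rewrite !subrr expr0n /= addr0 sqrtr0.
have zn : r < nrm z.
  by rewrite ltNge; apply/negP => zn; apply: zr; split; apply: le_trans zn; [exact: Re_le_nrm|exact: Im_le_nrm].
have zj : nrm (p j - p i) / e < nrm (z - p j).
  by have := nrmB_le z (p j); rewrite /r in zn; lra.
have zj0 : 0 < nrm (z - p j) by apply: le_lt_trans zj; rewrite divr_ge0 ?nrm_ge0 // ltW.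
have zj0' : z - p j != 0 by rewrite -nrm_gt0.
have -> : (z - p i) / (z - p j) - 1 = (p j - p i) / (z - p j).
  by rewrite -(divff zj0') -mulrBl opprB addrC addrA subrK.
by rewrite nrmM nrmV ltr_pdivrMr // mulrC -ltr_pdivrMr.
Qed.

Definition winding i j (h : H1 R (sphere R) 'F_2 off) : 'F_2 := mono_class (quot (p i) (p j)) h.

Lemma windingB i j (h k : H1 R (sphere R) 'F_2 off) :
  winding i j (h - k) = winding i j h - winding i j k.
Proof. by apply: mono_classB; [exact: quot_cts|exact: quot_neq0]. Qed.

Definition square_root (b : bool) (a : C) (s u : R -> C) : Prop :=
  [/\ forall x, cts u x, forall x, u x ^+ 2 = s x - a & u 1 = (-1) ^+ b * u 0].

(** The quotient of the two roots is a lift of [quot] along the loop, so the sign changes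
    multiply. *)
Lemma winding_loop i j (s u v : R -> C) (b d : bool) : (forall x, cts s x) ->
  (forall x k, s x != p k) -> s 0 = s 1 -> square_root b (p i) s u -> square_root d (p j) s v ->
  winding i j (hclass off << (fun x => Some (s x) : sphere R) >>) = (b (+) d)%:R.
Proof.
move=> sc sB s01 [uc u2 ub] [vc v2 vd].
have ss : singular1 off (fun x => Some (s x) : sphere R).
  apply: path_in_singular1; split=> x; last by move=> [k [/eqP]]; apply/negP.
  move=> U HU; have /ctsP cs := sc x; exact: (cs _ HU).
have v0 x : v x != 0 by rewrite -sqrf_eq0 v2 subr_eq0.
rewrite /winding mono_loop //; [|exact: quot_cts|exact: quot_neq0|by rewrite s01].
congr (_%:R); congr nat_of_bool.
have qn x : off x -> quot (p i) (p j) x != 0 by exact: quot_neq0.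
pose f x := u (clamp x) / v (clamp x).
apply: (@mono_closed R (sphere R) off (quot (p i) (p j)) qn _ f) => //.
- by rewrite s01.
- split=> x; last by rewrite /= exprMn exprVn u2 v2.
  apply: ctsM; first exact: (cts_comp (h := @clamp R) (@clamp_continuous R x)).
  by apply: ctsV => //; exact: (cts_comp (h := @clamp R) (@clamp_continuous R x)).
by rewrite /f clamp0 clamp1 ub vd invfM mulrACA -exprVn invrN1 sign_addb.
Qed.

Local Notation pi := (trigo.pi : R).
Definition unit_circle (t : R) : C := cos (2 * pi * t) +i* sin (2 * pi * t).

Lemma double_pi t : 2 * pi * t = pi * t + pi * t.
Proof. by ring. Qed.

Definition half_circle (t : R) : C := cos (pi * t) +i* sin (pi * t).

Lemma half_circle_sqr t : half_circle t ^+ 2 = unit_circle t.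
Proof.
rewrite /half_circle /unit_circle double_pi cosD sinD expr2.
by apply/eqP; rewrite eq_complex /=; apply/andP; split; apply/eqP; ring.
Qed.

Lemma half_circle_cts t : cts half_circle t.
Proof.
by apply: cts_Complex; apply: (@cont_comp R _ (fun y => pi * y)); (try exact: cont_pi (@cont_id _ _));
  [exact: continuous_cos|exact: continuous_sin].
Qed.

Lemma unit_circle_cts t : cts unit_circle t.
Proof.
have -> : unit_circle = fun t => half_circle t ^+ 2 by apply/funext => x; rewrite half_circle_sqr.
exact: ctsX (half_circle_cts t).
Qed.

Lemma nrm_half_circle t : nrm (half_circle t) = 1.
Proof. by apply/eqP; rewrite -sqrp_eq1 ?nrm_ge0 // nrm_sqr /= cos2Dsin2. Qed.

Lemma nrm_unit_circle t : nrm (unit_circle t) = 1.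
Proof. by rewrite -half_circle_sqr nrmX nrm_half_circle expr1n. Qed.

Hypothesis p_inj : injective p.

Lemma branch_radiusP m : 0 < branch_radius p m /\
  forall k, k != m -> branch_radius p m <= nrm (p m - p k) / 2.
Proof.
split; last first.
  move=> k km; rewrite nrmBC.
  apply: (le_trans (y := complex.Re `|p k - p m| / 2)); last by rewrite normcE_real.
  by rewrite /branch_radius (bigD1 k) //= ge_min lexx.
rewrite /branch_radius; apply: (big_ind (fun x : R => 0 < x)) => [|x y x0 y0|k km].
- exact: ltr01.
- by rewrite lt_min x0 y0.
by rewrite normcE_real /= divr_gt0 ?ltr0n // nrm_gt0 subr_eq0; apply: contra km => /eqP/p_inj ->.
Qed.

Definition circle m (t : R) : C := p m + (branch_radius p m)%:C * unit_circle t.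

Lemma circle_cts m t : cts (circle m) t.
Proof. by apply: ctsD; [exact: cts_cst|apply: ctsM; [exact: cts_cst|exact: unit_circle_cts]]. Qed.

Lemma unit_circle01 : unit_circle 1 = unit_circle 0.
Proof. by rewrite -!half_circle_sqr /half_circle !mulr1 !mulr0 cospi sinpi cos0 sin0 !expr2; 
  apply/eqP; rewrite eq_complex /=; apply/andP; split; apply/eqP; ring. Qed.

(** At the center of the circle the root is a multiple of [half_circle], which changes sign. For
    another branch point the radius is at most half the distance, so the ratio of [circle m t - p k]
    to [p m - p k] stays in the right half plane and its principal root closes up. *)
Lemma circle_root m k : exists u, square_root (k == m) (p k) (circle m) u.
Proof.
have [r0 rk] := branch_radiusP m; set r := branch_radius p m in r0 rk.
have [->|km] := eqVneq k m.
  exists (fun t => toC (Num.sqrt r) * half_circle t); split=> [x|x|].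
  - by apply: ctsM; [exact: cts_cst|exact: half_circle_cts].
  - rewrite exprMn half_circle_sqr /circle [p m + _]addrC addrK -/r /toC -rmorphXn /=.
    by rewrite sqr_sqrtr // ltW.
  - rewrite expr1 mulrCA; congr (_ * _); rewrite /half_circle mulr1 mulr0 cospi sinpi cos0 sin0.
    by apply/eqP; rewrite eq_complex /=; apply/andP; split; apply/eqP; ring.
have d0 : p m - p k != 0 by rewrite subr_eq0; apply: contra km => /eqP/p_inj ->.
pose y t : C := 1 + toC r * unit_circle t / (p m - p k).
have y0 t : 0 < complex.Re (y t).
  have dn : 0 < nrm (p m - p k) by rewrite nrm_gt0.
  have xb : nrm (toC r * unit_circle t / (p m - p k)) <= 2^-1.
    rewrite !nrmM nrmV nrm_unit_circle mulr1 nrm_real gtr0_norm //.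
    by rewrite ler_pdivrMr // mulrC; exact: rk.
  have := le_trans (Re_le_nrm _) xb; rewrite ler_norml /y cReD /= => /andP[h _].
  by lra.
have yc t : cts y t.
  apply: ctsD; first exact: cts_cst.
  by apply: ctsM; [apply: ctsM; [exact: cts_cst|exact: unit_circle_cts]|exact: cts_cst].
exists (fun t => sqrtc (p m - p k) * sqrtc (y t)); split=> [x|x|].
- by apply: ctsM; [exact: cts_cst|exact: (cts_compC (yc x) (cts_sqrtc (y0 x)))].
- rewrite exprMn !sqr_sqrtc /y mulrDr mulr1 mulrCA divff // mulr1 /circle /toC.
  by rewrite addrAC.
- by rewrite expr0 mul1r /y unit_circle01.
Qed.

Lemma circle_neq m t k : circle m t != p k.
Proof.
have [r0 rk] := branch_radiusP m; rewrite /circle; set r := branch_radius p m in r0 rk *.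
have rn : nrm (r%:C * unit_circle t) = r by rewrite nrmM nrm_unit_circle mulr1 nrm_real gtr0_norm.
have [->|km] := eqVneq k m.
  apply/negP => /eqP/(canRL (addKr _)); rewrite addNr => e.
  by move: rn r0; rewrite e (nrm_real 0) normr0 => <-; rewrite ltxx.
apply/negP => /eqP e; have := rk k km; rewrite -e opprD addrA subrr sub0r nrmN rn; lra.
Qed.

Lemma winding_epsilon i j m : winding i j (epsilon p m) = ((i == m) (+) (j == m))%:R.
Proof.
have [u iu] := circle_root m i; have [v jv] := circle_root m j.
rewrite -(winding_loop (@circle_cts m) (@circle_neq m) _ iu jv) //.
by rewrite /circle unit_circle01.
Qed.

End RootQuotient.

(** * Sign characters on the loops over the segments *)

Section LoopWinding.
Context (R : realType) (g : nat) (p : 'I_(2 * g + 2) -> R[i]^o).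
Local Notation C := (R[i]^o).
Local Notation T := (curve p).
Local Notation n := (2 * g + 2)%N.
Local Notation off := (~` branch_locus p).
Context (q : nat -> C) (rot : C).
Hypothesis rot0 : rot != 0.
Hypothesis q_sorted : forall i j, (i < j)%N -> (j < n)%N ->
  ell rot (q i) < ell rot (q j).
Hypothesis branch_polyE : forall z, branch_poly p z = \prod_(k <- iota 0 n) (z - q k).
Context (pos : 'I_n -> nat).
Hypothesis pos_lt : forall k, (pos k < n)%N.
Hypothesis pE : forall k, p k = q (pos k).
Local Notation loop := (loop p q rot).
Local Notation strip := (strip g q rot).
Implicit Types (i j k : nat) (e s t : R).

Lemma csin_neq0 e s : 0 < e -> csin e s != 0.
Proof.
move=> e0; apply/eqP => z0; have := congr1 (@complex.Re R) z0; have := congr1 (@complex.Im R) z0.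
rewrite /csin /= => /eqP; rewrite mulf_eq0 (gt_eqF e0) orbF => /eqP c0 /eqP.
have r0 : 0 < Num.sqrt (1 + e ^+ 2) by rewrite sqrtr_gt0; nra.
rewrite mulf_eq0 (gt_eqF r0) orbF => /eqP s0; have := cos2Dsin2 (trigo.pi * s).
by rewrite s0 c0 !expr0n /= addr0 => /esym/eqP; rewrite oner_eq0.
Qed.

Lemma ccos_neq0 e s : 0 < e -> ccos e s != 0.
Proof.
move=> e0; apply/eqP => z0; have := congr1 (@complex.Re R) z0; have := congr1 (@complex.Im R) z0.
rewrite /ccos /= => /eqP; rewrite oppr_eq0 mulf_eq0 (gt_eqF e0) orbF => /eqP c0 /eqP.
have r0 : 0 < Num.sqrt (1 + e ^+ 2) by rewrite sqrtr_gt0; nra.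
rewrite mulf_eq0 (gt_eqF r0) orbF => /eqP s0; have := cos2Dsin2 (trigo.pi * s).
by rewrite s0 c0 !expr0n /= addr0 => /esym/eqP; rewrite oner_eq0.
Qed.

Lemma loop_z_cts i e s : cts (loop_z q i e) s.
Proof.
apply: ctsD; first exact: cts_cst.
by apply: ctsM; [exact: cts_cst|apply: ctsX; exact: (C1_cont (@toCc R) (C1_csin e s))].
Qed.

(** Up to constants [csin] and [ccos] are the roots of [z] minus either focus, and they change sign
    over one period. For the other branch points the root [sr] is holomorphic along the loop. *)
Lemma loop_root i e k : (i.+1 < n)%N -> (k < n)%N -> 0 < e ->
  (forall s, strip 1 i (loop_z q i e s)) ->
  exists2 u, square_root ((k == i) || (k == i.+1)) (q k) (loop_z q i e) u & forall s, u s != 0.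
Proof.
move=> iN kN e0 st.
have en : edge q i != 0.
  by rewrite subr_eq0; apply/eqP => qe; have := ell_ltS q_sorted iN; rewrite qe ltxx.
have [->|ki] := eqVneq k i.
  exists (fun s => sqrtc (edge q i) * csin e s).
    split=> [s|s|].
    - by apply: ctsM; [exact: cts_cst|exact: (C1_cont (@toCc R) (C1_csin e s))].
    - by rewrite exprMn sqr_sqrtc /loop_z addrAC subrr add0r.
    - by rewrite expr1 -[1]add0r csin_shift mulrN mulN1r.
  by move=> s; rewrite mulf_neq0 ?csin_neq0 // -sqrf_eq0 sqr_sqrtc.
have [->|kS] := eqVneq k i.+1.
  exists (fun s => sqrtc (- edge q i) * ccos e s).
    split=> [s|s|].
    - by apply: ctsM; [exact: cts_cst|exact: (C1_cont (@toCc R) (C1_ccos e s))].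
    - by rewrite exprMn sqr_sqrtc loop_zB mulNr.
    - by rewrite expr1 -[1]add0r ccos_shift mulrN mulN1r.
  by move=> s; rewrite mulf_neq0 ?ccos_neq0 // -sqrf_eq0 sqr_sqrtc oppr_eq0.
have ok : outer 1 i k by rewrite /outer addn1; lia.
have sd s := st s k kN ok.
exists (fun s => sr q rot (k < i)%N k (loop_z q i e s)).
  split=> [s|s|].
  - apply: (cts_compC (loop_z_cts i e s)).
    have sC := sr_C1 (sd s).
    exact: (@C1_cont R _ (fun z : C => z) (@idCc R) _ _ sC).
  - exact: sr_sqr.
  - by rewrite expr0 mul1r -[1]add0r loop_z_periodic.
by move=> s; exact: sr_neq0.
Qed.

Lemma loop_off_branch i e (k : 'I_n) s : (i.+1 < n)%N -> 0 < e ->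
  (forall s, strip 1 i (loop_z q i e s)) -> loop_z q i e s != p k.
Proof.
move=> iN e0 st; have [u [_ u2 _] un] := loop_root iN (pos_lt k) e0 st.
by rewrite -subr_eq0 pE -u2 sqrf_eq0.
Qed.

Lemma cover_piece (P : T) : piece false P -> Defs.cover P = Some (crd false P).1.
Proof. by case: P. Qed.

(** [v] is prescribed on cycles away from the ramification points, which [loop i 0] meets; the
    homologous loop over an ellipse avoids them. *)
Lemma winding_red2_loop (v : {additive H1 R T 'F_2 [set: T] -> H1 R (sphere R) 'F_2 off})
    (vP : is_pushforward_off_branch v) i (a b : 'I_n) : (i.+1 < n)%N ->
  winding a b (v (red2 (hclass [set: T] << loop i 0 >>))) =
  (((pos a == i) || (pos a == i.+1)) (+) ((pos b == i) || (pos b == i.+1)))%:R.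
Proof.
move=> iN; have [e /andP[e0 e1] st] := loop_strip q_sorted iN.
have st' s : strip 1 i (loop_z q i e s) by apply: st; rewrite ltW // lexx.
have ste c s : 0 <= c <= e -> strip 1 i (loop_z q i c s) by exact: st.
rewrite -[hclass _ _]/(loop_class int (loop i 0)).
rewrite -(loop_pushed_class rot0 q_sorted branch_polyE iN (ltW e0) ste).
have lp := loop_path rot0 branch_polyE iN st'.
have lc : (<< loop i e >> : {freeg (R -> T) / int}) \in cycle1 [set: T].
  by apply: closed_cycle (path_in_singular1 lp) _; rewrite -[1]add0r loop_periodic.
have cE s : Defs.cover (loop i e s) = Some (loop_z q i e s).
  by rewrite cover_piece ?piece_loop // (crd_loop rot0 branch_polyE).
rewrite /loop_class red2_hclass // redcU vP; last first.
  apply: closed_cycle; last by rewrite -[1]add0r loop_periodic.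
  have [lcont _] := lp; apply: path_in_singular1; split=> // s [k].
  by rewrite cE => -[] /eqP; rewrite (negPf (loop_off_branch k s iN e0 st')).
rewrite /push liftU scale1r.
have -> : @Defs.cover R g p \o loop i e = fun s => Some (loop_z q i e s) by apply/funext => s; exact: cE.
have [u au _] := loop_root iN (pos_lt a) e0 st'; have [u' bu _] := loop_root iN (pos_lt b) e0 st'.
rewrite -!pE in au bu.
apply: (winding_loop _ _ _ au bu).
- exact: loop_z_cts.
- by move=> s k; exact: loop_off_branch.
- by rewrite -[1]add0r loop_z_periodic.
Qed.

End LoopWinding.

(** * The cubic form *)

Section Tensors.
Context (U V W : zmodType) (f : U -> V -> W).
Hypothesis fBl : forall u u' v, f (u - u') v = f u v - f u' v.
Hypothesis fBr : forall u v v', f u (v - v') = f u v - f u v'.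

Local Notation tq := (Quotient.quot (generated_subgroup (@tensor_relation U V))).

Lemma tensor_lift_zlift (x : tensor U V) :
  tensor_lift f x = zlift (fun k => f k.1 k.2) (repr (x : tq)).
Proof. by rewrite zliftE. Qed.

Lemma tens_pi_eq (c d : {freeg (U * V) / int}) :
  \pi_tq c = \pi_tq d -> c - d \in generated_subgroup (@tensor_relation U V).
Proof. by move=> /eqP; rewrite -Quotient.idealrBE. Qed.

Lemma biadditiveDl u u' v : f (u + u') v = f u v + f u' v.
Proof.
have f0 : f 0 v = 0 by have := fBl 0 0 v; rewrite !subrr.
by rewrite -{1}[u']opprK fBl -(sub0r u') fBl f0 sub0r opprK.
Qed.

Lemma biadditiveDr u v v' : f u (v + v') = f u v + f u v'.
Proof.
have f0 : f u 0 = 0 by have := fBr u 0 0; rewrite !subrr.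
by rewrite -{1}[v']opprK fBr -(sub0r v') fBr f0 sub0r opprK.
Qed.

Lemma zlift_relation c : c \in generated_subgroup (@tensor_relation U V) ->
  zlift (fun k => f k.1 k.2) c = 0.
Proof.
move=> /asboolP /(_ [pred c | zlift (fun k => f k.1 k.2) c == 0]) H; apply/eqP; apply: H.
  split=> [|x y]; rewrite !inE ?zlift0 // => /eqP x0 /eqP y0.
  by rewrite zliftB x0 y0 subrr.
move=> _ [[u [u' [w ->]]]|[u [w [w' ->]]]]; rewrite inE !zliftB !zliftU1 /=.
  by rewrite biadditiveDl addrAC addrK subrr.
by rewrite biadditiveDr addrAC addrK subrr.
Qed.

(** The lift of a biadditive map kills the relations, so [tensor_lift] does not depend on the
    representative that it picks. *)
Lemma zlift_pi (c d : {freeg (U * V) / int}) : \pi_tq c = \pi_tq d ->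
  zlift (fun k => f k.1 k.2) c = zlift (fun k => f k.1 k.2) d.
Proof. by move=> /tens_pi_eq /zlift_relation; rewrite zliftB => /eqP; rewrite subr_eq0 => /eqP. Qed.

Lemma tensor_liftB x y : tensor_lift f (x - y) = tensor_lift f x - tensor_lift f y.
Proof.
rewrite !tensor_lift_zlift -zliftB; apply: zlift_pi.
by rewrite reprK -[in LHS](reprK (x : tq)) -[in LHS](reprK (y : tq)) !piE.
Qed.

Lemma tensor_lift_tens u v : tensor_lift f (tens u v) = f u v.
Proof.
by rewrite tensor_lift_zlift -[RHS](zliftU1 (fun k => f k.1 k.2) (u, v)); apply: zlift_pi; rewrite reprK.
Qed.

End Tensors.

Lemma tens_Dr (U V : zmodType) (u : U) (v v' : V) :
  tens u (v + v') = tens u v + tens u v'.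
Proof.
pose tq := Quotient.quot (generated_subgroup (@tensor_relation U V)).
rewrite /tens; apply/eqP.
have -> : \pi_tq << (u, v) >> + \pi_tq << (u, v') >> = \pi_tq (<< (u, v) >> + << (u, v') >>).
  by rewrite !piE.
rewrite -Quotient.idealrBE opprD addrA; apply/asboolP => P _; apply; right.
by exists u, v, v'.
Qed.

Lemma tensBl (U V : zmodType) (u u' : U) (v : V) : tens (u - u') v = tens u v - tens u' v.
Proof. by rewrite tensDl tensNl. Qed.

Lemma tensBr (U V : zmodType) (u : U) (v v' : V) : tens u (v - v') = tens u v - tens u v'.
Proof. by apply: (addIr (tens u v')); rewrite -tens_Dr !subrK. Qed.

Lemma tensor_ind (U V : zmodType) (P : {pred tensor U V}) : zmod_closed P ->
  (forall u v, tens u v \in P) -> forall x, x \in P.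
Proof.
move=> PZ Pt x; pose P' : zmodClosed (tensor U V) := HB.pack P (GRing.isZmodClosed.Build _ P PZ).
pose tq := Quotient.quot (generated_subgroup (@tensor_relation U V)).
have piB (c d : {freeg (U * V) / int}) : \pi_tq (c - d) = \pi_tq c - \pi_tq d.
  by rewrite !piE.
have -> : x = zlift (fun k => tens k.1 k.2) (repr (x : tq)).
  rewrite -[LHS](reprK (x : tq)) -{1}(zlift_id (repr (x : tq))) (zlift_additive _ _ piB).
  by congr (zlift _ _); apply/funext => -[].
rewrite zliftE -[P]/(P' : {pred _}); apply: rpred_sum => k _; apply: rpredMz; exact: Pt.
Qed.

(** * Half integers modulo integers *)

Section Halves.
Context (R : realType).

Lemma modZB (x y : R) : modZ (x - y) = modZ x - modZ y.
Proof. by rewrite /modZ !piE. Qed.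

Lemma modZD (x y : R) : modZ (x + y) = modZ x + modZ y.
Proof. by rewrite /modZ !piE. Qed.

Lemma modZ_int (z : int) : modZ (z%:~R : R) = 0.
Proof.
have -> : 0 = modZ (0 : R) by rewrite -[in RHS](subrr 0) modZB subrr.
apply/eqP; rewrite /modZ -Quotient.idealrBE subr0.
exact: intr_int.
Qed.

Definition half_mod (u : 'F_2) : RmodZ R := modZ (2^-1 * (u : nat)%:R).

Lemma half_modB u v : half_mod (u - v) = half_mod u - half_mod v.
Proof.
have h0 : half_mod 0 = 0 by rewrite /half_mod mulr0 -(modZ_int 0).
have h1 : half_mod 1 + half_mod 1 = 0.
  by rewrite /half_mod -modZD mulr1 (_ : 2^-1 + 2^-1 = 1%:~R) ?modZ_int //; field.
case: (F2_cases u) => ->; case: (F2_cases v) => ->; rewrite ?subrr ?subr0 ?h0 ?subr0 ?subrr //.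
rewrite (_ : (0 - 1 : 'F_2) = 1); last exact/val_inj.
by rewrite sub0r; apply/eqP; rewrite -subr_eq0 opprK h1.
Qed.

Lemma half_mod_int (z : int) : modZ (2^-1 * z%:~R) = half_mod z%:~R.
Proof.
pose h1 : {additive 'F_2 -> RmodZ R} :=
  HB.pack half_mod (GRing.isZmodMorphism.Build _ _ half_mod half_modB).
pose h2 : {additive R -> RmodZ R} :=
  HB.pack (@modZ R) (GRing.isZmodMorphism.Build _ _ (@modZ R) modZB).
rewrite -[RHS]/(h1 _) -[LHS]/(h2 _) mulrzr !raddfMz; congr (_ *~ z).
by rewrite /= /half_mod mulr1.
Qed.

Lemma half_mod_nat (m : nat) : modZ (2^-1 * m%:R) = half_mod m%:R.
Proof. exact: (half_mod_int m%:Z). Qed.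

End Halves.

(** * The volume as a cubic form *)

Section Final.
Context (R : realType) (g : nat) (p : 'I_(2 * g + 2) -> R[i]^o).
Local Notation C := (R[i]^o).
Local Notation T := (curve p).
Local Notation n := (2 * g + 2)%N.
Local Notation atlas := (@curve_atlas R g p).
Local Notation off := (~` branch_locus p).
Local Notation H := (H1 R T int [set: T]).
Local Notation H2 := (H1 R T 'F_2 [set: T]).
Hypothesis p_inj : injective p.
Context (q : nat -> C) (rot : C).
Hypothesis rot0 : rot != 0.
Hypothesis q_sorted : forall i j, (i < j)%N -> (j < n)%N ->
  ell rot (q i) < ell rot (q j).
Hypothesis branch_polyE : forall z, branch_poly p z = \prod_(k <- iota 0 n) (z - q k).
Context (pos : 'I_n -> nat) (rk : nat -> 'I_n).
Hypothesis pos_lt : forall k, (pos k < n)%N.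
Hypothesis rkK : forall k, (k < n)%N -> pos (rk k) = k.
Hypothesis posK : forall k, rk (pos k) = k.
Hypothesis pE : forall k, p k = q (pos k).
Context (nu : 'I_n) (B : intersection_pairing atlas).
Context (hf : H -> form1 R T) (hfP : harmonic_forms B hf).
Context (I : {additive tensor (K B) H -> RmodZ R})
  (IP : is_pointed_harmonic_volume (@curve_integral R g p) hf (weierstrass_point p nu) I).
Context (v : {additive H2 -> H1 R (sphere R) 'F_2 off}) (vP : is_pushforward_off_branch v).
Local Notation lc k := (hclass [set: T] << loop p q rot k 0 >>).
Local Notation mc k := (dbl_class p q rot (pos nu) k).
Implicit Types (a b c h : H) (r : 'I_n) (k i j : nat).

Definition chi r (a : H2) : 'F_2 := winding r nu (v a).
Definition chiz r (a : H) : 'F_2 := chi r (red2 a).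
Definition Bz a b : 'F_2 := (B a b)%:~R.

Lemma chiB r (a b : H2) : chi r (a - b) = chi r a - chi r b.
Proof. by rewrite /chi raddfB windingB. Qed.

Lemma chizB r a b : chiz r (a - b) = chiz r a - chiz r b.
Proof. by rewrite /chiz red2B chiB. Qed.

Lemma pairing_Bl a b c : B (a - b) c = B a c - B b c.
Proof. by apply: (addIr (B b c)); rewrite -pairingDl !subrK. Qed.

Lemma pairing_Br a b c : B a (b - c) = B a b - B a c.
Proof. by apply: (addIr (B a c)); rewrite -pairingDr !subrK. Qed.

Lemma BzBl a b c : Bz (a - b) c = Bz a c - Bz b c.
Proof. by rewrite /Bz pairing_Bl rmorphB. Qed.

Lemma BzBr a b c : Bz a (b - c) = Bz a b - Bz a c.
Proof. by rewrite /Bz pairing_Br rmorphB. Qed.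

Lemma BzDr a b c : Bz a (b + c) = Bz a b + Bz a c.
Proof. by rewrite /Bz pairingDr rmorphD. Qed.

Lemma agree_on_loops (W : zmodType) (F G : H -> W) : (forall a b, F (a - b) = F a - F b) ->
  (forall a b, G (a - b) = G a - G b) -> (forall k, (k.+1 < n)%N -> F (lc k) = G (lc k)) ->
  forall a, F a = G a.
Proof.
move=> FB GB FG a; apply/eqP.
apply: (H1_generated rot0 q_sorted branch_polyE (A := [pred a | F a == G a])) => [|k kn].
  split=> [|x y]; rewrite !inE.
    by have := FB 0 0; have := GB 0 0; rewrite !subrr => -> ->.
  by move=> /eqP xE /eqP yE; rewrite FB GB xE yE.
by rewrite inE FG.
Qed.

Definition incident r k : 'F_2 := (pos r == k)%:R + (pos r == k.+1)%:R.

Lemma chiz_loop r k : (k.+1 < n)%N -> chiz r (lc k) = incident r k + incident nu k.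
Proof.
move=> kn; rewrite /chiz /chi (winding_red2_loop rot0 q_sorted branch_polyE pos_lt pE vP) //.
rewrite /incident !natF2D; congr (_%:R); congr nat_of_bool.
have sx x : (x == k) || (x == k.+1) = (x == k) (+) (x == k.+1).
  by have [->|//] := eqVneq x k; rewrite ltn_eqF.
by rewrite !sx addbA.
Qed.

Lemma sum_at (F : 'I_n -> 'F_2) k : (k < n)%N -> \sum_r F r * (pos r == k)%:R = F (rk k).
Proof.
move=> kn; rewrite (bigD1 (rk k)) //= rkK // eqxx mulr1 big1 ?addr0 // => r rk'.
have [e|_] := eqVneq (pos r) k; last by rewrite mulr0.
by case/eqP: rk'; rewrite -e posK.
Qed.

Lemma F2_double (x : 'F_2) : x + x = 0.
Proof. by case: (F2_cases x) => ->; apply/val_inj. Qed.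

Lemma sum_incident (F : 'I_n -> 'F_2) k : (k.+1 < n)%N ->
  \sum_r F r * incident r k = F (rk k) + F (rk k.+1).
Proof.
move=> kn; rewrite /incident; under eq_bigr do rewrite mulrDr.
by rewrite big_split /= !sum_at // ltnW.
Qed.

(** A segment has two ends, and the base term [incident nu k] is counted [2 * g + 2] times; both
    numbers are even. *)
Lemma sum_chiz a : \sum_r chiz r a = 0.
Proof.
apply: (agree_on_loops (F := fun a => \sum_r chiz r a) (G := fun=> 0)) => [x y|x y|k kn].
- by rewrite -sumrB; apply: eq_bigr => r _; exact: chizB.
- by rewrite subrr.
under eq_bigr => r _ do rewrite chiz_loop // -[incident r k]mul1r.
rewrite big_split /= (sum_incident (fun=> 1)) // F2_double add0r sumr_const card_ord.
have -> : n = (2 * g.+1)%N by lia.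
by rewrite mulrnA mulr2n F2_double mul0rn.
Qed.

Lemma natF2 m : (m%:R : 'F_2) = (odd m)%:R.
Proof. by elim: m => [|m IH]; rewrite ?mulr0n // mulrS IH addrC (natF2D _ true) addbT. Qed.

Lemma odd_intF2 (z : int) : odd `|z|%N -> (z%:~R : 'F_2) = 1.
Proof.
case: z => m om; first by rewrite -pmulrn natF2 om.
by rewrite NegzE mulrNz -pmulrn natF2 om natF2N.
Qed.

(** On a generator both sides are the number of common ends of two segments mod 2: one for
    neighbours, two for the same segment, none otherwise. The base terms of the two [chiz]
    cancel. *)
Lemma Bz_loop a k : (k.+1 < n)%N -> Bz a (lc k) = chiz (rk k) a + chiz (rk k.+1) a.
Proof.
move=> kn; apply: (agree_on_loops (F := fun a => Bz a (lc k))
  (G := fun a => chiz (rk k) a + chiz (rk k.+1) a)) => [x y|x y|i iN].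
- exact: BzBl.
- by rewrite !chizB opprD addrACA.
rewrite !chiz_loop // addrACA F2_double addr0 /incident !rkK // ?(ltnW kn) // /Bz.
have [e1|e1] := ltnP i.+1 k.
  rewrite (pairing_far rot0 q_sorted branch_polyE B e1 kn).1 mulr0z.
  by rewrite !(gtn_eqF (_ : _ < _)%N) ?addr0 //; lia.
have [e2|e2] := ltnP k.+1 i.
  rewrite (pairing_far rot0 q_sorted branch_polyE B e2 iN).2 mulr0z.
  by rewrite !(ltn_eqF (_ : _ < _)%N) ?addr0 //; lia.
have [E|ki] := eqVneq k i.
  rewrite E (pairing_self rot0 q_sorted branch_polyE B) ?mulr0z -?E // !eqxx.
  by rewrite ltn_eqF // gtn_eqF // addr0 add0r F2_double.
have [E|kS] := eqVneq k i.+1.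
  rewrite E in kn *; have [ob _] := pairing_adjacent rot0 q_sorted branch_polyE B kn.
  rewrite (odd_intF2 ob).
  by rewrite (gtn_eqF (_ : i < i.+2)%N) // (gtn_eqF (_ : i.+1 < i.+2)%N) // add0r !addr0.
have E : i = k.+1 by lia.
rewrite E in iN *; have [_ ob] := pairing_adjacent rot0 q_sorted branch_polyE B iN.
by rewrite (odd_intF2 ob) eqxx (ltn_eqF (_ : k.+1 < k.+2)%N) // !add0r addr0.
Qed.

(** On a generator the base term multiplies the sum of all [chiz r a], which vanishes, and the two
    incident branch points give the value of [Bz_loop]. *)
Lemma Bz_chiz a b : Bz a b = \sum_r chiz r a * chiz r b.
Proof.
apply: (agree_on_loops (F := Bz a) (G := fun b => \sum_r chiz r a * chiz r b)) => [x y|x y|k kn].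
- exact: BzBr.
- by rewrite -sumrB; apply: eq_bigr => r _; rewrite chizB mulrBr.
under eq_bigr => r _ do rewrite chiz_loop // mulrDr.
by rewrite Bz_loop // big_split /= sum_incident // -mulr_suml sum_chiz mul0r addr0.
Qed.

Lemma chiz_base a : chiz nu a = 0.
Proof.
apply: (agree_on_loops (F := chiz nu) (G := fun=> 0)) => [x y|x y|k kn].
- exact: chizB.
- by rewrite subrr.
by rewrite chiz_loop // F2_double.
Qed.

(** The class of the loop grows by one segment at a time, and by [Bz_loop] the values telescope,
    starting from [chiz nu a = 0]. *)
Lemma Bz_dbl a k : (k < n)%N -> Bz a (mc k) = chiz (rk k) a.
Proof.
move=> kn; move: a.
apply: (@dbl_class_ind R g p q rot rot0 q_sorted branch_polyE (pos nu) (pos_lt nu)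
  (fun k h => forall a, Bz a h = chiz (rk k) a)) => // [a|{kn}k h kn IH a|{kn}k h kn IH a].
- by rewrite posK chiz_base; have := BzBr a 0 0; rewrite !subrr.
- by rewrite BzDr IH Bz_loop // addrA F2_double add0r.
- by rewrite BzBr IH Bz_loop // opprD addrCA subrr addr0; case: (F2_cases (chiz (rk k) a)) => ->; apply/val_inj.
Qed.

Lemma dbl_start k : dbl p q rot (pos nu) k 0 = weierstrass_point p nu.
Proof.
rewrite dbl0 //; have [h1 h2] := branch_pointE branch_polyE (pos_lt nu).
by apply: (@coord_inj R g p false) => //; rewrite h2 /= pE.
Qed.

Lemma volume_dbl (x : K B) (ab : seq (H * H)) k : (k < n)%N ->
  val x = \sum_(s <- ab) tens s.1 s.2 ->
  I (tens x (mc k)) = half_mod R (\sum_(s <- ab) chiz (rk k) s.1 * chiz (rk k) s.2).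
Proof.
move=> kn xE; have [eta [ef ed eo] etaI] := IP xE.
set M := dbl p q rot (pos nu) k.
have Mloop : is_loop atlas M by exact: dbl_is_loop.
have Mpw : piecewise_C1 atlas M := Mloop.1.
have Msym t : M (1 - t) = invol (M t) by exact: dbl_sym.
have anti h psi t l : atlas psi -> chart_dom psi t -> hf h (invol_chart psi) t l = - hf h psi t l.
  by move=> aP dP; apply: (harmonic_anti_invariant rot0 q_sorted branch_polyE) => //; case: (hfP h).
have forms h : is_form1 atlas (hf h) by case: (hfP h) => -[] [].
have eta_inv psi t l : atlas psi -> chart_dom psi t -> eta (invol_chart psi) t l = eta psi t l.
  apply: (invariant_primitive rot0 q_sorted branch_polyE ef _ eo) => {}psi {}t aP dP.
  rewrite (ed _ _ (invol_chart_atlas aP) dP) ed //; apply: eq_bigr => s _.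
  by rewrite /wedge !anti // !mulrNN.
have eta0 : path_integral atlas M eta = 0.
  exact: (path_integral_invariant rot0 q_sorted branch_polyE Mpw Msym ef eta_inv).
have ME : mc k = loop_class int M by [].
rewrite ME etaI //; last exact: dbl_start.
rewrite eta0 subr0.
have -> : \sum_(s <- ab) chen_integral atlas M (hf s.1) (hf s.2) =
    2^-1 * (\sum_(s <- ab) B s.1 (mc k) * B s.2 (mc k))%:~R.
  rewrite rmorph_sum mulr_sumr; apply: eq_bigr => s _.
  have := chen_anti_invariant rot0 q_sorted branch_polyE Mpw Msym (forms s.1) (forms s.2)
    (anti s.1) (anti s.2).
  rewrite (hfP s.1).2 // (hfP s.2).2 // -ME rmorphM => <-.
  by rewrite mulKf // pnatr_eq0.
rewrite half_mod_int rmorph_sum; congr half_mod; apply: eq_bigr => s _.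
by rewrite /= intrM -/(Bz s.1 (mc k)) -/(Bz s.2 (mc k)) !Bz_dbl.
Qed.

Definition theta r (y : tensor H2 H2) : 'F_2 :=
  tensor_lift (fun a b : H2 => chi r a * chi r b) y.

Lemma theta_tens r (a b : H2) : theta r (tens a b) = chi r a * chi r b.
Proof. by apply: tensor_lift_tens => *; rewrite chiB ?mulrBl ?mulrBr. Qed.

Lemma thetaB r y z : theta r (y - z) = theta r y - theta r z.
Proof. by apply: tensor_liftB => *; rewrite chiB ?mulrBl ?mulrBr. Qed.

Definition redK (x : tensor H H) : tensor H2 H2 :=
  tensor_lift (fun a b => tens (red2 a) (red2 b)) x.

Lemma tens_red2Bl a b c : tens (red2 (a - b)) (red2 c) =
  tens (red2 a) (red2 c) - tens (red2 b) (red2 c) :> tensor H2 H2.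
Proof. by rewrite red2B tensBl. Qed.

Lemma tens_red2Br a b c : tens (red2 c) (red2 (a - b)) =
  tens (red2 c) (red2 a) - tens (red2 c) (red2 b) :> tensor H2 H2.
Proof. by rewrite red2B tensBr. Qed.

Lemma redK_tens a b : redK (tens a b) = tens (red2 a) (red2 b).
Proof.
by apply: tensor_lift_tens => [x x' y|x y y']; [exact: tens_red2Bl|exact: tens_red2Br].
Qed.

Lemma redKB x y : redK (x - y) = redK x - redK y.
Proof.
by apply: tensor_liftB => [u u' w|u w w']; [exact: tens_red2Bl|exact: tens_red2Br].
Qed.

Lemma theta_redK r (ab : seq (H * H)) : theta r (redK (\sum_(s <- ab) tens s.1 s.2)) =
  \sum_(s <- ab) chiz r s.1 * chiz r s.2.
Proof.
pose h x := theta r (redK x).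
have hB x y : h (x - y) = h x - h y by rewrite /h redKB thetaB.
pose h' : {additive tensor H H -> 'F_2} := HB.pack h (GRing.isZmodMorphism.Build _ _ h hB).
rewrite -[LHS]/(h' _) raddf_sum; apply: eq_bigr => s _.
by rewrite /= /h redK_tens theta_tens.
Qed.

(** The cubic form of the overview. *)
Definition psi3 : tensor (tensor H2 H2) H2 -> 'F_2 :=
  tensor_lift (fun y (c : H2) => \sum_r theta r y * chi r c).

Lemma psi3_Bl (y z : tensor H2 H2) (c : H2) : \sum_r theta r (y - z) * chi r c =
  \sum_r theta r y * chi r c - \sum_r theta r z * chi r c.
Proof. by rewrite -sumrB; apply: eq_bigr => r _; rewrite thetaB mulrBl. Qed.

Lemma psi3_Br (y : tensor H2 H2) (c d : H2) : \sum_r theta r y * chi r (c - d) =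
  \sum_r theta r y * chi r c - \sum_r theta r y * chi r d.
Proof. by rewrite -sumrB; apply: eq_bigr => r _; rewrite chiB mulrBr. Qed.

Lemma psi3_tens y (c : H2) : psi3 (tens y c) = \sum_r theta r y * chi r c.
Proof. by apply: tensor_lift_tens => [a b d|a b d]; [exact: psi3_Bl|exact: psi3_Br]. Qed.

Lemma psi3B x y : psi3 (x - y) = psi3 x - psi3 y.
Proof. by apply: tensor_liftB => [a b d|a b d]; [exact: psi3_Bl|exact: psi3_Br]. Qed.

Lemma red2_KH_tens (x : K B) c : red2_KH (tens x c) = tens (redK (val x)) (red2 c).
Proof.
apply: tensor_lift_tens => [y z d|y d e]; rewrite -!/(redK _).
  by rewrite raddfB redKB tensBl.
by rewrite red2B tensBr.
Qed.

Lemma red2_KHB (x y : tensor (K B) H) : red2_KH (x - y) = red2_KH x - red2_KH y.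
Proof.
apply: tensor_liftB => [{}y z d|{}y d e]; rewrite -!/(redK _).
  by rewrite raddfB redKB tensBl.
by rewrite red2B tensBr.
Qed.

(** Here the kernel condition enters: the base terms of [chiz_loop] contribute a multiple of the sum
    of all [th r], which is the pairing of [x] mod 2, hence 0. What remains is the difference of two
    values from [volume_dbl]. *)
Lemma volume_tens (x : K B) c :
  I (tens x c) = half_mod R (\sum_r theta r (redK (val x)) * chiz r c).
Proof.
have /asboolP[ab [xE xB]] := valP x.
set th := fun r => theta r (redK (val x)).
have thE r : th r = \sum_(s <- ab) chiz r s.1 * chiz r s.2 by rewrite /th xE theta_redK.
have th0 : \sum_r th r = 0.
  under eq_bigr do rewrite thE.
  rewrite exchange_big /=; under eq_bigr do rewrite -Bz_chiz.
  transitivity ((\sum_(s <- ab) B s.1 s.2)%:~R : 'F_2); last by rewrite xB mulr0z.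
  by rewrite rmorph_sum.
apply: (agree_on_loops (F := fun c => I (tens x c))
  (G := fun c => half_mod R (\sum_r th r * chiz r c))) => [a b|a b|k kn].
- by rewrite tensBr raddfB.
- by rewrite -half_modB -sumrB; congr half_mod; apply: eq_bigr => r _; rewrite chizB mulrBr.
under eq_bigr => r _ do rewrite chiz_loop // mulrDr.
rewrite big_split /= sum_incident // -mulr_suml th0 mul0r addr0.
have kn' : (k < n)%N by exact: ltnW.
rewrite -(dbl_class_step rot0 q_sorted branch_polyE (pos_lt nu) kn) tensBr raddfB.
rewrite !(volume_dbl _ xE) // -!thE -half_modB; congr half_mod.
by case: (F2_cases (th (rk k))) => ->; case: (F2_cases (th (rk k.+1))) => ->; apply/val_inj.
Qed.

Lemma volume_psi3 A : I A = half_mod R (psi3 (red2_KH A)).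
Proof.
apply/eqP; apply: (tensor_ind (P := [pred A | I A == half_mod R (psi3 (red2_KH A))])) => [|x c].
  split=> [|x y]; rewrite !inE.
    have := red2_KHB 0 0; rewrite !subrr => ->; have := psi3B 0 0; rewrite !subrr => ->.
    by have := half_modB R 0 0; rewrite !subrr raddf0 => ->.
  by move=> /eqP xE /eqP yE; rewrite red2_KHB psi3B half_modB raddfB xE yE.
by rewrite inE red2_KH_tens psi3_tens volume_tens.
Qed.

(** * Values on products of the classes [f] *)

Section Expansion.
Context (f : 'I_n -> H2).
Hypothesis fP : forall x : 'I_n, v (f x) = epsilon p nu + epsilon p x.
Implicit Types (x y z : 'I_n).

Lemma windingD r (h1 h2 : H1 R (sphere R) 'F_2 off) :
  winding r nu (h1 + h2) = winding r nu h1 + winding r nu h2.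
Proof.
have w0 : winding r nu (0 : H1 R (sphere R) 'F_2 off) = 0.
  by have := windingB r nu (0 : H1 R (sphere R) 'F_2 off) 0; rewrite !subrr.
by rewrite -{1}[h2]opprK windingB -(sub0r h2) windingB w0 sub0r opprK.
Qed.

Lemma chi_f r x : x != nu -> chi r (f x) = ((r != nu) && (r != x))%:R.
Proof.
move=> xnu; rewrite /chi fP windingD !winding_epsilon // natF2D eqxx (eq_sym nu) (negPf xnu).
have [->|rn] := eqVneq r nu; first by rewrite eq_sym (negPf xnu).
by case: eqVneq.
Qed.

(** The sum counts the branch points other than [nu], [x], [y], [z]. Together with [nu] and the [c]
    distinct ones among [x], [y], [z] they number [2 * g + 2], so the count is odd exactly when [c]
    is even; as [c] lies between 1 and 3, this means [c = 2]. *)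
Lemma psi3_fff x y z : x != nu -> y != nu -> z != nu ->
  psi3 (tens (tens (f x) (f y)) (f z)) = (#|pred3 x y z| == 2)%:R.
Proof.
move=> xn yn zn; rewrite psi3_tens.
under eq_bigr => r _ do rewrite theta_tens !chi_f // -!natrM !mulnb.
rewrite -natr_sum natF2; congr (_%:R); congr nat_of_bool.
set N := (\sum_r _)%N; set c := #|pred3 x y z|.
have NE : (N + c.+1 = n)%N.
  have <- : #|predU1 nu (pred3 x y z)| = c.+1.
    have nun : nu \notin pred3 x y z.
      by rewrite !inE !(eq_sym nu) (negPf xn) (negPf yn) (negPf zn).
    by rewrite cardU1 nun.
  rewrite -[RHS]card_ord -(cardC (predU1 nu (pred3 x y z))) addnC; congr (_ + _)%N.
  rewrite /N -sum1_card [RHS]big_mkcond; apply: eq_bigr => r _.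
  rewrite -[r \in _]/(~~ [|| r == nu, r == x, r == y | r == z]).
  by case: (r == nu); case: (r == x); case: (r == y); case: (r == z).
have c1 : (0 < c)%N by apply/card_gt0P; exists x; rewrite !inE eqxx.
have c3 : (c <= 3)%N.
  apply: leq_trans (card_size [:: x; y; z]); rewrite leq_eqVlt; apply/orP; left; apply/eqP.
  by apply: eq_card => r; rewrite !inE.
have oN : odd (N + c.+1) = false by rewrite NE oddD oddM.
by move: oN c1 c3; rewrite oddD /=; case: c {NE} => [|[|[|[|c]]]] //=; case: (odd N).
Qed.

Lemma psi3_expansion (a : 'I_n -> 'I_n -> 'I_n -> bool) :
  half_mod R (psi3 (f_expansion nu f a)) = kappa R nu a.
Proof.
pose h := HB.pack psi3 (GRing.isZmodMorphism.Build _ _ psi3 psi3B) : {additive tensor (tensor H2 H2) H2 -> 'F_2}.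
have term x y z : x != nu -> y != nu -> z != nu ->
    h (tens (tens (f x) (f y)) (f z) *+ a x y z) = (a x y z && (#|pred3 x y z| == 2))%:R.
  move=> xn yn zn; rewrite raddfMn -[h _]/(psi3 _) psi3_fff //.
  by case: (a x y z); rewrite ?mulr1n.
rewrite /kappa half_mod_nat; congr half_mod.
transitivity (\sum_(x | x != nu) \sum_(y | y != nu) \sum_(z | z != nu)
    ((a x y z && (#|pred3 x y z| == 2))%:R : 'F_2)).
  rewrite -[LHS]/(h _) /f_expansion raddf_sum; apply: eq_bigr => x xn.
  rewrite raddf_sum; apply: eq_bigr => y yn.
  by rewrite raddf_sum; apply: eq_bigr => z zn; exact: term.
rewrite -sum1_card natr_sum [RHS]big_mkcond /=.
rewrite (pair_big_dep (fun x => x != nu) (fun x y => y != nu)) /=.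
rewrite (pair_big_dep (fun s : 'I_n * 'I_n => (s.1 != nu) && (s.2 != nu)) (fun s z => z != nu)) /=.
rewrite big_mkcond /=; apply: eq_bigr => -[[x y] z] _ /=.
rewrite inE /= [a x y z && _]andbC.
by case: (x != nu); case: (y != nu); case: (z != nu); case: (a x y z); case: (_ == 2)%N.
Qed.

End Expansion.
End Final.

(** * Numbering of the branch points and conclusion *)

Lemma separating_direction (R : realType) (m : nat) (p : 'I_m -> R[i]^o) : injective p ->
  exists2 rot : R[i]^o, rot != 0 & injective (fun k => ell rot (p k)).
Proof.
move=> p_inj; pose slope (s : 'I_m * 'I_m) : R :=
  complex.Re (p s.1 - p s.2) / complex.Im (p s.1 - p s.2).
(* With the multiplier [1 +i* t], points that differ by [x +i* y] have equal [ell] only if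
   [x = y * t]. As [t] exceeds every slope [x / y], this forces [y = 0] and then [x = 0]. *)
pose t : R := 1 + \sum_s `|slope s|.
have t_gt s : slope s < t.
  apply: le_lt_trans (ler_norm _) _; rewrite /t (bigD1 s) //= addrCA ltrDl.
  by rewrite ltr_wpDr // sumr_ge0.
exists (1 +i* t); first by apply/eqP => /(congr1 (@complex.Re R)) /eqP; rewrite oner_eq0.
move=> i j e; apply: p_inj; apply/eqP; rewrite -subr_eq0; apply/eqP.
have : ell (1 +i* t : R[i]^o) (p i - p j) = 0 by rewrite ellB e subrr.
have := t_gt (i, j); rewrite /slope /ell /=; case: (p i - p j) => x y /=.
rewrite mul1r => h /eqP; rewrite subr_eq0 => /eqP xE.
have [y0|y0] := eqVneq y 0; first by rewrite xE y0 mulr0.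
by move: h; rewrite xE mulfK // ltxx.
Qed.

Lemma sorted_enumeration (R : realType) (m : nat) (F : 'I_m -> R) (i0 : 'I_m) :
  injective F -> exists rk : nat -> 'I_m,
  exists2 pos : 'I_m -> nat, [/\ forall k, (pos k < m)%N,
    forall k, (k < m)%N -> pos (rk k) = k & forall k, rk (pos k) = k] &
  (forall i j, (i < j)%N -> (j < m)%N -> F (rk i) < F (rk j)) /\
  perm_eq [seq rk k | k <- iota 0 m] (enum 'I_m).
Proof.
move=> Fi; pose le := relpre F <=%R; pose s := sort le (enum 'I_m).
have ss : size s = m by rewrite size_sort size_enum_ord.
have us : uniq s by rewrite sort_uniq enum_uniq.
have ms k : k \in s by rewrite mem_sort mem_enum.
exists (nth i0 s), (fun k => index k s).
  split=> k; first by have := ms k; rewrite -index_mem ss.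
    by move=> km; rewrite index_uniq // ss.
  by rewrite nth_index.
have so : sorted le s by apply: sort_sorted => x y; exact: le_total.
split=> [i j ij jm|].
  have le_tr : transitive le by move=> x y z; exact: le_trans.
  have im : (i < m)%N by exact: ltn_trans jm.
  rewrite lt_neqAle; apply/andP; split.
    apply/eqP => /Fi /eqP; rewrite nth_uniq ?ss // => /eqP E; by rewrite E ltnn in ij.
  have : le (nth i0 s i) (nth i0 s j) by apply: (sorted_ltn_nth le_tr i0 so); rewrite ?inE ?ss.
  by [].
have -> : [seq nth i0 s k | k <- iota 0 m] = s by rewrite -[X in iota 0 X]ss -/(mkseq _ _) mkseq_nth.
by rewrite perm_sort.
Qed.

Theorem theorem1p1 (R : realType) (g : nat) (hg : (2 <= g)%N)
  (p : 'I_(2 * g + 2) -> R[i]^o) (p_inj : injective p)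
  (nu : 'I_(2 * g + 2))
  (B : intersection_pairing (@curve_atlas R g p))
  (hf : H1 R (curve p) int [set: curve p] -> form1 R (curve p))
  (hfP : harmonic_forms B hf)
  (I : {additive tensor (K B) (H1 R (curve p) int [set: curve p]) -> RmodZ R})
  (IP : is_pointed_harmonic_volume (@curve_integral R g p) hf
          (weierstrass_point p nu) I)
  (v : {additive H1 R (curve p) 'F_2 [set: curve p] ->
                 H1 R (sphere R) 'F_2 (~` branch_locus p)})
  (vP : is_pushforward_off_branch v)
  (f : 'I_(2 * g + 2) -> H1 R (curve p) 'F_2 [set: curve p])
  (fP : forall i, v (f i) = epsilon p nu + epsilon p i)
  (A : tensor (K B) (H1 R (curve p) int [set: curve p]))
  (a : 'I_(2 * g + 2) -> 'I_(2 * g + 2) -> 'I_(2 * g + 2) -> bool)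
  (Aa : red2_KH A = f_expansion nu f a) :
  I A = kappa R nu a.
Proof.
have [rot rot0 roti] := separating_direction p_inj.
have [rk [pos [pos_lt rkK posK] [rk_lt rk_perm]]] := sorted_enumeration nu roti.
have branch_polyE z : branch_poly p z = \prod_(k <- iota 0 (2 * g + 2)) (z - p (rk k)).
  rewrite -(big_map rk predT (fun k => z - p k)) (perm_big _ rk_perm) /=.
  by rewrite big_enum.
have pE k : p k = p (rk (pos k)) by rewrite posK.
rewrite (volume_psi3 rot0 rk_lt branch_polyE pos_lt rkK posK pE hfP IP vP) Aa.
exact: (psi3_expansion p_inj fP).
Qed.
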